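(* Let $E,E_0,\mathcal U,\Xi,A,B,\mathcal D$ be as in the context and let $U\subseteq E$ be open. Suppose that for every $\nu\in\mathcal P(E)$ there exists a solution of the controlled martingale problem for $(A,E_0,B,\Xi)$ with initial distribution $\nu$. Then for every solution $(Y^U,\lambda_0^U,\Lambda_1^U)$ of the stopped controlled martingale problem for $(A,E_0,B,\Xi;U)$ there exists a solution $(Y,\lambda_0,\Lambda_1)$ of the controlled martingale problem for $(A,E_0,B,\Xi)$ such that, with $$\theta:=\inf\{t\ge 0:\ Y(t)\notin U \text{ or } Y(t-)\notin U\},$$ the random element $(Y^U,\lambda_0^U,\Lambda_1^U,\theta^U)$ has the same distribution as $\big(Y(\cdot\wedge\theta),\lambda_0(\cdot\wedge\theta),\Lambda_1(\cdot\wedge\theta),\theta\big)$, where $\theta^U$ is the exit time of $Y^U$ defined in the context.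
   Context: Standing setting: $E$ is a compact metric space, $E_0\subseteq E$ is open, $\overline{E_0}$ its closure. $\mathcal U$ is a compact metric space and $\Xi$ is a closed subset of $(E\setminus E_0)\times\mathcal U$ such that for every $x\in E\setminus E_0$ there is $u\in\mathcal U$ with $(x,u)\in\Xi$. $A$ is a linear operator with domain $\mathcal D(A)\subseteq C(E)$ and values in $C(E)$, with $1\in\mathcal D(A)$, $A1=0$; $B$ is a linear operator with domain $\mathcal D(B)\subseteq C(E)$ and values in $C(\Xi)$, with $1\in\mathcal D(B)$, $B1=0$; $\mathcal D:=\mathcal D(A)\cap\mathcal D(B)$ is dense in $C(E)$. $\mathcal L_{\mathcal U}$ denotes the space of Borel measures $\mu$ on $[0,\infty)\times\mathcal U$ with $\mu([0,t]\times\mathcal U)<\infty$ for all $t$, topologized by: $\mu_n\to\mu$ iff $\int f\,d\mu_n\to\int f\,d\mu$ for all continuous $f$ with compact support in $[0,\infty)\times\mathcal U$ (this is a complete separable metrizable topology); $\mathcal L_\Xi$ is defined analogously with $\Xi$ in place of $\mathcal U$. For a process $Z$, $\mathcal F^Z_t:=\sigma(Z(s),s\le t)$. Stopped controlled martingale problem: for $U\subseteq E$ open, a triple $(Y^U,\lambda_0^U,\Lambda_1^U)$, where $Y^U$ is a process with paths in $D_E[0,\infty)$, $\lambda_0^U$ is a nonnegative nondecreasing process with $\lambda_0^U(t)=\int_{[0,t]}\mathbf 1_{\overline{E_0}}(Y^U(s))\,d\lambda_0^U(s)$ a.s., and $\Lambda_1^U$ is an $\mathcal L_{\mathcal U}$-valued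 random variable with $\lambda_1^U(t):=\Lambda_1^U([0,t]\times\mathcal U)=\int_{[0,t]\times\mathcal U}\mathbf 1_\Xi(Y^U(s),u)\Lambda_1^U(ds\times du)$, is a solution of the stopped controlled martingale problem for $(A,E_0,B,\Xi;U)$ if, with $\theta^U:=\inf\{t\ge0: Y^U(t)\notin U\text{ or }Y^U(t-)\notin U\}$: $(Y^U,\lambda_0^U,\Lambda_1^U)(t)=(Y^U,\lambda_0^U,\Lambda_1^U)(t\wedge\theta^U)$ for all $t$ a.s. (where $\Lambda_1^U(t)$ means the measure $\Lambda_1^U([0,t]\times\cdot)$); $\lambda_0^U(t)+\lambda_1^U(t)=t\wedge\theta^U$ for all $t$ a.s.; and for every $f\in\mathcal D$, $f(Y^U(t))-f(Y^U(0))-\int_0^tAf(Y^U(s))\,d\lambda_0^U(s)-\int_{[0,t]\times\mathcal U}Bf(Y^U(s),u)\,\Lambda_1^U(ds\times du)$ is an $\{\mathcal F_t^{Y^U,\lambda_0^U,\Lambda_1^U}\}$-martingale. For $U=E$ such a triple $(Y,\lambda_0,\Lambda_1)$ is called a solution of the controlled martingale problem for $(A,E_0,B,\Xi)$; its initial distribution is the law of $Y(0)$. *)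

(* Defs.v *)
From HB Require Import structures.
From mathcomp Require Import all_boot all_order all_algebra.
From mathcomp Require Import all_classical all_reals all_analysis.

Set Implicit Arguments.
Unset Strict Implicit.
Unset Printing Implicit Defensive.

Import Order.TTheory GRing.Theory Num.Theory.
Import numFieldNormedType.Exports.

Local Open Scope classical_set_scope.
Local Open Scope ring_scope.

Section defs.
Context {R : realType}.

Definition Borel (T : ptopologicalType) := g_sigma_algebraType (@open T).

Definition rv {d} {Om : measurableType d} {T : topologicalType} (X : Om -> T) : Prop :=
  forall O : set T, open O -> measurable (X @^-1` O).

Definition leftlim {T : ptopologicalType} (y : R -> T) (t : R) : T :=
  if 0 < t then lim (y @ t^'-) else y 0.

Definition cadlag {T : ptopologicalType} (y : R -> T) : Prop :=
  (forall t, 0 <= t -> y @ t^'+ --> y t) /\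
  (forall t, 0 < t -> cvg (y @ t^'-)).

Definition exit_time {T : ptopologicalType} (U : set T) (y : R -> T) : \bar R :=
  ereal_inf [set t%:E | t in [set t | 0 <= t /\ (~ U (y t) \/ ~ U (leftlim y t))]].

Definition tmin (t : R) (th : \bar R) : R :=
  if (t%:E <= th)%E then t else fine th.

Definition ext0 (F : R -> R) : R -> R := fun s => if s < 0 then 0 else F s.

(* Lebesgue-Stieltjes measure dF of a nondecreasing right-continuous F on
   [0,oo) with the convention F(0-) = 0 ; (the zero measure otherwise) *)
Definition LS (F : R -> R) : {measure set (measurableTypeR R) -> \bar R} :=
  match pselect ({homo ext0 F : x y / x <= y} /\ right_continuous (ext0 F)) with
  | left h => lebesgue_stieltjes_measure
      (HB.pack_for (cumulative R R) (ext0 F)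
         (isCumulative.Build R _ R (ext0 F) (proj1 h) (proj2 h)))
  | right _ => mzero
  end.

End defs.

Section cmp.
Context {R : realType} {E Uc : pseudoPMetricType R}.

Definition I0 (t : R) : set R := `[0, t].

(* random measures on [0,oo) x Uc are measures on R x Uc (Borel) *)
Definition LMeas := {measure set (R * Borel Uc)%type -> \bar R}.

Definition in_LU (mu : LMeas) : Prop :=
  mu [set p | p.1 < 0] = 0%E /\
  forall t, 0 <= t -> (mu (I0 t `*` setT) < +oo)%E.

Definition Cc (f : R * Uc -> R) : Prop :=
  {within [set p : R * Uc | 0 <= p.1], continuous f} /\
  exists K : set (R * Uc), compact K /\ K `<=` [set p | 0 <= p.1] /\
    (forall p, 0 <= p.1 -> ~ K p -> f p = 0).

Definition int_LU (mu : LMeas) (f : R * Uc -> R) : \bar R :=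
  \int[mu]_(p in [set p : R * Borel Uc | 0 <= p.1]) (f p)%:E.

Definition nat_filtration {d} {Om : measurableType d}
  (Y : Om -> R -> E) (l0 : Om -> R -> R) (L1 : Om -> LMeas) (t : R) :
  set (set Om) :=
  <<s [set A | exists s, 0 <= s <= t /\
       ((exists O : set E, open O /\ A = (fun w => Y w s) @^-1` O) \/
        (exists O : set R, open O /\ A = (fun w => l0 w s) @^-1` O) \/
        (exists (C : set (Borel Uc)) (O : set (\bar R)), measurable C /\ open O /\
            A = (fun w => L1 w (I0 s `*` C)) @^-1` O))] >>.

Definition martingale {d} {Om : measurableType d} (P : probability Om R)
  (F : R -> set (set Om)) (M : R -> Om -> R) : Prop :=
  forall t, 0 <= t ->
    (forall O : set R, open O -> F t (M t @^-1` O)) /\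
    P.-integrable setT (EFin \o M t) /\
    (forall s A, 0 <= s <= t -> F s A ->
       (\int[P]_(w in A) (M t w)%:E = \int[P]_(w in A) (M s w)%:E)%E).

Definition stopped_cmp_solution (E0 : set E) (Xi : set (E * Uc))
  (DA : set (E -> R)) (A : (E -> R) -> (E -> R))
  (DB : set (E -> R)) (B : (E -> R) -> (E * Uc -> R)) (U : set E)
  {d} {Om : measurableType d} (P : probability Om R)
  (Y : Om -> R -> E) (l0 : Om -> R -> R) (L1 : Om -> LMeas) : Prop :=
  let th := fun w => exit_time U (Y w) in
  (forall w, cadlag (Y w)) /\
  (forall t, 0 <= t -> rv (fun w => Y w t)) /\
  (forall w, (forall t, 0 <= t -> 0 <= l0 w t) /\
             (forall s t, 0 <= s <= t -> l0 w s <= l0 w t)) /\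
  (forall t, 0 <= t -> rv (fun w => l0 w t)) /\
  (forall w, in_LU (L1 w)) /\
  (forall f, Cc f -> rv (fun w => int_LU (L1 w) f)) /\
  {ae P, forall w, forall t, 0 <= t ->
     ((l0 w t)%:E = \int[LS (l0 w)]_(s in I0 t) (\1_(closure E0) (Y w s))%:E)%E} /\
  {ae P, forall w, forall t, 0 <= t ->
     (L1 w (I0 t `*` setT) =
      \int[L1 w]_(p in I0 t `*` setT) (\1_Xi (Y w p.1, p.2))%:E)%E} /\
  {ae P, forall w, forall t, 0 <= t ->
     Y w t = Y w (tmin t (th w)) /\ l0 w t = l0 w (tmin t (th w)) /\
     (forall C : set (Borel Uc), measurable C ->
        L1 w (I0 t `*` C) = L1 w (I0 (tmin t (th w)) `*` C))} /\
  {ae P, forall w, forall t, 0 <= t ->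
     ((l0 w t)%:E + L1 w (I0 t `*` setT) = mine t%:E (th w))%E} /\
  (forall f, DA f -> DB f ->
     martingale P (nat_filtration Y l0 L1)
       (fun t w => f (Y w t) - f (Y w 0)
          - fine (\int[LS (l0 w)]_(s in I0 t) (A f (Y w s))%:E)
          - fine (\int[L1 w]_(p in I0 t `*` setT) (B f (Y w p.1, p.2))%:E))).

Definition cmp_solution (E0 : set E) (Xi : set (E * Uc))
  (DA : set (E -> R)) (A : (E -> R) -> (E -> R))
  (DB : set (E -> R)) (B : (E -> R) -> (E * Uc -> R))
  {d} {Om : measurableType d} (P : probability Om R)
  (Y : Om -> R -> E) (l0 : Om -> R -> R) (L1 : Om -> LMeas) : Prop :=
  stopped_cmp_solution E0 Xi DA A DB B setT P Y l0 L1.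

Definition has_initial_law {d} {Om : measurableType d} (P : probability Om R)
  (Y : Om -> R -> E) (nu : probability (Borel E) R) : Prop :=
  forall C : set (Borel E), measurable C -> P ((fun w => Y w 0) @^-1` C) = nu C.

(* state space of (Y, l0, L1, th): paths, paths, L_U (encoded by its
   integrals against C_c functions), [0,+oo] ; with the sigma-algebra
   generated by the coordinate / evaluation maps *)
Definition state := ((R -> E) * (R -> R) * ((R * Uc -> R) -> \bar R) * \bar R)%type.

Definition state_gen : set (set state) := fun G =>
  (exists t (O : set E), 0 <= t /\ open O /\ G = [set z | O (z.1.1.1 t)]) \/
  (exists t (O : set R), 0 <= t /\ open O /\ G = [set z | O (z.1.1.2 t)]) \/
  (exists f (O : set (\bar R)), Cc f /\ open O /\ G = [set z | O (z.1.2 f)]) \/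
  (exists O : set (\bar R), open O /\ G = [set z | O z.2]).

Definition same_law {d1} {Om1 : measurableType d1} (P1 : probability Om1 R)
  (X1 : Om1 -> state) {d2} {Om2 : measurableType d2} (P2 : probability Om2 R)
  (X2 : Om2 -> state) : Prop :=
  forall G, <<s state_gen >> G -> P1 (X1 @^-1` G) = P2 (X2 @^-1` G).

Definition encode {d} {Om : measurableType d} (Y : Om -> R -> E)
  (l0 : Om -> R -> R) (L1 : Om -> LMeas) (th : Om -> \bar R) : Om -> state :=
  fun w => (Y w, l0 w, fun f => int_LU (L1 w) f, th w).

Definition encode_stopped {d} {Om : measurableType d} (Y : Om -> R -> E)
  (l0 : Om -> R -> R) (L1 : Om -> LMeas) (th : Om -> \bar R) : Om -> state :=
  fun w => (fun t => Y w (tmin t (th w)), fun t => l0 w (tmin t (th w)),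
            fun f : R * Uc -> R =>
              (\int[L1 w]_(p in [set p : R * Borel Uc | (0 <= p.1)%R /\ (p.1%:E <= th w)%E])
                        (f p)%:E)%E,
            th w).

End cmp.

(* Main.v *)
Require Import Defs.
From HB Require Import structures.
From mathcomp Require Import all_boot all_order all_algebra.
From mathcomp Require Import all_classical all_reals all_analysis.
From mathcomp Require Import measurable_realfun ring lra.

Set Implicit Arguments.
Unset Strict Implicit.
Unset Printing Implicit Defensive.

Import Order.TTheory GRing.Theory Num.Theory.
Import numFieldNormedType.Exports.

Local Open Scope classical_set_scope.
Local Open Scope ring_scope.

(** Let theta be the exit time of the stopped solution and Z its position at theta. Start a
    solution of the controlled martingale problem from the law of Z and let it continue the
    stopped path after time theta. Gluing needs the conditional law of that solution given its
    starting point; since E and U are compact metric, the whole solution can be coded by a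
    single real number, which reduces the disintegration to conditional quantile functions and
    puts the continuation on Om * R.

    Because lambda_0(t) + Lambda_1([0,t] x U) is the (stopped) clock, lambda_0 is determined by
    Lambda_1, and after extending Bf continuously from Xi by Tietze's theorem
    f(Y(t)) - f(Y(0)) - int Af dlambda_0 - int Bf dLambda_1 is a functional of the pair
    (Y, Lambda_1) alone. For the glued pair this functional is the sum of the stopped martingale
    and of the functional of the continuation run from time theta on. The first summand only
    moves before theta, where the two natural filtrations have the same trace. For the second
    one theta is discretized from below: on theta in [k/n, (k+1)/n) the information available
    at time s is contained in the product of the initial sigma-algebra and the filtration of the
    continuation at time s - k/n, where the increments have mean zero by a pi-lambda argument;
    right continuity and dominated convergence then let n tend to infinity. *)

(** * Random elements of compact metric spaces *)

(** The obstacle is that the solution started from the exit law lives on an arbitrary probability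
    space, where conditional laws need not exist. Only its law matters, so it is moved to the line
    by a code from which path and control can be recovered; the decoding is then corrected so that
    every real number, not just almost every one, yields a cadlag path and an admissible control.
    Whatever holds only almost surely is collected in one set G of full measure. Two choices avoid
    any stopping-time argument. Before theta, an event of the glued filtration is replaced by an
    event of the stopped one; they may differ where theta <= s, but there the stopped increment is
    zero. After theta, rounding theta down rounds the elapsed time s - theta up: the enlarged
    information still contains the glued past, and elapsed times are approached from the right, the
    side on which cadlag paths converge. Measurability is reduced throughout to countably many
    conditions. Since [rv] speaks of open sets of a single space, pairs of maps are treated through
    the Cantor set, which maps onto every compact metric space. *)

Section measurable_maps.
Context {R : realType}.

Lemma rvP {d} {Om : measurableType d} {T : ptopologicalType} (X : Om -> T) :
  rv X <-> measurable_fun setT (X : Om -> Borel T).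
Proof.
split=> [rX|mX O oO].
  apply: (@measurability _ _ Om (Borel T) setT _ (@open T)) => //.
  by move=> _ [V oV <-]; rewrite setTI; exact: rX.
rewrite -[X in measurable X]setTI; apply: mX => //.
exact: sub_sigma_algebra.
Qed.

Lemma Borel_open {T : ptopologicalType} (O : set T) : open O ->
  measurable (O : set (Borel T)).
Proof. by move=> oO; exact: sub_sigma_algebra. Qed.

Lemma Borel_closed {T : ptopologicalType} (O : set T) : closed O ->
  measurable (O : set (Borel T)).
Proof.
move=> cO; rewrite -(setCK O); apply: measurableC; apply: Borel_open.
exact: closed_openC.
Qed.

Lemma rv_comp {d} {Om : measurableType d} {S T : topologicalType}
  (X : Om -> S) (h : S -> T) : continuous h -> rv X -> rv (h \o X).
Proof.
move=> /continuousP ch rX O oO; rewrite comp_preimage; exact/rX/ch.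
Qed.

Lemma rv_realP {d} {Om : measurableType d} (X : Om -> R) :
  rv X <-> measurable_fun setT X.
Proof.
split=> [rX|mX O oO].
  apply: (measurability _ (RGenOpens.measurableE R)) => //.
  move=> _ [_ [a [b ->]] <-]; rewrite setTI; apply: rX.
  exact: interval_open.
rewrite -[X in measurable X]setTI; apply: mX => //.
exact: open_measurable.
Qed.

Lemma ereal_open_measurable (O : set (\bar R)) : open O -> measurable O.
Proof.
move=> oO; have mO : measurable (EFin @^-1` O : set R).
  apply: open_measurable; rewrite openE => r Or; rewrite /interior /preimage.
  by apply: (proj1 (@nbhs_EFin R O r)); apply: open_nbhs_nbhs; split.
have mI x : measurable (O `&` [set x]).
  have [Ox|nOx] := pselect (O x).
    by rewrite setIidr// => _ ->.
  by rewrite (_ : _ `&` _ = set0)// -subset0 => y [Oy yx]; apply: nOx; rewrite -yx.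
rewrite (_ : O = EFin @` (EFin @^-1` O) `|` (O `&` [set +oo; -oo]%E)).
  apply: measurableU; first exact: measurable_image_EFin.
  by rewrite setIUr; apply: measurableU.
apply/seteqP; split.
  by move=> [r| |] Or; [left; exists r|right; split => //; left|right; split=> //; right].
by move=> x [[r Or <-]|[]].
Qed.

Lemma rv_erealP {d} {Om : measurableType d} (X : Om -> \bar R) :
  rv X <-> measurable_fun setT X.
Proof.
split=> [rX|mX O oO].
  apply: (measurability _ (ErealGenOInfty.measurableE R)) => //.
  move=> _ [_ [x ->] <-]; rewrite setTI; apply: rX.
  have -> : [set` `]x%:E, +oo[] = [set y | (x%:E < y)%E].
    by apply/funext => y /=; rewrite in_itv/= andbT.
  exact: open_ereal_gt_ereal.
rewrite -[X in measurable X]setTI; apply: mX => //.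
exact: ereal_open_measurable.
Qed.

End measurable_maps.

Section cozero.
Context {R : realType}.

(** The truncation x -> min(1, x) is nondecreasing and 1-Lipschitz. Infinite values are treated
    apart because [edist] may be +oo. *)
Lemma fine_min1_lip (a b : \bar R) (e : R) : (0 <= a)%E -> (0 <= b)%E ->
  0 <= e -> (a <= e%:E + b)%E -> fine (mine 1%E a) <= e + fine (mine 1%E b).
Proof.
have minE (c : R) : fine (mine 1%E c%:E) = Num.min 1 c by rewrite -EFin_min.
have miny : mine 1%E +oo%E = 1%E :> \bar R by rewrite /Order.min ltry.
case: b => [b| |] //; case: a => [a| |] //; rewrite ?lee_fin ?miny => a0 b0 e0.
- rewrite !minE => abe.
  by rewrite /Order.min; case: ltP => h1; case: ltP => h2; lra.
- by move=> _; rewrite minE /= ge_min lerDr e0.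
- by move=> _; rewrite /= lerDr.
Qed.

Lemma fine_min1_gt0 (a : \bar R) : (0 <= a)%E ->
  (0 < fine (mine 1%E a)) = (0 < a)%E.
Proof.
case: a => [a| |] // a0.
  by rewrite -EFin_min /= lt_min ltr01 lte_fin.
by rewrite /Order.min /= ltry /= ltr01 ltry.
Qed.

Lemma fine_min1_le1 (a : \bar R) : (0 <= a)%E -> fine (mine 1%E a) <= 1.
Proof.
case: a => [a| |] // a0; first by rewrite -EFin_min /= ge_min lexx.
by rewrite /Order.min ltry.
Qed.

Context {T : pseudoMetricType R}.

(** The extended distance cut off at 1: real valued, jointly continuous, and with the same small
    balls, so that closeness becomes a measurable real condition. *)
Definition bdist (x y : T) : R := fine (mine 1%E (edist (x, y))).

Lemma bdist_xx x : bdist x x = 0.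
Proof. by rewrite /bdist edist_refl /Order.min ifN // -leNgt lee01. Qed.

Lemma bdist_le (x y x' y' : T) (e : R) : 0 <= e ->
  (edist (x, y) <= e%:E + edist (x', y'))%E -> bdist x y <= e + bdist x' y'.
Proof. by move=> e0 ?; apply: fine_min1_lip => //; exact: edist_ge0. Qed.

Lemma bdist_ball x y e : e <= 1 -> bdist x y < e -> ball x e y.
Proof.
move=> e1; rewrite /bdist => h; apply: (@edist_lt_ball _ _ _ (x, y)).
move: h (edist_ge0 (x, y)); case: (edist (x, y)) => [r| |] //.
  by rewrite -EFin_min /= gt_min lte_fin => /orP[|//]; lra.
by rewrite /Order.min ltry /= => /lt_geF; rewrite e1.
Qed.

Lemma ball_bdist x y e : 0 < e -> ball x e y -> bdist x y <= e.
Proof.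
move=> e0 xy; rewrite -[leRHS]addr0 -(bdist_xx x); apply: bdist_le (ltW e0) _.
by rewrite edist_refl adde0; exact: (@edist_fin _ _ _ (x, y)).
Qed.

Lemma bdist_ge0 x y : 0 <= bdist x y.
Proof.
by rewrite /bdist fine_ge0// le_min lee01 edist_ge0.
Qed.

Lemma bdist_sym x y : bdist x y = bdist y x.
Proof. by rewrite /bdist edist_sym. Qed.

Lemma bdist_triangle x y z : bdist x z <= bdist x y + bdist y z.
Proof.
have [xy1|xy1] := leP 1%E (edist (x, y)).
  rewrite {2}/bdist (min_idPl xy1) /=.
  have : bdist x z <= 1.
    exact/fine_min1_le1/edist_ge0.
  by have := bdist_ge0 y z; lra.
have xyf : edist (x, y) \is a fin_num.
  by rewrite ge0_fin_numE ?edist_ge0// (lt_le_trans xy1)// leey.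
rewrite {2}/bdist (min_idPr (ltW xy1)); apply: bdist_le.
  by rewrite fine_ge0// edist_ge0.
by rewrite fineK//; exact: edist_triangle.
Qed.

Lemma bdist_continuous : continuous (fun p : T * T => bdist p.1 p.2).
Proof.
move=> [x y]; apply/cvgrPdist_le => /= e e0.
have e20 : 0 < e / 2 by rewrite divr_gt0.
exists (ball x (e / 2), ball y (e / 2)); first by split => /=; exact: nbhsx_ballx.
move=> [x' y'] [/= /(ball_bdist e20) xx' /(ball_bdist e20) yy'].
have := bdist_triangle x x' y; have := bdist_triangle x' y' y.
have := bdist_triangle x' x y'; have := bdist_triangle x y y'.
rewrite (bdist_sym x' x) (bdist_sym y' y) ler_norml => *; lra.
Qed.

(** The witness is the truncated distance to the complement. It turns membership in an open set into
    positivity of a continuous function, which is how limits of random elements and masses of open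
    sets are reached. *)
Lemma cozero_open (O : set T) : open O -> exists f : T -> R,
  [/\ continuous f, forall x, 0 <= f x <= 1 & forall x, O x <-> 0 < f x].
Proof.
move=> oO; exists (fun x => fine (mine 1%E (edist_inf (~` O) x))); split.
- move=> x; apply/cvgrPdist_le => /= e e0.
  near=> y; have xy : ball x e y by near: y; exact: nbhsx_ballx.
  have lip u v : ball u e v -> fine (mine 1%E (edist_inf (~` O) u)) <=
      e + fine (mine 1%E (edist_inf (~` O) v)).
    move=> uv; apply: fine_min1_lip; rewrite ?edist_inf_ge0 ?(ltW e0)//.
    apply: le_trans (edist_inf_triangle _ u v) _; apply: leeD => //.
    exact: (@edist_fin _ _ _ (u, v)).
  by have := lip _ _ xy; have := lip _ _ (ball_sym xy); rewrite ler_norml => *; lra.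
- move=> x; rewrite fine_ge0 ?le_min ?lee01 ?edist_inf_ge0//=.
  exact/fine_min1_le1/edist_inf_ge0.
- move=> x; rewrite fine_min1_gt0 ?edist_inf_ge0//; split.
    move=> Ox; have /nbhs_ballP[e /= e0 xe] := open_nbhs_nbhs (conj oO Ox).
    apply: (@lt_le_trans _ _ e%:E); first by rewrite lte_fin.
    apply: le_ereal_inf_tmp => _ [y nOy <-]; rewrite leNgt; apply/negP => /edist_lt_ball.
    by move/xe.
  by apply: contraPP => nOx; rewrite edist_inf0 ?ltxx.
Unshelve. all: by end_near.
Qed.

End cozero.

Section rv_limits.
Context {R : realType} {d : measure_display} {Om : measurableType d}.

Lemma rv_continuousP {T : pseudoMetricType R} (X : Om -> T) :
  rv X <-> forall f : T -> R, continuous f -> measurable_fun setT (f \o X).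
Proof.
split=> [rX f cf|fX O oO]; first exact/rv_realP/rv_comp.
have [f [cf _ Of]] := cozero_open oO.
have -> : X @^-1` O = (f \o X) @^-1` `]0, +oo[.
  by apply/seteqP; split => w /=; rewrite in_itv/= andbT => /Of.
by rewrite -[_ @^-1` _]setTI; exact: fX.
Qed.

(** Preimages of open sets do not pass to pointwise limits; compositions with continuous real
    functions do. *)
Lemma rv_cvg {T : pseudoMetricType R} (X_ : nat -> Om -> T) (X : Om -> T) :
  (forall n, rv (X_ n)) -> (forall w, X_ n w @[n --> \oo] --> X w) -> rv X.
Proof.
move=> rX XX; apply/rv_continuousP => f cf.
apply: (@measurable_fun_cvg _ _ _ _ (fun n => f \o X_ n)) => [m|w _].
  by have /rv_continuousP := rX m; exact.
by apply: continuous_cvg; [exact: cf|exact: XX].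
Qed.

Lemma rv_const {T : topologicalType} (x : T) : rv (fun _ : Om => x).
Proof.
move=> O oO; have [Ox|nOx] := pselect (O x).
  by rewrite (_ : _ @^-1` _ = setT)//; apply/seteqP; split.
by rewrite (_ : _ @^-1` _ = set0)//; apply/seteqP; split.
Qed.

Lemma rv_if {T : topologicalType} (B : set Om) (X Y : Om -> T) :
  measurable B -> rv X -> rv Y -> rv (fun w => if w \in B then X w else Y w).
Proof.
move=> mB rX rY O oO.
rewrite (_ : _ @^-1` _ = (B `&` X @^-1` O) `|` (~` B `&` Y @^-1` O)).
  apply: measurableU; apply: measurableI => //; [exact: rX|exact: measurableC|exact: rY].
apply/seteqP; split => w /=.
  by case: ifPn => [/set_mem|/negP]; rewrite ?inE; [left|right].
by move=> [[Bw]|[Bw]]; [rewrite mem_set|rewrite memNset].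
Qed.

End rv_limits.

Lemma bigcup_count_measurable d (T : measurableType d) (I : countType)
  (D : set I) (F : I -> set T) : (forall i, D i -> measurable (F i)) ->
  measurable (\bigcup_(i in D) F i).
Proof.
move=> mF; rewrite bigcup_mkcond; apply: countable_bigcupT_measurable => // i.
by case: ifPn => // /set_mem; exact: mF.
Qed.

Section cantor_coding.
Context {R : realType}.

Definition cyl (s : seq bool) : set cantor_space :=
  [set c | forall i, (i < size s)%N -> c i = nth false s i].

Lemma cantor_cvg (c_ : nat -> cantor_space) (c : cantor_space) :
  (forall i, \forall n \near \oo, c_ n i = c i) -> c_ n @[n --> \oo] --> c.
Proof.
move=> h; apply/cvg_sup => i U [V] [[W] oW <-] Wc WU.
apply: (filterS WU); have [N _ Nc] := h i; exists N => // n /= Nn.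
by rewrite /preimage /= Nc.
Qed.

(** Otherwise each cylinder around c would contain a point outside A, and these points would
    converge to c. *)
Lemma nbhs_cyl (c : cantor_space) (A : set cantor_space) : nbhs c A ->
  exists n, cyl (mkseq c n) `<=` A.
Proof.
move=> cA; apply: contrapT => /forallNP h.
have {}h n : exists b, cyl (mkseq c n) b /\ ~ A b.
  by apply: contrapT => /forallNP k; apply: (h n) => b nb; apply: contrapT => nA; exact: (k b).
pose b_ n := projT1 (cid (h n)).
have : b_ n @[n --> \oo] --> c.
  apply: cantor_cvg => i; near=> n.
  have [+ _] := projT2 (cid (h n)); move=> /(_ i).
  have ni : (i < n)%N by near: n; exact: nbhs_infty_gt.
  by rewrite size_mkseq => /(_ ni); rewrite nth_mkseq.
move=> /(_ _ cA) [n _ /(_ n (leqnn n))] /=.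
by have [] := projT2 (cid (h n)).
Unshelve. all: by end_near.
Qed.

Lemma closed_cyl s : closed (cyl s).
Proof.
have -> : cyl s = \bigcap_(i in [set i | (i < size s)%N])
    (proj i @^-1` [set nth false s i] : set cantor_space).
  by apply/seteqP; split.
apply: closed_bigI => i _; apply: preimage_closed.
  by move=> ? _; exact: (@proj_continuous _ (fun _ : nat => bool)).
exact: discrete_closed.
Qed.

(** There are only countably many finite words, so the preimage of an open set is a countable union
    of cylinder events. *)
Lemma rv_cantor d (Om : measurableType d) (T : topologicalType) (sg : cantor_space -> T)
    (b : Om -> nat -> bool) : continuous sg ->
  (forall n, measurable [set w | b w n]) -> rv (fun w => sg (b w)).
Proof.
move=> /continuousP csg mb O oO.
have -> : (fun w => sg (b w)) @^-1` O =
    \bigcup_(s in [set s | cyl s `<=` sg @^-1` O]) [set w | cyl s (b w)].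
  apply/seteqP; split => [w /= Obw|w [s sO bs]]; last exact: (sO _ bs).
  have [n nO] : exists n, cyl (mkseq (b w) n) `<=` sg @^-1` O.
    by apply: nbhs_cyl; apply: open_nbhs_nbhs; split => //; exact: csg.
  by exists (mkseq (b w) n) => //= i; rewrite size_mkseq => ni; rewrite nth_mkseq.
apply: bigcup_count_measurable => // s _.
have -> : [set w | cyl s (b w)] = \bigcap_(i in [set i | (i < size s)%N])
    [set w | b w i = nth false s i].
  by apply/seteqP; split => w.
apply: bigcap_measurableType => // i _; case: (nth _ _ _); first exact: mb.
rewrite (_ : [set _ | _] = ~` [set w | b w i]); first exact/measurableC/mb.
by apply/seteqP; split => w /=; case: (b w i).
Qed.

End cantor_coding.

Section cantor_section.
Context {R : realType} {T : pseudoPMetricType R}.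
Variable sg : cantor_space -> T.
Hypotheses (hT : hausdorff_space T) (csg : continuous sg)
  (ssg : forall x, exists c, sg c = x).

Let hit s : set T := sg @` cyl s.

(** Greedy choice of the lexicographically least preimage of x: append 0 if some preimage of x
    continues that way, and 1 otherwise. This yields a Borel section of the surjection [sg]. *)
Fixpoint lexmin_prefix (x : T) n : seq bool := if n is m.+1 then
  rcons (lexmin_prefix x m) (~~ `[< hit (rcons (lexmin_prefix x m) false) x >]) else [::].

Definition lexmin (x : T) : nat -> bool := fun n => nth false (lexmin_prefix x n.+1) n.

Lemma size_lexmin_prefix x n : size (lexmin_prefix x n) = n.
Proof. by elim: n => //= n IH; rewrite size_rcons IH. Qed.

Lemma lexmin_prefixE x n : lexmin_prefix x n = mkseq (lexmin x) n.
Proof.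
elim: n => //= n IH; rewrite /mkseq -addn1 iotaD map_cat/= add0n.
rewrite -/(mkseq _ _) -IH cats1; congr rcons.
by rewrite /lexmin /= nth_rcons size_lexmin_prefix ltnn eqxx.
Qed.

Lemma lexmin_prefix_hit x n : hit (lexmin_prefix x n) x.
Proof.
elim: n => [|n [c cn cx]]; first by have [c cx] := ssg x; exists c.
rewrite /=; case: asboolP => //= h.
exists c => // i; rewrite size_rcons nth_rcons size_lexmin_prefix.
rewrite ltnS leq_eqVlt => /predU1P[->|ni].
  rewrite ltnn eqxx; apply: contrapT => /negP cf; apply: h.
  exists c => // j; rewrite size_rcons nth_rcons size_lexmin_prefix.
  rewrite ltnS leq_eqVlt => /predU1P[->|nj].
    by rewrite ltnn eqxx; apply/negbTE.
  by rewrite nj; apply: cn; rewrite size_lexmin_prefix.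
by rewrite ni; apply: cn; rewrite size_lexmin_prefix.
Qed.

(** Every prefix of [lexmin x] extends to a preimage of x; these preimages converge to [lexmin x],
    and the fibre over x is closed. *)
Lemma lexminK x : sg (lexmin x) = x.
Proof.
have h n : exists c, cyl (mkseq (lexmin x) n) c /\ sg c = x.
  by have [c] := lexmin_prefix_hit x n; rewrite lexmin_prefixE; exists c.
pose c_ n := projT1 (cid (h n)).
have cc : c_ n @[n --> \oo] --> (lexmin x : cantor_space).
  apply: cantor_cvg => i; near=> n.
  have [+ _] := projT2 (cid (h n)); move=> /(_ i).
  have ni : (i < n)%N by near: n; exact: nbhs_infty_gt.
  by rewrite size_mkseq => /(_ ni); rewrite nth_mkseq.
have /(cvg_unique hT) : sg (c_ n) @[n --> \oo] --> sg (lexmin x).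
  by apply: continuous_cvg => //; exact: csg.
apply; rewrite (_ : (fun n => sg (c_ n)) = cst x); first exact: cvg_cst.
by apply/funext => n; have [] := projT2 (cid (h n)).
Unshelve. all: by end_near.
Qed.

(** A cylinder is compact, so its image is compact and hence closed. *)
Lemma measurable_hit s : measurable (hit s : set (Borel T)).
Proof.
apply: Borel_closed; apply: compact_closed => //.
apply: continuous_compact; first exact: continuous_subspaceT.
apply: (@subclosed_compact _ _ setT) => //; first exact: closed_cyl.
exact: cantor_space_compact.
Qed.

Lemma measurable_lexmin_prefix n s :
  measurable ([set x | lexmin_prefix x n = s] : set (Borel T)).
Proof.
elim: n s => [|n IH] s.
  have [->|s0] := eqVneq s [::].
    by rewrite (_ : [set _ | _] = setT)//; apply/seteqP; split.
  rewrite (_ : [set _ | _] = set0)//; apply/seteqP; split => // x /= x0.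
  by rewrite -x0 eqxx in s0.
case/lastP: s => [|s b].
  rewrite (_ : [set _ | _] = set0)//; apply/seteqP; split => // x /= /(congr1 size).
  by rewrite size_rcons.
rewrite (_ : [set _ | _] = [set x | lexmin_prefix x n = s] `&`
   (if b then ~` hit (rcons s false) else hit (rcons s false))).
  apply: measurableI => //; case: b; [apply: measurableC|]; exact: measurable_hit.
apply/seteqP; split => x /=.
  move=> /rcons_inj[xs]; rewrite xs => <-; split => //.
  by case: asboolP.
by move=> [->]; case: b => h; congr rcons; case: asboolP.
Qed.

Lemma measurable_lexmin n : measurable ([set x | lexmin x n] : set (Borel T)).
Proof.
rewrite (_ : [set _ | _] = \bigcup_(s in [set s | nth false s n])
  [set x | lexmin_prefix x n.+1 = s]).
  by apply: bigcup_count_measurable => // s _; exact: measurable_lexmin_prefix.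
apply/seteqP; split => [x /= xn|x [s /= sn xs]].
  by exists (lexmin_prefix x n.+1).
by move: sn; rewrite -xs.
Qed.

(** A countably valued approximation of the identity map: the first n digits, padded with zeros. *)
Definition lexmin_approx n (x : T) : T := sg (nth false (lexmin_prefix x n)).

Lemma cvg_lexmin_approx x : lexmin_approx n x @[n --> \oo] --> x.
Proof.
rewrite -[X in _ --> X](lexminK x); apply: (cvg_comp (fun n => nth false (lexmin_prefix x n) : cantor_space) sg
  (G := nbhs (lexmin x : cantor_space))); last exact: csg.
apply: cantor_cvg => i; near=> n.
have ni : (i < n)%N by near: n; exact: nbhs_infty_gt.
by rewrite lexmin_prefixE nth_mkseq.
Unshelve. all: by end_near.
Qed.

End cantor_section.

Section rv_pair.
Context {R : realType} {S T : pseudoPMetricType R}.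
Hypotheses (hS : hausdorff_space S) (cS : compact [set: S])
           (hT : hausdorff_space T) (cT : compact [set: T]).

Lemma compact_cantor_image (U : pseudoPMetricType R) : hausdorff_space U ->
  compact [set: U] ->
  exists sg : cantor_space -> U, continuous sg /\ forall x, exists c, sg c = x.
Proof.
move=> hU cU; have [f cf] := cantor_surj cU hU; exists f; split => // x.
by have [c _ <-] := @surj _ _ _ _ f x I; exists c.
Qed.

(** An open set of the product is not given as a countable union of rectangles. The approximations
    take countably many values, so the preimage of any set under the approximating pair is a
    countable union of intersections of coordinate events; [rv_cvg] passes to the limit. *)
Lemma rv_pair d (Om : measurableType d) (X : Om -> S) (V : Om -> T) :
  rv X -> rv V -> rv (fun w => (X w, V w)).
Proof.
move=> rX rV.
have [f [cf sf]] := compact_cantor_image hS cS.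
have [g [cg sgg]] := compact_cantor_image hT cT.
apply: (@rv_cvg R _ _ (S * T)%type
  (fun n w => (lexmin_approx f n (X w), lexmin_approx g n (V w)))); last first.
  by move=> w; apply: cvg_pair; exact: cvg_lexmin_approx.
move=> n O oO.
rewrite (_ : _ @^-1` _ = \bigcup_(p in [set p : seq bool * seq bool |
    O (f (nth false p.1), g (nth false p.2))])
    ((X @^-1` [set x | lexmin_prefix f x n = p.1]) `&`
     (V @^-1` [set x | lexmin_prefix g x n = p.2]))).
  apply: bigcup_count_measurable => // p _; apply: measurableI.
    move/rvP : rX => /(_ measurableT _ (measurable_lexmin_prefix hS cf n p.1)).
    by rewrite setTI.
  move/rvP : rV => /(_ measurableT _ (measurable_lexmin_prefix hT cg n p.2)).
  by rewrite setTI.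
apply/seteqP; split => [w /= Ow|w [p /= Op [Xp Vp]]].
  by exists (lexmin_prefix f (X w) n, lexmin_prefix g (V w) n).
by rewrite /preimage /lexmin_approx /= Xp Vp.
Qed.

End rv_pair.

(** * Coding by reals and coupling *)

Section real_codes.
Context {R : realType}.

(** The base 4 is even, so the parity of the whole integer part is the parity of its last base-4
    digit. *)
Definition bit (r : R) n : bool := odd `|Num.floor (r * 4 ^+ n.+1)|%N.

Lemma measurable_bit n : measurable [set r | bit r n].
Proof.
rewrite (_ : [set _ | _] = \bigcup_(k in [set k : int | odd `|k|%N])
   ((fun r : R => r * 4 ^+ n.+1) @^-1` `[k%:~R, (k + 1)%:~R[)).
  apply: bigcup_count_measurable => k _; rewrite -[_ @^-1` _]setTI.
  have : measurable_fun setT (fun r : R => r * 4 ^+ n.+1) by exact: measurable_funM.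
  exact.
apply/seteqP; split => [r rn|r [k /= ok]].
  exists (Num.floor (r * 4 ^+ n.+1)) => //=.
  by rewrite in_itv/= floor_itv.
by rewrite in_itv/= -floor_eq => /eqP rk; rewrite /bit rk.
Qed.

Fixpoint code_num (b : nat -> bool) n : nat :=
  if n is m.+1 then (4 * code_num b m + b m)%N else 0%N.

Definition code_sum (b : nat -> bool) n : R := (code_num b n)%:R / 4 ^+ n.

(* The digits 0 and 1 are read in base 4, so that the tail of the expansion
   never carries over into an earlier digit. *)
Definition code (b : nat -> bool) : R := sup (range (code_sum b)).

Lemma code_sumS b n : code_sum b n.+1 = code_sum b n + (b n)%:R / 4 ^+ n.+1.
Proof.
rewrite /code_sum /= natrD natrM exprS invfM mulrDl; congr (_ + _).
have h1 : (4 : R) != 0 by rewrite pnatr_eq0.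
have h2 : (4 : R) ^+ n != 0 by rewrite expf_neq0// pnatr_eq0.
by rewrite mulrACA -mulrA mulVKf// mulrC mulrA mulfV// mul1r.
Qed.

(** The constant 1/3 is the geometric tail 1/4 + 1/16 + ..., reached when all remaining digits are
    1. Being below 1, it excludes a carry. *)
Lemma code_sum_le b m n : code_sum b m <= code_sum b n + 3^-1 / 4 ^+ n.
Proof.
have nd : {homo code_sum b : i j / (i <= j)%N >-> i <= j}.
  apply: homo_leq => //; first exact: le_trans.
  by move=> i; rewrite code_sumS lerDl divr_ge0// exprn_ge0.
have ni : {homo (fun n => code_sum b n + 3^-1 / 4 ^+ n) : i j / (i <= j)%N >-> j <= i}.
  apply: homo_leq => //; first by move=> y x z xy yz; exact: le_trans yz xy.
  move=> i; rewrite code_sumS -addrA lerD2l exprS.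
  have i0 : 0 < (4 : R)^-1 ^+ i by rewrite exprn_gt0// invr_gt0.
  rewrite invfM -exprVn; case: (b i) => /=; nra.
have d0 k : 0 <= 3^-1 / 4 ^+ k :> R by rewrite divr_ge0// exprn_ge0.
have [mn|/ltnW nm] := leqP m n.
  by rewrite (le_trans (nd _ _ mn))// lerDl.
by rewrite (le_trans _ (ni _ _ nm))//= lerDl.
Qed.

Lemma code_itv b n : code_sum b n <= code b <= code_sum b n + 3^-1 / 4 ^+ n.
Proof.
apply/andP; split.
  apply: ub_le_sup; last by exists n.
  by exists (code_sum b 0 + 3^-1 / 4 ^+ 0) => _ [m _ <-]; exact: code_sum_le.
apply: ge_sup; first by exists (code_sum b 0); exists 0%N.
by move=> _ [m _ <-]; exact: code_sum_le.
Qed.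

Lemma code_ge0 b : 0 <= code b.
Proof. by have := code_itv b 0; rewrite /code_sum /= mul0r => /andP[]. Qed.

Lemma code_lt1 b : code b < 1.
Proof.
have := code_itv b 0; rewrite /code_sum /= mul0r add0r expr0 divr1 => /andP[_].
by move=> /le_lt_trans; apply; lra.
Qed.

(** The integer shift N serves [strip_code], whose integer part records the time; it changes each
    integer part by an even number. *)
Lemma codeK N b n : bit (N%:R + code b) n = b n.
Proof.
rewrite /bit; have -> : Num.floor ((N%:R + code b) * 4 ^+ n.+1) =
    (N * 4 ^ n.+1 + code_num b n.+1)%N.
  apply/eqP; rewrite floor_eq; have := code_itv b n.+1; rewrite /code_sum.
  have p0 : 0 < (4 : R) ^+ n.+1 by rewrite exprn_gt0.
  rewrite -mulrDl ler_pdivrMr// ler_pdivlMr// => /andP[h1 h2].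
  set m := (N * 4 ^ n.+1 + code_num b n.+1)%N.
  have mE : m%:R = N%:R * 4 ^+ n.+1 + (code_num b n.+1)%:R :> R.
    by rewrite natrD natrM natrX.
  rewrite intrD -!pmulrn mE mulrDl.
  by apply/andP; split; lra.
rewrite absz_nat oddD oddM oddX /= andbF /= oddD oddM /=.
by case: (b n).
Qed.

Lemma measurable_code d (Om : measurableType d) (b : Om -> nat -> bool) :
  (forall n, measurable [set w | b w n]) -> measurable_fun setT (fun w => code (b w)).
Proof.
move=> mb; apply: (@measurable_fun_cvg _ _ _ _ (fun n w => code_sum (b w) n)).
  elim=> [|n IH].
    by rewrite (_ : (fun _ => _) = cst 0)//; apply/funext => w; rewrite /code_sum mul0r.
  rewrite (_ : (fun _ => _) = (fun w => code_sum (b w) n + \1_[set w | b w n] w / 4 ^+ n.+1)).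
      apply: measurable_funD => //; apply: measurable_funM => //.
  apply/funext => w; rewrite code_sumS indicE; congr (_ + _ / _).
  by congr _%:R; case: (boolP (b w n)) => h; [rewrite mem_set|rewrite memNset//; exact/negP].
move=> w _; apply/cvgrPdist_le => /= e e0.
have : (fun n : nat => 3^-1 * (4^-1) ^+ n : R) @ \oo --> (3^-1 * 0 : R).
  by apply: cvgMr; apply: cvg_expr; rewrite ger0_norm//; lra.
rewrite mulr0 => /cvgrPdist_le /(_ e e0) [N _ hN]; exists N => // n /= Nn.
have := hN n Nn; rewrite /= sub0r normrN exprVn.
have /andP[h1 h2] := code_itv (b w) n.
rewrite !ger0_norm ?subr_ge0 ?divr_ge0 ?exprn_ge0//; lra.
Qed.

End real_codes.

Section countable_codes.
Context {R : realType} {I : countType}.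

Definition codeI (b : I -> bool) : R := code (fun n => oapp b false (unpickle n)).
Definition bitI (r : R) (i : I) := bit r (pickle i).

Lemma codeIK N b i : bitI (N%:R + codeI b) i = b i.
Proof. by rewrite /bitI codeK pickleK. Qed.

Lemma measurable_codeI d (Om : measurableType d) (b : Om -> I -> bool) :
  (forall n, measurable [set w | b w n]) -> measurable_fun setT (fun w => codeI (b w)).
Proof.
move=> mb; apply: measurable_code => n; case: (unpickle n) => [i|] /=; first exact: mb.
by rewrite (_ : [set _ | _] = set0)//; apply/seteqP; split.
Qed.

End countable_codes.

Section rational_infimum.
Context {R : realType}.

(** An extended real is stored as the set of rationals above it, that is, as countably many bits.
    Every set of rationals decodes to some value, the empty one to +oo. *)
Definition einf_rat (A : set rat) : \bar R := ereal_inf [set (ratr q)%:E | q in A].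

Lemma einf_rat_lt (A : set rat) (x : \bar R) :
  (einf_rat A < x)%E <-> exists2 q, A q & ((ratr q : R)%:E < x)%E.
Proof.
split; first by move=> /ereal_inf_lt [_ [q Aq <-] qx]; exists q.
move=> [q Aq qx]; apply: le_lt_trans qx.
by apply: ereal_inf_lbound; exists q.
Qed.

Lemma einf_rat_gt (x : \bar R) : einf_rat [set q | (x < (ratr q)%:E)%E] = x.
Proof.
apply/eqP; rewrite eq_le; apply/andP; split; last first.
  by apply: le_ereal_inf_tmp => _ [q /= xq <-]; exact: ltW.
rewrite leNgt; apply/negP => h.
have [q [xq qe]] : exists q : rat, (x < (ratr q)%:E)%E /\
    ((ratr q)%:E < einf_rat [set q | (x < (ratr q)%:E)%E])%E.
  case: x h => [x| |]; case: (einf_rat _) => [y| |] //.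
  - rewrite lte_fin => /rat_in_itvoo[q]; rewrite in_itv/= => /andP[? ?].
    by exists q; rewrite !lte_fin.
  - move=> _; have /rat_in_itvoo[q] : x < x + 1 by rewrite ltrDl.
    by rewrite in_itv/= => /andP[? ?]; exists q; rewrite lte_fin ltry.
  - move=> _; have /rat_in_itvoo[q] : y - 1 < y by rewrite gtrBl.
    by rewrite in_itv/= => /andP[? ?]; exists q; rewrite lte_fin ltNyr.
  - by move=> _; exists 0; rewrite ltNyr ltry.
have : (einf_rat [set q | (x < (ratr q)%:E)%E] <= (ratr q)%:E)%E.
  by apply: ereal_inf_lbound; exists q.
by rewrite leNgt qe.
Qed.

Lemma measurable_einf_rat d (Om : measurableType d) (A : Om -> set rat) :
  (forall q, measurable [set w | A w q]) ->
  measurable_fun setT (fun w => einf_rat (A w)).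
Proof.
move=> mA; apply: (measurability _ (ErealGenInftyO.measurableE R)) => //.
move=> _ [_ [x ->] <-]; rewrite setTI.
rewrite (_ : _ @^-1` _ = \bigcup_(q in [set q : rat | ratr q < x]) [set w | A w q]).
  by apply: bigcup_count_measurable => q _; exact: mA.
apply/seteqP; split => w /=.
  by rewrite in_itv/= => /einf_rat_lt [q Aq]; rewrite lte_fin => qx; exists q.
by move=> [q qx Aq]; rewrite in_itv/=; apply/einf_rat_lt; exists q.
Qed.

End rational_infimum.

Section halfline_squeeze.
Context {R : realType}.

Lemma measure_lt_sup (m : {measure set (measurableTypeR R) -> \bar R}) (x : R) (c : \bar R) :
  (forall y, y < x -> (m `]-oo, y]%classic <= c)%E) -> (m `]-oo, x[%classic <= c)%E.
Proof.
move=> mc; pose F n : set (measurableTypeR R) := `]-oo, x - n.+1%:R^-1]%classic.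
have FE : \bigcup_n F n = `]-oo, x[%classic.
  apply/seteqP; split => [y [n _]|y]; rewrite /F /= !in_itv/=.
    by move=> /le_lt_trans; apply; rewrite gtrBl.
  move=> yx; have /ltr_add_invr [k] := yx; exists k => //.
  by rewrite /F /= in_itv/= lerBrDr ltW.
have : (m \o F) n @[n --> \oo] --> m (\bigcup_n F n).
  apply: nondecreasing_cvg_mu => [n||]; [exact: measurable_itv|by rewrite FE; exact: measurable_itv|].
  move=> i j ij; apply/subsetPset => y; rewrite /F /= !in_itv/= => /le_trans; apply.
  by rewrite lerD2l lerN2 lef_pV2 ?posrE// ler_nat.
rewrite FE => /cvg_lim <- //; apply: lime_le.
  apply: ereal_nondecreasing_is_cvgn => i j ij; apply: le_measure; rewrite ?inE; [exact: measurable_itv..|].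
  move=> y; rewrite /F /= !in_itv/= => /le_trans; apply.
  by rewrite lerD2l lerN2 lef_pV2 ?posrE// ler_nat.
by near=> n; apply: mc; rewrite gtrBl.
Unshelve. all: by end_near.
Qed.

(** Open half-lines for [m1], closed ones for [m2], and only rational endpoints: this is what a
    quantile transform provides when F is known at rationals without right continuity. Squeezing
    between neighbouring rationals gives equality on all open half-lines. *)
Lemma measure_eq_of_squeeze (m1 m2 : {measure set (measurableTypeR R) -> \bar R}) :
  (forall r : rat, (m2 `]-oo, ratr r]%classic < +oo)%E) ->
  (forall r : rat, (m1 `]-oo, ratr r[%classic <= m2 `]-oo, ratr r]%classic)%E) ->
  (forall q r : rat, q < r -> (m2 `]-oo, ratr q]%classic <= m1 `]-oo, ratr r[%classic)%E) ->
  forall A, measurable A -> m1 A = m2 A.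
Proof.
move=> m2oo m12 m21 A mA.
have le1 (x : R) : (m1 `]-oo, x[%classic <= m2 `]-oo, x[%classic)%E.
  apply: measure_lt_sup => y yx.
  have [q] := rat_in_itvoo yx; rewrite in_itv/= => /andP[yq qx].
  have := m12 q => /le_trans h; apply: (@le_trans _ _ (m1 `]-oo, ratr q[%classic)).
    by apply: le_measure; rewrite ?inE// => z /=; rewrite !in_itv/= => /le_lt_trans; apply.
  apply: h; apply: le_measure; rewrite ?inE// => z /=; rewrite !in_itv/= => /le_lt_trans; exact.
have le2 (x : R) : (m2 `]-oo, x[%classic <= m1 `]-oo, x[%classic)%E.
  apply: measure_lt_sup => y yx.
  have [r] := rat_in_itvoo yx; rewrite in_itv/= => /andP[yr rx].
  have [q] := rat_in_itvoo yr; rewrite in_itv/= => /andP[yq qr].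
  apply: (@le_trans _ _ (m2 `]-oo, ratr q]%classic)).
    by apply: le_measure; rewrite ?inE// => z /=; rewrite !in_itv/= => /le_trans; apply; exact: ltW.
  apply: le_trans (m21 q r _) _; first by rewrite ltr_rat in qr.
  by apply: le_measure; rewrite ?inE// => z /=; rewrite !in_itv/= => /lt_trans; apply.
apply: (@measure_unique _ R (measurableTypeR R) (RGenInftyO.G (R:=R)) (fun n : nat => `]-oo, (n%:R : R)[%classic : set R)) => //.
- exact: RGenInftyO.measurableE.
- move=> _ _ [x ->] [y ->]; exists (Num.min x y).
  by apply/seteqP; split => z /=; rewrite !in_itv/= lt_min => /andP.
- by move=> n; exists n%:R.
- apply/seteqP; split => // z _; exists (Num.truncn `|z|).+1 => //=.
  rewrite in_itv/=; apply: le_lt_trans (ler_norm z) _.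
  exact: truncnS_gt.
- by move=> _ [x ->]; apply/eqP; rewrite eq_le le1 le2.
- move=> n; apply: le_lt_trans (le1 _) _; apply: le_lt_trans (m2oo n%:R).
  rewrite rmorph_nat; apply: le_measure; rewrite ?inE// => z /=; rewrite !in_itv/=; exact: ltW.
Qed.

End halfline_squeeze.

Section quantile.
Context {R : realType} {d : measure_display} {T : measurableType d}.
Variable F : rat -> T -> \bar R.
Hypotheses (mF : forall q, measurable_fun setT (F q))
  (F0 : forall q x, q < 0 -> F q x = 0%E).

Let Fset (p : T * measurableTypeR R) : set rat := [set q | ((p.2 : R)%:E < F q p.1)%E].

(** Generalized inverse of q -> F q x at level v, taken over rationals so as to be jointly
    measurable in x and v. Where the infimum is infinite [fine] gives 0; [quant_dom] excludes those
    points. *)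
Definition quant (p : T * measurableTypeR R) : measurableTypeR R := fine (einf_rat (Fset p) : \bar R).

Definition quant_dom : set (T * measurableTypeR R) :=
  [set p | (0 : R) <= p.2 /\ exists q, Fset p q].

Let measurable_Fset q : measurable [set p | Fset p q].
Proof.
rewrite -[X in measurable X]setTI; apply: measurable_lte => //.
  by apply/measurable_EFinP; exact: measurable_snd.
exact: measurableT_comp (mF q) measurable_fst.
Qed.

Lemma measurable_quant : measurable_fun setT quant.
Proof.
by apply: measurableT_comp; [exact: fine_measurable|apply: measurable_einf_rat => q; exact: measurable_Fset].
Qed.

Lemma measurable_quant_dom : measurable quant_dom.
Proof.
rewrite (_ : quant_dom = (snd @^-1` `[0, +oo[) `&` \bigcup_q [set p | Fset p q]).
  apply: measurableI; last by apply: bigcup_count_measurable => q _; exact: measurable_Fset.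
  rewrite -[X in measurable X]setTI; exact: measurable_snd.
apply/seteqP; split => p /=.
  by rewrite /quant_dom /= => -[p0 [q pq]]; split; [rewrite in_itv/= p0|exists q].
by rewrite in_itv/= andbT => -[p0 [q _ pq]]; split => //; exists q.
Qed.

(** On [quant_dom] the infimum is a real number: some rational bounds it above, and it is
    nonnegative because F vanishes at negative rationals. *)
Lemma quant_lt p (x : R) : quant_dom p ->
  quant p < x <-> exists q, ratr q < x /\ ((p.2 : R)%:E < F q p.1)%E.
Proof.
move=> [p0 [q0 pq0]]; rewrite /quant.
have e0 : (0 <= einf_rat (Fset p) :> \bar R)%E.
  rewrite /einf_rat; apply: le_ereal_inf_tmp => _ [q pq <-]; rewrite lee_fin ler0q leNgt; apply/negP => q0'.
  by move: pq; rewrite /Fset /= F0// lte_fin ltNge p0.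
have efin : (einf_rat (Fset p) : \bar R) \is a fin_num.
  rewrite ge0_fin_numE//; apply: (@le_lt_trans _ _ (ratr q0 : R)%:E); last exact: ltry.
  by apply: ereal_inf_lbound; exists q0.
rewrite -lte_fin fineK//; split => [/einf_rat_lt[q pq qx]|[q [qx pq]]].
  by exists q; rewrite lte_fin in qx.
by apply/einf_rat_lt; exists q.
Qed.

End quantile.

Section image.
Context {R : realType} {d1 d2 : measure_display}.
Context {T1 : measurableType d1} {T2 : measurableType d2}.

Definition image_measure (m : {measure set T1 -> \bar R}) (f : T1 -> T2)
    (mf : measurable_fun setT f) : {measure set T2 -> \bar R} :=
  measure_function_pushforward__canonical__measure_function_Measure m mf.

Lemma image_measureE m f (mf : measurable_fun setT f) A :
  image_measure m mf A = m (f @^-1` A).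
Proof. by []. Qed.

Definition image_prob (P : probability T1 R) (f : T1 -> T2)
    (mf : measurable_fun setT f) : probability T2 R :=
  let mf' := isMeasurableFun.Build _ _ _ _ f mf in
  let f' : {mfun T1 >-> T2} := HB.pack f mf' in
  distribution P f'.

Lemma image_probE P f (mf : measurable_fun setT f) A :
  image_prob P mf A = P (f @^-1` A).
Proof. by []. Qed.

End image.

Section uniform.
Context {R : realType}.

Definition unif : set (measurableTypeR R) -> \bar R :=
  mrestr lebesgue_measure (measurable_itv `[0, 1[ : measurable (`[0, 1[%classic : set (measurableTypeR R))).
HB.instance Definition _ := Measure.on unif.

Let unif_setT : unif setT = 1%E.
Proof.
by rewrite /unif /mrestr setTI lebesgue_measure_itv/= lte_fin ltr01 sube0.
Qed.

HB.instance Definition _ := @Measure_isProbability.Build _ _ _ unif unif_setT.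

End uniform.

Lemma ae_forall_count {R : realType} {d : measure_display} {T : measurableType d}
  (mu : {measure set T -> \bar R}) (I : countType) (Q : I -> T -> Prop) :
  (forall i, {ae mu, forall x, Q i x}) -> {ae mu, forall x, forall i, Q i x}.
Proof.
move=> aQ; have : {ae mu, forall x, forall n : nat,
    if unpickle n is Some i then Q i x else True}.
  by apply: ae_foralln => n; case: unpickle => [i|]; [exact: aQ|exact: nearW].
by apply: filterS => x h i; have := h (pickle i); rewrite pickleK.
Qed.

Section ae_le.
Context {R : realType} {d : measure_display} {T : measurableType d}.

(** On the set where g < f the positive function f - g has nonpositive integral, so it vanishes
    almost everywhere there, which is absurd at each of its points. *)
Lemma ae_le_of_integral (mu : {measure set T -> \bar R}) (f g : T -> \bar R) :
  mu.-integrable setT f -> mu.-integrable setT g ->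
  (forall x, f x \is a fin_num) -> (forall x, g x \is a fin_num) ->
  (forall C, measurable C -> (\int[mu]_(x in C) f x <= \int[mu]_(x in C) g x)%E) ->
  {ae mu, forall x, (f x <= g x)%E}.
Proof.
move=> fi gi ff gf fg; pose D := [set x | (g x < f x)%E].
have mf := measurable_int _ fi; have mg := measurable_int _ gi.
have mD : measurable D by rewrite -[D]setTI; exact: measurable_lte.
have fiD := integrableS measurableT mD (@subsetT _ _) fi.
have giD := integrableS measurableT mD (@subsetT _ _) gi.
have h0 : (\int[mu]_(x in D) `|f x - g x| = 0)%E.
  under eq_integral => x /[!inE] Dx.
    rewrite gee0_abs; last by rewrite sube_ge0 ?gf ?orbT// ltW.
    over.
  apply/eqP; rewrite eq_le integral_ge0 ?andbT; last first.
    by move=> x Dx; rewrite sube_ge0 ?gf ?orbT// ltW.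
  rewrite integralB//; have gD := integrable_fin_num mD giD.
  by rewrite sube_le0 fg.
have /ae_eq_integral_abs : measurable_fun D (fun x => f x - g x)%E.
  by apply: emeasurable_funB; exact: measurable_funTS.
move=> /(_ mu mD)[/(_ h0) + _]; apply: filterS => x /= h.
rewrite leNgt; apply/negP => Dx; have /eqP := h Dx.
by rewrite sube_eq ?gf ?ff// add0e => /eqP fgx; move: Dx; rewrite fgx ltxx.
Qed.

End ae_le.

Section strip.
Context {R : realType} {d1 d2 : measure_display}.
Context {T1 : measurableType d1} {T2 : measurableType d2}.

Lemma bounded_integrable (m : {finite_measure set T1 -> \bar R}) (K : R)
    D (f : T1 -> R) : measurable D -> measurable_fun D f -> (forall r, `|f r| <= K) ->
  m.-integrable D (EFin \o f).
Proof.
move=> mD mf fK; apply: (le_integrable mD _ _ (finite_measure_integrable_cst m K mD)).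
  exact/measurable_EFinP.
by move=> x _ /=; rewrite lee_fin (le_trans (fK x))// ler_norm.
Qed.

End strip.

Lemma fubini_strip {R : realType} {d1 d2 : measure_display}
    {T1 : measurableType d1} {T2 : measurableType d2}
    (m1 : probability T1 R) (m2 : probability T2 R)
    (f : T1 * T2 -> R) (K : R) (B : set T1) :
  measurable B -> measurable_fun setT f -> (forall p, `|f p| <= K) ->
  (\int[(m1 \x m2)%E]_(p in B `*` setT) (f p)%:E =
   \int[m1]_(x in B) \int[m2]_u (f (x, u))%:E)%E.
Proof.
move=> mB mf fK; have mBT : measurable (B `*` setT : set (T1 * T2)) by exact: measurableX.
have fi : (m1 \x m2)%E.-integrable setT (EFin \o f).
  exact: (bounded_integrable ((m1 \x m2)%E : probability _ R) _ mf fK).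
rewrite integral_mkcond -integral12_prod_meas1; last first.
  apply/(integrable_mkcond _ mBT); exact: integrableS fi.
rewrite [RHS]integral_mkcond; apply: eq_integral => x _.
rewrite /fubini_F patchE; case: ifPn => xB.
  by apply: eq_integral => u _; rewrite patchE mem_set//; split=> //; exact/set_mem.
rewrite integral0_eq// => u _; rewrite patchE memNset// => -[/= /mem_set xB' _].
by rewrite xB' in xB.
Qed.

Lemma eq_measure_rect {R : realType} {d1 d2 : measure_display}
    {T1 : measurableType d1} {T2 : measurableType d2}
    (m1 m2 : {measure set (T1 * T2) -> \bar R}) : (m1 setT < +oo)%E ->
  (forall A B, measurable A -> measurable B -> m1 (A `*` B) = m2 (A `*` B)) ->
  forall X, measurable X -> m1 X = m2 X.
Proof.
move=> moo m12 X mX.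
pose C : set (set (T1 * T2)) :=
  [set C | exists A, measurable A /\ exists B, measurable B /\ C = A `*` B].
apply: (measure_unique C (fun n => setT)) => //.
- rewrite measurable_prod_measurableType //; congr (<<s _ >>).
  rewrite predeqE; split => [[A mA [B mB <-]]|[A [mA [B [mB ->]]]]].
    by exists A; split => //; exists B.
  by exists A => //; exists B.
- move=> /= _ _ [X1 [mX1 [X2 [mX2 ->]]]] [Y1 [mY1 [Y2 [mY2 ->]]]].
  rewrite -setXI; exists (X1 `&` Y1); split; first exact: measurableI.
  by exists (X2 `&` Y2); split => //; exact: measurableI.
- by move=> _; exists setT; split => //; exists setT; split => //; rewrite setXTT.
- by rewrite bigcup_const//; exists 0%N.
- by move=> _ [A [mA [B [mB ->]]]]; exact: m12.
Qed.

(** * Conditional quantile coupling *)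

Section coupling.
Context {R : realType} {d dE : measure_display}.
Context {Om : measurableType d} {E : measurableType dE}.
Variables (P : probability Om R) (Z : Om -> E).
Variables (P2 : probability (measurableTypeR R) R) (Y0 : measurableTypeR R -> E).
Hypotheses (mZ : measurable_fun setT Z) (mY0 : measurable_fun setT Y0).
Hypothesis law : forall C, measurable C -> P (Z @^-1` C) = P2 (Y0 @^-1` C).
Hypothesis P2ge0 : P2 [set r : R | r < 0] = 0%E.
Hypothesis P2le1 : P2 [set r : R | r <= 1] = 1%E.

Let nu : probability E R := image_prob P mZ.

Let cst1E C : measurable C -> (\int[nu]_(_ in C) 1 = P2 (Y0 @^-1` C))%E.
Proof. by move=> mC; rewrite integral_cst// mul1e; exact: law. Qed.

Let mYI C A : measurable C -> measurable A -> measurable (Y0 @^-1` C `&` A).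
Proof. by move=> mC mA; apply: measurableI => //; rewrite -[_ @^-1` _]setTI; exact: mY0. Qed.

Let mY0C C : measurable C -> measurable (Y0 @^-1` C).
Proof. by move=> mC; rewrite -[_ @^-1` _]setTI; exact: mY0. Qed.

Let half (q : rat) : set (measurableTypeR R) := [set r : R | r <= ratr q].

Let mhalf q : measurable (half q).
Proof. by rewrite (_ : half q = `]-oo, ratr q]%classic)//; apply/seteqP; split. Qed.

(** Radon-Nikodym density of C -> P2(Y0 in C, r <= q) with respect to the common law nu: a version
    of the conditional distribution function at q. *)
Let cond_cdf (q : rat) : exists f : E -> \bar R,
  [/\ forall x, (0 <= f x)%E, forall x, f x \is a fin_num, nu.-integrable setT f &
   forall C, measurable C -> P2 (Y0 @^-1` C `&` half q) = (\int[nu]_(x in C) f x)%E].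
Proof.
pose m := image_measure (mrestr P2 (mhalf q)) mY0.
have mfin : fin_num_fun m.
  by move=> A mA; rewrite image_measureE /mrestr; apply: fin_num_measure; exact: mY0C.
pose H1 := Measure.on m.
pose H2 := Measure_isFinite.Build _ _ _ m mfin.
pose m' := HB.pack_for (FiniteMeasure.type E R) (Measure.sort m) H1 H2.
have dom : m' `<< nu.
  apply/null_content_dominatesP => A mA A0.
  have A0' : P2 (Y0 @^-1` A) = 0%E by rewrite -law.
  apply/eqP; rewrite -measure_le0 -A0'.
  change (P2 (Y0 @^-1` A `&` half q) <= P2 (Y0 @^-1` A))%E.
  apply: le_measure; rewrite ?inE; [exact: mYI|exact: mY0C|exact: subIsetl].
by have [f [f0 ff fi fE]] := radon_nikodym_sigma_finite dom; exists f.
Qed.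

(** Negative q are overridden for every x because [quant_lt] needs this everywhere; monotonicity and
    the bounds by 1 hold only almost everywhere. *)
Let F (q : rat) (x : E) : \bar R :=
  if q < 0 then 0%E else projT1 (cid (cond_cdf q)) x.

Let Fge0 q x : (0 <= F q x)%E.
Proof. by rewrite /F; case: ifP => // _; case: cid => f []. Qed.

Let Ffin q x : F q x \is a fin_num.
Proof. by rewrite /F; case: ifP => // _; case: cid => f []. Qed.

Let Fint q : nu.-integrable setT (F q).
Proof.
rewrite /F; have [q0|q0] := boolP (q < 0); first exact: integrable0.
by case: cid => f [].
Qed.

Let FE q C : measurable C ->
  (\int[nu]_(x in C) F q x = P2 (Y0 @^-1` C `&` half q))%E.
Proof.
move=> mC; rewrite /F; have [q0|q0] := boolP (q < 0); last by case: cid => f /= [_ _ _ ->].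
rewrite integral0; apply/esym/eqP; rewrite -measure_le0 -P2ge0.
apply: le_measure; rewrite ?inE; first exact: mYI.
  by rewrite (_ : [set _ | _] = `]-oo, (0:R)[%classic)//; apply/seteqP; split.
by move=> r [_]; rewrite /half /= => /le_lt_trans; apply; rewrite ltrq0.
Qed.

Let mF q : measurable_fun setT (F q).
Proof. exact: measurable_int (Fint q). Qed.

Let F0 q x : q < 0 -> F q x = 0%E. Proof. by rewrite /F => ->. Qed.

Let F_mono : {ae nu, forall x, forall q r : rat, q <= r -> (F q x <= F r x)%E}.
Proof.
apply: ae_forall_count => q; apply: ae_forall_count => r.
have [qr|qr] := boolP (q <= r); last by apply: nearW => x.
have : {ae nu, forall x, (F q x <= F r x)%E}.
  apply: ae_le_of_integral => // C mC; rewrite !FE//; apply: le_measure; rewrite ?inE.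
  - exact: mYI.
  - exact: mYI.
  - by apply: setIS => y; rewrite /half /= => /le_trans; apply; rewrite ler_rat.
by apply: filterS.
Qed.

Let F_le1 : {ae nu, forall x, forall q, (F q x <= 1)%E}.
Proof.
apply: ae_forall_count => q; apply: ae_le_of_integral => //.
  exact: finite_measure_integrable_cst.
move=> C mC; rewrite FE// cst1E//.
by apply: le_measure; rewrite ?inE//; [exact: mYI|exact: mY0C].
Qed.

Let F_ge1 : {ae nu, forall x, (1 <= F 1 x)%E}.
Proof.
apply: ae_le_of_integral => //; first exact: finite_measure_integrable_cst.
move=> C mC; rewrite FE// cst1E//.
have h0 : P2 (~` half 1) = 0%E.
  rewrite probability_setC// (_ : half 1 = [set r | r <= 1]) ?P2le1 ?subee//.
  by apply/seteqP; split => r; rewrite /half /= rmorph1.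
have mC' := mY0C mC; have mh := mhalf 1.
rewrite [leLHS](measureDI P2 mC' mh) -[leRHS]add0e leeD2r// setDE -h0.
apply: le_measure; rewrite ?inE; [apply: measurableI => //|by apply: measurableC|by move=> ? []].
by apply: measurableC.
Qed.

Let g := quant F.
Let mg : measurable_fun setT g := measurable_quant mF.

Let mfstC C : measurable C -> measurable (@fst E (measurableTypeR R) @^-1` C).
Proof. by move=> mC; rewrite -[_ @^-1` _]setTI; exact: measurable_fst. Qed.

(** For almost every x and rationals q < r, the set of u in [0, 1) with g (x, u) < r lies between
    [0, F q x) and [0, F r x). Integrating over C gives the two inequalities of
    [measure_eq_of_squeeze]. *)
Let g_law C A : measurable C -> measurable A ->
  (nu \x unif)%E ((fst @^-1` C) `&` (g @^-1` A)) = P2 (Y0 @^-1` C `&` A).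
Proof.
move=> mC mA.
pose m1 := image_measure (mrestr (nu \x unif)%E (mfstC mC)) mg.
pose m2 : {measure set _ -> \bar R} := mrestr P2 (mY0C mC).
rewrite setIC [RHS](_ : _ = m2 A); last by rewrite /m2/= /mrestr setIC.
have mlt (r : rat) : measurable (`]-oo, (ratr r : R)[%classic : set (measurableTypeR R)).
  exact: measurable_itv.
have mS (r : rat) : measurable (g @^-1` `]-oo, ratr r[ `&` (@fst E (measurableTypeR R) @^-1` C)).
  apply: measurableI; last exact: mfstC.
  by rewrite -[_ @^-1` _]setTI; exact: mg.
have m1E (r : rat) : m1 `]-oo, ratr r[%classic =
    (\int[nu]_x unif (xsection (g @^-1` `]-oo, ratr r[ `&` (fst @^-1` C)) x))%E by [].
have munif (r : rat) : measurable_fun setT (fun x =>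
    unif (xsection (g @^-1` `]-oo, ratr r[ `&` (fst @^-1` C)) x)).
  exact: (measurable_fun_xsection unif (mS r)).
have m2E (r : rat) : m2 `]-oo, ratr r]%classic = (\int[nu]_(x in C) F r x)%E.
  rewrite FE// /m2/= /mrestr setIC; congr (P2 (_ `&` _)).
have FC0 r x : (0 <= (F r \_ C) x)%E by rewrite patchE; case: ifP.
have mFC r : measurable_fun setT (F r \_ C).
  by apply/(measurable_restrictT _ _).1 => //; exact: measurable_funTS.
apply: (@measure_eq_of_squeeze _ m1 m2) => //.
- by move=> r; rewrite m2E FE// -ge0_fin_numE// fin_num_measure//; exact: mYI.
- move=> r; rewrite m1E m2E [leRHS]integral_mkcond.
  apply: (ae_ge0_le_integral measurableT) => [x _||x _||]; [exact: measure_ge0|exact: munif|exact: FC0|exact: mFC|].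
  move: F_mono F_ge1 F_le1; apply: filterS3 => x xmono x1 xle _.
  rewrite patchE; case: ifPn => xC; last first.
    rewrite (_ : xsection _ _ = set0) ?measure0//; apply/seteqP; split => // u.
    by rewrite /xsection /= inE => -[_ /mem_set]; exact/negP.
  rewrite /unif /mrestr; apply: (@le_trans _ _ (lebesgue_measure `[0, fine (F r x)[%classic)).
    apply: le_measure; rewrite ?inE.
    + by apply: measurableI; [exact: measurable_xsection|exact: measurable_itv].
    + exact: measurable_itv.
    + move=> u [] /=; rewrite /xsection /= inE => -[gu _]; rewrite in_itv/= => /andP[u0 u1].
      rewrite in_itv/= u0/= -lte_fin fineK//.
      (* Here u < 1 <= F 1 x, so the infimum defining the quantile runs over a nonempty set. *)
      have /(quant_lt F0) : quant_dom F (x, u).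
        by split => //; exists 1; apply: lt_le_trans x1; rewrite lte_fin.
      move=> /(_ (ratr r))[+ _]; move: gu; rewrite /preimage /= in_itv/= => gu /(_ gu)[q [qr uq]].
      by apply: lt_le_trans uq _; apply: xmono; rewrite ltW// -(ltr_rat R).
  rewrite lebesgue_measure_itv/=; case: ifP => _ //.
  by rewrite sube0 fineK.
- move=> q r qr; rewrite m1E m2E [leLHS]integral_mkcond.
  apply: (ae_ge0_le_integral measurableT) => [x _||x _||]; [exact: FC0|exact: mFC|exact: measure_ge0|exact: munif|].
  move: F_mono F_ge1 F_le1; apply: filterS3 => x xmono x1 xle _.
  rewrite patchE; case: ifPn => xC; last exact: measure_ge0.
  rewrite /unif /mrestr; apply: (@le_trans _ _ (lebesgue_measure `[0, fine (F q x)[%classic)).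
    rewrite lebesgue_measure_itv/=; case: ifPn; first by rewrite sube0 fineK.
    by rewrite lte_fin -leNgt => h; rewrite -(fineK (Ffin q x)) lee_fin.
  apply: le_measure; rewrite ?inE.
  + exact: measurable_itv.
  + by apply: measurableI; [exact: measurable_xsection|exact: measurable_itv].
  + move=> u /=; rewrite in_itv/= => /andP[u0]; rewrite -lte_fin fineK// => uq.
    have u1 : u < 1 by rewrite -lte_fin; apply: lt_le_trans uq (xle q).
    split; last by rewrite /= in_itv/= u0.
    rewrite /xsection /= inE; split; last by rewrite /=; exact/set_mem.
    rewrite /= in_itv/=; apply/(quant_lt F0); first by split => //; exists q.
    by exists q; rewrite ltr_rat.
Qed.

Let mgZ : measurable_fun setT (fun p : Om * measurableTypeR R => g (Z p.1, p.2)).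
Proof.
apply: measurableT_comp mg _; apply/measurable_fun_pairP; split; last exact: measurable_snd.
exact: measurableT_comp mZ measurable_fst.
Qed.

Let mTheta : measurable_fun setT (fun p : E * measurableTypeR R => (p.1, g p)).
Proof. by apply/measurable_fun_pairP; split; [exact: measurable_fst|exact: mg]. Qed.

Let mY0r : measurable_fun setT (fun r : measurableTypeR R => (Y0 r, r)).
Proof. by apply/measurable_fun_pairP; split => //; exact: measurable_id. Qed.

Let joint_law X : measurable X ->
  image_measure (nu \x unif)%E mTheta X = image_measure P2 mY0r X.
Proof.
apply: eq_measure_rect => [|A B mA mB].
  by rewrite image_measureE preimage_setT [ltLHS]probability_setT ltry.
by rewrite !image_measureE; exact: (g_law mA mB).
Qed.

Section bounded.
Variables (h : R -> R) (K : R).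
Hypotheses (mh : measurable_fun setT h) (hK : forall r, `|h r| <= K).
Hypothesis h0 : forall C, measurable C ->
  (\int[P2]_(r in Y0 @^-1` C) (h r)%:E = 0)%E.

(** The conditional expectation of [h] given that Y0 = x, computed with the quantile function. *)
Let k x := (\int[unif]_u (h (g (x, u)))%:E)%E.

Let mhg : measurable_fun setT (h \o g).
Proof. exact: measurableT_comp mh mg. Qed.

Let k_int : nu.-integrable setT k.
Proof.
apply: (integrable_fubini_F (m1 := nu) (m2 := unif) (f := fun p => (h (g p))%:E)).
apply: (@bounded_integrable _ _ _ (nu \x unif : probability _ R)%E K setT (h \o g)) => // r.
exact: hK.
Qed.

Let kC C : measurable C -> (\int[nu]_(x in C) k x = 0)%E.
Proof.
move=> mC; rewrite /k -(@fubini_strip _ _ _ _ _ nu unif (h \o g) K C mC mhg); last by move=> p; exact: hK.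
rewrite -(h0 mC).
have mCT : measurable (C `*` setT : set (E * measurableTypeR R)) by exact: measurableX.
have mh2 : measurable_fun setT (fun p : E * measurableTypeR R => h p.2).
  exact: measurableT_comp mh measurable_snd.
transitivity (\int[image_measure (nu \x unif)%E mTheta]_(p in C `*` setT) (h p.2)%:E)%E.
  rewrite integral_pushforward//.
  - exact/measurable_EFinP.
  - apply: (@bounded_integrable _ _ _ (nu \x unif : probability _ R)%E K _ (h \o g)) => //.
      exact: measurable_funTS.
    by move=> r; exact: hK.
transitivity (\int[image_measure P2 mY0r]_(p in C `*` setT) (h p.2)%:E)%E.
  by apply: eq_measure_integral => A mA _; exact: joint_law.
have YC : (fun r : measurableTypeR R => (Y0 r, r)) @^-1` (C `*` setT) = Y0 @^-1` C.
  by apply/seteqP; split => r // [].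
rewrite integral_pushforward ?YC//.
- exact/measurable_EFinP.
- apply: (@bounded_integrable _ _ _ P2 K _ h) => //; first exact: mY0C.
  exact: measurable_funTS.
Qed.

Let k_ae0 : {ae nu, forall x, k x = 0%E}.
Proof.
have : ae_eq nu setT k (cst 0%E).
  apply: integral_ae_eq => [//||//|C _ mC]; first exact: k_int.
  by rewrite integral0; exact: kC.
by apply: filterS => x; exact.
Qed.

(** The conditional mean [k] vanishes nu-almost everywhere and nu is the law of [Z], so [k (Z w)]
    vanishes almost surely; Fubini then integrates u out first, whatever the event [B] of the first
    factor. *)
Lemma coupled_integral0 B : measurable B ->
  (\int[(P \x unif)%E]_(p in B `*` setT) (h (g (Z p.1, p.2)))%:E = 0)%E.
Proof.
move=> mB; rewrite (@fubini_strip _ _ _ _ _ P unif (fun p => h (g (Z p.1, p.2))) K)//.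
- have [N [mN N0 sN]] := k_ae0.
  transitivity (\int[P]_(x in B) cst 0%E x)%E; last exact: integral0.
  apply: ae_eq_integral => //.
  + apply: measurable_funTS; apply: (measurableT_comp (f := k)) mZ.
    exact: measurable_int k_int.
  + exists (Z @^-1` N); split => //.
      by rewrite -[_ @^-1` _]setTI; exact: mZ.
    by move=> w /= h'; apply: sN => /= kw; apply: h' => _; exact: kw.
- exact: (measurableT_comp mh mgZ).
Qed.

End bounded.

(* The second coordinate is [g (Z w, u)] with [u] uniform and [g (x, _)] the quantile function
   of [P2] given [Y0 = x]. *)
Lemma coupling_exists : exists P' : probability (Om * measurableTypeR R)%type R,
  [/\ forall B, measurable B -> P' (B `*` setT) = P B,
   forall C A, measurable C -> measurable A ->
     P' [set p | C (Z p.1) /\ A p.2] = P2 (Y0 @^-1` C `&` A) &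
   forall (h : R -> R) (K : R), measurable_fun setT h -> (forall r, `|h r| <= K) ->
    (forall C, measurable C -> (\int[P2]_(r in Y0 @^-1` C) (h r)%:E = 0)%E) ->
    forall B, measurable B -> (\int[P']_(p in B `*` setT) (h p.2)%:E = 0)%E].
Proof.
have mZg : measurable_fun setT (fun p : Om * measurableTypeR R => (p.1, g (Z p.1, p.2))).
  apply/measurable_fun_pairP; split; first exact: measurable_fst.
  exact: mgZ.
exists (image_prob (P \x unif)%E mZg); split.
- move=> B mB; transitivity ((P \x unif)%E (B `*` setT)).
    congr ((P \x unif)%E _); apply/seteqP; split => //.
  rewrite product_measure1E//.
  by rewrite [X in (_ * X)%E](_ : _ = 1%E) ?mule1//; exact: probability_setT.
- move=> C A mC mA; rewrite -g_law//.
  have mCA : measurable (fst @^-1` C `&` g @^-1` A).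
    by apply: measurableI; [exact: mfstC|rewrite -[_ @^-1` _]setTI; exact: mg].
  transitivity (\int[P]_w (unif \o xsection (fst @^-1` C `&` g @^-1` A)) (Z w))%E.
    apply: eq_integral => w _; by congr (unif _).
  have := @ge0_integral_pushforward _ _ _ _ R Z mZ P setT (unif \o xsection (fst @^-1` C `&` g @^-1` A)).
  rewrite preimage_setT => <- //.
  exact: measurable_fun_xsection.
- move=> h K mh hK h0 B mB; rewrite -[RHS](coupled_integral0 mh hK h0 mB).
  rewrite [LHS](integral_pushforward mZg)//.
  - apply/measurable_EFinP; exact: measurableT_comp mh measurable_snd.
  - apply: (@bounded_integrable _ _ _ (P \x unif : probability _ R)%E K _ (fun p => h (g (Z p.1, p.2)))) => //.
      rewrite -[X in measurable X]setTI; apply: mZg => //; exact: measurableX.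
    by apply: measurable_funTS; exact: measurableT_comp mh mgZ.
  - exact: measurableX.
Qed.

End coupling.

(** * Random measures and right-continuous paths *)

Section restricted_integral.
Context {R : realType} {d : measure_display} {X : measurableType d}.

Lemma ge0_integral_mrestr (m : {measure set X -> \bar R}) (D : set X)
    (mD : measurable D) (f : X -> \bar R) :
  measurable_fun setT f -> (forall x, (0 <= f x)%E) ->
  (\int[mrestr m mD]_x f x = \int[m]_(x in D) f x)%E.
Proof.
move=> mf f0; pose m' : {measure set X -> \bar R} := mrestr m mD.
have D0 : m' (~` D) = 0%E by rewrite /m'/= /mrestr setICl measure0.
rewrite (@ge0_negligible_integral _ _ _ m' setT (~` D) f)//; last exact: measurableC.
rewrite setTD setCK; apply: eq_measure_integral => A mA AD.
by rewrite /m'/= /mrestr setIidl.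
Qed.

End restricted_integral.

Section random_measure_integral.
Context {R : realType} {d d' : measure_display}.
Context {T : measurableType d} {X : measurableType d'}.
Variables (L : T -> {measure set X -> \bar R}) (D : set X) (K : R).
Hypotheses (mD : measurable D)
  (mL : forall A, measurable A -> measurable_fun setT (fun w => L w (A `&` D)))
  (LK : forall w, (L w D <= K%:E)%E).

Let k (w : T) : {measure set X -> \bar R} := mrestr (L w) mD.

Let mk U : measurable U -> measurable_fun setT (k ^~ U).
Proof. by move=> mU; exact: mL. Qed.

Let kub : measure_fam_uub k.
Proof.
exists (K + 1) => w; rewrite /k /= /mrestr setTI (le_lt_trans (LK w))//.
by rewrite lte_fin ltrDl.
Qed.

(** Cut down to [D], the random measures are uniformly bounded and hence form a finite kernel. *)
Lemma measurable_random_integral (h : T * X -> \bar R) :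
  measurable_fun setT h -> (forall p, (0 <= h p)%E) ->
  measurable_fun setT (fun w => (\int[L w]_(x in D) h (w, x))%E).
Proof.
move=> mh h0.
pose H1 := isKernel.Build _ _ T X R k mk.
pose k1 : R.-ker T ~> X := HB.pack k H1.
pose H2 := Kernel_isFinite.Build _ _ T X R k1 kub.
pose k2 := HB.pack_for (FiniteKernel.type T X R) (Kernel.sort k1) H2.
rewrite (_ : (fun w => _) = (fun w => (\int[k2 w]_x h (w, x))%E)).
  exact: measurable_fun_integral_finite_kernel.
apply/funext => w; rewrite -(ge0_integral_mrestr (L w) mD)//.
exact: (measurableT_comp mh (pair1_measurable w)).
Qed.

Lemma measurable_random_integral_signed (h : T * X -> R) :
  measurable_fun setT h ->
  measurable_fun setT (fun w => (\int[L w]_(x in D) (h (w, x))%:E)%E).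
Proof.
move=> mh; have mhE : measurable_fun setT (EFin \o h) by exact/measurable_EFinP.
rewrite (_ : (fun w => _) = (fun w =>
   (\int[L w]_(x in D) (EFin \o h)^\+%E (w, x) -
    \int[L w]_(x in D) (EFin \o h)^\-%E (w, x))%E)).
  apply: emeasurable_funB; apply: measurable_random_integral => //.
    exact: measurable_funepos.
  exact: measurable_funeneg.
apply/funext => w; rewrite [LHS]integralE; congr (_ - _)%E; apply: eq_integral => x _.
  by rewrite !funeposE.
by rewrite !funenegE.
Qed.

Lemma measurable_random_section (S : set (T * X)) : measurable S ->
  measurable_fun setT (fun w => L w (xsection S w `&` D)).
Proof.
move=> mS; rewrite (_ : (fun w => _) =
    (fun w => (\int[L w]_(x in D) (\1_S (w, x))%:E)%E)).
  apply: (measurable_random_integral (h := fun p => (\1_S p)%:E)) => [|p].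
    by apply/measurable_EFinP; exact: measurable_indic.
  by rewrite lee_fin indicE.
apply/funext => w; rewrite -integral_indic//; last exact: measurable_xsection.
apply: eq_integral => x _; rewrite !indicE; congr (_%:R)%:E.
by rewrite mem_xsection.
Qed.

End random_measure_integral.

Section cadlag_paths.
Context {R : realType} {T : pseudoPMetricType R}.
Implicit Types y : R -> T.

Lemma cadlag_right y t A : cadlag y -> 0 <= t -> nbhs (y t) A ->
  exists2 e, 0 < e & forall s, t <= s < t + e -> A (y s).
Proof.
move=> [+ _] t0 yA => /(_ t t0 A yA).
rewrite /nbhs /= /at_right /within /= => -[e /= e0 h].
exists e => // s /andP[]; rewrite le_eqVlt => /predU1P[<- _|ts se]; first exact: nbhs_singleton.
by apply: h => //=; rewrite distrC gtr0_norm ?subr_gt0// ltrBlDl.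
Qed.

Lemma cadlag_left y t A : cadlag y -> 0 < t -> nbhs (leftlim y t) A ->
  exists2 e, 0 < e & forall s, t - e < s < t -> A (y s).
Proof.
move=> [_ yl] t0; rewrite /leftlim t0 => /(yl _ t0).
rewrite /nbhs /= /at_left /within /= => -[e /= e0 h].
exists e => // s /andP[ts se]; apply: h => //=.
by rewrite gtr0_norm ?subr_gt0// ltrBlDl -ltrBlDr.
Qed.

Lemma cadlag_cvg_right y t (s : nat -> R) : cadlag y -> 0 <= t ->
  (forall n, t <= s n) -> s n @[n --> \oo] --> t -> y (s n) @[n --> \oo] --> y t.
Proof.
move=> cy t0 ts st A /(cadlag_right cy t0)[e e0 h].
have : \forall n \near \oo, s n < t + e by apply: (cvgr_lt t) => //; rewrite ltrDl.
by rewrite /nbhs /=; apply: filterS => n sn; apply: h; rewrite ts.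
Qed.

End cadlag_paths.

Section progressive.
Context {R : realType}.

(** Projection of the line onto [0, t]. A path composed with it is defined at all real times and
    uses only values in [0, t], which keeps measurability statements adapted. *)
Definition clamp (t s : R) : R := Num.max 0 (Num.min t s).

(** Strictly to the right of s, so that right continuity of the path suffices for convergence. *)
Definition grid_up n (s : R) : R := (Num.floor (s * n.+1%:R) + 1)%:~R / n.+1%:R.

Lemma grid_up_gt n s : s < grid_up n s.
Proof. by rewrite /grid_up ltr_pdivlMr// floorD1_gt. Qed.

Lemma grid_up_le n s : grid_up n s <= s + n.+1%:R^-1.
Proof.
rewrite /grid_up ler_pdivrMr// mulrDl mulVf// intrD lerD2r.
exact: floor_le.
Qed.

Lemma clamp_ge0 t s : 0 <= clamp t s.
Proof. by rewrite /clamp le_max lexx. Qed.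

Lemma clamp_le t s : 0 <= t -> clamp t s <= t.
Proof. by move=> t0; rewrite /clamp ge_max t0 ge_min lexx. Qed.

Lemma clamp_id t s : 0 <= s <= t -> clamp t s = s.
Proof. by move=> /andP[s0 st]; rewrite /clamp (min_idPr st) (max_idPr s0). Qed.

Lemma clamp_grid t n s : clamp t s <= clamp t (grid_up n s) <= clamp t s + n.+1%:R^-1.
Proof.
have := grid_up_gt n s; have := grid_up_le n s.
have : 0 < n.+1%:R^-1 :> R by rewrite invr_gt0.
rewrite /clamp; move: (grid_up n s) (n.+1%:R^-1) => g e e0 h1 h2.
rewrite /Order.max /Order.min; apply/andP.
by case: (ltP t s); case: (ltP t g); case: (ltP 0 t); case: (ltP 0 s); case: (ltP 0 g) => *; split; lra.
Qed.

Lemma cvg_invS : n.+1%:R^-1 @[n --> \oo] --> (0 : R).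
Proof. exact: cvg_harmonic. Qed.

Lemma cvg_clamp_grid t s : clamp t (grid_up n s) @[n --> \oo] --> clamp t s.
Proof.
apply: (@squeeze_cvgr _ _ _ _ (fun=> clamp t s) (fun n => clamp t s + n.+1%:R^-1)).
- by apply: nearW => n; exact: clamp_grid.
- exact: cvg_cst.
- by rewrite -[X in _ --> X]addr0; apply: cvgD; [exact: cvg_cst|exact: cvg_invS].
Qed.

Context {d : measure_display} {Om : measurableType d} {T : pseudoPMetricType R}.

(** Progressive measurability: rounding the time up to a grid gives countably many times, and
    clamping afterwards keeps them at or before t. *)
Lemma rv_progressive (Y : Om -> R -> T) (t : R) : (forall w, cadlag (Y w)) ->
  0 <= t -> (forall s, 0 <= s <= t -> rv (Y ^~ s)) ->
  rv (fun p : Om * measurableTypeR R => Y p.1 (clamp t p.2)).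
Proof.
move=> cY t0 rY; apply: (rv_cvg (X_ := fun n p => Y p.1 (clamp t (grid_up n p.2)))); last first.
  move=> p; apply: cadlag_cvg_right => //; [exact: clamp_ge0| |exact: cvg_clamp_grid].
  by move=> n; have /andP[] := clamp_grid t n p.2.
move=> n O oO.
rewrite (_ : _ @^-1` _ = \bigcup_(k in [set: int])
   ((Y ^~ (clamp t ((k + 1)%:~R / n.+1%:R)) @^-1` O) `*`
    ((fun s : R => s * n.+1%:R) @^-1` `[k%:~R, (k + 1)%:~R[))).
  apply: bigcup_count_measurable => k _; apply: measurableX.
    by apply: rY => //; rewrite clamp_ge0 clamp_le.
  rewrite -[_ @^-1` _]setTI.
  have : measurable_fun setT (fun s : R => s * n.+1%:R) by exact: measurable_funM.
  exact.
apply/seteqP; split => [p /= Op|p [k _ [/= Op]]].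
  exists (Num.floor (p.2 * n.+1%:R)) => //; split => //=.
  by rewrite in_itv/= floor_itv.
by rewrite in_itv/= -floor_eq => /eqP pk; rewrite /preimage /= /grid_up pk.
Qed.

End progressive.

Section dynkin_random_measure.
Context {R : realType} {d d' : measure_display}.
Context {Om : measurableType d} {X : measurableType d'}.

Lemma measurable_random_measure (G : set (set X)) (m : Om -> {measure set X -> \bar R}) :
  measurable = <<s G >> -> setI_closed G ->
  (forall w, (m w setT < +oo)%E) -> measurable_fun setT (m ^~ setT) ->
  (forall A, G A -> measurable_fun setT (m ^~ A)) ->
  forall A, measurable A -> measurable_fun setT (m ^~ A).
Proof.
move=> GE GI moo mT mG A; rewrite GE; move: A.
apply: (@dynkin_induction _ X G (fun A => measurable_fun setT (m ^~ A))) => //.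
- move=> S mS mmS; rewrite (_ : (fun w => _) = (fun w => m w setT - m w S)%E).
    exact: emeasurable_funB.
  apply/funext => w; by rewrite -(setTD S) measureD ?setTI//; exact: moo.
- move=> F mF tF mmF; rewrite (_ : (fun w => _) = (fun w => \sum_(0 <= i <oo) m w (F i))%E).
    exact: ge0_emeasurable_sum.
  apply/funext => w; apply/esym/cvg_lim => //.
  exact: measure_sigma_additive.
Qed.

End dynkin_random_measure.

Section halfline_unique.
Context {R : realType}.

Lemma measure_eq_halfline (m1 m2 : {measure set (measurableTypeR R) -> \bar R}) :
  (forall x : R, (m2 `]-oo, x]%classic < +oo)%E) ->
  (forall x : R, m1 `]-oo, x]%classic = m2 `]-oo, x]%classic) ->
  forall A, measurable A -> m1 A = m2 A.
Proof.
move=> moo m12; apply: measure_eq_of_squeeze => // [r|q r qr].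
  rewrite -m12; apply: le_measure; rewrite ?inE; [exact: measurable_itv..|].
  by move=> x /=; rewrite !in_itv/=; exact: ltW.
rewrite -m12; apply: le_measure; rewrite ?inE; [exact: measurable_itv..|].
by move=> x /=; rewrite !in_itv/= => /le_lt_trans; apply; rewrite ltr_rat.
Qed.

End halfline_unique.

Section random_occupation.
Context {R : realType} {Uc : pseudoPMetricType R} {d : measure_display}.
Context {Om : measurableType d}.
Local Notation LM := (@LMeas R Uc).

Lemma measurable_I0 (t : R) : measurable (I0 t).
Proof. by rewrite /I0; exact: measurable_itv. Qed.

Lemma measurable_I0T (t : R) : measurable (I0 t `*` setT : set (R * Borel Uc)).
Proof. by apply: measurableX => //; exact: measurable_I0. Qed.

Lemma lebesgue_I0 (t : R) : 0 <= t -> lebesgue_measure (I0 t) = t%:E.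
Proof.
have -> : lebesgue_measure (I0 t) = _ := lebesgue_measure_itv `[0, t].
rewrite /= lte_fin le_eqVlt => /predU1P[<-|->]; first by rewrite ltxx.
by rewrite sube0.
Qed.

Lemma I0_lt0 (t : R) : t < 0 -> I0 t = set0.
Proof.
move=> t0; rewrite -subset0 => x; rewrite /I0 /= in_itv/= => /andP[x0 xt].
by have := le_lt_trans x0 (le_lt_trans xt t0); rewrite ltxx.
Qed.

(** Two Dynkin arguments: in the time variable for a fixed control set, then from rectangles to the
    whole product. *)
Lemma measurable_occupation (L : Om -> LM) (t : R) :
  (forall w, (L w (I0 t `*` setT) < +oo)%E) ->
  (forall s C, 0 <= s <= t -> measurable C ->
     measurable_fun setT (fun w => L w (I0 s `*` C))) ->
  forall D, measurable D -> measurable_fun setT (fun w => L w (D `&` (I0 t `*` setT))).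
Proof.
move=> Loo mL D mD.
have [t0|t0] := ltP t 0.
  rewrite (_ : (fun w => _) = cst 0%E)//; apply/funext => w.
  by rewrite I0_lt0// set0X setI0 measure0.
have mIC s C : measurable C -> measurable (I0 s `*` C : set (R * Borel Uc)).
  by move=> mC; apply: measurableX => //; exact: measurable_I0.
have mrect (A : set R) (C : set (Borel Uc)) : measurable A -> measurable C ->
    measurable_fun setT (fun w => L w ((A `&` I0 t) `*` C)).
  move=> mA mC; pose m w : {measure set R -> \bar R} :=
    image_measure (mrestr (L w) (mIC t C mC)) measurable_fst.
  have mE w B : m w B = L w ((B `&` I0 t) `*` C).
    rewrite /m image_measureE /mrestr; congr (L w _); apply/seteqP.
    by split => [[x u] /= [? [? ?]]|[x u] /= [[? ?] ?]].
  under eq_fun do rewrite -mE.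
  apply: (measurable_random_measure (G := RGenInftyO.G (R:=R))) => //.
  - exact: RGenInftyO.measurableE.
  - move=> _ _ [x ->] [y ->]; exists (Num.min x y).
    by apply/seteqP; split => z /=; rewrite !in_itv/= lt_min => /andP.
  - move=> w; rewrite mE setTI; apply: le_lt_trans (Loo w).
    by apply: le_measure; rewrite ?inE; [exact: (mIC t C mC)|exact: measurable_I0T|move=> [x u] /= []].
  - by under eq_fun do rewrite mE setTI; apply: mL => //; rewrite lexx t0.
  - move=> _ [x ->]; under eq_fun do rewrite mE.
    (* Evaluations are given on closed intervals only, so the open half-line is exhausted by closed
       ones. *)
    pose B n : set R := `]-oo, x - n.+1%:R^-1]%classic `&` I0 t.
    have BE : \bigcup_n (B n `*` C) = (`]-oo, x[%classic `&` I0 t) `*` C.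
      apply/seteqP; split => [[y u] [n _ [[/= yx yt] Cu]]|[y u] [[/= yx yt] Cu]].
        split => //=; split => //; move: yx; rewrite !in_itv/= => /le_lt_trans; apply.
        by rewrite gtrBl.
      move: yx; rewrite in_itv/= => yx; have /ltr_add_invr [k] := yx; exists k => //.
      by split => //=; split => //=; rewrite in_itv/= lerBrDr ltW.
    have mB n : measurable (B n `*` C : set (R * Borel Uc)).
      by apply: measurableX => //; apply: measurableI; [exact: measurable_itv|exact: measurable_I0].
    apply: (emeasurable_fun_cvg (fun n w => L w (B n `*` C))) => [n|w _]; last first.
      rewrite -BE; apply: nondecreasing_cvg_mu => //.
        by apply: bigcup_measurable.
      move=> i j ij; apply/subsetPset => -[y u] [[/= yx yt] Cu]; split => //=; split => //=.
      move: yx; rewrite !in_itv/= => /le_trans; apply.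
      by rewrite lerD2l lerN2 lef_pV2 ?posrE// ler_nat.
    have [xn|xn] := ltP (x - n.+1%:R^-1) 0.
      rewrite (_ : (fun w => _) = cst 0%E)//; apply/funext => w; rewrite -[RHS](measure0 (L w)).
      congr (L w _); rewrite -subset0 => -[y u] [[/=]]; rewrite /I0 /= !in_itv/= => yx /andP[y0 _] _.
      by have := le_lt_trans (le_trans y0 yx) xn; rewrite ltxx.
    rewrite (_ : B n = I0 (Num.min t (x - n.+1%:R^-1))).
      by apply: mL => //; rewrite le_min t0 xn ge_min lexx.
    apply/seteqP; split => y; rewrite /B /I0 /= !in_itv/=.
      by move=> [yx /andP[y0 yt]]; rewrite y0 le_min yt.
    by rewrite le_min => /and3P[-> -> ->].
pose m w : {measure set (R * Borel Uc) -> \bar R} := mrestr (L w) (measurable_I0T t).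
pose C : set (set (R * Borel Uc)) :=
  [set C | exists A, measurable A /\ exists B, measurable B /\ C = A `*` B].
rewrite -[X in measurable_fun _ X]/(m ^~ D).
apply: (@measurable_random_measure _ _ _ _ _ C m) => //.
- rewrite measurable_prod_measurableType //; congr (<<s _ >>).
  rewrite predeqE; split => [[A mA [B mB <-]]|[A [mA [B [mB ->]]]]].
    by exists A; split => //; exists B.
  by exists A => //; exists B.
- move=> /= _ _ [X1 [mX1 [X2 [mX2 ->]]]] [Y1 [mY1 [Y2 [mY2 ->]]]].
  rewrite -setXI; exists (X1 `&` Y1); split; first exact: measurableI.
  by exists (X2 `&` Y2); split => //; exact: measurableI.
- by move=> w; rewrite /m/= /mrestr setTI.
- by rewrite /m/= /mrestr; under eq_fun do rewrite setTI; apply: mL => //; rewrite lexx t0.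
- move=> _ [A [mA [B [mB ->]]]]; rewrite /m/= /mrestr.
  under eq_fun do rewrite -setXI setIT; exact: mrect.
Qed.

End random_occupation.

Section path_functionals.
Context {R : realType} {E Uc : pseudoPMetricType R}.
Hypotheses (hE : hausdorff_space E) (cE : compact [set: E]).
Hypotheses (hU : hausdorff_space Uc) (cU : compact [set: Uc]).
Local Notation LM := (@LMeas R Uc).

Lemma rv_measurable_comp d d' (Om : measurableType d) (Om' : measurableType d')
    (T : topologicalType) (X : Om -> T) (phi : Om' -> Om) :
  measurable_fun setT phi -> rv X -> rv (X \o phi).
Proof.
move=> mphi rX O oO; rewrite comp_preimage -[_ @^-1` _]setTI; apply: mphi => //.
exact: rX.
Qed.

Lemma rv_path (y : R -> E) t : cadlag y -> 0 <= t ->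
  rv (fun s : measurableTypeR R => y (clamp t s)).
Proof.
move=> cy t0; have := @rv_progressive R _ (measurableTypeR R) E (fun=> y) t (fun=> cy) t0.
move=> /(_ (fun _ _ => rv_const _)).
apply: (@rv_measurable_comp _ _ _ _ _ _ (fun s : measurableTypeR R => (s, s))).
by apply/measurable_fun_pairP; split; exact: measurable_id.
Qed.

Section joint.
Context {d : measure_display} {Om : measurableType d}.
Variables (Y : Om -> R -> E) (t : R).
Hypotheses (cY : forall w, cadlag (Y w)) (t0 : 0 <= t)
  (rY : forall s, 0 <= s <= t -> rv (Y ^~ s)).

Lemma rv_joint : rv (fun q : Om * (R * Borel Uc) => (Y q.1 (clamp t q.2.1), q.2.2 : Uc)).
Proof.
apply: rv_pair => //.
  apply: (@rv_measurable_comp _ _ _ _ _ (fun p : Om * measurableTypeR R => Y p.1 (clamp t p.2))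
     (fun q : Om * (R * Borel Uc) => (q.1, q.2.1 : measurableTypeR R))); last exact: rv_progressive.
  apply/measurable_fun_pairP; split; first exact: measurable_fst.
  exact: measurableT_comp measurable_fst measurable_snd.
apply/rvP; exact: measurableT_comp measurable_snd measurable_snd.
Qed.

Lemma measurable_control_integral (L : Om -> LM) (K : R) (h : E * Uc -> R) :
  continuous h -> (forall w, (L w (I0 t `*` setT) <= K%:E)%E) ->
  (forall s C, 0 <= s <= t -> measurable C ->
     measurable_fun setT (fun w => L w (I0 s `*` C))) ->
  measurable_fun setT (fun w =>
    (\int[L w]_(p in I0 t `*` setT) (h (Y w p.1, p.2))%:E)%E).
Proof.
move=> ch LK mL.
rewrite (_ : (fun w => _) = (fun w =>
    (\int[L w]_(p in I0 t `*` setT) (h (Y w (clamp t p.1), p.2))%:E)%E)); last first.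
  apply/funext => w; apply: eq_integral => p /set_mem[]; rewrite /I0 /= in_itv/= => pt _.
  by rewrite clamp_id.
apply: (@measurable_random_integral_signed _ _ _ _ _ L _ K (measurable_I0T t) _ LK
  (fun q => h (Y q.1 (clamp t q.2.1), q.2.2))).
  apply: measurable_occupation => // w; apply: le_lt_trans (LK w) _; exact: ltry.
by move/rv_continuousP : rv_joint => /(_ _ ch).
Qed.

Lemma measurable_time_integral (a : E -> R) : continuous a ->
  measurable_fun setT (fun w => (\int[lebesgue_measure]_(s in I0 t) (a (Y w s))%:E)%E).
Proof.
move=> ca.
rewrite (_ : (fun w => _) = (fun w =>
    (\int[lebesgue_measure]_(s in I0 t) (a (Y w (clamp t s)))%:E)%E)); last first.
  by apply/funext => w; apply: eq_integral => s /set_mem; rewrite /I0 /= in_itv/= => st; rewrite clamp_id.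
apply: (@measurable_random_integral_signed _ _ _ _ (measurableTypeR R) (fun=> lebesgue_measure) _ t (measurable_I0 t) _ _
  (fun q => a (Y q.1 (clamp t q.2)))) => //.
  have h : (lebesgue_measure (I0 t) <= t%:E)%E by rewrite lebesgue_I0.
  by move=> _; exact: h.
by have /rv_continuousP := rv_progressive cY t0 rY; exact.
Qed.

End joint.

End path_functionals.

Section integral_mrestr.
Context {R : realType} {d : measure_display} {X : measurableType d}.

Lemma integral_mrestrI (m : {measure set X -> \bar R}) (D J : set X)
    (mJ : measurable J) (f : X -> \bar R) :
  measurable D -> measurable_fun D f ->
  (\int[mrestr m mJ]_(x in D) f x = \int[m]_(x in D `&` J) f x)%E.
Proof.
move=> mD mf; pose m' : {measure set X -> \bar R} := mrestr m mJ.
have J0 : m' (~` J) = 0%E by rewrite /m'/= /mrestr setICl measure0.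
have ge0 (g : X -> \bar R) : measurable_fun D g -> (forall x, (0 <= g x)%E) ->
    (\int[m']_(x in D) g x = \int[m]_(x in D `&` J) g x)%E.
  move=> mg g0; rewrite (@ge0_negligible_integral _ _ _ m' D (~` J) g)//; last exact: measurableC.
  rewrite setDE setCK; apply: eq_measure_integral => A mA AD.
  by rewrite /m'/= /mrestr setIidl// => x /AD [].
rewrite [LHS]integralE [RHS]integralE; congr (_ - _)%E; apply: ge0 => //.
  exact: measurable_funepos.
exact: measurable_funeneg.
Qed.

End integral_mrestr.

(** * The clock identity and the Stieltjes measure *)

Section time_split.
Context {R : realType} {Uc : pseudoPMetricType R}.
Local Notation LM := (@LMeas R Uc).

Lemma lebesgue_stieltjes_itvoc (f : cumulative R R) (a b : R) : a <= b ->
  lebesgue_stieltjes_measure f (`]a, b]%classic : set R) = (f b - f a)%:E.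
Proof.
move=> ab; rewrite /lebesgue_stieltjes_measure/= /measure_extension/=.
rewrite measurable_mu_extE/=; first by rewrite wlength_itv_bnd.
exact: is_ocitv.
Qed.

Lemma LS_itv (F : R -> R) (a b : R) :
  {homo ext0 F : x y / x <= y} -> right_continuous (ext0 F) -> a <= b ->
  LS F `]a, b]%classic = (ext0 F b - ext0 F a)%:E.
Proof.
move=> h1 h2 ab; rewrite /LS; case: pselect => [[h3 h4]|[]//].
exact: lebesgue_stieltjes_itvoc.
Qed.

Variables (F : R -> R) (m : LM) (th : \bar R).
Hypotheses (th0 : (0 <= th)%E) (m0 : m [set p | p.1 < 0] = 0%E).
Hypotheses (F0 : forall t, 0 <= t -> 0 <= F t)
  (Fmono : forall s t : R, 0 <= s <= t -> F s <= F t)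
  (Fm : forall t : R, 0 <= t -> ((F t)%:E + m (I0 t `*` setT) = mine t%:E th)%E).

Lemma occupation_le (t : R) : 0 <= t -> (m (I0 t `*` setT) <= t%:E)%E.
Proof.
move=> t0; have := Fm t0; have := F0 t0; have : (0 <= m (I0 t `*` setT))%E by exact: measure_ge0.
case: (m _) => [r| |] // r0 F0t e.
- rewrite lee_fin in r0.
  by rewrite (@le_trans _ _ (mine t%:E th))// ?ge_min ?lexx// -e leeDr// lee_fin.
- have : (mine t%:E th <= t%:E)%E by rewrite ge_min lexx.
  by rewrite -e addey.
Qed.

Lemma occupation_fin (t : R) : 0 <= t -> m (I0 t `*` setT) \is a fin_num.
Proof.
move=> t0; rewrite ge0_fin_numE ?measure_ge0//.
by apply: le_lt_trans (occupation_le t0) _; exact: ltry.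
Qed.

(** By the clock identity F is t -> min(t, th) minus the nondecreasing mass of the control. The
    resulting continuity matters: [LS F] is the intended Stieltjes measure only when [ext0 F] is
    monotone and right continuous, and zero otherwise. *)
Lemma F_lip (s t : R) : 0 <= s <= t -> F t <= F s + (t - s).
Proof.
move=> /andP[s0 st]; have t0 := le_trans s0 st.
have : (m (I0 s `*` setT) <= m (I0 t `*` setT))%E.
  apply: le_measure; rewrite ?inE; [exact: measurable_I0T..|].
  move=> [x u] [/=]; rewrite /I0 /= !in_itv/= => /andP[x0 xs] _.
  by rewrite x0 (le_trans xs).
have := Fm s0; have := Fm t0; have := occupation_fin s0; have := occupation_fin t0.
case: (m _) => [a| |] // _; case: (m _) => [b| |] // _; rewrite lee_fin.
case: th th0 => [r| |] // r0.
- rewrite -!EFin_min -!EFinD => /eqP; rewrite eqe => /eqP h1 /eqP; rewrite eqe => /eqP h2.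
  by move: h1 h2; rewrite /Order.min; case: ltP => h3; case: ltP => h4 /= h1 h2 ba; lra.
- rewrite /Order.min !ltry -!EFinD => /eqP; rewrite eqe => /eqP h1 /eqP; rewrite eqe => /eqP h2.
  lra.
Qed.

(** The clock reads 0 at time 0 and both of its terms are nonnegative. Hence [ext0 F] does not jump
    at 0. *)
Lemma F_at0 : F 0 = 0.
Proof.
have := Fm (lexx 0); have := F0 (lexx 0); have := occupation_fin (lexx 0).
have : (0 <= m (I0 0 `*` setT))%E by exact: measure_ge0.
case: (m _) => [r| |] // r0 _ F00.
rewrite (min_idPl th0) -EFinD => /eqP; rewrite eqe => /eqP; rewrite -lee_fin in F00; move: r0 F00; rewrite !lee_fin; lra.
Qed.

Lemma ext0_mono : {homo ext0 F : x y / x <= y}.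
Proof.
move=> x y xy; rewrite /ext0; case: ltP => x0; case: ltP => y0 //.
- exact: F0.
- by have := le_lt_trans (le_trans x0 xy) y0; rewrite ltxx.
- by apply: Fmono; rewrite x0.
Qed.

Lemma ext0_lip (x y : R) : x <= y -> ext0 F y <= ext0 F x + (y - x).
Proof.
move=> xy; rewrite /ext0; case: (ltP y) => y0; case: ltP => x0.
- by rewrite add0r subr_ge0.
- by have := le_lt_trans (le_trans x0 xy) y0; rewrite ltxx.
- by have := F_lip (s := 0) (t := y); rewrite F_at0 lexx y0 => /(_ isT); lra.
- by apply: F_lip; rewrite x0.
Qed.

Lemma ext0_right_continuous : right_continuous (ext0 F).
Proof.
move=> x; apply/cvgrPdist_le => /= e e0; near=> y.
have xy : x <= y by near: y; exact: nbhs_right_ge.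
have ye : y <= x + e by near: y; apply: nbhs_right_le; rewrite ltrDl.
have := ext0_mono xy; have := ext0_lip xy; rewrite ler_norml => h1 h2.
apply/andP; split; lra.
Unshelve. all: by end_near.
Qed.

Let LSi (a b : R) : a <= b -> LS F `]a, b]%classic = (ext0 F b - ext0 F a)%:E.
Proof. by move=> ab; apply: LS_itv => //; [exact: ext0_mono|exact: ext0_right_continuous]. Qed.

Lemma LS_neg : LS F `]-oo, 0[%classic = 0%E.
Proof.
apply/eqP; rewrite -measure_le0; apply: measure_lt_sup => y y0.
apply: (@le_trans _ _ (LS F (\bigcup_n `](y - n%:R), y]%classic))).
  apply: le_measure; rewrite ?inE; [exact: measurable_itv|by apply: bigcup_measurable|].
  move=> x /=; rewrite in_itv/= => xy; exists (Num.truncn (y - x)).+1 => //=.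
  by rewrite in_itv/= xy andbT ltrBlDl -ltrBlDr truncnS_gt.
rewrite (le_trans (generalized_Boole_inequality _ _ _))//; first by apply: bigcup_measurable.
rewrite eseries0// => n _ _; rewrite LSi ?gerBl// /ext0 y0.
by rewrite (_ : y - n%:R < 0) ?subrr//; apply: le_lt_trans y0; rewrite gerBl.
Qed.

Lemma LS_Iy (x : R) : 0 <= x -> LS F (I0 x) = (F x)%:E.
Proof.
(* [LS_itv] measures half-open intervals. The start -1 is an arbitrary negative number, since
   negative times carry no mass. *)
move=> x0; have e : `]-1, x]%classic = `]-1, 0[%classic `|` I0 x :> set (measurableTypeR R).
  apply/seteqP; split => y; rewrite /I0 /= !in_itv/=.
    by move=> /andP[y1 yx]; case: (ltP y 0) => y0; [left; rewrite y1|right].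
  move=> [/andP[y1 y0]|/andP[y0 yx]]; first by rewrite y1 (le_trans (ltW y0)).
  by rewrite yx andbT; apply: lt_le_trans y0; rewrite ltrN10.
have : LS F `]-1, x]%classic = (F x)%:E.
  rewrite LSi; last by rewrite (le_trans _ x0)// lerN10.
  by rewrite /ext0 ltrN10 ltNge x0 /= subr0.
rewrite e measureU; [|exact: measurable_itv|exact: measurable_itv|].
  rewrite [X in (X + _)%E](_ : _ = 0%E) ?add0e//.
  apply/eqP; rewrite -measure_le0 -LS_neg; apply: le_measure; rewrite ?inE; [exact: measurable_itv..|].
  by move=> y /=; rewrite !in_itv/= => /andP[].
rewrite -subset0 => y []; rewrite /I0 /= !in_itv/= => /andP[_ y0] /andP[y0' _].
by have := lt_le_trans y0 y0'; rewrite ltxx.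
Qed.

Lemma lebesgue_I0_stop (x : R) : 0 <= x ->
  lebesgue_measure (I0 x `&` [set s | s%:E <= th]%E) = mine x%:E th.
Proof.
move=> x0; rewrite (_ : _ `&` _ = I0 (fine (mine x%:E th))).
  have f : mine x%:E th \is a fin_num.
    rewrite ge0_fin_numE ?le_min ?lee_fin ?x0//.
    by apply: (@le_lt_trans _ _ x%:E); [rewrite ge_min lexx|exact: ltry].
  by rewrite lebesgue_I0 ?fineK// fine_ge0// le_min lee_fin x0.
apply/seteqP; split => s; rewrite /I0 /= !in_itv/=.
  move=> [/andP[s0 sx]]; rewrite s0/=; case: th th0 => [r| |] // r0 sr.
    by rewrite -EFin_min /= le_min sx -lee_fin.
  by rewrite /Order.min ltry.
case: th th0 => [r| |] // r0; last by rewrite /Order.min ltry /= leey.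
by rewrite -EFin_min /= le_min lee_fin => /and3P[-> -> ->].
Qed.

Lemma measurable_before : measurable ([set s | s%:E <= th]%E : set R).
Proof.
rewrite -[X in measurable X]setTI; apply: emeasurable_fun_infty_c => //.
Qed.

(** Cut down to [0, t], both sides are measures in [A]; on half-lines their equality is the clock
    identity. *)
Lemma LS_split (t : R) A : 0 <= t -> measurable A -> A `<=` I0 t ->
  (LS F A + m (A `*` setT) = lebesgue_measure (A `&` [set s | s%:E <= th]))%E.
Proof.
move=> t0 mA At.
have mI : measurable (I0 t : set (measurableTypeR R)) := measurable_I0 t.
have mJ : measurable (I0 t `&` [set s | s%:E <= th]%E : set (measurableTypeR R)).
  by apply: measurableI; [exact: measurable_I0|exact: measurable_before].
pose n1 : {measure set (measurableTypeR R) -> \bar R} := mrestr (LS F) mI.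
have mf : measurable_fun setT (fun p : R * Borel Uc => p.1 : measurableTypeR R).
  exact: measurable_fst.
pose n2 : {measure set (measurableTypeR R) -> \bar R} :=
  image_measure (mrestr m (measurable_I0T t)) mf.
pose n3 : {measure set (measurableTypeR R) -> \bar R} := mrestr lebesgue_measure mJ.
have n2E B : n2 B = m ((B `&` I0 t) `*` setT).
  rewrite /n2 image_measureE /mrestr; congr (m _).
  by apply/seteqP; split => [[x u] /= [? [? ?]]|[x u] /= [[? ?] ?]].
have -> : (LS F A = n1 A)%E by rewrite /n1/= /mrestr setIidl.
have -> : m (A `*` setT) = n2 A by rewrite n2E setIidl.
have -> : lebesgue_measure (A `&` [set s | s%:E <= th]%E) = n3 A.
  by rewrite /n3/= /mrestr setIA (setIidl At).
have itvI (x : R) : `]-oo, x]%classic `&` I0 t = I0 (Num.min x t).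
  apply/seteqP; split => s; rewrite /I0 /= !in_itv/=.
    by move=> [sx /andP[-> st]]; rewrite le_min sx.
  by rewrite le_min => /and3P[-> -> ->].
rewrite -measure_addE.
have n3E (x : R) : n3 `]-oo, x]%classic =
    if x < 0 then 0%E else mine (Num.min x t)%:E th.
  rewrite /n3/= /mrestr setIA itvI; case: ltP => x0.
    by rewrite I0_lt0 ?set0I ?measure0// gt_min x0.
  by rewrite lebesgue_I0_stop// le_min x0.
apply: measure_eq_halfline => // x.
  rewrite n3E; case: (ltP x 0) => // x0.
  by apply: (@le_lt_trans _ _ (Num.min x t)%:E); [rewrite ge_min lexx|exact: ltry].
transitivity (n1 `]-oo, x]%classic + n2 `]-oo, x]%classic)%E; first exact: measure_addE.
rewrite n3E n2E /n1/= /mrestr itvI.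
case: (ltP x 0) => x0; first by rewrite I0_lt0 ?set0X ?measure0 ?adde0// gt_min x0.
by rewrite LS_Iy ?Fm// le_min x0.
Qed.

Lemma LS_split_integral (t K : R) (g : R -> R) : 0 <= t ->
  measurable_fun setT g -> (forall s, `|g s| <= K) ->
  (\int[LS F]_(s in I0 t) (g s)%:E + \int[m]_(p in I0 t `*` setT) (g p.1)%:E =
   \int[lebesgue_measure]_(s in I0 t `&` [set s | s%:E <= th]) (g s)%:E)%E.
Proof.
move=> t0 mg gK.
have mI : measurable (I0 t : set (measurableTypeR R)) := measurable_I0 t.
have mf : measurable_fun setT (fun p : R * Borel Uc => p.1 : measurableTypeR R).
  exact: measurable_fst.
have mgE : measurable_fun setT (EFin \o g : measurableTypeR R -> \bar R).
  exact/measurable_EFinP.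
have mIT := measurable_I0T t (Uc := Uc).
have fstI : (fun p : R * Borel Uc => p.1 : measurableTypeR R) @^-1` I0 t = I0 t `*` setT.
  by apply/seteqP; split => [[x u] /=|[x u] []].
have bnd d (X : measurableType d) (mu : {measure set X -> \bar R}) (D : set X) (k : X -> R) :
    measurable D -> (mu D < +oo)%E -> measurable_fun setT k -> (forall x, `|k x| <= K) ->
    mu.-integrable D (EFin \o k).
  move=> mD muD mk kK; apply: (le_integrable mD _ _ (_ : mu.-integrable D (cst K%:E))).
  - exact/measurable_EFinP/measurable_funTS.
  - by move=> x _ /=; rewrite lee_fin (le_trans (kK x))// ler_norm.
  - apply/integrableP; split => //; rewrite integral_cst//.
    by rewrite lte_mul_pinfty// lee_fin.
have LSoo : (LS F (I0 t) < +oo)%E by rewrite LS_Iy// ltry.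
have moo : (m (I0 t `*` setT) < +oo)%E.
  by apply: le_lt_trans (occupation_le t0) _; exact: ltry.
have im := bnd _ _ m _ (fun p => g p.1) mIT moo (measurableT_comp mg measurable_fst) (fun p => gK p.1).
have iL := bnd _ _ (LS F) _ g mI LSoo mg gK.
pose im1 := image_measure m mf.
have -> : (\int[m]_(p in I0 t `*` setT) (g p.1)%:E = \int[im1]_(s in I0 t) (g s)%:E)%E.
  by rewrite [RHS](integral_pushforward mf) ?fstI//.
have mJ := measurable_before : measurable ([set s | s%:E <= th]%E : set (measurableTypeR R)).
rewrite -(integral_mrestrI lebesgue_measure mJ mI); last exact: measurable_funTS.
rewrite -integral_measure_add//; last by apply: bnd => //; rewrite /im1 image_measureE fstI.
apply: eq_measure_integral => A mA At.
transitivity (LS F A + im1 A)%E; first exact: measure_addE.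
transitivity (lebesgue_measure (A `&` [set s | s%:E <= th]%E)); last by [].
rewrite -(LS_split t0 mA At).
congr (_ + m _)%E.
by apply/seteqP; split => [[x u]|[x u] []].
Qed.

End time_split.

Section null_sets.
Context {R : realType} {d : measure_display} {X : measurableType d}.
Import HBNNSimple.

(** The integrands may be non-measurable, as [B f] is arbitrary off [Xi]. The proof therefore
    returns to the definition of the integral as a supremum over simple functions: setting a simple
    function to zero on N does not change its integral. *)
Lemma eq_integral_null (mu : {measure set X -> \bar R}) (D N : set X) (f g : X -> \bar R) :
  measurable N -> mu N = 0%E -> (forall x, D x -> ~ N x -> f x = g x) ->
  (\int[mu]_(x in D) f x = \int[mu]_(x in D) g x)%E.
Proof.
move=> mN N0.
pose nn h := ereal_sup [set sintegral mu s |
  s in [set s : {nnsfun X >-> R} | forall x, ((s x)%:E <= h x)%E]].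
have key (h k : X -> \bar R) : (forall x, (0 <= k x)%E) ->
    (forall x, ~ N x -> h x = k x) -> (nn h <= nn k)%E.
  move=> k0 hk; apply: ub_ereal_sup => _ [s sh <-].
  have mNC : measurable (~` N) by exact: measurableC.
  pose s' : {nnsfun X >-> R} := proj_nnsfun s mNC.
  apply: ereal_sup_ubound; exists s'.
    move=> x; rewrite /s' -mrestrict patchE; case: ifPn => [|_]; last exact: k0.
    by rewrite inE => Nx; rewrite -hk//; exact: sh.
  rewrite -!integralT_nnsfun.
  rewrite [RHS](@ge0_negligible_integral _ _ _ mu setT N)//; last 2 first.
  - exact/measurable_EFinP.
  - by move=> x _; rewrite lee_fin.
  rewrite [LHS](@ge0_negligible_integral _ _ _ mu setT N)//; last 2 first.
  - exact/measurable_EFinP.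
  - by move=> x _; rewrite lee_fin.
  apply: eq_integral => x; rewrite inE => -[_ Nx].
  by rewrite /s' -mrestrict patchE ifT// inE.
move=> fg; have fgD x : ~ N x -> (f \_ D) x = (g \_ D) x.
  by move=> Nx; rewrite !patchE; case: ifPn => //; rewrite inE => Dx; exact: fg.
change (nn (f \_ D)^\+%E - nn (f \_ D)^\-%E = nn (g \_ D)^\+%E - nn (g \_ D)^\-%E)%E.
congr (_ - _)%E; apply/eqP; rewrite eq_le; apply/andP; split;
  apply: key => [x|x Nx]; rewrite ?funeposE ?funenegE ?le_max ?lexx ?orbT// ?fgD//.
Qed.

End null_sets.

Section continuous_on_compact.
Context {R : realType} {E Uc : pseudoPMetricType R}.
Hypotheses (hE : hausdorff_space E) (cE : compact [set: E]).
Hypotheses (hU : hausdorff_space Uc) (cU : compact [set: Uc]).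

Lemma continuous_compact_bounded (T : topologicalType) (A : set T) (f : T -> R) :
  compact A -> {within A, continuous f} ->
  exists2 K : R, 0 < K & forall x, A x -> `|f x| <= K.
Proof.
move=> cA cf; have /compact_bounded [M [_ hM]] := continuous_compact cf cA.
exists (`|M| + 1) => [|x Ax]; first by rewrite ltr_wpDl.
by apply: (hM (`|M| + 1)); [rewrite (le_lt_trans (ler_norm _))// ltrDl|exists x].
Qed.

Lemma compact_prodT : compact [set: E * Uc].
Proof. by rewrite -setXTT; exact: compact_setX. Qed.

Lemma hausdorff_prod : hausdorff_space (E * Uc)%type.
Proof.
move=> [x u] [y v] h; congr pair.
  apply: hE => A B nA nB.
  have [] := h (A `*` setT) (B `*` setT).
  - by exists (A, setT) => //; split => //; exact: filterT.
  - by exists (B, setT) => //; split => //; exact: filterT.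
  by move=> [a b] [[/= Aa _] [Ba _]]; exists a.
apply: hU => A B nA nB.
have [] := h (setT `*` A) (setT `*` B).
- by exists (setT, A) => //; split => //; exact: filterT.
- by exists (setT, B) => //; split => //; exact: filterT.
by move=> [a b] [[/= _ Aa] [_ Ba]]; exists b.
Qed.

Lemma closed_extension (Xi : set (E * Uc)) (f : E * Uc -> R) : closed Xi ->
  {within Xi, continuous f} ->
  exists g : E * Uc -> R, continuous g /\ forall p, Xi p -> f p = g p.
Proof.
move=> cXi cf.
have cX : compact Xi by apply: (subclosed_compact cXi compact_prodT).
have [K K0 fK] := continuous_compact_bounded cX cf.
have nX : normal_space (E * Uc)%type.
  exact: compact_normal hausdorff_prod compact_prodT.
have [g [fg cg _]] := continuous_bounded_extension nX cXi K0 cf fK.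
by exists g; split => // p Xp; rewrite fg// inE.
Qed.

End continuous_on_compact.

(** * Random control measures and their test functions *)

Section random_measure_evaluations.
Context {R : realType} {Uc : pseudoPMetricType R}.
Hypotheses (hU : hausdorff_space Uc) (cU : compact [set: Uc]).
Context {d : measure_display} {Om : measurableType d}.
Local Notation LM := (@LMeas R Uc).

Lemma continuous_clamp (t : R) : continuous (clamp t).
Proof.
move=> x; apply: continuous_max; first exact: cvg_cst.
by apply: continuous_min; [exact: cvg_cst|exact: cvg_id].
Qed.

Lemma measurable_ge0T : measurable ([set p | 0 <= p.1] : set (R * Borel Uc)).
Proof.
rewrite (_ : mkset _ = `[0, +oo[%classic `*` setT).
  by apply: measurableX => //; exact: measurable_itv.
by apply/seteqP; split => -[r u] /=; rewrite in_itv/= andbT => // -[].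
Qed.

Lemma Cc_clamp (f : R * Uc -> R) (s : R) : continuous f -> 0 <= s ->
  (forall p, s < p.1 -> f p = 0) -> Cc f.
Proof.
move=> cf s0 fs; split; first exact: continuous_subspaceT.
exists (I0 s `*` setT); split; first by apply: compact_setX => //; exact: segment_compact.
split; first by move=> [r u] [/=]; rewrite /I0 /= in_itv/= => /andP[].
move=> [r u] /= r0 h; apply: fs => /=; rewrite ltNge; apply/negP => rs.
by apply: h; split => //=; rewrite /I0 /= in_itv/= r0.
Qed.

(** Continuous approximation of the indicator of times at most s and controls with f > 0. The time
    factor falls from 1 at s to 0 at s + 1/(n+1), so all these functions vanish after s + 1, which
    gives both compact support and a common dominating function. *)
Definition bump (f : Uc -> R) (s : R) n (p : R * Uc) : R :=
  clamp 1 (1 - n.+1%:R * (p.1 - s)) * clamp 1 (n%:R * f p.2).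

Lemma continuous_bump f s n : continuous f -> continuous (bump f s n).
Proof.
move=> cf p; apply: cvgM.
  apply: (@continuous_comp _ _ _ (fun p : R * Uc => 1 - n.+1%:R * (p.1 - s)) (clamp 1));
    last exact: continuous_clamp.
  apply: cvgB; first exact: cvg_cst.
  apply: cvgM; first exact: cvg_cst.
  by apply: cvgB; [exact: cvg_fst|exact: cvg_cst].
apply: (@continuous_comp _ _ _ (fun p : R * Uc => n%:R * f p.2) (clamp 1));
  last exact: continuous_clamp.
apply: cvgM; first exact: cvg_cst.
apply: (@continuous_comp _ _ _ (snd : R * Uc -> Uc) f); [exact: cvg_snd|exact: cf].
Qed.

Lemma clamp1_0 (x : R) : x <= 0 -> clamp 1 x = 0.
Proof. by move=> x0; rewrite /clamp /Order.max /Order.min; case: (ltP 1 x) => ?; case: ltP => ?; lra. Qed.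

Lemma clamp1_1 (x : R) : 1 <= x -> clamp 1 x = 1.
Proof. by move=> x0; rewrite /clamp /Order.max /Order.min; case: (ltP 1 x) => ?; case: ltP => ?; lra. Qed.

Lemma bump0 f s n p : s + 1 < p.1 -> bump f s n p = 0.
Proof.
move=> ps; rewrite /bump clamp1_0 ?mul0r//.
have : 1 * (p.1 - s) <= n.+1%:R * (p.1 - s) by apply: ler_wpM2r; [lra|rewrite ler1n].
by move: (_.+1%:R * _) => x; lra.
Qed.

Lemma measurable_bump f s n : continuous f ->
  measurable_fun setT (bump f s n : R * Borel Uc -> R).
Proof.
move=> cf; apply: measurable_funM.
  apply: (measurableT_comp (continuous_measurable_fun (@continuous_clamp 1))).
  apply: measurable_funB => //; apply: measurable_funM => //.
  by apply: measurable_funB => //; exact: measurable_fst.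
apply: (measurableT_comp (continuous_measurable_fun (@continuous_clamp 1))).
apply: measurable_funM => //.
apply: (measurableT_comp (_ : measurable_fun setT (f : Borel Uc -> R))) => //.
by apply/rv_realP => O oO; apply: Borel_open; move/continuousP : cf; exact.
Qed.

Lemma natr_mul_ge1 (x : R) : 0 < x -> \forall n \near \oo, 1 <= n%:R * x.
Proof.
move=> x0; near=> n; rewrite -ler_pdivrMr//; near: n; exact: nbhs_infty_ger.
Unshelve. all: end_near. Qed.

Lemma cvg_bump (f : Uc -> R) s p : (forall u, 0 <= f u) ->
  bump f s n p @[n --> \oo] --> (((p.1 <= s) && (0 < f p.2))%:R : R).
Proof.
move=> f0; apply: cvg_near_cst.
have [ps|ps] := leP p.1 s; last first.
  have := natr_mul_ge1 (x := p.1 - s); rewrite subr_gt0 => /(_ ps).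
  apply: filterS => n h; rewrite /bump clamp1_0 ?mul0r//.
  rewrite -natr1 mulrDl mul1r; move: (_ * _) h => x; lra.
have c1 n : clamp 1 (1 - n.+1%:R * (p.1 - s)) = 1.
  apply: clamp1_1; rewrite lerBrDr gerDl; apply: mulr_ge0_le0 => //; lra.
have [fp|fp] := ltP 0 (f p.2).
  have := natr_mul_ge1 fp; apply: filterS => n h.
  by rewrite /bump c1 clamp1_1// mulr1.
by apply: nearW => n; rewrite /bump c1 clamp1_0 ?mulr0// mulr_ge0_le0.
Qed.

(** Only integrals against compactly supported functions are known to be measurable. Bumps built
    from a cozero function reach open control sets by dominated convergence, and a Dynkin argument
    reaches the rest. *)
Lemma measurable_evaluation (L : Om -> LM) : (forall w, in_LU (L w)) ->
  (forall f, Cc f -> rv (fun w => int_LU (L w) f)) ->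
  forall s C, 0 <= s -> measurable C -> measurable_fun setT (fun w => L w (I0 s `*` C)).
Proof.
move=> LU Lf s C s0.
have open_case (O : set Uc) : open O -> measurable_fun setT (fun w => L w (I0 s `*` (O : set (Borel Uc)))).
  move=> oO; have [f [cf f01 fO]] := cozero_open oO.
  have f0 u : 0 <= f u by have /andP[] := f01 u.
  apply: (emeasurable_fun_cvg (fun n w => int_LU (L w) (bump f s n))) => [n|w _].
    apply/rv_erealP; apply: Lf; apply: (@Cc_clamp _ (s + 1)); first exact: continuous_bump.
      by rewrite addr_ge0.
    by move=> p ps; exact: bump0.
  pose D : set (R * Borel Uc) := [set p | 0 <= p.1].
  have mO : measurable (O : set (Borel Uc)) by exact: Borel_open.
  have -> : L w (I0 s `*` (O : set (Borel Uc))) =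
      (\int[L w]_(p in D) ((((p.1 <= s) && (0 < f p.2))%:R : R))%:E)%E.
    have -> : I0 s `*` (O : set (Borel Uc)) = (I0 s `*` O) `&` D.
      by apply/seteqP; split => [[r u] [/= h Ou]|p []//]; split => //; move: h; rewrite /I0 /= in_itv/= => /andP[].
    rewrite -integral_indic//; first last.
    - by apply: measurableX => //; exact: measurable_I0.
    - exact: measurable_ge0T.
    apply: eq_integral => p; rewrite inE => Dp; rewrite indicE; congr ((nat_of_bool _)%:R)%:E.
    apply/idP/idP; first by rewrite inE => -[]; rewrite /I0 /= in_itv/= => /andP[_ ->] /fO.
    by move=> /andP[ps /fO Op]; rewrite inE; split => //; rewrite /I0 /= in_itv/= ps andbT.
  have mD : measurable D := measurable_ge0T.
  have ms1 := measurable_I0T (s + 1) (Uc := Uc).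
  have [] // := @dominated_convergence _ _ _ (L w) D mD
    (fun n p => (bump f s n p)%:E) (fun p => (((p.1 <= s) && (0 < f p.2))%:R)%:E)
    (fun p => (\1_(I0 (s + 1) `*` setT : set (R * Borel Uc)) p)%:E).
  - by move=> n; apply/measurable_EFinP; apply: measurable_funTS; exact: (measurable_bump s n cf).
  - apply: (emeasurable_fun_cvg (fun n (p : R * Borel Uc) => (bump f s n p)%:E)) => [n|p _].
      by apply/measurable_EFinP; apply: measurable_funTS; exact: (measurable_bump s n cf).
    by apply/cvg_EFin; [exact: nearW|exact: cvg_bump].
  - by apply: aeW => p _; apply/cvg_EFin; [exact: nearW|exact: cvg_bump].
  - apply/integrableP; split.
      by apply/measurable_EFinP; apply: measurable_funTS; exact: measurable_indic.
    under eq_integral do rewrite gee0_abs ?lee_fin ?indicE//.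
    under eq_integral do rewrite -indicE.
    rewrite integral_indic//; apply: le_lt_trans (_ : (L w (I0 (s + 1) `*` setT) < +oo)%E).
      by apply: le_measure; rewrite ?inE//; exact: measurableI.
    by have [_ /(_ (s + 1))] := LU w; apply; rewrite addr_ge0.
  - apply: aeW => p n Dp; rewrite lee_fin indicE.
    have [ps|ps] := leP p.1 (s + 1).
      rewrite mem_set; last by split => //; rewrite /I0 /= in_itv/= ps andbT.
      rewrite ger0_norm ?mulr_ge0 ?clamp_ge0//.
      by rewrite -[leRHS]mulr1 ler_pM ?clamp_ge0 ?clamp_le.
    rewrite memNset; last by move=> [+ _]; rewrite /I0 /= in_itv/= => /andP[_ /(lt_le_trans ps)]; rewrite ltxx.
    by rewrite bump0 ?normr0.
pose m (w : Om) := image_measure (mrestr (L w) (measurable_I0T s)) (measurable_snd : measurable_fun setT (snd : R * Borel Uc -> Borel Uc)).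
have mE w (A : set (Borel Uc)) : m w A = L w (I0 s `*` A).
  rewrite /m image_measureE /= /mrestr; congr (L w _); apply/seteqP; split => -[r u].
    by move=> [/= Au [/= rs _]]; split.
  by move=> [/= rs Au]; split.
move=> mC; rewrite (_ : (fun w => _) = m ^~ C); last by apply/funext => w; rewrite mE.
apply: (@measurable_random_measure R _ _ Om (Borel Uc) (@open Uc) m) => //.
- by move=> A B; exact: openI.
- by move=> w; rewrite mE; have [_ /(_ s s0)] := LU w.
- rewrite (_ : (fun w => _) = (fun w => L w (I0 s `*` (setT : set Uc)))); last by apply/funext => w; rewrite mE.
  by apply: open_case; exact: openT.
- move=> A oA; rewrite (_ : (fun w => _) = (fun w => L w (I0 s `*` (A : set Uc)))); last by apply/funext => w; rewrite mE.
  exact: open_case.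
Qed.

Lemma continuous_within_comp (S T V : topologicalType) (A : set T) (f : T -> V) (g : S -> T) :
  {within A, continuous f} -> continuous g -> (forall x, A (g x)) -> continuous (f \o g).
Proof.
move=> cf cg Ag x B nB; have := cf (g x) B nB.
rewrite /nbhs /= -nbhs_subspace_in// /within /= => h.
have := cg x _ h; rewrite /nbhs /=; apply: filterS => y; apply; exact: Ag.
Qed.

(** Converse to [measurable_evaluation]. Since f is continuous for nonnegative times only, its joint
    measurability is obtained by reading it as a cadlag process in time, indexed by u, and applying
    [rv_progressive]. *)
Lemma rv_int_LU (L : Om -> LM) (f : R * Uc -> R) :
  (forall w t, 0 <= t -> (L w (I0 t `*` setT) <= t%:E)%E) ->
  (forall s C, 0 <= s -> measurable C -> measurable_fun setT (fun w => L w (I0 s `*` C))) ->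
  Cc f -> rv (fun w => int_LU (L w) f).
Proof.
move=> LK mL [cf [C [cC [C0 fC]]]].
have [N N0 hN] : exists2 N : R, 0 <= N & forall p, C p -> p.1 <= N.
  have [|K K0 hK] := continuous_compact_bounded (f := fst : R * Uc -> R) cC.
    by apply: continuous_subspaceT => p; exact: cvg_fst.
  by exists K; [exact: ltW|move=> p /hK; exact: le_trans (ler_norm _)].
have mf : measurable_fun setT (fun p : R * Borel Uc => f (clamp N p.1, p.2)).
  have := @rv_progressive R _ (Borel Uc) R^o (fun u r => f (Num.max 0 r, u)) N _ N0.
  have cad (u : Borel Uc) : cadlag (fun r : R => f (Num.max 0 r, u)).
    have cu : continuous (fun r : R => f (Num.max 0 r, u)).
      apply: (continuous_within_comp cf (g := fun r : R => (Num.max 0 r, u : Uc))).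
        move=> r.
        have h1 : Num.max 0 x @[x --> r] --> Num.max 0 r.
          by apply: continuous_max; [exact: cvg_cst|exact: cvg_id].
        have h2 : (u : Uc) @[x --> r] --> (u : Uc) by exact: cvg_cst.
        exact: (cvg_pair h1 h2).
      by move=> r /=; rewrite le_max lexx.
    split => t _; first exact: cvg_within_filter (cu t).
    by apply/cvg_ex; exists (f (Num.max 0 t, u)); exact: cvg_within_filter (cu t).
  move=> /(_ cad) h.
  have /h/rv_realP h' : forall s, 0 <= s <= N ->
      rv (fun x : Borel Uc => f (Num.max 0 s, x)).
    move=> s s0 B oB; apply: Borel_open; move: B oB; apply/continuousP.
    apply: (continuous_within_comp cf (g := fun u : Uc => (Num.max 0 s, u))).
      move=> u; have h1 : (Num.max 0 s : R) @[_ --> u] --> Num.max 0 s by exact: cvg_cst.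
      exact: (cvg_pair h1 (@cvg_id _ (nbhs u))).
    by move=> u /=; rewrite le_max lexx.
  rewrite (_ : (fun p => _) = (fun p : Borel Uc * measurableTypeR R => f (Num.max 0 (clamp N p.2), p.1)) \o
     (fun p : R * Borel Uc => (p.2, p.1 : measurableTypeR R))).
    apply: measurableT_comp => //; apply/measurable_fun_pairP; split; [exact: measurable_snd|exact: measurable_fst].
  by apply/funext => p /=; rewrite (max_idPr (clamp_ge0 _ _)).
have -> : (fun w => int_LU (L w) f) = (fun w => \int[L w]_(p in I0 N `*` setT) (f (clamp N p.1, p.2))%:E)%E.
  apply/funext => w; rewrite /int_LU integral_mkcond [RHS]integral_mkcond; apply: eq_integral => -[r u] _.
  rewrite !patchE /= /I0; case: ifPn => [|r0].
    rewrite inE/= => r0; case: ifPn => [|rN].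
      by rewrite inE/= in_itv/= => -[rN _]; rewrite clamp_id.
    rewrite fC// => /hN/= rN'; move/negP : rN; apply; rewrite inE/= in_itv/= r0.
    by [].
  rewrite ifF//; apply/negP; rewrite inE/= in_itv/= => -[/andP[r0' _] _].
  by move/negP : r0; apply; rewrite inE.
apply/rv_erealP.
apply: (@measurable_random_integral_signed _ _ _ _ _ L _ N (measurable_I0T N) _ _ (fun q => f (clamp N q.2.1, q.2.2))).
- apply: measurable_occupation => [w|s D /andP[s0 _]]; last exact: mL.
  by apply: le_lt_trans (LK _ _ N0) _; exact: ltry.
- by move=> w; exact: LK.
- exact: measurableT_comp mf measurable_snd.
Qed.

End random_measure_evaluations.

(** * Paths with an admissible control *)

Section bounded_integrals.
Context {R : realType} {d : measure_display} {X : measurableType d}.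
Variable mu : {measure set X -> \bar R}.

Lemma bounded_integrable_on (D : set X) (k : X -> R) (K : R) : measurable D ->
  (mu D < +oo)%E -> measurable_fun D k -> (forall x, D x -> `|k x| <= K) ->
  mu.-integrable D (EFin \o k).
Proof.
move=> mD muD mk kK; apply: (le_integrable mD _ _ (_ : mu.-integrable D (cst K%:E))).
- exact/measurable_EFinP.
- by move=> x Dx /=; rewrite lee_fin (le_trans (kK x Dx))// ler_norm.
- apply/integrableP; split => //; rewrite integral_cst//.
  by rewrite lte_mul_pinfty// lee_fin.
Qed.

Lemma fine_integral_le (D : set X) (k : X -> R) (K r : R) : measurable D ->
  (mu D <= r%:E)%E -> 0 <= K -> measurable_fun D k -> (forall x, D x -> `|k x| <= K) ->
  `|fine (\int[mu]_(x in D) (k x)%:E)| <= K * r.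
Proof.
move=> mD muD K0 mk kK.
have muoo : (mu D < +oo)%E by apply: le_lt_trans muD _; exact: ltry.
have ik := bounded_integrable_on mD muoo mk kK.
have fk := integrable_fin_num mD ik.
rewrite -lee_fin -abse_EFin fineK//; apply: le_trans (le_abse_integral _ mD _) _.
  exact/measurable_EFinP.
apply: (@le_trans _ _ (\int[mu]_(x in D) K%:E)%E).
  apply: ge0_le_integral => //.
  by apply/measurable_EFinP; exact: measurableT_comp.
by rewrite integral_cst// EFinM lee_wpmul2l.
Qed.

Lemma fine_integral_diff (D1 D2 : set X) (k : X -> R) (K r : R) :
  measurable D1 -> measurable D2 -> D1 `<=` D2 -> (mu D2 < +oo)%E ->
  (mu (D2 `\` D1) <= r%:E)%E -> 0 <= K -> measurable_fun D2 k ->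
  (forall x, D2 x -> `|k x| <= K) ->
  `|fine (\int[mu]_(x in D2) (k x)%:E) - fine (\int[mu]_(x in D1) (k x)%:E)| <= K * r.
Proof.
move=> mD1 mD2 D12 muD2 mur K0 mk kK.
have mD := measurableD mD2 mD1.
have e : D2 = D1 `|` (D2 `\` D1) by rewrite setDUK.
have lt1 : (mu D1 < +oo)%E by apply: le_lt_trans muD2; apply: le_measure; rewrite ?inE.
have lt2 : (mu (D2 `\` D1) < +oo)%E by apply: le_lt_trans mur _; exact: ltry.
have mk1 : measurable_fun D1 k by apply: measurable_funS mk.
have mk2 : measurable_fun (D2 `\` D1) k by apply: measurable_funS mk => // x [].
have k1 x : D1 x -> `|k x| <= K by move=> /D12; exact: kK.
have k2 x : (D2 `\` D1) x -> `|k x| <= K by move=> -[/kK].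
have f1 := integrable_fin_num mD1 (bounded_integrable_on mD1 lt1 mk1 k1).
have f2 := integrable_fin_num mD (bounded_integrable_on mD lt2 mk2 k2).
rewrite [in X in fine X - _]e integral_setU_EFin//; last 2 first.
- by rewrite -e.
- by apply/disj_setPS => x [D1x []].
rewrite fineD// addrC addKr.
exact: fine_integral_le.
Qed.

End bounded_integrals.

Lemma lebesgue_measure_I0 {R : realType} (t : R) : 0 <= t ->
  (lebesgue_measure : {measure set (measurableTypeR R) -> \bar R}) (I0 t) = t%:E.
Proof. exact: lebesgue_I0. Qed.

Section admissible_pairs.
Context {R : realType} {E Uc : pseudoPMetricType R}.
Hypotheses (hE : hausdorff_space E) (cE : compact [set: E]).
Hypotheses (hU : hausdorff_space Uc) (cU : compact [set: Uc]).
Variables (Xi : set (E * Uc)) (cXi : closed Xi).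
Local Notation LM := (@LMeas R Uc).

Definition off_Xi (y : R -> E) : set (R * Borel Uc) :=
  [set p | 0 <= p.1 /\ ~ Xi (y p.1, p.2)].

(** What is left of a solution once lambda_0 is dropped. The increment bound says exactly that t
    minus the mass on [0, t] is nondecreasing, so that lambda_0 can be recovered. *)
Definition admissible (y : R -> E) (m : LM) : Prop :=
  [/\ cadlag y, m [set p | p.1 < 0] = 0%E, m (I0 0 `*` setT) = 0%E,
      (forall s t, 0 <= s <= t -> (m (I0 t `*` setT) <= m (I0 s `*` setT) + (t - s)%:E)%E) &
      m (off_Xi y) = 0%E].

Lemma rv_joint_path (y : R -> E) (t : R) : cadlag y -> 0 <= t ->
  rv (fun p : R * Borel Uc => (y (clamp t p.1), p.2 : Uc)).
Proof.
move=> cy t0.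
have := @rv_joint _ _ _ hE cE hU cU _ (measurableTypeR R) (fun=> y) t (fun=> cy) t0 (fun _ _ => rv_const _).
apply: (@rv_measurable_comp _ _ _ _ _ _ (fun p : R * Borel Uc => (p.1 : measurableTypeR R, p))).
by apply/measurable_fun_pairP; split; [exact: measurable_fst|exact: measurable_id].
Qed.

Lemma measurable_off_Xi (y : R -> E) : cadlag y -> measurable (off_Xi y).
Proof.
move=> cy; rewrite (_ : off_Xi y = \bigcup_n ((I0 n%:R `*` setT) `&`
    [set p | ~ Xi (y (clamp n%:R p.1), p.2)])).
  apply: bigcup_measurable => n _; apply: measurableI; first exact: measurable_I0T.
  have := @rv_joint_path y n%:R cy (ler0n _ _) (~` Xi); apply; exact: closed_openC.
apply/seteqP; split => [[r u] [/= r0 h]|[r u] [n _ [[/= + _]]]].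
  exists (Num.truncn r).+1 => //=; have rn := ltW (truncnS_gt r).
  by split; [split => //; rewrite /I0 /= in_itv/= r0|rewrite clamp_id ?r0].
by rewrite /I0 /= in_itv/= => rn; rewrite clamp_id//; case/andP : rn.
Qed.

Lemma measurable_control_path (y : R -> E) (h : E * Uc -> R) (t : R) : cadlag y -> 0 <= t ->
  continuous h -> measurable_fun (I0 t `*` setT) (fun p : R * Borel Uc => h (y p.1, p.2)).
Proof.
move=> cy t0 ch; apply: (eq_measurable_fun (fun p : R * Borel Uc => h (y (clamp t p.1), p.2))).
  by move=> [r u]; rewrite inE => -[/= + _]; rewrite /I0 /= in_itv/= => rt; rewrite clamp_id.
apply: measurable_funTS.
by have /rv_continuousP /(_ _ ch) := rv_joint_path cy t0.
Qed.

Lemma measurable_time_path (y : R -> E) (a : E -> R) (t : R) : cadlag y -> 0 <= t ->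
  continuous a -> measurable_fun (I0 t) (a \o y).
Proof.
move=> cy t0 ca; apply: (eq_measurable_fun (fun s => a (y (clamp t s)))).
  by move=> r; rewrite inE /I0 /= in_itv/= => rt; rewrite clamp_id.
apply: measurable_funTS.
by have /rv_continuousP /(_ _ ca) := rv_path cy t0.
Qed.

Definition compensated (f a : E -> R) (c : E * Uc -> R) (y : R -> E) (m : LM)
    (th : \bar R) (t : R) : R :=
  f (y t) - f (y 0)
    - fine (\int[lebesgue_measure]_(s in I0 t `&` [set s | s%:E <= th]%E) (a (y s))%:E)
    - fine (\int[m]_(p in I0 t `*` setT) (c (y p.1, p.2))%:E).

(* The clock identity turns [dF] into Lebesgue measure minus the time marginal of [m], so
   that no Stieltjes integral is left. *)
Lemma compensatedE (f a : E -> R) (Bf b : E * Uc -> R) (y : R -> E) (F : R -> R) (m : LM)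
    (th : \bar R) (t : R) : (0 <= th)%E ->
  (forall t, 0 <= t -> 0 <= F t) -> (forall s t : R, 0 <= s <= t -> F s <= F t) ->
  (forall t : R, 0 <= t -> ((F t)%:E + m (I0 t `*` setT) = mine t%:E th)%E) ->
  cadlag y -> m (off_Xi y) = 0%E -> continuous a -> continuous b ->
  (forall p, Xi p -> Bf p = b p) -> 0 <= t ->
  f (y t) - f (y 0) - fine (\int[LS F]_(s in I0 t) (a (y s))%:E)
    - fine (\int[m]_(p in I0 t `*` setT) (Bf (y p.1, p.2))%:E) =
  compensated f a (fun q => b q - a q.1) y m th t.
Proof.
move=> th0 F0 Fmono Fm cy mXi ca cb Bb t0.
have [Ka Ka0 aK] : exists2 K : R, 0 < K & forall x, setT x -> `|a x| <= K.
  by apply: continuous_compact_bounded => //; exact: continuous_subspaceT.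
have [Kb Kb0 bK] : exists2 K : R, 0 < K & forall x, setT x -> `|b x| <= K.
  apply: continuous_compact_bounded; first exact: compact_prodT.
  exact: continuous_subspaceT.
(* Off [Xi] the values of [Bf] and its extension are unrelated, but m does not charge that set. *)
have -> : (\int[m]_(p in I0 t `*` setT) (Bf (y p.1, p.2))%:E =
           \int[m]_(p in I0 t `*` setT) (b (y p.1, p.2))%:E)%E.
  apply: (eq_integral_null (N := off_Xi y)) => //; first exact: measurable_off_Xi.
  move=> [r u] [/= + _] h; rewrite /I0 /= in_itv/= => /andP[r0 _].
  by rewrite Bb//; apply: contrapT => nX; apply: h.
(* The splitting needs a bounded measurable integrand on the whole line, hence the clamped time; on
   [0, t] clamping changes nothing. *)
have := LS_split_integral th0 F0 Fmono Fm t0 (g := fun s => a (y (clamp t s))) (K := Ka).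
have -> : (\int[LS F]_(s in I0 t) (a (y (clamp t s)))%:E = \int[LS F]_(s in I0 t) (a (y s))%:E)%E.
  by apply: eq_integral => s; rewrite inE /I0/= in_itv/= => st; rewrite clamp_id.
have -> : (\int[m]_(p in I0 t `*` setT) (a (y (clamp t p.1)))%:E =
           \int[m]_(p in I0 t `*` setT) (a (y p.1))%:E)%E.
  by apply: eq_integral => -[s u]; rewrite inE /I0/= in_itv/= => -[st _]; rewrite clamp_id.
have -> : (\int[lebesgue_measure]_(s in I0 t `&` [set s | (s%:E <= th)%E]) (a (y (clamp t s)))%:E =
           \int[lebesgue_measure]_(s in I0 t `&` [set s | (s%:E <= th)%E]) (a (y s))%:E)%E.
  by apply: eq_integral => s; rewrite inE /I0/= in_itv/= => -[st _]; rewrite clamp_id.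
have ma := measurable_time_path cy t0 ca.
have mI : measurable (I0 t : set (measurableTypeR R)) := measurable_I0 t.
have mIT := measurable_I0T t (Uc := Uc).
have LSoo : (LS F (I0 t) < +oo)%E by rewrite (LS_Iy th0 F0 Fmono Fm)// ltry.
have moo : (m (I0 t `*` setT) < +oo)%E.
  by have := occupation_le F0 Fm t0; move=> /le_lt_trans; apply; exact: ltry.
have iL : (LS F).-integrable (I0 t) (EFin \o (a \o y)).
  by apply: (bounded_integrable_on (K := Ka)) => // s _; exact: aK.
have ca1 : continuous (fun q : E * Uc => a q.1).
  by move=> q; apply: (@continuous_comp _ _ _ (fst : E * Uc -> E) a); [exact: cvg_fst|exact: ca].
have ia : m.-integrable (I0 t `*` setT) (EFin \o (fun p : R * Borel Uc => a (y p.1))).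
  apply: (bounded_integrable_on (K := Ka)) => //.
    exact: (measurable_control_path cy t0 ca1).
  by move=> p _; exact: aK.
have ib : m.-integrable (I0 t `*` setT) (EFin \o (fun p : R * Borel Uc => b (y p.1, p.2))).
  apply: (bounded_integrable_on (K := Kb)) => //.
    exact: (measurable_control_path cy t0 cb).
  by move=> p _; exact: bK.
have fL := integrable_fin_num mI iL.
have fa := integrable_fin_num mIT ia.
have fb := integrable_fin_num mIT ib.
rewrite /compensated.
have -> : (\int[m]_(p in I0 t `*` setT) ((b (y p.1, p.2)) - a (y p.1))%:E =
   \int[m]_(p in I0 t `*` setT) (b (y p.1, p.2))%:E - \int[m]_(p in I0 t `*` setT) (a (y p.1))%:E)%E.
  by rewrite -integralB_EFin.
move=> <-; last 2 first.
- by have /rv_continuousP /(_ _ ca) := rv_path cy t0.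
- by move=> s; exact: aK.
by rewrite (fineD fL fa) (fineB fb fa); lra.
Qed.

Section admissible_facts.
Variables (y : R -> E) (m : LM).
Hypothesis ym : admissible y m.

Lemma admissible_le (t : R) : 0 <= t -> (m (I0 t `*` setT) <= t%:E)%E.
Proof.
move=> t0; have [_ _ m0 mL _] := ym.
by have := mL 0 t; rewrite lexx t0 m0 add0e subr0; apply.
Qed.

Lemma admissible_fin (t : R) : 0 <= t -> m (I0 t `*` setT) \is a fin_num.
Proof.
move=> t0; rewrite ge0_fin_numE ?measure_ge0//.
by apply: le_lt_trans (admissible_le t0) _; exact: ltry.
Qed.

Lemma admissible_lt (t : R) : 0 <= t -> (m (I0 t `*` setT) < +oo)%E.
Proof. by move=> t0; rewrite ltey_eq admissible_fin. Qed.

Lemma admissible_in_LU : in_LU m.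
Proof. by have [_ ? _ _ _] := ym; split => // t; exact: admissible_lt. Qed.

(* The process lambda_0 recovered from Lambda_1 through the clock lambda_0(t) + lambda_1(t) = t. *)
Definition idle_time (t : R) : R := t - fine (m (I0 t `*` setT)).

Lemma idle_time_ge0 t : 0 <= t -> 0 <= idle_time t.
Proof.
by move=> t0; rewrite subr_ge0 -lee_fin fineK ?admissible_fin// admissible_le.
Qed.

Lemma idle_time_mono (s t : R) : 0 <= s <= t -> idle_time s <= idle_time t.
Proof.
move=> st; have /andP[s0 le_st] := st; have t0 := le_trans s0 le_st.
have [_ _ _ /(_ _ _ st) + _] := ym.
rewrite -(fineK (admissible_fin s0)) -(fineK (admissible_fin t0)) -EFinD lee_fin.
by rewrite /idle_time; lra.
Qed.

Lemma idle_timeE (t : R) : 0 <= t ->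
  ((idle_time t)%:E + m (I0 t `*` setT) = mine t%:E +oo)%E.
Proof.
move=> t0; rewrite (min_idPl (leey _)) -(fineK (admissible_fin t0)) -EFinD.
by rewrite /idle_time subrK.
Qed.

Lemma admissible_increment (s t : R) : 0 <= s <= t ->
  (m ((I0 t `*` setT) `\` (I0 s `*` setT)) <= (t - s)%:E)%E.
Proof.
move=> st; have /andP[s0 le_st] := st; have t0 := le_trans s0 le_st.
have [_ _ _ /(_ _ _ st) h _] := ym.
have sub : I0 s `*` setT `<=` (I0 t `*` setT : set (R * Borel Uc)).
  by move=> [r u] [/= + _]; rewrite /I0 /= !in_itv/= => /andP[r0 rs]; rewrite r0 (le_trans rs).
rewrite measureD ?(setIidr sub) ?admissible_lt//; [|exact: measurable_I0T..].
by rewrite leeBlDr ?admissible_fin// addeC.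
Qed.

Lemma lebesgue_increment (s t : R) : 0 <= s <= t ->
  (lebesgue_measure ((I0 t `\` I0 s) : set (measurableTypeR R)) <= (t - s)%:E)%E.
Proof.
move=> st; have /andP[s0 le_st] := st; have t0 := le_trans s0 le_st.
have sub : I0 s `<=` I0 t.
  by move=> r; rewrite /I0 /= !in_itv/= => /andP[r0 rs]; rewrite r0 (le_trans rs).
have ms : measurable (I0 s : set (measurableTypeR R)) := measurable_I0 s.
have mt : measurable (I0 t : set (measurableTypeR R)) := measurable_I0 t.
have h := @measureD _ _ _ (lebesgue_measure : {measure set (measurableTypeR R) -> \bar R}) _ _ mt ms.
have e1 := lebesgue_measure_I0 t0; have e2 := lebesgue_measure_I0 s0.
rewrite -(setIidr sub) in e2.
have e3 := etrans (h (eq_ind_r (fun x => x < +oo)%E (ltry t) e1))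
  (f_equal2 (fun x y => x - y)%E e1 e2).
by rewrite le_eqVlt; apply/orP; left; apply/eqP; exact: e3.
Qed.

Variables (f a : E -> R) (c : E * Uc -> R).
Hypotheses (cf : continuous f) (ca : continuous a) (cc : continuous c).

Definition compensated_full (t : R) : R :=
  f (y t) - f (y 0) - fine (\int[lebesgue_measure]_(s in I0 t) (a (y s))%:E)
    - fine (\int[m]_(p in I0 t `*` setT) (c (y p.1, p.2))%:E).

Lemma compensated_fullE t : compensated_full t = compensated f a c y m +oo t.
Proof.
rewrite /compensated_full /compensated.
rewrite [in RHS](_ : I0 t `&` _ = I0 t)//.
by apply/seteqP; split => [s []//|s ts]; split => //=; exact: leey.
Qed.

Section bounds.
Variables (Ka Kc : R).
Hypotheses (Ka0 : 0 <= Ka) (Kc0 : 0 <= Kc)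
  (aK : forall x, `|a x| <= Ka) (cK : forall p, `|c p| <= Kc).

Lemma compensated_bound Kf t : (forall x, `|f x| <= Kf) -> 0 <= t -> `|compensated_full t| <= Kf + Kf + Ka * t + Kc * t.
Proof.
move=> fK t0; have [cy _ _ _ _] := ym.
rewrite /compensated_full.
apply: (le_trans (ler_normB _ _)); apply: lerD.
  apply: (le_trans (ler_normB _ _)); apply: lerD.
    by apply: (le_trans (ler_normB _ _)); exact: lerD.
  apply: fine_integral_le => //; first exact: measurable_I0.
    by rewrite lebesgue_measure_I0.
  exact: measurable_time_path.
apply: fine_integral_le => //; first exact: measurable_I0T.
  exact: admissible_le.
exact: (measurable_control_path cy t0 cc).
Qed.

Lemma compensated_increment s t : 0 <= s <= t ->
  `|compensated_full t - compensated_full s| <= `|f (y t) - f (y s)| + (Ka + Kc) * (t - s).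
Proof.
move=> st; have /andP[s0 le_st] := st; have t0 := le_trans s0 le_st.
have [cy _ _ _ _] := ym.
have sub : I0 s `<=` I0 t.
  by move=> r; rewrite /I0 /= !in_itv/= => /andP[r0 rs]; rewrite r0 (le_trans rs).
have h1 : `|fine (\int[lebesgue_measure]_(s in I0 t) (a (y s))%:E) -
           fine (\int[lebesgue_measure]_(s in I0 s) (a (y s))%:E)| <= Ka * (t - s).
  apply: fine_integral_diff => //.
  - exact: measurable_I0.
  - exact: measurable_I0.
  - by rewrite lebesgue_measure_I0 ?ltry.
  - exact: lebesgue_increment.
  - exact: measurable_time_path.
have h2 : `|fine (\int[m]_(p in I0 t `*` setT) (c (y p.1, p.2))%:E) -
           fine (\int[m]_(p in I0 s `*` setT) (c (y p.1, p.2))%:E)| <= Kc * (t - s).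
  apply: fine_integral_diff => //.
  - exact: measurable_I0T.
  - exact: measurable_I0T.
  - by move=> [r u] [/= /sub ? _].
  - exact: admissible_lt.
  - exact: admissible_increment.
  - exact: (measurable_control_path cy t0 cc).
rewrite /compensated_full.
move: (fine _) h1 => A1; move: (fine _) => A2 h1.
move: (fine _) h2 => A3; move: (fine _) => A4 h2.
have := ler_normD (f (y t) - f (y s)) ((A2 - A1) + (A4 - A3)).
have := ler_normD (A2 - A1) (A4 - A3).
rewrite (distrC A2) (distrC A4) => u1 u2.
rewrite (_ : _ - _ = f (y t) - f (y s) + ((A2 - A1) + (A4 - A3))); last by ring.
by apply: (le_trans u2); rewrite lerD2l (le_trans u1)// mulrDl lerD.
Qed.

End bounds.

Lemma compensated_right_cvg t (s : nat -> R) : 0 <= t -> (forall n, t <= s n) ->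
  s n @[n --> \oo] --> t -> compensated_full (s n) @[n --> \oo] --> compensated_full t.
Proof.
move=> t0 ts st; have [cy _ _ _ _] := ym.
have [Ka Ka0 aK] : exists2 K : R, 0 < K & forall x, setT x -> `|a x| <= K.
  by apply: continuous_compact_bounded => //; exact: continuous_subspaceT.
have [Kc Kc0 cK] : exists2 K : R, 0 < K & forall x, setT x -> `|c x| <= K.
  apply: continuous_compact_bounded; first exact: compact_prodT.
  exact: continuous_subspaceT.
apply/subr_cvg0/norm_cvg0P.
apply: (@squeeze_cvgr _ _ _ _ (cst 0)
   (fun n => `|f (y (s n)) - f (y t)| + (Ka + Kc) * (s n - t))).
- apply: nearW => n /=; rewrite normr_ge0/= (compensated_increment (ltW Ka0) (ltW Kc0))//.
  + by move=> x; exact: aK.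
  + by move=> x; exact: cK.
  + by rewrite t0 ts.
- exact: cvg_cst.
rewrite [X in _ --> X](_ : 0 = 0 + (Ka + Kc) * 0); last by rewrite mulr0 addr0.
apply: cvgD.
  apply/norm_cvg0P/subr_cvg0.
  by apply: (cvg_comp _ _ (cadlag_cvg_right cy t0 ts st)); exact: cf.
by apply: cvgMr; apply/subr_cvg0.
Qed.

End admissible_facts.

Section compensated_measurable.
Context {d : measure_display} {Om : measurableType d}.
Variables (Y : Om -> R -> E) (L : Om -> LM) (t : R).
Hypotheses (YL : forall w, admissible (Y w) (L w)) (t0 : 0 <= t)
  (rY : forall s, 0 <= s <= t -> rv (Y ^~ s))
  (mL : forall s C, 0 <= s <= t -> measurable C ->
     measurable_fun setT (fun w => L w (I0 s `*` C))).
Variables (f a : E -> R) (c : E * Uc -> R).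
Hypotheses (cf : continuous f) (ca : continuous a) (cc : continuous c).

Lemma measurable_compensated :
  measurable_fun setT (fun w => compensated_full (Y w) (L w) f a c t).
Proof.
have cY w : cadlag (Y w) by have [] := YL w.
apply: measurable_funB; last first.
  apply: measurableT_comp => //; apply: (@measurable_control_integral _ _ _ hE cE hU cU _ _ Y t cY t0 rY L t) => //.
  by move=> w; exact: admissible_le.
apply: measurable_funB; last first.
  by apply: measurableT_comp => //; exact: measurable_time_integral.
apply: measurable_funB.
  by have /rv_continuousP /(_ _ cf) : rv (Y ^~ t) by apply: rY; rewrite t0 lexx.
by have /rv_continuousP /(_ _ cf) : rv (Y ^~ 0) by apply: rY; rewrite t0 lexx.
Qed.

End compensated_measurable.

End admissible_pairs.

(** * Reconstruction of paths and controls from their codes *)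

Section countable_quantifiers.
Context {d : measure_display} {T : measurableType d}.

Lemma measurable_forall (I : countType) (Q : I -> T -> Prop) :
  (forall i, measurable [set w | Q i w]) -> measurable [set w | forall i, Q i w].
Proof.
move=> mQ; rewrite (_ : mkset _ = ~` \bigcup_(i in setT) ~` [set w | Q i w]).
  apply: measurableC; apply: bigcup_count_measurable => i _; exact: measurableC.
by apply/seteqP; split => [w h [i _]|w h i]; [exact|apply: contrapT => ?; apply: h; exists i].
Qed.

Lemma measurable_exists (I : countType) (Q : I -> T -> Prop) :
  (forall i, measurable [set w | Q i w]) -> measurable [set w | exists i, Q i w].
Proof.
move=> mQ; rewrite (_ : mkset _ = \bigcup_(i in setT) [set w | Q i w]).
  exact: bigcup_count_measurable.
by apply/seteqP; split => [w [i h]|w [i _ h]]; exists i.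
Qed.

Lemma measurable_imply (C : Prop) (Q : T -> Prop) :
  measurable [set w | Q w] -> measurable [set w | C -> Q w].
Proof.
move=> mQ; have [c|nc] := pselect C.
  rewrite (_ : mkset _ = [set w | Q w])//; apply/seteqP; split => w //=; exact.
by rewrite (_ : mkset _ = setT)//; apply/seteqP; split => // w _ /nc.
Qed.

End countable_quantifiers.

(** * Cadlag functions from their values at the rationals *)

Section compact_metric.
Context {R : realType} {E : pseudoPMetricType R}.
Hypotheses (hE : hausdorff_space E) (cE : compact [set: E]).

Lemma bdist_eq0 (x y : E) : (forall e : R, 0 < e -> bdist x y <= e) -> x = y.
Proof.
move=> h; apply: hE => A B /nbhs_ballP[e /= e0 xA] yB.
exists y; split; last exact: nbhs_singleton.
have m0 : 0 < Num.min e 1 by rewrite lt_min e0 ltr01.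
apply: xA; apply: (@le_ball _ _ _ (Num.min e 1)); first by rewrite ge_min lexx.
apply: bdist_ball; first by rewrite ge_min lexx orbT.
apply: (le_lt_trans (h (Num.min e 1 / 2) _)); first by rewrite divr_gt0.
by rewrite ltr_pdivrMr// ltr_pMr ?ltr1n.
Qed.

Lemma cvg_bdist (F : set_system E) (x : E) : Filter F ->
  (forall e : R, 0 < e -> F [set a | bdist x a <= e]) -> F --> x.
Proof.
move=> FF h; apply/cvg_ballP => e e0.
have m0 : 0 < Num.min e 1 / 2 by rewrite divr_gt0// lt_min e0 ltr01.
apply: filterS (h _ m0) => a /= xa.
apply: (@le_ball _ _ _ (Num.min e 1)); first by rewrite ge_min lexx.
apply: bdist_ball; first by rewrite ge_min lexx orbT.
apply: (le_lt_trans xa); rewrite ltr_pdivrMr// ltr_pMr ?ltr1n//.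
by rewrite lt_min e0 ltr01.
Qed.

Lemma compact_cauchy_cvg (F : set_system E) : ProperFilter F ->
  (forall e : R, 0 < e -> exists2 A, F A & forall a b, A a -> A b -> bdist a b <= e) ->
  cvg F.
Proof.
move=> FF small; have [x [_ clx]] := cE FF filterT.
apply/cvg_ex; exists x; apply: cvg_bdist => e e0.
have e2 : 0 < e / 2 by rewrite divr_gt0.
have [A FA hA] := small _ e2; apply: (filterS _ FA) => a Aa /=.
have [b [Ab xb]] := clx A _ FA (nbhsx_ballx x _ e2).
have := bdist_triangle x b a; have := hA b a Ab Aa.
by have := ball_bdist e2 xb; move: (bdist _ _) => u; lra.
Qed.

(** A cadlag function may jump once inside a short interval, but two successive oscillations above a
    given size must be separated. This is stated cell by cell on a grid of mesh 1/(j+1) up to time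
    N, with quantifiers over countable sets only, so that it defines a measurable set of codes. *)
Definition oscillation_small (z : rat -> E) : Prop := forall m N : nat, exists j : nat,
  forall (i : nat) (q1 q2 q3 q4 : rat), [&& (i < N * j.+1)%N, i%:R / j.+1%:R <= q1, q1 < q2,
    q2 <= q3, q3 < q4 & q4 <= i.+1%:R / j.+1%:R] ->
  bdist (z q1) (z q2) <= m.+1%:R^-1 \/ bdist (z q3) (z q4) <= m.+1%:R^-1.

Definition right_continuous_rat (z : rat -> E) : Prop := forall (q : rat) (m : nat),
  0 <= q -> exists j : nat, forall r : rat, q < r < q + j.+1%:R^-1 ->
  bdist (z q) (z r) <= m.+1%:R^-1.

Lemma small_inv (e : R) : 0 < e -> exists m : nat, m.+1%:R^-1 < e.
Proof.
move=> e0; exists (Num.truncn e^-1); rewrite -[X in _ < X]invrK ltf_pV2 ?posrE ?invr_gt0//.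
exact: truncnS_gt.
Qed.

(** Otherwise, for every mesh, some cell carries two oscillations; by compactness these cells
    cluster at a time t, and one of the two pairs lies on one side of t, against the left limit or
    right continuity there. *)
Lemma cadlag_oscillation (y : R -> E) : cadlag y ->
  oscillation_small (fun q => y (ratr q)).
Proof.
move=> cy m N; apply: contrapT => nj; set e : R := m.+1%:R^-1 in nj.
have e0 : 0 < e by rewrite invr_gt0.
have e2 : 0 < e / 2 by rewrite divr_gt0.
have /choice [i hi] : forall j : nat, exists i : nat, exists q1 q2 q3 q4 : rat,
    [&& (i < N * j.+1)%N, i%:R / j.+1%:R <= q1, q1 < q2,
    q2 <= q3, q3 < q4 & q4 <= i.+1%:R / j.+1%:R] /\
    (e < bdist (y (ratr q1)) (y (ratr q2)) /\ e < bdist (y (ratr q3)) (y (ratr q4))).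
  move=> j; apply: contrapT => ni; apply: nj; exists j => i q1 q2 q3 q4 h.
  apply: contrapT => /not_orP[/negP b1 /negP b2]; apply: ni; exists i, q1, q2, q3, q4.
  by split => //; rewrite !ltNge b1 b2.
pose x (j : nat) : R := (i j)%:R / j.+1%:R.
have x0N j : I0 N%:R (x j).
  have [q1 [q2 [q3 [q4 [/and5P[iN _ _ _ _] _]]]]] := hi j.
  rewrite /I0 /= in_itv/= divr_ge0//= ler_pdivrMr// -natrM ler_nat; exact: ltnW.
have [|t [t0N clt]] := @segment_compact R 0 N%:R (x @ \oo) _.
  by exists 0%N => // j _; exact: x0N.
move: t0N; rewrite /I0 /= in_itv/= => /andP[t0 tN].
have [er er0 hr] := cadlag_right cy t0 (nbhsx_ballx (y t) _ e2).
have [el el0 hl] : exists2 el, 0 < el & forall s s', 0 <= s -> 0 <= s' ->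
    t - el < s < t -> t - el < s' < t -> bdist (y s) (y s') <= e.
  move: t0; rewrite le_eqVlt => /predU1P[<-|t0].
    by exists 1 => // s s' s0 _ /andP[_]; rewrite ltNge s0.
  have [el el0 hl] := cadlag_left cy t0 (nbhsx_ballx (leftlim y t) _ e2).
  exists el => // s s' _ _ /hl /(ball_bdist e2) h1 /hl /(ball_bdist e2) h2.
  have := bdist_triangle (y s) (leftlim y t) (y s'); rewrite bdist_sym in h1.
  by move: (bdist _ _) h1 (bdist _ _) h2 => u hu v hv; lra.
pose d := Num.min er el.
have d0 : 0 < d by rewrite lt_min er0.
have d20 : 0 < d / 2 by rewrite divr_gt0.
have [J hJ] := small_inv d20.
have xJ : (x @ \oo) [set u | exists2 j, (J <= j)%N & u = x j].
  by rewrite /nbhs /=; exists J => // j /= Jj; exists j.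
have [_ [[j Jj ->]]] := clt _ _ xJ (nbhsx_ballx t _ d20).
rewrite /ball /= => xt.
have jd : j.+1%:R^-1 < d / 2.
  by apply: le_lt_trans hJ; rewrite lef_pV2 ?posrE// ler_nat.
have [q1 [q2 [q3 [q4 [/and5P[_ i1 q12 q23 /andP[q34 i4]] [b12 b34]]]]]] := hi j.
have r1 : x j <= ratr q1 by move: i1; rewrite -(ler_rat R) fmorph_div /= !ratr_nat.
have r4 : ratr q4 <= x j + j.+1%:R^-1.
  by move: i4; rewrite -(ler_rat R) fmorph_div /= !ratr_nat -natr1 mulrDl mul1r.
have r12 : ratr q1 < ratr q2 :> R by rewrite ltr_rat.
have r23 : ratr q2 <= ratr q3 :> R by rewrite ler_rat.
have r34 : ratr q3 < ratr q4 :> R by rewrite ltr_rat.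
have := x0N j; rewrite /I0 /= in_itv/= => /andP[xj0 _].
move: xt; rewrite ltr_norml => /andP[xt1 xt2].
have der : d <= er by rewrite ge_min lexx.
have del : d <= el by rewrite ge_min lexx orbT.
(* If q2 < t, the first pair is to the left of t; otherwise q3 >= q2 >= t and the second pair is to
   the right. *)
have [q2t|tq2] := ltP (ratr q2) t.
  suff : bdist (y (ratr q1)) (y (ratr q2)) <= e by move=> /(lt_le_trans b12); rewrite ltxx.
  apply: hl.
  - lra.
  - lra.
  - by apply/andP; split; lra.
  - by apply/andP; split; lra.
have q4d : ratr q4 < t + d.
  apply: (le_lt_trans r4); move: xt1 jd; set u := j.+1%:R^-1; set v := x j; set w := d.
  by clearbody u v w; clear; move=> ? ?; lra.
have q4er : ratr q4 < t + er by apply: (lt_le_trans q4d); rewrite lerD2l.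
have tq3 : t <= ratr q3 := le_trans tq2 r23.
have /hr/(ball_bdist e2) h3 : t <= ratr q3 < t + er by rewrite tq3 (lt_trans r34).
have /hr/(ball_bdist e2) h4 : t <= ratr q4 < t + er by rewrite q4er (le_trans tq3)// ltW.
have := bdist_triangle (y (ratr q3)) (y t) (y (ratr q4)); rewrite bdist_sym in h3.
by move: (bdist _ _) h3 (bdist _ _) h4 (bdist _ _) b34 => u hu v hv w hw; lra.
Qed.

Lemma cadlag_right_continuous_rat (y : R -> E) : cadlag y ->
  right_continuous_rat (fun q => y (ratr q)).
Proof.
move=> cy q m q0; have e0 : 0 < m.+1%:R^-1 :> R by rewrite invr_gt0.
have rq0 : 0 <= ratr q :> R by rewrite ler0q.
have [e ep he] := cadlag_right cy rq0 (nbhsx_ballx (y (ratr q)) _ e0).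
have [j je] := small_inv ep; exists j => r /andP[qr rj].
apply: ball_bdist => //; apply: he; rewrite ler_rat (ltW qr)/=.
move: rj; rewrite -(ltr_rat R) rmorphD /= fmorphV /= ratr_nat => /lt_trans; apply.
by rewrite ltrD2l.
Qed.

Section extension.
Variable z : rat -> E.
Hypotheses (oz : oscillation_small z) (rz : right_continuous_rat z).

(** If large oscillations persisted immediately after t, one could be chosen in the grid cell of t,
    and then another between t and it: two in one cell, which [oz] forbids. *)
Lemma right_cauchy (t e : R) : 0 <= t -> 0 < e -> exists2 r : R, 0 < r &
  forall q q' : rat, t < ratr q < t + r -> t < ratr q' < t + r -> bdist (z q) (z q') <= e.
Proof.
move=> t0 e0; have [m me] := small_inv e0.
have [j hj] := oz m (Num.truncn t).+1.
pose i := Num.truncn (t * j.+1%:R).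
have /andP[it ti] : i%:R <= t * j.+1%:R < i.+1%:R by rewrite /i truncn_itv// mulr_ge0.
apply: contrapT => nr.
have pick (r : R) : 0 < r -> exists q q' : rat, [/\ t < ratr q, q < q', ratr q' < t + r &
    m.+1%:R^-1 < bdist (z q) (z q')].
  move=> r0; apply: contrapT => nq; apply: nr; exists r => // q q' /andP[tq qr] /andP[tq' qr'].
  apply: contrapT => /negP; rewrite -ltNge => b; apply: nq.
  have b' := lt_trans me b.
  have [qq'|qq'|qq'] := ltgtP q q'; [by exists q, q'|by exists q', q; rewrite bdist_sym|].
  by move: b; rewrite qq' bdist_xx ltNge ltW.
have p1 : 0 < i.+1%:R / j.+1%:R - t by rewrite subr_gt0 ltr_pdivlMr.
have [q3 [q4 [tq3 q34 q4i b34]]] := pick _ p1.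
have p2 : 0 < ratr q3 - t by rewrite subr_gt0.
have [q1 [q2 [tq1 q12 q2q3 b12]]] := pick _ p2.
rewrite addrC subrK in q4i; rewrite addrC subrK ltr_rat in q2q3.
have [|h|h] := hj i q1 q2 q3 q4.
- apply/and5P; split => //; last (apply/andP; split => //).
  + rewrite -(ltr_nat R) natrM; apply: (le_lt_trans it).
    by rewrite ltr_pM2r// truncnS_gt.
  + rewrite -(ler_rat R) fmorph_div /= !ratr_nat ler_pdivrMr//.
    by apply: (le_trans it); rewrite ler_pM2r// ltW.
  + exact: ltW.
  + by rewrite -(ler_rat R) fmorph_div /= !ratr_nat ltW.
- by move: b12; rewrite ltNge h.
- by move: b34; rewrite ltNge h.
Qed.

(** Mirror image of [right_cauchy]: the earlier pair is chosen first and the second one between it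
    and t. *)
Lemma left_cauchy (t e : R) : 0 < t -> 0 < e -> exists2 r : R, 0 < r &
  forall q q' : rat, t - r < ratr q < t -> t - r < ratr q' < t -> bdist (z q) (z q') <= e.
Proof.
move=> t0 e0; have [m me] := small_inv e0.
have [j hj] := oz m (Num.truncn t).+1.
(* The cell is open on the left and closed on the right, because a whole left neighbourhood of t has
   to lie in it even when t is a grid point. *)
have [i it ti] : exists2 i : nat, i%:R < t * j.+1%:R & t * j.+1%:R <= i.+1%:R.
  have : 0 < t * j.+1%:R by rewrite mulr_gt0.
  move: (t * _) => u u0; have /andP[] : (Num.truncn u)%:R <= u < (Num.truncn u).+1%:R.
    by rewrite truncn_itv// ltW.
  rewrite le_eqVlt => /predU1P[tu _|tu uu]; last by exists (Num.truncn u) => //; exact: ltW.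
  case E1 : (Num.truncn u) tu => [|k] tu; first by move: u0; rewrite -tu ltxx.
  by exists k; rewrite -tu ?ltr_nat.
apply: contrapT => nr.
have pick (r : R) : 0 < r -> exists q q' : rat, [/\ t - r < ratr q, q < q', ratr q' < t &
    m.+1%:R^-1 < bdist (z q) (z q')].
  move=> r0; apply: contrapT => nq; apply: nr; exists r => // q q' /andP[tq qr] /andP[tq' qr'].
  apply: contrapT => /negP; rewrite -ltNge => b; apply: nq.
  have b' := lt_trans me b.
  have [qq'|qq'|qq'] := ltgtP q q'; [by exists q, q'|by exists q', q; rewrite bdist_sym|].
  by move: b; rewrite qq' bdist_xx ltNge ltW.
have p1 : 0 < t - i%:R / j.+1%:R by rewrite subr_gt0 ltr_pdivrMr.
have [q1 [q2 [iq1 q12 q2t b12]]] := pick _ p1.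
have p2 : 0 < t - ratr q2 by rewrite subr_gt0.
have [q3 [q4 [q2q3 q34 q4t b34]]] := pick _ p2.
rewrite subKr in iq1; rewrite subKr ltr_rat in q2q3.
have [|h|h] := hj i q1 q2 q3 q4.
- apply/and5P; split => //; last (apply/andP; split => //).
  + rewrite -(ltr_nat R) natrM; apply: (lt_trans it).
    by rewrite ltr_pM2r// truncnS_gt.
  + by rewrite -(ler_rat R) fmorph_div /= !ratr_nat ltW.
  + exact: ltW.
  + rewrite -(ler_rat R) fmorph_div /= !ratr_nat; apply/ltW/(lt_le_trans q4t).
    by rewrite ler_pdivlMr.
- by move: b12; rewrite ltNge h.
- by move: b34; rewrite ltNge h.
Qed.

Definition qgrid n (t : R) : rat := (Num.floor (t * n.+1%:R) + 1)%:~R / n.+1%:R.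

Lemma ratr_qgrid n t : ratr (qgrid n t) = grid_up n t.
Proof. by rewrite /qgrid /grid_up fmorph_div /= ratr_int ratr_nat. Qed.

Lemma qgrid_ge0 n t : 0 <= t -> 0 <= qgrid n t.
Proof.
move=> t0; have : 0 <= ratr (qgrid n t) :> R.
  by rewrite ratr_qgrid (le_trans t0)// ltW// grid_up_gt.
by rewrite ler0q.
Qed.

Lemma qgrid_near (t r : R) : 0 < r -> \forall n \near \oo, t < ratr (qgrid n t) < t + r.
Proof.
move=> r0; have [m mr] := small_inv r0; exists m => // n /= mn.
rewrite ratr_qgrid grid_up_gt (le_lt_trans (grid_up_le n t))// ltrD2l.
by apply: le_lt_trans mr; rewrite lef_pV2 ?posrE// ler_nat.
Qed.

Lemma right_limit (t : R) : 0 <= t -> exists x : E, forall e, 0 < e -> exists2 r : R, 0 < r &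
  forall q : rat, t < ratr q < t + r -> bdist x (z q) <= e.
Proof.
move=> t0; have : cvg (z (qgrid n t) @[n --> \oo]).
  apply: compact_cauchy_cvg => e e0; have [r r0 hr] := right_cauchy t0 e0.
  exists [set a | exists2 q, t < ratr q < t + r & a = z q].
    by rewrite /nbhs /=; apply: filterS (qgrid_near t r0) => n h; exists (qgrid n t).
  by move=> _ _ [q hq ->] [q' hq' ->]; exact: hr.
move=> /cvg_ex[x xl]; exists x => e e0; have e2 : 0 < e / 2 by rewrite divr_gt0.
have [r r0 hr] := right_cauchy t0 e2; exists r => // q hq.
have n1 : \forall n \near \oo, ball x (e / 2) (z (qgrid n t)).
  by move/cvg_ballP : xl; exact.
near \oo => n.
have /(ball_bdist e2) : ball x (e / 2) (z (qgrid n t)) by near: n; exact: n1.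
have /hr /(_ hq) : t < ratr (qgrid n t) < t + r by near: n; exact: qgrid_near.
have := bdist_triangle x (z (qgrid n t)) (z q).
by move: (bdist _ _) => u; move: (bdist _ _) => v; move: (bdist _ _) => w; lra.
Unshelve. all: end_near. Qed.

(** The extension is the right limit along rationals. Oscillation control makes it cadlag; right
    continuity of z at rationals makes it agree with z there. *)
Lemma cadlag_extension : exists2 y : R -> E, cadlag y & forall q : rat, 0 <= q -> y (ratr q) = z q.
Proof.
have /choice[y0 hy0] : forall t : R, exists x : E, forall e, 0 < e -> exists2 r : R, 0 < r &
    forall q : rat, Num.max 0 t < ratr q < Num.max 0 t + r -> bdist x (z q) <= e.
  by move=> t; apply: right_limit; rewrite le_max lexx.
have hy (t : R) : 0 <= t -> forall e, 0 < e -> exists2 r : R, 0 < r &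
    forall q : rat, t < ratr q < t + r -> bdist (y0 t) (z q) <= e.
  by move=> t0 e e0; have := hy0 t e e0; rewrite (max_idPr t0).
(* A bound at the rationals of an interval passes to the right limits y0 s inside it, at the price
   of a factor 2. *)
have spread (a b e : R) (x : E) : 0 < e -> 0 <= a ->
    (forall q : rat, a < ratr q < b -> bdist x (z q) <= e) ->
    forall s, a < s < b -> bdist x (y0 s) <= e + e.
  move=> e0 a0 h s /andP[sa sb]; have s0 : 0 <= s by rewrite ltW// (le_lt_trans a0).
  have [r r0 hr] := hy s s0 _ e0.
  have p : 0 < Num.min r (b - s) by rewrite lt_min r0 subr_gt0.
  near \oo => n; have /andP[n1 n2] : s < ratr (qgrid n s) < s + Num.min r (b - s).
    by near: n; exact: qgrid_near.
  have [m1 m2] : Num.min r (b - s) <= r /\ Num.min r (b - s) <= b - s.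
    by rewrite !ge_min !lexx orbT.
  have h1 : bdist (y0 s) (z (qgrid n s)) <= e by apply: hr; apply/andP; split; lra.
  have h2 : bdist x (z (qgrid n s)) <= e by apply: h; apply/andP; split; lra.
  have := bdist_triangle x (z (qgrid n s)) (y0 s); rewrite bdist_sym in h1.
  by move: (bdist _ _) h1 => u; move: (bdist _ _) h2 => v; lra.
exists y0.
  split => t t0.
    apply: cvg_bdist => e e0; have e2 : 0 < e / 2 by rewrite divr_gt0.
    have [r r0 hr] := hy t t0 _ e2; rewrite /nbhs /=; near=> s.
    rewrite (splitr e); apply: (spread t (t + r)) => //; apply/andP; split.
      by near: s; exact: nbhs_right_gt.
    by near: s; apply: nbhs_right_lt; rewrite ltrDl.
  apply: compact_cauchy_cvg => e e0; have e4 : 0 < e / 4 by rewrite divr_gt0.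
  have [r r0 hr] := left_cauchy t0 e4.
  pose a := Num.max 0 (t - r).
  have [a0 ar at'] : [/\ 0 <= a, t - r <= a & a < t].
    by rewrite /a !le_max !lexx orbT gt_max t0/= gtrBl r0.
  exists (y0 @` [set s | a < s < t]).
    rewrite /nbhs /=; near=> s; exists s => //=; apply/andP; split.
      by near: s; exact: nbhs_left_gt.
    by near: s; exact: nbhs_left_lt.
  have [q] := rat_in_itvoo at'; rewrite in_itv/= => /andP[aq qt].
  move=> _ _ [s1 h1 <-] [s2 h2 <-].
  have hq s : a < s < t -> bdist (z q) (y0 s) <= e / 4 + e / 4.
    apply: spread => // q' /andP[aq' q't]; apply: hr; rewrite ?qt ?q't ?andbT.
      exact: le_lt_trans aq.
    exact: le_lt_trans aq'.
  have := bdist_triangle (y0 s1) (z q) (y0 s2); rewrite (bdist_sym (y0 s1) (z q)).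
  by have := hq _ h1; have := hq _ h2; move: (bdist _ _) => u; move: (bdist _ _) => v; lra.
move=> q q0; apply: bdist_eq0 => e e0; have e2 : 0 < e / 2 by rewrite divr_gt0.
have [m me] := small_inv e2; have [j hj] := rz m q0.
have rq0 : 0 <= ratr q :> R by rewrite ler0q.
have [r r0 hr] := hy (ratr q) rq0 _ e2.
have j0 : 0 < j.+1%:R^-1 :> R by rewrite invr_gt0.
near \oo => n.
have h1 : bdist (y0 (ratr q)) (z (qgrid n (ratr q))) <= e / 2.
  by apply: hr; near: n; exact: qgrid_near.
have h2 : bdist (z q) (z (qgrid n (ratr q))) <= e / 2.
  apply: (le_trans (hj _ _)); last exact: ltW.
  rewrite -(ltr_rat R) -[X in _ && X](ltr_rat R) rmorphD /= fmorphV /= ratr_nat.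
  by near: n; exact: qgrid_near.
have := bdist_triangle (y0 (ratr q)) (z (qgrid n (ratr q))) (z q); rewrite (bdist_sym (z (qgrid n (ratr q))) (z q)).
by move: (bdist _ _) h1 => u; move: (bdist _ _) h2 => v; lra.
Unshelve. all: end_near. Qed.

End extension.

End compact_metric.

Section measurable_sublevels.
Context {R : realType} {d : measure_display} {T : measurableType d}.

Lemma measurable_le_cst (f : T -> R) (r : R) : measurable_fun setT f ->
  measurable [set x | f x <= r].
Proof.
by move=> mf; rewrite -[X in measurable X]setTI; exact: measurable_fun_le.
Qed.

Lemma measurable_lt_cst (f : T -> R) (r : R) : measurable_fun setT f ->
  measurable [set x | f x < r].
Proof.
move=> mf; rewrite (_ : mkset _ = ~` [set x | r <= f x]).
  by apply: measurableC; rewrite -[X in measurable X]setTI; exact: measurable_fun_le.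
by apply/seteqP; split => x /= h; [apply/negP|]; rewrite -?ltNge// ltNge; apply/negP.
Qed.

Lemma measurable_preimage d' (T' : measurableType d') (f : T -> T') B :
  measurable_fun setT f -> measurable B -> measurable (f @^-1` B).
Proof. by move=> mf mB; rewrite -[X in measurable X]setTI; exact: mf. Qed.

End measurable_sublevels.

(** * Measures from their distribution functions *)

Section quantile_law.
Context {R : realType} {d : measure_display} {T : measurableType d}.
Variable F : rat -> T -> \bar R.
Hypotheses (mF : forall q, measurable_fun setT (F q))
  (F0 : forall q x, q < 0 -> F q x = 0%E).

Lemma measurable_quant_section x :
  measurable_fun setT (fun v : measurableTypeR R => quant F (x, v)).
Proof. exact: (measurableT_comp (measurable_quant mF) (pair1_measurable x)). Qed.

(** The quantile transform for a measure of possibly infinite mass: Lebesgue measure on the levels v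
    >= 0 lying below some F q x is pushed forward by the quantile function. It is a measure for
    every family F, and has distribution function F(., x) whenever some measure does. *)
Definition quant_law (x : T) : {measure set (measurableTypeR R) -> \bar R} :=
  image_measure (mrestr lebesgue_measure (measurable_xsection x (measurable_quant_dom mF)))
    (measurable_quant_section x).

Lemma quant_lawE x A : quant_law x A =
  lebesgue_measure ([set v | A (quant F (x, v))] `&` xsection (quant_dom F) x).
Proof. by []. Qed.

Lemma measurable_quant_law A : measurable A -> measurable_fun setT (quant_law ^~ A).
Proof.
move=> mA; have mD := measurable_quant_dom mF.
have mS : measurable (quant F @^-1` A `&` quant_dom F).
  by apply: measurableI => //; apply: measurable_preimage mA; exact: measurable_quant.
rewrite (_ : (fun x => _) = (fun x => lebesgue_measure (xsection (quant F @^-1` A `&` quant_dom F) x))).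
  exact: (measurable_fun_xsection (lebesgue_measure : {sigma_finite_measure set (measurableTypeR R) -> \bar R})).
apply/funext => x; rewrite quant_lawE; congr lebesgue_measure.
apply/seteqP; split => [v [/= Av /xsectionP vd]|v /xsectionP[/= Av vd]].
  by apply/xsectionP.
by split => //; apply/xsectionP.
Qed.

Lemma lebesgue_co (r : \bar R) : (0 <= r)%E -> (r < +oo)%E ->
  lebesgue_measure [set v : R | 0 <= v /\ (v%:E < r)%E] = r.
Proof.
case: r => [r| |]// r0 _; rewrite (_ : mkset _ = `[0, r[%classic).
  rewrite lebesgue_measure_itv/= lte_fin; case: ltP => h; first by rewrite oppr0 adde0.
  by congr EFin; apply/eqP; rewrite eq_le h andbT.
by apply/seteqP; split => v /=; rewrite in_itv/= lte_fin; [move=> [-> ->]|move/andP].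
Qed.

Lemma quant_law_eq x (mu : {measure set (measurableTypeR R) -> \bar R}) :
  (forall q : rat, mu `]-oo, ratr q]%classic = F q x) -> (forall q, (F q x < +oo)%E) ->
  forall A, measurable A -> quant_law x A = mu A.
Proof.
move=> muF Foo.
have Fge0 q : (0 <= F q x)%E by rewrite -muF measure_ge0.
have Fmono (q r : rat) : q <= r -> (F q x <= F r x)%E.
  move=> qr; rewrite -!muF; apply: le_measure; rewrite ?inE; [exact: measurable_itv..|].
  by move=> v /=; rewrite !in_itv/= => /le_trans; apply; rewrite ler_rat.
have mco q : measurable ([set v : R | 0 <= v /\ (v%:E < F q x)%E] : set (measurableTypeR R)).
  apply: measurableI.
    by rewrite -[X in measurable X]setTI; exact: measurable_fun_le.
  by rewrite -[X in measurable X]setTI; apply: emeasurable_fun_infty_o.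
have mdom r : measurable ([set v : measurableTypeR R | `]-oo, ratr r[%classic (quant F (x, v))] `&` xsection (quant_dom F) x).
  apply: measurableI; last exact: (measurable_xsection x (measurable_quant_dom mF)).
  by rewrite -[X in measurable X]setTI; apply: (measurable_quant_section x) => //; exact: measurable_itv.
apply: measure_eq_of_squeeze.
- by move=> r; rewrite muF.
- move=> r; rewrite muF quant_lawE -[leRHS]lebesgue_co//.
  apply: le_measure; rewrite ?inE; [exact: mdom|exact: mco|].
  move=> v [/= + /xsectionP vd]; rewrite in_itv/= => /(quant_lt F0 _ vd)[q [qr vq]].
  by case: vd => v0 _; split => //; apply: (lt_le_trans vq); rewrite Fmono// -(ler_rat R) ltW.
- move=> q r qr; rewrite muF quant_lawE -[leLHS]lebesgue_co//.
  apply: le_measure; rewrite ?inE; [exact: mco|exact: mdom|].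
  move=> v [/= v0 vq]; have vd : quant_dom F (x, v) by split => //; exists q.
  split; last exact/xsectionP.
  by rewrite /= in_itv/=; apply/(quant_lt F0 _ vd); exists q; rewrite ltr_rat.
Qed.

End quantile_law.

Section strip_coding.
Context {R : realType} {Uc : pseudoPMetricType R}.
Variable sg : cantor_space -> Uc.
Hypotheses (hU : hausdorff_space Uc) (csg : continuous sg) (ssg : forall x, exists c, sg c = x).

Definition strip_bits (p : R * Uc) (i : rat + nat) : bool :=
  match i with inl q => p.1 < ratr q | inr n => lexmin sg p.2 n end.

(** The integer part bounds the time: a point with code at most q has time below q + 1. A locally
    finite measure on the strip thus has a finite distribution function on the line. *)
Definition strip_code (p : R * Uc) : R := (Num.truncn p.1)%:R + codeI (strip_bits p).

Definition strip_decode (r : R) : R * Uc :=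
  (fine (einf_rat [set q | bitI r (inl q : rat + nat)] : \bar R),
   sg (fun n => bitI r (inr n : rat + nat))).

Lemma strip_codeK p : strip_decode (strip_code p) = p.
Proof.
case: p => s u; rewrite /strip_decode /strip_code; congr pair.
  rewrite (_ : mkset _ = [set q | (s%:E < (ratr q : R)%:E)%E]); first by rewrite einf_rat_gt.
  by apply/seteqP; split => q /=; rewrite codeIK lte_fin.
rewrite -[RHS](lexminK hU csg ssg); congr sg.
by apply/funext => n; rewrite codeIK.
Qed.

Lemma measurable_strip_code : measurable_fun setT (strip_code : R * Borel Uc -> R).
Proof.
apply: measurable_funD.
  apply: (measurableT_comp (_ : measurable_fun setT (fun s : R => (Num.truncn s)%:R : R))); last exact: measurable_fst.
  by apply: nondecreasing_measurable => // x y xy; rewrite ler_nat le_truncn.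
apply: measurable_codeI => -[q|n] /=.
  exact: (measurable_lt_cst (ratr q) (measurable_fst : measurable_fun setT (fst : R * Borel Uc -> R))).
exact: (measurable_preimage (measurable_snd : measurable_fun setT (snd : R * Borel Uc -> Borel Uc)) (measurable_lexmin hU csg n)).
Qed.

Lemma measurable_strip_decode :
  measurable_fun setT (strip_decode : measurableTypeR R -> R * Borel Uc).
Proof.
apply/measurable_fun_pairP; split.
  rewrite (_ : _ \o _ = fine \o (fun r : measurableTypeR R => einf_rat [set q | bitI r (inl q : rat + nat)] : \bar R))//.
  apply: measurableT_comp => //; apply: (measurable_einf_rat (A := fun r : measurableTypeR R => [set q | bitI r (inl q : rat + nat)])) => q.
  exact: measurable_bit.
by apply/rvP; apply: rv_cantor => // n; exact: measurable_bit.
Qed.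

Lemma strip_code_ge0 p : 0 <= strip_code p.
Proof. by rewrite addr_ge0// code_ge0. Qed.

Lemma strip_code_lt p : p.1 < strip_code p + 1.
Proof.
rewrite /strip_code; have := truncnS_gt p.1; have := code_ge0 (R := R); rewrite -natr1 => h.
have := h (fun n : nat => oapp (strip_bits p) false (unpickle n)).
by rewrite /codeI; set u := code _; clearbody u; lra.
Qed.

End strip_coding.

Section measure_codes.
Context {R : realType} {Uc : pseudoPMetricType R}.
Local Notation LM := (@LMeas R Uc).
Variable sg : cantor_space -> Uc.
Hypotheses (hU : hausdorff_space Uc) (csg : continuous sg) (ssg : forall x, exists c, sg c = x).
Local Notation phi := (strip_code sg).
Local Notation psi := (strip_decode sg).

Definition code_cdf (m : LM) (q : rat) : \bar R := m [set p | 0 <= p.1 /\ phi p <= ratr q].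

Lemma code_cdf_lt0 m q : q < 0 -> code_cdf m q = 0%E.
Proof.
move=> q0; rewrite /code_cdf (_ : mkset _ = set0) ?measure0//; apply/seteqP; split => // p [_].
by move=> /(le_trans (strip_code_ge0 _ _)); rewrite ler0q leNgt q0.
Qed.

Lemma measurable_code_set q :
  measurable ([set p | 0 <= p.1 /\ phi p <= ratr q] : set (R * Borel Uc)).
Proof.
apply: measurableI; first exact: measurable_ge0T.
exact: (measurable_le_cst _ (measurable_strip_code hU csg)).
Qed.

Lemma code_set_sub q : [set p | 0 <= p.1 /\ phi p <= ratr q] `<=`
  I0 (Num.max 0 (ratr q + 1)) `*` (setT : set (Borel Uc)).
Proof.
move=> p [p0 pq]; split => //; rewrite /I0 /= in_itv/= p0 le_max; apply/orP; right.
by rewrite ltW// (lt_le_trans (strip_code_lt sg p))// lerD2r.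
Qed.

Lemma code_cdf_lty m q : in_LU m -> (code_cdf m q < +oo)%E.
Proof.
move=> [_ moo]; apply: le_lt_trans (moo (Num.max 0 (ratr q + 1)) _); last by rewrite le_max lexx.
apply: le_measure; rewrite ?inE; [exact: measurable_code_set|exact: measurable_I0T|].
exact: code_set_sub.
Qed.

Lemma measurable_code_cdf d (Om : measurableType d) (L : Om -> LM) q :
  (forall w, in_LU (L w)) ->
  (forall s C, 0 <= s -> measurable C -> measurable_fun setT (fun w => L w (I0 s `*` C))) ->
  measurable_fun setT (fun w => code_cdf (L w) q).
Proof.
move=> LU mL; rewrite (_ : (fun w => _) = (fun w =>
    L w ([set p | 0 <= p.1 /\ phi p <= ratr q] `&` (I0 (Num.max 0 (ratr q + 1)) `*` setT)))).
  apply: measurable_occupation; last exact: measurable_code_set.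
    by move=> w; have [_] := LU w; apply; rewrite le_max lexx.
  by move=> s C /andP[s0 _]; exact: mL.
by apply/funext => w; rewrite (setIidl (@code_set_sub q)).
Qed.

Section decode.
Context {d : measure_display} {T : measurableType d}.
Variable F : rat -> T -> \bar R.
Hypotheses (mF : forall q, measurable_fun setT (F q)) (F0 : forall q x, q < 0 -> F q x = 0%E).

Definition decode_measure (x : T) : LM :=
  image_measure (quant_law mF x) (measurable_strip_decode csg).

Lemma measurable_decode_measure A : measurable A -> measurable_fun setT (decode_measure ^~ A).
Proof.
move=> mA; apply: measurable_quant_law.
by rewrite -[X in measurable X]setTI; exact: (measurable_strip_decode csg).
Qed.

(** [strip_code] carries m to the line, where its distribution function identifies it as
    [quant_law]; [strip_decode] carries it back. *)
Lemma decode_measureE x (m : LM) : in_LU m -> (forall q, F q x = code_cdf m q) ->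
  forall A, measurable A -> decode_measure x A = m A.
Proof.
move=> mLU Fm A mA.
pose m2 := image_measure (mrestr m measurable_ge0T)
  (measurable_strip_code hU csg : measurable_fun setT (phi : R * Borel Uc -> measurableTypeR R)).
have mge0 := @measurable_ge0T R Uc.
have m0 : m (A `\` [set p : R * Borel Uc | 0 <= p.1]) = 0%E.
  apply/eqP; rewrite -measure_le0; have [<- _] := mLU; apply: le_measure; rewrite ?inE.
  - exact: measurableD.
  - exact: (measurable_lt_cst 0 (measurable_fst : measurable_fun setT (fst : R * Borel Uc -> R))).
  - by move=> p [_ /= /negP]; rewrite -ltNge.
rewrite /decode_measure image_measureE (@quant_law_eq _ _ _ _ mF F0 x m2).
- rewrite /m2 image_measureE /= /mrestr.
  transitivity (m (A `&` [set p : R * Borel Uc | 0 <= p.1])).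
    by congr (m (_ `&` _)); apply/seteqP; split => p /=; rewrite strip_codeK.
  rewrite -[in RHS](setUIDK A [set p : R * Borel Uc | 0 <= p.1]) measureU//.
  + by rewrite -[LHS]adde0; congr (_ + _)%E; exact/esym.
  + exact: measurableI.
  + exact: measurableD.
  + by rewrite -subset0 => p [[_ h] [_ nh]].
- move=> q; rewrite /m2 image_measureE /= /mrestr Fm /code_cdf; congr (m _).
  by apply/seteqP; split => p /=; rewrite in_itv/= => -[].
- by move=> q; rewrite Fm; exact: code_cdf_lty.
- exact: (measurable_preimage (measurable_strip_decode csg)).
Qed.

End decode.
End measure_codes.

Section lipschitz_on_rationals.
Context {R : realType} {Uc : pseudoPMetricType R}.
Local Notation LM := (@LMeas R Uc).

(** The mass of [0, a] is right continuous in a by continuity from above, so real endpoints are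
    approached by larger rational ones. The rational form is needed because it is a countable
    condition. *)
Lemma lipschitz_of_rat (m : LM) : m (I0 0 `*` setT) = 0%E ->
  (forall p q : rat, 0 <= p <= q ->
     (m (I0 (ratr q) `*` setT) <= m (I0 (ratr p) `*` setT) + (ratr q - ratr p)%:E)%E) ->
  forall s t : R, 0 <= s <= t -> (m (I0 t `*` setT) <= m (I0 s `*` setT) + (t - s)%:E)%E.
Proof.
move=> m0 mL.
have subI (a b : R) : a <= b -> I0 a `*` setT `<=` (I0 b `*` setT : set (R * Borel Uc)).
  by move=> ab [r u] [/= + _]; rewrite /I0 /= !in_itv/= => /andP[r0 ra]; rewrite r0 (le_trans ra).
have mono (a b : R) : a <= b -> (m (I0 a `*` setT) <= m (I0 b `*` setT))%E.
  by move=> ab; apply: le_measure; rewrite ?inE; [exact: measurable_I0T..|exact: subI].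
have fin (a : R) : m (I0 a `*` setT) \is a fin_num.
  rewrite ge0_fin_numE ?measure_ge0//.
  pose q : rat := (Num.truncn a).+1%:R.
  apply: (@le_lt_trans _ _ (m (I0 (ratr q) `*` setT))).
    by apply: mono; rewrite /q ratr_nat ltW// truncnS_gt.
  by have := mL 0 q; rewrite lexx ler0n rmorph0 m0 add0e => /(_ isT)/le_lt_trans; apply; exact: ltry.
pose g (a : R) := fine (m (I0 a `*` setT)).
have gE a : m (I0 a `*` setT) = (g a)%:E by rewrite fineK.
have gmono a b : a <= b -> g a <= g b by move=> /mono; rewrite !gE lee_fin.
have gL (p q : rat) : 0 <= p <= q -> g (ratr q) <= g (ratr p) + (ratr q - ratr p).
  by move=> /mL; rewrite !gE -EFinD lee_fin.
have gr (s e : R) : 0 <= s -> 0 < e -> exists q : rat, [/\ s < ratr q, ratr q < s + e & g (ratr q) <= g s + e].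
  move=> s0 e0.
  pose F n : set (R * Borel Uc) := I0 (s + n.+1%:R^-1) `*` setT.
  have capF : \bigcap_n F n = I0 s `*` setT.
    apply/seteqP; split => [[r u] h|[r u] [/= h _] n _]; last first.
      by split => //; move: h; rewrite /I0 /= !in_itv/= => /andP[-> /le_trans]; apply; rewrite lerDl.
    split => //; rewrite /I0 /= in_itv/=.
    have [/= + _] := h 0%N I; rewrite /I0 /= in_itv/= => /andP[-> _] /=.
    apply/ler_addgt0Pr => e' e'0; have [k ke] := small_inv e'0.
    have [/= + _] := h k I; rewrite /I0 /= in_itv/= => /andP[_ /le_trans]; apply.
    by rewrite lerD2l ltW.
  have cF : g (s + n.+1%:R^-1) @[n --> \oo] --> g s.
    apply: (@fine_cvg _ _ _ _ (fun n => m (F n)) (g s)).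
    rewrite -gE -capF; apply: nonincreasing_cvg_mu.
    - by rewrite ltey_eq fin.
    - by move=> k; exact: measurable_I0T.
    - by rewrite capF; exact: measurable_I0T.
    - move=> a b ab; apply/subsetPset/subI; rewrite lerD2l lef_pV2 ?posrE// ler_nat//.
  near \oo => n.
  have gn : g (s + n.+1%:R^-1) < g s + e.
    by near: n; apply: (cvgr_lt (g s)); [exact: cF|rewrite ltrDl].
  have ne : n.+1%:R^-1 < e.
    by near: n; apply: (cvgr_lt 0); [exact: cvg_invS|].
  have n0 : 0 < n.+1%:R^-1 :> R by rewrite invr_gt0.
  have [|q] := @rat_in_itvoo R s (s + n.+1%:R^-1); first by rewrite ltrDl.
  rewrite in_itv/= => /andP[sq qs]; exists q; split => //; first by rewrite (lt_trans qs)// ltrD2l.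
  by rewrite (le_trans (gmono _ _ (ltW qs)))// ltW.
move=> s t /andP[s0 st]; rewrite !gE -EFinD lee_fin; apply/ler_addgt0Pr => e e0.
have e2 : 0 < e / 2 by rewrite divr_gt0.
have [p [sp ps gp]] := gr s (e / 2) s0 e2.
have [pt|tp] := leP (ratr p) t; last first.
  by apply: (le_trans (gmono _ _ (ltW tp))); lra.
have [q [tq qt gq]] := gr t (e / 2) (le_trans s0 st) e2.
apply: (le_trans (gmono _ _ (ltW tq))).
have p0 : 0 <= p by rewrite -(ler0q R) ltW// (le_lt_trans s0).
have pq : p <= q by rewrite -(ler_rat R) (le_trans pt)// ltW.
by have := gL p q; rewrite p0 pq => /(_ isT); lra.
Unshelve. all: end_near. Qed.

End lipschitz_on_rationals.

Lemma cvg_qgrid {R : realType} (t : R) : ratr (qgrid n t) @[n --> \oo] --> t.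
Proof.
apply: (@squeeze_cvgr _ _ _ _ (fun=> t) (fun n => t + n.+1%:R^-1)).
- by apply: nearW => n; rewrite ratr_qgrid grid_up_le ltW ?grid_up_gt.
- exact: cvg_cst.
- by rewrite -[X in _ --> X]addr0; apply: cvgD; [exact: cvg_cst|exact: cvg_invS].
Qed.

Lemma cadlag_eq_rat {R : realType} {E : pseudoPMetricType R} (y y' : R -> E) :
  hausdorff_space E -> cadlag y -> cadlag y' ->
  (forall q : rat, 0 <= q -> y (ratr q) = y' (ratr q)) ->
  forall t, 0 <= t -> y t = y' t.
Proof.
move=> hE cy cy' yq t t0.
have gt n : t <= ratr (qgrid n t) by rewrite ratr_qgrid ltW// grid_up_gt.
have gc := @cvg_qgrid R t.
have c1 := cadlag_cvg_right cy t0 gt gc.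
have c2 := cadlag_cvg_right cy' t0 gt gc.
apply: (cvg_unique hE c1); apply: cvg_trans c2; apply: near_eq_cvg; apply: nearW => n.
by rewrite yq// qgrid_ge0.
Qed.

Section process_coding.
Context {R : realType} {E Uc : pseudoPMetricType R}.
Hypotheses (hE : hausdorff_space E) (cE : compact [set: E]).
Hypotheses (hU : hausdorff_space Uc) (cU : compact [set: Uc]).
Variables (Xi : set (E * Uc)) (cXi : closed Xi).
Local Notation LM := (@LMeas R Uc).
Variables (sE : cantor_space -> E) (sU : cantor_space -> Uc).
Hypotheses (csE : continuous sE) (ssE : forall x, exists c, sE c = x).
Hypotheses (csU : continuous sU) (ssU : forall x, exists c, sU c = x).

Let I : countType := ((rat * nat) + (rat * rat))%type.

(** Negative rationals are read as time 0, the path being constrained only on nonnegative times. The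
    control is stored through its distribution function under [strip_code], each value as the set of
    rationals above it. *)
Definition pair_bits (y : R -> E) (m : LM) (i : I) : bool :=
  match i with
  | inl (q, n) => lexmin sE (y (ratr (Num.max 0 q))) n
  | inr (q, p) => (code_cdf sU m q < (ratr p : R)%:E)%E
  end.

Definition pair_code (y : R -> E) (m : LM) : R := codeI (pair_bits y m).

Lemma measurable_pair_code d (Om : measurableType d) (Y : Om -> R -> E) (L : Om -> LM) :
  (forall t, 0 <= t -> rv (Y ^~ t)) -> (forall w, in_LU (L w)) ->
  (forall s C, 0 <= s -> measurable C -> measurable_fun setT (fun w => L w (I0 s `*` C))) ->
  measurable_fun setT (fun w => pair_code (Y w) (L w)).
Proof.
move=> rY LU mL; apply: measurable_codeI => -[[q n]|[q p]] /=.
  have /rvP mY : rv (Y ^~ (ratr (Num.max 0 q) : R)) by apply: rY; rewrite ler0q le_max lexx.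
  exact: (measurable_preimage mY (measurable_lexmin hE csE n)).
rewrite -[X in measurable X]setTI; apply: emeasurable_fun_infty_o => //.
exact: (measurable_code_cdf hU csU).
Qed.

Definition dec_val (r : R) (q : rat) : E := sE (fun n => bitI r (inl (q, n) : I)).

(** The value at negative q is imposed, because the quantile construction needs it for every real r
    and not only for genuine codes. *)
Definition dec_cdf (q : rat) (r : R) : \bar R :=
  if q < 0 then 0%E else einf_rat [set p | bitI r (inr (q, p) : I)].

Lemma dec_valK y m q : 0 <= q -> dec_val (pair_code y m) q = y (ratr q).
Proof.
move=> q0; rewrite -[RHS](lexminK hE csE ssE) /dec_val; congr sE; apply/funext => n.
by rewrite -[pair_code _ _]add0r (codeIK 0) /= (max_idPr q0).
Qed.

Lemma dec_cdfK y m q : dec_cdf q (pair_code y m) = code_cdf sU m q.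
Proof.
rewrite /dec_cdf; case: ltP => q0; first by rewrite code_cdf_lt0.
rewrite -[RHS]einf_rat_gt; congr einf_rat; apply/seteqP; split => p /=;
  by rewrite -[pair_code _ _]add0r (codeIK 0).
Qed.

Lemma rv_dec_val q : rv (fun r : measurableTypeR R => dec_val r q).
Proof. by apply: rv_cantor => // n; exact: measurable_bit. Qed.

Lemma measurable_dec_cdf q : measurable_fun setT (dec_cdf q : measurableTypeR R -> \bar R).
Proof.
rewrite /dec_cdf; case: (q < 0); first exact: measurable_cst.
apply: (measurable_einf_rat (A := fun r : measurableTypeR R => [set p | bitI r (inr (q, p) : I)])) => p.
exact: measurable_bit.
Qed.

Definition dec_regular : set (measurableTypeR R) :=
  [set r | oscillation_small (dec_val r) /\ right_continuous_rat (dec_val r)].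

Lemma measurable_dec_dist q q' e :
  measurable [set r : measurableTypeR R | bdist (dec_val r q) (dec_val r q') <= e].
Proof.
apply: measurable_le_cst.
have := rv_pair hE cE hE cE (rv_dec_val q) (rv_dec_val q').
by move/rv_continuousP => /(_ _ (@bdist_continuous _ _)).
Qed.

Lemma measurable_dec_regular : measurable dec_regular.
Proof.
apply: measurableI.
  apply: measurable_forall => m; apply: measurable_forall => N; apply: measurable_exists => j.
  apply: measurable_forall => i; do 4 apply: measurable_forall => ?.
  by apply: measurable_imply; apply: measurableU; exact: measurable_dec_dist.
apply: measurable_forall => q; apply: measurable_forall => m; apply: measurable_imply.
apply: measurable_exists => j; apply: measurable_forall => r; apply: measurable_imply.
exact: measurable_dec_dist.
Qed.

Definition dec_path (r : measurableTypeR R) : R -> E :=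
  match pselect (dec_regular r) with
  | left h => sval (cid2 (cadlag_extension hE cE (proj1 h) (proj2 h)))
  | right _ => fun=> point
  end.

Lemma cadlag_dec_path r : cadlag (dec_path r).
Proof.
rewrite /dec_path; case: pselect => [h|_]; first by case: cid2.
by split => t _; [exact: cvg_cst|apply/cvg_ex; exists point; exact: cvg_cst].
Qed.

Lemma dec_path_rat r q : dec_regular r -> 0 <= q -> dec_path r (ratr q) = dec_val r q.
Proof.
by move=> h q0; rewrite /dec_path; case: pselect => // h'; case: cid2 => y _ /= ->.
Qed.

(** The extension comes from a choice, but right continuity determines it: it is the limit of
    decoded values at rationals to the right, and these are measurable. *)
Lemma rv_dec_path t : 0 <= t -> rv (fun r => dec_path r t).
Proof.
move=> t0; apply: (rv_cvg (X_ := fun n r => if r \in dec_regular then dec_val r (qgrid n t) else point)).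
  move=> n; apply: rv_if; [exact: measurable_dec_regular|exact: rv_dec_val|exact: rv_const].
move=> r; have gt n : t <= ratr (qgrid n t) by rewrite ratr_qgrid ltW// grid_up_gt.
have [h|h] := pselect (dec_regular r); last first.
  rewrite /dec_path; case: pselect => // _; apply: cvg_near_cst; apply: nearW => n.
  by rewrite memNset.
have := cadlag_cvg_right (cadlag_dec_path r) t0 gt (@cvg_qgrid R t).
apply: cvg_trans; apply: near_eq_cvg; apply: nearW => n.
by rewrite dec_path_rat ?qgrid_ge0// mem_set.
Qed.

Lemma dec_regular_code y m : cadlag y -> dec_regular (pair_code y m).
Proof.
move=> cy; split => [k N|q k q0].
  have [j hj] := cadlag_oscillation cy k N; exists j => i q1 q2 q3 q4 h.
  have q10 : 0 <= q1 by case/and5P: h => _ + _ _ _; apply: le_trans; rewrite divr_ge0.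
  case/and5P : (h) => _ _ q12 q23 /andP[q34 _].
  have q20 := le_trans q10 (ltW q12); have q30 := le_trans q20 q23.
  by rewrite !dec_valK ?(le_trans q30 (ltW q34))//; exact: (hj i).
have [j hj] := cadlag_right_continuous_rat cy k q0; exists j => r /andP[qr rj].
by rewrite !dec_valK ?(le_trans q0 (ltW qr))//; apply: hj; rewrite qr.
Qed.

Lemma dec_pathK y m t : cadlag y -> 0 <= t -> dec_path (pair_code y m) t = y t.
Proof.
move=> cy; apply: cadlag_eq_rat => //; first exact: cadlag_dec_path.
by move=> q q0; rewrite dec_path_rat ?dec_valK//; exact: dec_regular_code.
Qed.

Definition dec_measure : measurableTypeR R -> LM := decode_measure csU measurable_dec_cdf.

Lemma measurable_dec_measure A : measurable A -> measurable_fun setT (dec_measure ^~ A).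
Proof. exact: measurable_decode_measure. Qed.

Lemma dec_measureK y m A : in_LU m -> measurable A -> dec_measure (pair_code y m) A = m A.
Proof.
move=> mLU mA.
have F0 (q : rat) (r : measurableTypeR R) : q < 0 -> dec_cdf q r = 0%E.
  by move=> q0; rewrite /dec_cdf q0.
apply: (decode_measureE hU csU ssU measurable_dec_cdf F0 mLU _ mA) => q.
by rewrite dec_cdfK.
Qed.

(** Correction of decoded controls in stages: outside the measurable set where a required property
    holds, the control becomes the zero measure, which is admissible along any cadlag path. *)
Definition keep_on (B : set (measurableTypeR R)) (L : measurableTypeR R -> LM) r : LM :=
  if r \in B then L r else mzero.

Lemma measurable_keep_on B (L : measurableTypeR R -> LM) A : measurable B -> measurable_fun setT (L ^~ A) ->
  measurable_fun setT (keep_on B L ^~ A).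
Proof.
move=> mB mL; rewrite (_ : (fun r => _) = fun r => if r \in B then L r A else 0%E); last first.
  by apply/funext => r; rewrite /keep_on; case: ifP.
apply: measurable_fun_if => //.
- by apply: (measurable_fun_bool true); rewrite setTI (_ : _ @^-1` _ = B)//; apply/seteqP; split => r; rewrite /preimage/=; [move/set_mem|move/mem_set].
- exact: measurable_funTS.
Qed.

Definition dec_lipschitz : set (measurableTypeR R) :=
  [set r | [/\ dec_measure r [set p | p.1 < 0] = 0%E, dec_measure r (I0 0 `*` setT) = 0%E &
    forall p q : rat, 0 <= p <= q ->
     (dec_measure r (I0 (ratr q) `*` setT) <=
      dec_measure r (I0 (ratr p) `*` setT) + (ratr q - ratr p)%:E)%E]].

Lemma measurable_eq0 d (T : measurableType d) (f : T -> \bar R) : measurable_fun setT f ->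
  measurable [set r | f r = 0%E].
Proof. by move=> mf; exact: (measurable_preimage mf (emeasurable_set1 0%E)). Qed.

Lemma measurable_lt0T : measurable ([set p | p.1 < 0] : set (R * Borel Uc)).
Proof. exact: (measurable_lt_cst 0 (measurable_fst : measurable_fun setT (fst : R * Borel Uc -> R))). Qed.

Lemma measurable_dec_lipschitz : measurable dec_lipschitz.
Proof.
rewrite (_ : dec_lipschitz = [set r | dec_measure r [set p | p.1 < 0] = 0%E] `&`
   [set r | dec_measure r (I0 0 `*` setT) = 0%E] `&` [set r | forall p q : rat, 0 <= p <= q ->
     (dec_measure r (I0 (ratr q) `*` setT) <=
      dec_measure r (I0 (ratr p) `*` setT) + (ratr q - ratr p)%:E)%E]); last first.
  by apply/seteqP; split => r [] => [a b c|[a b] c].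
apply: measurableI; first apply: measurableI.
- by apply: measurable_eq0; apply: measurable_dec_measure; exact: measurable_lt0T.
- by apply: measurable_eq0; apply: measurable_dec_measure; exact: measurable_I0T.
apply: measurable_forall => p; apply: measurable_forall => q; apply: measurable_imply.
rewrite -[X in measurable X]setTI; apply: measurable_lee => //.
  by apply: measurable_dec_measure; exact: measurable_I0T.
by apply: emeasurable_funD => //; apply: measurable_dec_measure; exact: measurable_I0T.
Qed.

Definition dec_control1 := keep_on dec_lipschitz dec_measure.

Lemma measurable_dec_control1 A : measurable A -> measurable_fun setT (dec_control1 ^~ A).
Proof.
by move=> mA; apply: measurable_keep_on; [exact: measurable_dec_lipschitz|exact: measurable_dec_measure].
Qed.

Lemma dec_control1_neg r : dec_control1 r [set p | p.1 < 0] = 0%E.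
Proof. by rewrite /dec_control1 /keep_on; case: ifPn => //; rewrite inE => -[]. Qed.

Lemma dec_control1_0 r : dec_control1 r (I0 0 `*` setT) = 0%E.
Proof. by rewrite /dec_control1 /keep_on; case: ifPn => //; rewrite inE => -[]. Qed.

Lemma dec_control1_lip r (s t : R) : 0 <= s <= t ->
  (dec_control1 r (I0 t `*` setT) <= dec_control1 r (I0 s `*` setT) + (t - s)%:E)%E.
Proof.
move=> st; rewrite /dec_control1 /keep_on; case: ifPn => [|_].
  by rewrite inE => -[_ m0 mL]; exact: lipschitz_of_rat.
by rewrite /= /mzero add0e lee_fin subr_ge0; case/andP : st.
Qed.

Lemma dec_control1_le r (t : R) : 0 <= t -> (dec_control1 r (I0 t `*` setT) <= t%:E)%E.
Proof.
by move=> t0; have := @dec_control1_lip r 0 t; rewrite dec_control1_0 lexx t0 add0e subr0; exact.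
Qed.

Lemma measurable_off_to (y : R -> E) (N : nat) : cadlag y ->
  measurable [set p : R * Borel Uc | ~ Xi (y (clamp N%:R p.1), p.2)].
Proof.
move=> cy; have N0 : 0 <= N%:R :> R by [].
have := @rv_joint_path R E Uc hE cE hU cU y N%:R cy N0 (~` Xi).
by apply; exact: closed_openC.
Qed.

Lemma off_Xi_null (y : R -> E) (m : LM) : cadlag y ->
  (forall N : nat, m ([set p | ~ Xi (y (clamp N%:R p.1), p.2)] `&` (I0 N%:R `*` setT)) = 0%E) ->
  m (off_Xi Xi y) = 0%E.
Proof.
move=> cy m0; have mX : measurable (off_Xi Xi y) by exact: measurable_off_Xi.
apply/(negligibleP m mX).
apply: negligibleS (_ : negligible m (\bigcup_N
    ([set p | ~ Xi (y (clamp N%:R p.1), p.2)] `&` (I0 N%:R `*` setT)))).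
  move=> [r u] [/= r0 nX]; exists (Num.truncn r).+1 => //.
  have rN : r <= (Num.truncn r).+1%:R by rewrite ltW// truncnS_gt.
  by split; [rewrite /= clamp_id// r0|split => //; rewrite /I0 /= in_itv/= r0].
apply: negligible_bigcup => N; apply/negligibleP; last exact: m0.
by apply: measurableI; [exact: measurable_off_to|exact: measurable_I0T].
Qed.

Let off_to (N : nat) (r : measurableTypeR R) : set (R * Borel Uc) :=
  [set p | ~ Xi (dec_path r (clamp N%:R p.1), p.2)].

Definition dec_on_Xi : set (measurableTypeR R) :=
  [set r | forall N : nat, dec_control1 r (off_to N r `&` (I0 N%:R `*` setT)) = 0%E].

Lemma measurable_dec_on_Xi : measurable dec_on_Xi.
Proof.
apply: measurable_forall => N; apply: measurable_eq0.
have N0 : 0 <= N%:R :> R by [].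
pose S : set (measurableTypeR R * (R * Borel Uc)) := [set q | ~ Xi (dec_path q.1 (clamp N%:R q.2.1), q.2.2)].
have mS : measurable S.
  have := @rv_joint _ _ _ hE cE hU cU _ (measurableTypeR R) dec_path N%:R cadlag_dec_path N0.
  move=> /(_ (fun s s0 => rv_dec_path (proj1 (andP s0)))) h.
  by apply: (h (~` Xi)); exact: closed_openC.
have := @measurable_random_section _ _ _ _ _ dec_control1 (I0 N%:R `*` setT) N%:R (measurable_I0T N%:R).
move=> /(_ _ _ S mS); rewrite (_ : (fun w => _) = (fun r => dec_control1 r (off_to N r `&` (I0 N%:R `*` setT)))); last first.
  apply/funext => r; congr (dec_control1 r (_ `&` _)); apply/seteqP; split => p.
    by move/xsectionP.
  by move=> ?; apply/xsectionP.
apply.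
  by move=> A mA; apply: measurable_dec_control1; apply: measurableI => //; exact: measurable_I0T.
by move=> r; exact: dec_control1_le.
Qed.

Definition dec_control := keep_on dec_on_Xi dec_control1.

Lemma measurable_dec_control A : measurable A -> measurable_fun setT (dec_control ^~ A).
Proof.
by move=> mA; apply: measurable_keep_on; [exact: measurable_dec_on_Xi|exact: measurable_dec_control1].
Qed.

Lemma admissible_dec r : admissible Xi (dec_path r) (dec_control r).
Proof.
have cr := cadlag_dec_path r.
rewrite /dec_control /keep_on; case: ifPn => [|_]; last first.
  split => //= s t /andP[s0 st]; by rewrite /mzero add0e lee_fin subr_ge0.
rewrite inE => on; split => //; [exact: dec_control1_neg|exact: dec_control1_0|by move=> s t; exact: dec_control1_lip|].
exact: off_Xi_null.
Qed.

(** The code of an admissible pair lies in both correction sets, so neither correction alters the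
    control. *)
Lemma dec_controlK y m A : admissible Xi y m -> measurable A ->
  dec_control (pair_code y m) A = m A.
Proof.
move=> ym mA; have mLU := admissible_in_LU ym; have [cy m0 m00 mL mX] := ym.
have lip : dec_lipschitz (pair_code y m).
  split; rewrite ?dec_measureK//; [exact: measurable_lt0T|exact: measurable_I0T|].
  move=> p q /andP[p0 pq]; rewrite !dec_measureK//; [|exact: measurable_I0T..].
  by apply: mL; rewrite ler0q p0 ler_rat.
have e1 B : measurable B -> dec_control1 (pair_code y m) B = m B.
  by move=> mB; rewrite /dec_control1 /keep_on mem_set// dec_measureK.
rewrite /dec_control /keep_on mem_set ?e1//.
move=> N; have mO := @measurable_off_to _ N (cadlag_dec_path (pair_code y m)).
rewrite e1; last by apply: measurableI => //; exact: measurable_I0T.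
apply/eqP; rewrite -measure_le0 -mX; apply: le_measure; rewrite ?inE.
- by apply: measurableI => //; exact: measurable_I0T.
- exact: measurable_off_Xi.
move=> [r u] [/= nX [/= + _]]; rewrite /I0 /= in_itv/= => rN.
by move: nX; rewrite /off_to /= dec_pathK ?clamp_ge0// clamp_id//; split => //; case/andP : rN.
Qed.

End process_coding.

(** * Standard form of a solution *)

(** Good sets principle for traces: matching the generators on [G] matches the generated
    sigma-algebra. It transports events of a filtration to another space up to a null set, or on the
    part of the space where two processes agree. *)
Lemma sigma_trace (Om X Om2 : Type) (gen : set (set X)) (c : Om -> X) (q : Om -> Om2)
    (G : set Om) (S : set (set Om2)) : sigma_algebra setT S ->
  (forall A, gen A -> exists2 B, S B & c @^-1` A `&` G = q @^-1` B `&` G) ->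
  forall A, <<s gen >> A -> exists2 B, S B & c @^-1` A `&` G = q @^-1` B `&` G.
Proof.
move=> [S0 SC SU] h; apply: smallest_sub => //; split.
- by exists set0 => //; rewrite !preimage_set0.
- move=> A [B SB AB]; exists (setT `\` B); first exact: SC.
  rewrite !setTD; apply/seteqP; split => w [/= nA Gw]; split => //= x.
    by have : (q @^-1` B `&` G) w by []; rewrite -AB => -[].
  by have : (c @^-1` A `&` G) w by []; rewrite AB => -[].
- move=> F /(_ _)/cid2-/all_sig2[B SB FB]; exists (\bigcup_k B k); first exact: SU.
  apply/seteqP; split => w [[k _ /= Fk] Gw]; split => //; exists k => //=.
    by have : (c @^-1` F k `&` G) w by []; rewrite FB => -[].
  by have : (q @^-1` B k `&` G) w by []; rewrite -FB => -[].
Qed.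

Lemma nat_filtration_measurable {R : realType} {E Uc : pseudoPMetricType R} d
    (Om : measurableType d) (Y : Om -> R -> E) (l0 : Om -> R -> R) (L : Om -> @LMeas R Uc) t :
  (forall s, 0 <= s <= t -> rv (Y ^~ s)) -> (forall s, 0 <= s <= t -> rv (l0 ^~ s)) ->
  (forall s C, 0 <= s <= t -> measurable C -> measurable_fun setT (fun w => L w (I0 s `*` C))) ->
  nat_filtration Y l0 L t `<=` measurable.
Proof.
move=> rY rl mL; apply: smallest_sub; first exact: sigma_algebra_measurable.
move=> A [s [st [[V [oV ->]]|[[V [oV ->]]|[C [V [mC [oV ->]]]]]]]].
- exact: rY.
- exact: rl.
- by apply: (measurable_preimage (mL s C st mC)); exact: ereal_open_measurable.
Qed.

Lemma exit_time_ge0 {R : realType} {E : pseudoPMetricType R} (U : set E) (y : R -> E) :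
  (0 <= exit_time U y)%E.
Proof. by apply: le_ereal_inf_tmp => _ [t [t0 _] <-]; rewrite lee_fin. Qed.

Lemma exit_timeT {R : realType} {E : pseudoPMetricType R} (y : R -> E) :
  exit_time setT y = +oo%E.
Proof.
rewrite /exit_time (_ : [set _ | _ in _] = set0) ?ereal_inf0//.
by rewrite -subset0 => x [t [_ h] _]; case: h; apply.
Qed.

Section full_measure_sets.
Context {R : realType} {d : measure_display} {T : measurableType d}.
Variable mu : {measure set T -> \bar R}.

Lemma ae_full_set (Q : T -> Prop) : {ae mu, forall w, Q w} ->
  exists G, [/\ measurable G, mu (~` G) = 0%E & forall w, G w -> Q w].
Proof.
move=> [N [mN N0 QN]]; exists (~` N); split; [exact: measurableC|by rewrite setCK|].
by move=> w Nw; apply: contrapT => nQ; apply: Nw; exact: QN.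
Qed.

Lemma full_set_ae (G : set T) (Q : T -> Prop) : measurable G -> mu (~` G) = 0%E ->
  (forall w, G w -> Q w) -> {ae mu, forall w, Q w}.
Proof.
move=> mG G0 GQ; exists (~` G); split => //; first exact: measurableC.
by move=> w nQ Gw; apply: nQ; exact: GQ.
Qed.

Lemma full_setI (G H : set T) : measurable G -> measurable H -> mu (~` G) = 0%E ->
  mu (~` H) = 0%E -> mu (~` (G `&` H)) = 0%E.
Proof.
move=> mG mH G0 H0; have mGC := measurableC mG; have mHC := measurableC mH.
by rewrite setCI; apply: (null_set_setU mGC mHC).
Qed.

Lemma eq_integral_trace (G A B : set T) (f g : T -> \bar R) : measurable G ->
  mu (~` G) = 0%E -> A `&` G = B `&` G -> (forall w, A w -> G w -> f w = g w) ->
  (\int[mu]_(w in A) f w = \int[mu]_(w in B) g w)%E.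
Proof.
move=> mG G0 AB fg; rewrite integral_mkcond [RHS]integral_mkcond.
apply: (eq_integral_null (N := ~` G)) => //; first exact: measurableC.
move=> w _ /contrapT Gw; rewrite !patchE.
have e : (w \in A) = (w \in B).
  apply/idP/idP; rewrite !inE => h.
    by have : (A `&` G) w by []; rewrite AB => -[].
  by have : (B `&` G) w by []; rewrite -AB => -[].
by rewrite -e; case: ifPn => //; rewrite inE => Aw; exact: fg.
Qed.

End full_measure_sets.

(** * Clock and support conditions along one path *)

Section pathwise.
Context {R : realType} {E Uc : pseudoPMetricType R}.
Hypotheses (hE : hausdorff_space E) (cE : compact [set: E]).
Hypotheses (hU : hausdorff_space Uc) (cU : compact [set: Uc]).
Variables (E0 : set E) (Xi : set (E * Uc)) (cXi : closed Xi).
Local Notation LM := (@LMeas R Uc).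

Section clock.
Variables (y : R -> E) (F : R -> R) (m : LM) (th : \bar R).
Hypotheses (cy : cadlag y) (th0 : (0 <= th)%E) (mLU : in_LU m).
Hypotheses (F0 : forall t, 0 <= t -> 0 <= F t)
  (Fmono : forall s t : R, 0 <= s <= t -> F s <= F t)
  (Fm : forall t : R, 0 <= t -> ((F t)%:E + m (I0 t `*` setT) = mine t%:E th)%E).

(** On [0, N] the integral of the indicator is the mass carried by [Xi]. It equals the total mass,
    which is finite, so the remaining mass is zero. *)
Lemma off_Xi_null_of_integral : (forall t : R, 0 <= t ->
    (m (I0 t `*` setT) = \int[m]_(p in I0 t `*` setT) (\1_Xi (y p.1, p.2))%:E)%E) ->
  m (off_Xi Xi y) = 0%E.
Proof.
move=> mX; apply: (off_Xi_null hE cE hU cU cXi cy) => N.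
have N0 : 0 <= N%:R :> R by [].
have := mX _ N0; set D := I0 N%:R `*` setT; set S : set (R * Borel Uc) := [set p | _].
have mS : measurable S := measurable_off_to hE cE hU cU cXi N cy.
have mD : measurable D := measurable_I0T N%:R.
have -> : (\int[m]_(p in D) (\1_Xi (y p.1, p.2))%:E = m (~` S `&` D))%E.
  rewrite -integral_indic//; last exact: measurableC.
  apply: eq_integral => -[r u]; rewrite inE /D /I0 => -[/= + _]; rewrite in_itv/= => rN.
  rewrite !indicE; congr ((nat_of_bool _)%:R)%:E; apply/idP/idP; rewrite !inE /S /=.
    by rewrite clamp_id// => h; apply.
  by rewrite clamp_id//; exact: contrapT.
have mDfin : m D \is a fin_num by rewrite ge0_fin_numE ?measure_ge0//; have [_] := mLU; exact.
have : (m D = m (~` S `&` D) + m (S `&` D))%E.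
  rewrite -measureU ?setIUl//; first by rewrite -setIUl setUC setUv setTI.
  - by apply: measurableI => //; exact: measurableC.
  - exact: measurableI.
  - by rewrite setIACA setICl set0I.
move=> e1 e2; move: e1; rewrite -e2 => e1.
by have := congr1 (fun x => x - m D)%E e1; rewrite subee// addeAC subee// add0e => <-.
Qed.

Lemma admissible_of_clock : m (off_Xi Xi y) = 0%E -> admissible Xi y m.
Proof.
move=> mX; have fin t : 0 <= t -> m (I0 t `*` setT) \is a fin_num by exact: (occupation_fin F0 Fm).
split => //; first by case: mLU.
  have := Fm (lexx 0); rewrite (F_at0 th0 F0 Fm) add0e => ->; exact: min_idPl.
move=> s t st; have /andP[s0 le_st] := st; have t0 := le_trans s0 le_st.
have := Fm t0; have := Fm s0; have := Fmono st; have := fin t t0; have := fin s s0.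
case: (m (I0 s `*` setT)) => // a _; case: (m (I0 t `*` setT)) => // b _ Fst.
case: th => [r| |].
- rewrite /mine /Order.min !lte_fin; case: ltP => h1; case: ltP => h2 => -[e1] [e2];
    rewrite lee_fin; lra.
- by rewrite !(min_idPl (leey _)) => -[e1] [e2]; rewrite lee_fin; lra.
- by rewrite (min_idPr (leNye _)).
Qed.

Definition outside : set R := [set s | ~ closure E0 (y s)].

Lemma measurable_outside t : 0 <= t -> measurable (I0 t `&` outside : set (measurableTypeR R)).
Proof.
move=> t0; rewrite (_ : _ `&` _ = I0 t `&` [set s | ~ closure E0 (y (clamp t s))]).
  apply: measurableI; first exact: measurable_I0.
  by apply: (rv_path cy t0 (O := ~` closure E0)); apply: closed_openC; exact: closed_closure.
by apply/seteqP; split => s []; rewrite /I0 /= in_itv/= => st; rewrite /outside /= clamp_id.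
Qed.

Lemma clock_closureP t : 0 <= t ->
  ((F t)%:E = \int[LS F]_(s in I0 t) (\1_(closure E0) (y s))%:E)%E <->
  LS F (I0 t `&` outside) = 0%E.
Proof.
move=> t0; have mO := measurable_outside t0.
have mI : measurable (I0 t : set (measurableTypeR R)) := measurable_I0 t.
have LSI : LS F (I0 t) = (F t)%:E by exact: (LS_Iy th0 F0 Fmono Fm).
have -> : (\int[LS F]_(s in I0 t) (\1_(closure E0) (y s))%:E = LS F (I0 t `\` (I0 t `&` outside)))%E.
  rewrite (_ : I0 t `\` _ = ~` (I0 t `&` outside) `&` I0 t); last by rewrite setDE setIC.
  rewrite -integral_indic//; last exact: measurableC.
  apply: eq_integral => s /set_mem It.
  rewrite !indicE; congr ((nat_of_bool _)%:R)%:E; apply/idP/idP; rewrite !inE /outside /=.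
    by move=> h [_]; exact.
  by move=> h; apply: contrapT => nh; apply: h.
have lt : (LS F (I0 t) < +oo)%E by rewrite LSI ltry.
have sub : I0 t `&` outside `<=` I0 t by move=> ? [].
have e : LS F ((I0 t `&` outside) `|` (I0 t `\` (I0 t `&` outside))) =
    (LS F (I0 t `&` outside) + LS F (I0 t `\` (I0 t `&` outside)))%E.
  by apply: measureU => //; [exact: measurableD|rewrite setDIK].
rewrite setDUK// LSI in e.
have : (LS F (I0 t `&` outside) <= (F t)%:E)%E.
  by rewrite -LSI; apply: le_measure; rewrite ?inE.
have : (0 <= LS F (I0 t `&` outside))%E by exact: measure_ge0.
move: e; case: (LS F (I0 t `&` outside)) => // r; case: (LS F _) => // r' [e] _ _.
by split => -[e']; congr EFin; lra.
Qed.

(** Because dF plus the time marginal of m is Lebesgue measure on [0, th], the Stieltjes condition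
    becomes an equality between Lebesgue measure and m. In that form it depends measurably on the
    path and control and adds up under pasting. *)
Lemma clock_outsideP t : 0 <= t -> LS F (I0 t `&` outside) = 0%E <->
  lebesgue_measure (I0 t `&` outside `&` [set s | s%:E <= th]%E) =
  m ((I0 t `&` outside) `*` setT).
Proof.
move=> t0; have mO := measurable_outside t0.
have sub : I0 t `&` outside `<=` I0 t by move=> ? [].
rewrite -(LS_split th0 F0 Fmono Fm t0 mO sub).
have fm : m ((I0 t `&` outside) `*` setT) \is a fin_num.
  rewrite ge0_fin_numE ?measure_ge0//; apply: le_lt_trans (_ : (m (I0 t `*` setT) < +oo)%E).
    apply: le_measure; rewrite ?inE; [exact: measurableX|exact: measurable_I0T|].
    by move=> [s u] [/= []].
  by case: mLU => _; exact.
split => [->|]; first by rewrite add0e.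
by move/(congr1 (fun x => x - m ((I0 t `&` outside) `*` setT))%E); rewrite addeK// subee.
Qed.

End clock.

End pathwise.

(** lambda_0 is left out: for an admissible pair it is a function of the control. *)
Definition path_filtration {R : realType} {E Uc : pseudoPMetricType R} {d}
    {Om : measurableType d} (Y : Om -> R -> E) (L : Om -> @LMeas R Uc) (t : R) : set (set Om) :=
  <<s [set A | exists s, 0 <= s <= t /\
       ((exists V : set E, open V /\ A = (fun w => Y w s) @^-1` V) \/
        (exists (C : set (Borel Uc)) (V : set (\bar R)), measurable C /\ open V /\
            A = (fun w => L w (I0 s `*` C)) @^-1` V))] >>.

Lemma path_filtration_measurable {R : realType} {E Uc : pseudoPMetricType R} d
    (Om : measurableType d) (Y : Om -> R -> E) (L : Om -> @LMeas R Uc) t :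
  (forall s, 0 <= s <= t -> rv (Y ^~ s)) ->
  (forall s C, 0 <= s <= t -> measurable C -> measurable_fun setT (fun w => L w (I0 s `*` C))) ->
  path_filtration Y L t `<=` measurable.
Proof.
move=> rY mL; apply: smallest_sub; first exact: sigma_algebra_measurable.
move=> A [s [st [[V [oV ->]]|[C [V [mC [oV ->]]]]]]]; first exact: rY.
by apply: (measurable_preimage (mL s C st mC)); exact: ereal_open_measurable.
Qed.

Lemma measurable_eqe {R : realType} d (T : measurableType d) (f g : T -> \bar R) :
  measurable_fun setT f -> measurable_fun setT g -> measurable [set x | f x = g x].
Proof.
move=> mf mg; rewrite (_ : mkset _ = [set x | (f x <= g x)%E] `&` [set x | (g x <= f x)%E]).
  by apply: measurableI; rewrite -[X in measurable X]setTI; exact: measurable_lee.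
apply/seteqP; split => x /= => [->|[h h']]; first by rewrite lexx.
by apply/eqP; rewrite eq_le h h'.
Qed.

Lemma integral_image_prob {R : realType} d1 d2 (T1 : measurableType d1) (T2 : measurableType d2)
    (P : probability T1 R) (f : T1 -> T2) (mf : measurable_fun setT f) (D : set T2)
    (g : T2 -> \bar R) : measurable_fun setT g ->
  P.-integrable (f @^-1` D) (g \o f) -> measurable D ->
  (\int[image_prob P mf]_(y in D) g y = \int[P]_(x in f @^-1` D) (g \o f) x)%E.
Proof. by move=> mg ig mD; exact: (integral_pushforward mf). Qed.

Section compensated_congruence.
Context {R : realType} {E Uc : pseudoPMetricType R}.

Lemma eq_compensated_full (y y' : R -> E) (m m' : @LMeas R Uc) (f a : E -> R)
    (c : E * Uc -> R) (t : R) : 0 <= t -> (forall s, 0 <= s -> y s = y' s) ->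
  (forall A, measurable A -> m A = m' A) ->
  compensated_full y m f a c t = compensated_full y' m' f a c t.
Proof.
move=> t0 yy' mm'; rewrite /compensated_full !yy'//; congr (_ - fine _ - fine _).
  by apply: eq_integral => s; rewrite inE /I0 /= in_itv/= => /andP[s0 _]; rewrite yy'.
rewrite (eq_measure_integral m'); last by move=> A mA _; exact: mm'.
by apply: eq_integral => -[s u]; rewrite inE /I0 /= in_itv/= => -[/andP[s0 _] _]; rewrite yy'.
Qed.

End compensated_congruence.

Section uniform_bound.
Context {R : realType} {E Uc : pseudoPMetricType R}.
Hypotheses (hE : hausdorff_space E) (cE : compact [set: E]).
Hypotheses (hU : hausdorff_space Uc) (cU : compact [set: Uc]).
Variables (f a : E -> R) (c : E * Uc -> R).
Hypotheses (cf : continuous f) (ca : continuous a) (cc : continuous c).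

Lemma compensated_uniform_bound t : 0 <= t -> exists K : R, forall u, 0 <= u <= t ->
  forall Xi y m, admissible Xi y m -> `|compensated_full y m f a c u| <= K.
Proof.
move=> t0.
have [Kf Kf0 fK] : exists2 K : R, 0 < K & forall x, setT x -> `|f x| <= K.
  by apply: continuous_compact_bounded => //; exact: continuous_subspaceT.
have [Ka Ka0 aK] : exists2 K : R, 0 < K & forall x, setT x -> `|a x| <= K.
  by apply: continuous_compact_bounded => //; exact: continuous_subspaceT.
have [Kc Kc0 cK] : exists2 K : R, 0 < K & forall x, setT x -> `|c x| <= K.
  apply: continuous_compact_bounded; first exact: compact_prodT.
  exact: continuous_subspaceT.
exists (Kf + Kf + Ka * t + Kc * t) => u /andP[u0 ut] Xi y m ym.
apply: (@le_trans _ _ (Kf + Kf + Ka * u + Kc * u)); last first.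
  by rewrite lerD ?lerD2l// ler_wpM2l// ltW.
apply: (compensated_bound hE cE hU cU ym ca cc (ltW Ka0) (ltW Kc0)) => //.
- by move=> x; exact: aK.
- by move=> x; exact: cK.
- by move=> x; exact: fK.
Qed.

End uniform_bound.

Section standard.
Context {R : realType} {E Uc : pseudoPMetricType R}.
Hypotheses (hE : hausdorff_space E) (cE : compact [set: E]).
Hypotheses (hU : hausdorff_space Uc) (cU : compact [set: Uc]).
Variables (E0 : set E) (Xi : set (E * Uc)) (cXi : closed Xi).
Variables (DA DB : set (E -> R)) (A : (E -> R) -> (E -> R)) (B : (E -> R) -> (E * Uc -> R)).
Hypotheses (DA_cont : forall f, DA f -> continuous f)
  (A_cont : forall f, DA f -> continuous (A f)).
Local Notation LM := (@LMeas R Uc).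

Section regular_set.
Context {d : measure_display} {Om : measurableType d} (P : probability Om R).
Variables (U : set E) (Y : Om -> R -> E) (l0 : Om -> R -> R) (L : Om -> LM).
Hypothesis sol : stopped_cmp_solution E0 Xi DA A DB B U P Y l0 L.
Let th w := exit_time U (Y w).

(** The almost sure clauses of a solution at one sample point, with both support conditions
    rewritten as null sets. *)
Definition regular_at w : Prop :=
  [/\ forall t, 0 <= t -> ((l0 w t)%:E + L w (I0 t `*` setT) = mine t%:E (th w))%E,
      L w (off_Xi Xi (Y w)) = 0%E,
      forall t, 0 <= t -> Y w t = Y w (tmin t (th w)) /\
         (forall C : set (Borel Uc), measurable C ->
           L w (I0 t `*` C) = L w (I0 (tmin t (th w)) `*` C)) &
      forall t, 0 <= t -> LS (l0 w) (I0 t `&` outside E0 (Y w)) = 0%E].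

Let cY w : cadlag (Y w). Proof. by case: sol. Qed.
Let rY t : 0 <= t -> rv (Y ^~ t). Proof. by move: t; case: sol => _ []. Qed.
Let l00 w t : 0 <= t -> 0 <= l0 w t.
Proof. by move: t; case: sol => _ [_ [/(_ w)[]]]. Qed.
Let l0mono w s t : 0 <= s <= t -> l0 w s <= l0 w t.
Proof. by move: s t; case: sol => _ [_ [/(_ w)[]]]. Qed.
Let rl t : 0 <= t -> rv (l0 ^~ t). Proof. by move: t; case: sol => _ [_ [_ []]]. Qed.
Let LU w : in_LU (L w). Proof. by case: sol => _ [_ [_ [_ []]]]. Qed.
Let mL s C : 0 <= s -> measurable C -> measurable_fun setT (fun w => L w (I0 s `*` C)).
Proof.
by move: s C; apply: measurable_evaluation => //; case: sol => _ [_ [_ [_ [_ []]]]].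
Qed.

Lemma solution_measurable_evaluation s C : 0 <= s -> measurable C ->
  measurable_fun setT (fun w => L w (I0 s `*` C)).
Proof. exact: mL. Qed.

Lemma solution_filtration_measurable t : nat_filtration Y l0 L t `<=` measurable.
Proof.
apply: nat_filtration_measurable => s => [/andP[s0 _]|/andP[s0 _]|C /andP[s0 _]].
- exact: rY.
- exact: rl.
- exact: mL.
Qed.

Lemma regular_set : exists G, [/\ measurable G, P (~` G) = 0%E & forall w, G w -> regular_at w].
Proof.
apply: ae_full_set; case: sol => _ [_ [_ [_ [_ [_ [cl [xi [st [ck _]]]]]]]]].
apply: filterS2 (filterI cl xi) (filterI st ck) => w [clw xiw] [stw ckw].
have th0 : (0 <= th w)%E by exact: exit_time_ge0.
split => //.
- exact: (off_Xi_null_of_integral hE cE hU cU cXi (cY w) (LU w) xiw).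
- by move=> t t0; have [? [_ ?]] := stw t t0.
by move=> t t0; have [+ _] := clock_closureP E0 (cY w) th0 (l00 w) (l0mono w) ckw t0; apply; exact: clw.
Qed.

Lemma regular_admissible w : regular_at w -> admissible Xi (Y w) (L w).
Proof.
move=> [ck xi _ _].
exact: (admissible_of_clock (cY w) (exit_time_ge0 U (Y w)) (LU w) (l00 w) (l0mono w) ck xi).
Qed.

Lemma regular_compensated w (f a : E -> R) (Bf b : E * Uc -> R) t : regular_at w ->
  continuous a -> continuous b -> (forall p, Xi p -> Bf p = b p) -> 0 <= t ->
  f (Y w t) - f (Y w 0) - fine (\int[LS (l0 w)]_(s in I0 t) (a (Y w s))%:E)
    - fine (\int[L w]_(p in I0 t `*` setT) (Bf (Y w p.1, p.2))%:E) =
  compensated f a (fun q => b q - a q.1) (Y w) (L w) (th w) t.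
Proof.
move=> [ck xi _ _] ca cb Bb t0.
exact: (compensatedE hE cE hU cU cXi f (exit_time_ge0 U (Y w)) (l00 w) (l0mono w) ck (cY w) xi ca cb Bb t0).
Qed.

Lemma solution_martingale f : DA f -> DB f ->
     martingale P (nat_filtration Y l0 L)
       (fun t w => f (Y w t) - f (Y w 0)
          - fine (\int[LS (l0 w)]_(s in I0 t) (A f (Y w s))%:E)
          - fine (\int[L w]_(p in I0 t `*` setT) (B f (Y w p.1, p.2))%:E)).
Proof. by move: f; case: sol => _ [_ [_ [_ [_ [_ [_ [_ [_ []]]]]]]]]. Qed.

End regular_set.

Section standardization.
Context {d : measure_display} {Om : measurableType d} (P : probability Om R).
Variables (Y : Om -> R -> E) (l0 : Om -> R -> R) (L : Om -> LM).
Hypothesis sol : cmp_solution E0 Xi DA A DB B P Y l0 L.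

(** Q is the law of the code, which lies in [0, 1). Decoding recovers path and control on a set of
    full measure, so every property involving only their law survives the move to the line. *)
Lemma standard_solution : exists (Q : probability (measurableTypeR R) R)
    (yd : measurableTypeR R -> R -> E) (Ld : measurableTypeR R -> LM),
  [/\ forall r, admissible Xi (yd r) (Ld r),
      (forall t, 0 <= t -> rv (yd ^~ t)) /\
      (forall D, measurable D -> measurable_fun setT (Ld ^~ D)),
      [/\ Q [set r : R | r < 0] = 0%E, Q [set r : R | r <= 1] = 1%E &
       forall C : set (Borel E), measurable C ->
         Q ((fun r => yd r 0) @^-1` C) = P ((fun w => Y w 0) @^-1` C)],
      exists G, [/\ measurable G, Q (~` G) = 0%E & forall r, G r -> forall t, 0 <= t ->
         LS (idle_time (Ld r)) (I0 t `&` outside E0 (yd r)) = 0%E] &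
      forall f (b : E * Uc -> R), DA f -> DB f -> continuous b ->
        (forall p, Xi p -> B f p = b p) -> forall s t D, 0 <= s <= t ->
        path_filtration yd Ld s D ->
        (\int[Q]_(r in D) (compensated_full (yd r) (Ld r) f (A f) (fun q => b q - A f q.1) t)%:E =
         \int[Q]_(r in D) (compensated_full (yd r) (Ld r) f (A f) (fun q => b q - A f q.1) s)%:E)%E].
Proof.
have cY w : cadlag (Y w) by case: sol.
have rY t : 0 <= t -> rv (Y ^~ t) by move: t; case: sol => _ [].
have LU w : in_LU (L w) by case: sol => _ [_ [_ [_ []]]].
have mL := solution_measurable_evaluation sol.
have [sE [csE ssE]] := compact_cantor_image hE cE.
have [sU [csU ssU]] := compact_cantor_image hU cU.
pose c w : measurableTypeR R := pair_code sE sU (Y w) (L w).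
have mc : measurable_fun setT c by exact: (measurable_pair_code hE hU csE csU rY LU mL).
pose yd := dec_path hE cE sE.
pose Ld := dec_control hE cE Xi sE csU.
have adm r : admissible Xi (yd r) (Ld r) by exact: admissible_dec.
have [G [mG G0 GP]] := regular_set sol.
have ydc w t : 0 <= t -> yd (c w) t = Y w t.
  by move=> t0; rewrite /yd /c dec_pathK.
have Ldc w D : G w -> measurable D -> Ld (c w) D = L w D.
  by move=> Gw mD; rewrite /Ld /c dec_controlK//; exact: (regular_admissible sol (GP w Gw)).
have ryd t : 0 <= t -> rv (yd ^~ t) by exact: rv_dec_path.
have mLd D : measurable D -> measurable_fun setT (Ld ^~ D) by exact: measurable_dec_control.
have cyd r : cadlag (yd r) by have [] := adm r.
have c0 w : 0 <= c w by exact: code_ge0.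
have c1 w : c w <= 1 by apply/ltW/code_lt1.
clearbody c yd Ld.
exists (image_prob P mc), yd, Ld; split; [exact: adm|by split| | | ].
- split.
  + rewrite image_probE (_ : _ @^-1` _ = set0) ?measure0//; apply/seteqP; split => // w /=.
    by rewrite ltNge c0.
  + rewrite image_probE (_ : _ @^-1` _ = setT) ?probability_setT//; apply/seteqP; split => // w _ /=.
    exact: c1.
  + move=> C mC; rewrite image_probE; congr (P _).
    by apply/seteqP; split => w /=; rewrite ydc.
(* By [clock_outsideP] with th = +oo the idle-time condition is [f1 N r = f2 N r] for all N, which
   defines a measurable set of r. *)
- pose f1 (N : nat) (r : measurableTypeR R) := lebesgue_measure (I0 N%:R `&` outside E0 (yd r)).
  pose f2 (N : nat) (r : measurableTypeR R) := Ld r ((I0 N%:R `&` outside E0 (yd r)) `*` setT).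
  pose S (N : nat) : set (measurableTypeR R * measurableTypeR R) :=
    [set q | ~ closure E0 (yd q.1 (clamp N%:R q.2))].
  have mS N : measurable (S N).
    have := @rv_progressive R _ _ E yd N%:R cyd (ler0n _ _)
      (fun s s0 => ryd s (proj1 (andP s0))) (~` closure E0).
    by apply; apply: closed_openC; exact: closed_closure.
  have mf1 N : measurable_fun setT (f1 N).
    have lt : forall r : measurableTypeR R, ((lebesgue_measure : {measure set (measurableTypeR R) -> \bar R}) (I0 N%:R) <= N%:R%:E)%E.
      by move=> r; rewrite lebesgue_measure_I0.
    have := @measurable_random_section R _ _ (measurableTypeR R) (measurableTypeR R)
      (fun=> lebesgue_measure) (I0 N%:R) N%:R (measurable_I0 _) (fun _ _ => measurable_cst _) lt (S N) (mS N).
    rewrite (_ : (fun w => _) = f1 N)//; apply/funext => r; congr lebesgue_measure.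
    apply/seteqP; split => s; rewrite /I0 /outside /S /= in_itv/=.
      by move=> [/xsectionP/= h sN]; split => //; move: h; rewrite clamp_id.
    by move=> [sN h]; split => //; apply/xsectionP; rewrite /= clamp_id.
  have mf2 N : measurable_fun setT (f2 N).
    have mS2 : measurable ((fun q : measurableTypeR R * (R * Borel Uc) => (q.1, q.2.1 : measurableTypeR R)) @^-1` S N).
      apply: (measurable_preimage _ (mS N)); apply/measurable_fun_pairP; split; first exact: measurable_fst.
      exact: measurableT_comp measurable_fst measurable_snd.
    have := @measurable_random_section R _ _ (measurableTypeR R) _ Ld (I0 N%:R `*` setT) N%:R
      (measurable_I0T _) _ _ _ mS2.
    rewrite (_ : (fun w => _) = f2 N); last first.
      apply/funext => r; congr (Ld r _); apply/seteqP; split => -[s u]; rewrite /I0 /outside /S /= in_itv/=.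
        by move=> [/xsectionP/= h [sN _]]; split => //; split => //; move: h; rewrite clamp_id.
      by move=> [[sN h] _]; split => //; apply/xsectionP; rewrite /= clamp_id.
    apply.
      by move=> D mD; apply: mLd; apply: measurableI => //; exact: measurable_I0T.
    by move=> r; apply: (admissible_le (adm r)).
  have mG2 : measurable [set r | forall N, f1 N r = f2 N r].
    by apply: measurable_forall => N; exact: measurable_eqe.
  have clk r := clock_outsideP E0 (cyd r) (leey 0 : (0 <= +oo :> \bar R)%E)
      (admissible_in_LU (adm r)) (idle_time_ge0 (adm r)) (idle_time_mono (adm r)) (idle_timeE (adm r)).
  have Ioo (D : set R) : D `&` [set s | (s%:E <= +oo)%E] = D.
    by apply/seteqP; split => [s []|s Ds]//; split => //=; exact: leey.
  exists [set r | forall N, f1 N r = f2 N r]; split => //.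
    rewrite image_probE; apply/eqP; rewrite -measure_le0 -G0; apply: le_measure; rewrite ?inE.
    + by apply: (measurable_preimage mc); exact: measurableC.
    + exact: measurableC.
    move=> w /= h Gw; apply: h => N; rewrite /f1 /f2.
    have oe : I0 N%:R `&` outside E0 (yd (c w)) = I0 N%:R `&` outside E0 (Y w).
      apply/seteqP; split => s; rewrite /I0 /outside /= in_itv/= => -[/andP[s0 sN] h]; split; rewrite ?s0//.
        by rewrite -ydc.
      by rewrite ydc.
    have [ck xi _ cl] := GP w Gw; have N0 : 0 <= N%:R :> R by [].
    have [_ [_ [/(_ w)[l00 l0m] _]]] := sol.
    have [+ _] := clock_outsideP E0 (cY w) (exit_time_ge0 setT (Y w)) (LU w) l00 l0m ck N0.
    move=> /(_ (cl _ N0)); rewrite exit_timeT Ioo oe => ->; rewrite Ldc//.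
    by apply: measurableX => //; exact: measurable_outside.
  move=> r Gr t t0.
  have tN : t <= (Num.truncn t).+1%:R by rewrite ltW// truncnS_gt.
  apply/eqP; rewrite -measure_le0.
  have [_ /(_ _)h] := clk r _ (ler0n R (Num.truncn t).+1); rewrite -h.
    apply: le_measure; rewrite ?inE; [exact: measurable_outside|exact: measurable_outside|].
    move=> s []; rewrite /I0 /= !in_itv/= => /andP[s0 st] so; split => //.
    by rewrite s0 (le_trans st).
  by rewrite Ioo; exact: Gr.
move=> f b fA fB cb Bb s t D st FD; have /andP[s0 le_st] := st; have t0 := le_trans s0 le_st.
have ca := A_cont fA; have cf := DA_cont fA.
pose a := A f; pose k (q : E * Uc) := b q - a q.1.
have ck : continuous k.
  move=> q; apply: cvgB; first exact: cb.
  by apply: (@continuous_comp _ _ _ (fst : E * Uc -> E) a); [exact: cvg_fst|exact: ca].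
have mD : measurable D.
  apply: path_filtration_measurable FD => [u /andP[u0 _]|u C _ mC]; first exact: ryd.
  by apply: mLd; apply: measurableX => //; exact: measurable_I0.
(* Decoding inverts the code on [G], so there an event of the decoded past is an event of the past
   of the original solution. *)
have [D2 FD2 DD2] : exists2 D2, nat_filtration Y l0 L s D2 & c @^-1` D `&` G = id @^-1` D2 `&` G.
  apply: (sigma_trace (q := id)) FD; first exact: smallest_sigma_algebra.
  move=> _ [u [us [[V [oV ->]]|[C [V [mC [oV ->]]]]]]].
    exists ((Y ^~ u) @^-1` V).
      by apply: sub_gen_smallest; exists u; split => //; left; exists V.
    by apply/seteqP; split => w [/= h Gw]; split => //; move: h; rewrite ydc//; case/andP : us.
  exists ((fun w => L w (I0 u `*` C)) @^-1` V).
    by apply: sub_gen_smallest; exists u; split => //; right; right; exists C, V.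
  apply/seteqP; split => w [/= h Gw]; split => //; move: h; rewrite Ldc//;
    by apply: measurableX => //; exact: measurable_I0.
have mart := solution_martingale sol fA fB.
have key u : 0 <= u -> (\int[image_prob P mc]_(r in D) (compensated_full (yd r) (Ld r) f a k u)%:E =
    \int[P]_(w in D2) (f (Y w u) - f (Y w 0)
          - fine (\int[LS (l0 w)]_(s in I0 u) (A f (Y w s))%:E)
          - fine (\int[L w]_(p in I0 u `*` setT) (B f (Y w p.1, p.2))%:E))%:E)%E.
  move=> u0.
  have mcomp : measurable_fun setT (fun r => compensated_full (yd r) (Ld r) f a k u).
    apply: (measurable_compensated hE cE hU cU adm u0 _ _ cf ca ck).
      by move=> v /andP[v0 _]; exact: ryd.
    by move=> v C _ mC; apply: mLd; apply: measurableX => //; exact: measurable_I0.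
  have [K bK] := compensated_uniform_bound hE cE hU cU cf ca ck u0.
  have {}bK := bK u (introT andP (conj u0 (lexx u))).
  rewrite (integral_image_prob mc (g := fun r => (compensated_full (yd r) (Ld r) f a k u)%:E))//; last 2 first.
  - exact/measurable_EFinP.
  - have mcD := measurable_preimage mc mD.
    apply: (bounded_integrable_on (k := fun w => compensated_full (yd (c w)) (Ld (c w)) f a k u) (K := K)) => //.
    + by apply: le_lt_trans (probability_le1 P mcD) _; exact: ltry.
    + by apply: measurable_funTS; exact: (measurableT_comp mcomp mc).
    + by move=> w _; exact: (bK _ _ _ (adm _)).
  apply: (eq_integral_trace mG G0 DD2) => w _ Gw /=; congr EFin.
  rewrite (eq_compensated_full f a k u0 (ydc w) (fun D' => Ldc w D' Gw)).
  rewrite (compensated_fullE (Y w) (L w)).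
  by rewrite (regular_compensated sol f (GP w Gw) ca cb Bb u0) exit_timeT.
have [_ [_ h]] := mart t t0.
exact: etrans (key t t0) (etrans (h s D2 st FD2) (esym (key s s0))).
Qed.

End standardization.
End standard.

(** * Exit times *)

Section exit_times.
Context {R : realType} {E : pseudoPMetricType R}.
Hypotheses (hE : hausdorff_space E).
Variables (U : set E) (oU : open U).
Implicit Types y : R -> E.

Lemma exit_before y t : 0 <= t -> (t%:E < exit_time U y)%E -> U (y t) /\ U (leftlim y t).
Proof.
move=> t0 tth; suff : ~ (~ U (y t) \/ ~ U (leftlim y t)).
  by move=> /not_orP[/contrapT ? /contrapT].
move=> h; have : (exit_time U y <= t%:E)%E by apply: ereal_inf_lbound; exists t.
by move/(lt_le_trans tth); rewrite ltxx.
Qed.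

(** If y and its left limit at t were both in the open set U, right continuity would keep the path
    and its left limits in U a little longer, and the infimum would exceed t. *)
Lemma exit_attained y (t : R) : cadlag y -> exit_time U y = t%:E ->
  0 <= t /\ (~ U (y t) \/ ~ U (leftlim y t)).
Proof.
move=> cy yt; have t0 : 0 <= t by rewrite -lee_fin -yt exit_time_ge0.
split => //; apply: contrapT => /not_orP[/contrapT Ut /contrapT Ult].
have /nbhs_ballP[e /= e0 eU] : nbhs (y t) U by exact: open_nbhs_nbhs.
have e2 : 0 < e / 2 by rewrite divr_gt0.
have [r r0 hr] := cadlag_right cy t0 (nbhsx_ballx (y t) _ e2).
suff : ((t + r)%:E <= exit_time U y)%E by rewrite yt lee_fin leNgt ltrDl r0.
apply: le_ereal_inf_tmp => _ [s [s0 hs] <-]; rewrite lee_fin leNgt; apply/negP => sr.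
have [st|ts|ts] := ltgtP s t.
- have := @exit_before y s s0; rewrite yt lte_fin => /(_ st)[u1 u2].
  by case: hs; exact.
- have sp : 0 < s := le_lt_trans t0 ts.
  case: hs; apply; apply: eU.
    by apply: (@le_ball _ _ _ (e / 2)); [lra|apply: hr; rewrite (ltW ts)].
  have [r' r'0 hr'] := cadlag_left cy sp (nbhsx_ballx (leftlim y s) _ e2).
  pose v := Num.max t (s - r').
  have [tv vs] : t <= v /\ s - r' <= v by rewrite /v !le_max !lexx orbT.
  have vlts : v < s by rewrite /v gt_max ts/= gtrBl.
  have h1 : ball (y t) (e / 2) (y ((v + s) / 2)) by apply: hr; apply/andP; split; lra.
  have h2 : ball (leftlim y s) (e / 2) (y ((v + s) / 2)) by apply: hr'; apply/andP; split; lra.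
  by rewrite (splitr e); apply: (ball_triangle h1); exact: ball_sym.
- by case: hs; rewrite ts.
Qed.

Lemma leftlim_eq y y' (t : R) : 0 < t -> (forall s, 0 <= s < t -> y' s = y s) ->
  y 0 = y' 0 -> leftlim y' t = leftlim y t.
Proof.
move=> t0 yy' _; rewrite /leftlim t0; congr lim.
have e : \forall s \near t^'-, y' s = y s.
  near=> s; apply: yy'; apply/andP; split.
    by near: s; exact: nbhs_left_ge.
  by near: s; exact: nbhs_left_lt.
apply/seteqP; split => V hV.
  have hV' : t^'- (y' @^-1` V) := hV.
  by apply: (filterS _ (filterI e hV')) => s []; rewrite /preimage /= => ->.
have hV' : t^'- (y @^-1` V) := hV.
by apply: (filterS _ (filterI e hV')) => s []; rewrite /preimage /= => ->.
Unshelve. all: end_near. Qed.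

(** An exit is decided by the path up to and including the exit time, since the infimum is attained.
    This makes the continuation invisible to theta. *)
Lemma exit_time_eq y y' : cadlag y ->
  (forall t, 0 <= t -> (t%:E <= exit_time U y)%E -> y' t = y t) ->
  exit_time U y' = exit_time U y.
Proof.
move=> cy yy'.
have ll t : 0 <= t -> (t%:E <= exit_time U y)%E -> leftlim y' t = leftlim y t.
  move=> t0 ty; move: (t0); rewrite le_eqVlt => /predU1P[<-|tp].
    by rewrite /leftlim ltxx yy'// exit_time_ge0.
  apply: leftlim_eq => //; last by rewrite yy'// exit_time_ge0.
  move=> s /andP[s0 st]; apply: yy' => //; apply: le_trans ty.
  by rewrite lee_fin ltW.
apply/eqP; rewrite eq_le; apply/andP; split.
  case th : (exit_time U y) => [t| |].
  - have [t0 h] := exit_attained cy th; apply: ereal_inf_lbound; exists t => //.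
    by split => //; rewrite yy' ?ll ?th.
  - exact: leey.
  - by have := exit_time_ge0 U y; rewrite th.
apply: le_ereal_inf_tmp => _ [s [s0 hs] <-]; rewrite leNgt; apply/negP => sy.
have [u1 u2] := exit_before s0 sy.
by move: hs; rewrite (yy' s s0 (ltW sy)) (ll s s0 (ltW sy)) => -[]; apply.
Qed.

Section measurability.
Context {d : measure_display} {Om : measurableType d} (Y : Om -> R -> E).
Hypotheses (cY : forall w, cadlag (Y w)) (rY : forall t, 0 <= t -> rv (Y ^~ t)).

(** Not having left U by time t means staying at a positive level of g on [0, t]: otherwise points
    with g tending to 0 would cluster at a time where g is positive on both sides. Right continuity
    lets rationals test this, except at the endpoint t, which is therefore tested separately. *)
Lemma exit_gtP y (t : R) (g : E -> R) : cadlag y -> continuous g ->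
  (forall x, U x <-> 0 < g x) -> 0 <= t ->
  (t%:E < exit_time U y)%E <->
  exists m : nat, (m.+1%:R^-1 <= g (y t)) /\
    forall q : rat, 0 <= q -> ratr q <= t -> m.+1%:R^-1 <= g (y (ratr q)).
Proof.
move=> cy cg Ug t0; split => [tth|[m [gt gq]]].
  have good s : 0 <= s <= t -> U (y s) /\ U (leftlim y s).
    by move=> /andP[s0 st]; apply: exit_before => //; apply: le_lt_trans tth; rewrite lee_fin.
  apply: contrapT => nm.
  have /choice[x hx] : forall m : nat, exists x : R, I0 t x /\ g (y x) < m.+1%:R^-1.
    move=> m; apply: contrapT => nx; apply: nm; exists m; split => [|q q0 qt].
      rewrite leNgt; apply/negP => h; apply: nx; exists t; split => //.
      by rewrite /I0 /= in_itv/= t0 lexx.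
    rewrite leNgt; apply/negP => h; apply: nx; exists (ratr q); split => //.
    by rewrite /I0 /= in_itv/= qt ler0q q0.
  have [|s [s0t cls]] := @segment_compact R 0 t (x @ \oo) _.
    by exists 0%N => // m _; have [] := hx m.
  move: s0t; rewrite /= in_itv/= => s0t; have [u1 u2] := good s s0t.
  have s0 : 0 <= s by case/andP : s0t.
  have low z : U z -> exists2 e : R, 0 < e & nbhs z [set z' | e < g z'].
    move=> /Ug gz; exists (g z / 2); first by rewrite divr_gt0.
    by apply: (cvgr_gt (g z) (cg z)); rewrite ltr_pdivrMr// ltr_pMr// ltr1n.
  have [e1 e10 n1] := low _ u1; have [e2 e20 n2] := low _ u2.
  have [r1 r10 h1] := cadlag_right cy s0 n1.
  have [r2 r20 h2] : exists2 r2, 0 < r2 & forall s', 0 <= s' -> s - r2 < s' < s -> e2 < g (y s').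
    move: (s0); rewrite le_eqVlt => /predU1P[<-|sp].
      by exists 1 => // s' s'0 /andP[_]; rewrite ltNge s'0.
    by have [r2 r20 h2] := cadlag_left cy sp n2; exists r2 => // s' _; exact: h2.
  have e0 : 0 < Num.min e1 e2 by rewrite lt_min e10.
  have r0 : 0 < Num.min r1 r2 by rewrite lt_min r10.
  have [J hJ] := small_inv e0.
  have xJ : (x @ \oo) [set u | exists2 j, (J <= j)%N & u = x j].
    by rewrite /nbhs /=; exists J => // j /= Jj; exists j.
  have [_ [[j Jj ->]]] := cls _ _ xJ (nbhsx_ballx s _ r0).
  rewrite /ball /= ltr_norml lt_min => /andP[b1 /andP[b2 b3]].
  have [xI gx] := hx j; move: xI; rewrite /I0 /= in_itv/= => /andP[xj0 _].
  have jJ : j.+1%:R^-1 <= J.+1%:R^-1 :> R by rewrite lef_pV2 ?posrE// ler_nat.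
  have : g (y (x j)) < Num.min e1 e2 by rewrite (lt_le_trans gx)// (le_trans jJ)// ltW.
  rewrite lt_min => /andP[g1 g2].
  have [xs|sx] := ltP (x j) s.
    have /(lt_trans g2) : e2 < g (y (x j)) by apply: h2 => //; apply/andP; split => //; lra.
    by rewrite ltxx.
  have r1b : Num.min r1 r2 <= r1 by rewrite ge_min lexx.
  have /(lt_trans g1) : e1 < g (y (x j)) by apply: h1; apply/andP; split => //; lra.
  by rewrite ltxx.
have ge s : 0 <= s <= t -> m.+1%:R^-1 <= g (y s).
  move=> /andP[s0]; rewrite le_eqVlt => /predU1P[->//|st].
  rewrite leNgt; apply/negP => gs.
  have nb : nbhs (y s) [set z | g z < m.+1%:R^-1] by exact: (cvgr_lt (g (y s)) (cg (y s))).
  have [r r0 hr] := cadlag_right cy s0 nb.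
  have [|q] := @rat_in_itvoo R s (Num.min t (s + r)).
    by rewrite lt_min st ltrDl.
  rewrite in_itv/= lt_min => /andP[sq /andP[qt qr]].
  have := gq q; rewrite -(ler0q R) (le_trans s0 (ltW sq)) (ltW qt) => /(_ isT isT).
  by rewrite leNgt hr// (ltW sq).
have m0 : 0 < m.+1%:R^-1 :> R by rewrite invr_gt0.
have gl s : 0 <= s <= t -> m.+1%:R^-1 <= g (leftlim y s).
  move=> /andP[s0 st]; move: (s0); rewrite le_eqVlt => /predU1P[<-|sp].
    by rewrite /leftlim ltxx; apply: ge; rewrite lexx.
  rewrite leNgt; apply/negP => gs.
  have nb : nbhs (leftlim y s) [set z | g z < m.+1%:R^-1].
    exact: (cvgr_lt (g (leftlim y s)) (cg (leftlim y s))).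
  have [r r0 hr] := cadlag_left cy sp nb.
  pose v := Num.max 0 (s - r).
  have [v0 vs] : 0 <= v /\ s - r <= v by rewrite /v !le_max !lexx orbT.
  have vlts : v < s by rewrite /v gt_max sp/= gtrBl.
  have : m.+1%:R^-1 <= g (y ((v + s) / 2)) by apply: ge; apply/andP; split; lra.
  by rewrite leNgt => /negP; apply; apply: hr; apply/andP; split; lra.
rewrite ltNge; apply/negP => tht.
case th : (exit_time U y) tht => [s| |]//.
  rewrite lee_fin => st; have [s0 h] := exit_attained cy th.
  have s0t : 0 <= s <= t by rewrite s0.
  by case: h; apply; apply/Ug; apply: (lt_le_trans m0); [exact: ge|exact: gl].
by have := exit_time_ge0 U y; rewrite th.
Qed.

Lemma measurable_exit_time : measurable_fun setT (fun w => exit_time U (Y w)).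
Proof.
have [g [cg _ Ug]] := cozero_open oU.
have mg s : 0 <= s -> forall m : nat, measurable [set w | m.+1%:R^-1 <= g (Y w s)].
  move=> s0 m; have /rv_continuousP/(_ _ cg) mgs := rY s0.
  by rewrite -[X in measurable X]setTI; exact: measurable_fun_le.
apply: (measurability _ (ErealGenOInfty.measurableE R)) => //.
move=> _ [_ [x ->] <-]; rewrite setTI.
have [x0|x0] := ltP x 0.
  rewrite (_ : _ @^-1` _ = setT)//; apply/seteqP; split => // w _ /=.
  by rewrite in_itv/= andbT (lt_le_trans _ (exit_time_ge0 _ _))// lte_fin.
rewrite (_ : _ @^-1` _ = [set w | exists m : nat, (m.+1%:R^-1 <= g (Y w x)) /\
    forall q : rat, 0 <= q -> ratr q <= x -> m.+1%:R^-1 <= g (Y w (ratr q))]).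
  apply: measurable_exists => m; apply: measurableI; first exact: mg.
  apply: measurable_forall => q; have [q0|q0] := leP 0 q.
  + by do 2 apply: measurable_imply; apply: mg; rewrite ler0q.
  + by rewrite (_ : mkset _ = setT)//; apply/seteqP; split.
by apply/seteqP; split => w /=; rewrite in_itv/= andbT => /(exit_gtP (cY w) cg Ug x0).
Qed.

(* Where the exit time is infinite this is the position at time 0, since fine +oo = 0. *)
Definition exit_position (w : Om) : E := Y w (fine (exit_time U (Y w))).

(** Truncating the exit time at n makes progressive measurability applicable; for each w the
    truncation is eventually inactive. *)
Lemma rv_exit_position : rv exit_position.
Proof.
have mth := measurable_exit_time.
apply: (rv_cvg (X_ := fun n w => Y w (clamp n%:R (fine (exit_time U (Y w)))))).
  move=> n; have n0 : 0 <= n%:R :> R by [].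
  have := rv_progressive cY n0 (fun s s0 => rY (proj1 (andP s0))).
  apply: (@rv_measurable_comp _ _ _ _ _ _ (fun w => (w, fine (exit_time U (Y w)) : measurableTypeR R))).
  apply/measurable_fun_pairP; split; first exact: measurable_id.
  rewrite (_ : snd \o _ = fine \o (fun w => exit_time U (Y w)))//.
  exact: measurableT_comp.
move=> w; apply: cvg_near_cst; near=> n; congr (Y w _); apply: clamp_id.
rewrite fine_ge0 ?exit_time_ge0//=.
by near: n; exact: nbhs_infty_ger.
Unshelve. all: end_near. Qed.

End measurability.
End exit_times.

Lemma lebesgue_I0_max {R : realType} (x : R) :
  lebesgue_measure (I0 x : set R) = (Num.max 0 x)%:E.
Proof.
have [x0|x0] := leP 0 x; first by rewrite lebesgue_I0.
by rewrite I0_lt0// measure0.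
Qed.

Lemma lebesgue_paste {R : realType} (t b : R) (D : set (measurableTypeR R)) : 0 <= t -> 0 <= b ->
  measurable D -> D `<=` I0 t ->
  lebesgue_measure D = (lebesgue_measure (D `&` I0 b) +
    lebesgue_measure ([set s | D (s + b)%R] `&` I0 (t - b)))%E.
Proof.
move=> t0 b0 mD DI.
have mI (s : R) : measurable (I0 s : set (measurableTypeR R)) := measurable_I0 s.
have msh : measurable_fun setT (fun s : measurableTypeR R => s + b : measurableTypeR R).
  exact: measurable_funD.
pose n1 := mrestr (lebesgue_measure : {measure set (measurableTypeR R) -> \bar R}) (mI t).
pose l1 := mrestr (lebesgue_measure : {measure set (measurableTypeR R) -> \bar R})
  (measurableI _ _ (mI t) (mI b)).
pose l2 := image_measure (mrestr (lebesgue_measure : {measure set (measurableTypeR R) -> \bar R}) (mI (t - b))) msh.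
pose n2 : {measure set (measurableTypeR R) -> \bar R} := measure_add l1 l2.
have n2E A : n2 A = (l1 A + l2 A)%E by exact: measure_addE.
have itvI (x y : R) : `]-oo, x]%classic `&` I0 y = I0 (Num.min x y).
  apply/seteqP; split => s; rewrite /I0 /= !in_itv/=.
    by move=> [sx /andP[-> sy]]; rewrite le_min sx.
  by rewrite le_min => /and3P[-> -> ->].
have I0I (x y : R) : I0 x `&` I0 y = I0 (Num.min x y).
  apply/seteqP; split => s; rewrite /I0 /= !in_itv/=.
    by move=> [/andP[-> sx] /andP[_ sy]]; rewrite le_min sx.
  by rewrite le_min => /and3P[-> -> ->].
have e1 x : n1 `]-oo, x]%classic = (Num.max 0 (Num.min x t))%:E.
  by rewrite /n1/= /mrestr itvI lebesgue_I0_max.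
have e2 x : n2 `]-oo, x]%classic = (Num.max 0 (Num.min (Num.min x t) b) + Num.max 0 (Num.min (x - b) (t - b)))%:E.
  rewrite n2E /l1 /l2 image_measureE /= /mrestr setIA !itvI.
  rewrite (_ : (fun s => _) @^-1` _ = `]-oo, x - b]%classic); last first.
    by apply/seteqP; split => s /=; rewrite !in_itv/= lerBrDr.
  by rewrite itvI I0I !lebesgue_I0_max.
have : n1 D = n2 D.
  apply: measure_eq_halfline => // x; first by rewrite e2 ltry.
  apply: (etrans (e1 x)); rewrite e2; congr EFin; have -> : Num.min (x - b) (t - b) = Num.min x t - b.
    by rewrite /Order.min ltrD2r; case: ifP.
  move: (Num.min x t) => u; rewrite /Order.max /Order.min.
  case: (ltP u b) => ?; case: (ltP 0 u) => ?; case: (ltP 0 b) => ?; case: (ltP 0 (u - b)) => ?; lra.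
rewrite n2E /n1 /l1 /l2 image_measureE /= /mrestr (setIidl DI) setIA (setIidl DI).
exact.
Qed.

Lemma eq_measure_null {R : realType} d (T : measurableType d) (mu : {measure set T -> \bar R})
    (N D D' : set T) : measurable N -> mu N = 0%E -> measurable D -> measurable D' ->
  (forall p, ~ N p -> D p <-> D' p) -> mu D = mu D'.
Proof.
move=> mN N0 mD mD' DD'.
have one (D1 D2 : set T) : measurable D1 -> measurable D2 ->
    (forall p, ~ N p -> D1 p -> D2 p) -> (mu D1 <= mu D2)%E.
  move=> mD1 mD2 h; rewrite -[leRHS]adde0 -N0.
  apply: le_trans (measureU2 mu mD2 mN); apply: le_measure; rewrite ?inE//.
    exact: measurableU.
  by move=> p D1p; have [Np|Np] := pselect (N p); [right|left; exact: h].
by apply/eqP; rewrite eq_le; apply/andP; split; apply: one => // p Np; have [] := DD' p Np.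
Qed.

Lemma eq_integral_set {R : realType} d (T : measurableType d) (mu : {measure set T -> \bar R})
    (D D' : set T) (f : T -> \bar R) : (forall x, D x <-> D' x) ->
  (\int[mu]_(x in D) f x = \int[mu]_(x in D') f x)%E.
Proof. by move=> h; congr integral; apply/seteqP; split => x /h. Qed.

(** * Pasting *)

Section pasting.
Context {R : realType} {E Uc : pseudoPMetricType R}.
Hypotheses (hE : hausdorff_space E) (cE : compact [set: E]).
Hypotheses (hU : hausdorff_space Uc) (cU : compact [set: Uc]).
Variables (E0 : set E) (Xi : set (E * Uc)) (cXi : closed Xi).
Local Notation LM := (@LMeas R Uc).

Definition paste_path (y1 : R -> E) (th : \bar R) (y2 : R -> E) (t : R) : E :=
  if (t%:E < th)%E then y1 t else y2 (t - fine th).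

Lemma measurable_time_shift (b : R) :
  measurable_fun setT (fun p : R * Borel Uc => (p.1 + b, p.2) : R * Borel Uc).
Proof.
apply/measurable_fun_pairP; split => /=; last exact: measurable_snd.
by apply: measurable_funD => //; exact: measurable_fst.
Qed.

(** m1 is not cut at b: the stopped clock leaves it without mass after b, see [m1_after]. *)
Definition paste_measure (m1 : LM) (th : \bar R) (m2 : LM) : LM :=
  if th is b%:E then measure_add m1 (image_measure m2 (measurable_time_shift b)) else m1.

Lemma paste_measureE m1 (b : R) m2 D : paste_measure m1 b%:E m2 D =
  (m1 D + m2 [set p | D (p.1 + b, p.2)%R])%E.
Proof. exact: measure_addE. Qed.

Lemma cadlagI (y : R -> E) :
  (forall t A, 0 <= t -> nbhs (y t) A -> exists2 e, 0 < e & forall s, t <= s < t + e -> A (y s)) ->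
  (forall t, 0 < t -> exists l : E, forall A, nbhs l A -> exists2 e, 0 < e & forall s, t - e < s < t -> A (y s)) ->
  cadlag y.
Proof.
move=> hr hl; split => t t0.
  move=> A yA; have [e e0 he] := hr t A t0 yA; rewrite /nbhs /=; near=> s.
  apply: he; apply/andP; split.
    by near: s; exact: nbhs_right_ge.
  by near: s; apply: nbhs_right_lt; rewrite ltrDl.
have [l hle] := hl t t0; apply/cvg_ex; exists l => A lA.
have [e e0 he] := hle A lA; rewrite /nbhs /=; near=> s; apply: he; apply/andP; split.
  by near: s; apply: nbhs_left_gt; rewrite gtrBl.
by near: s; exact: nbhs_left_lt.
Unshelve. all: end_near. Qed.

Section finite_time.
Variables (y1 y2 : R -> E) (m1 m2 : LM) (b : R).
Hypotheses (b0 : 0 <= b) (cy1 : cadlag y1) (adm2 : admissible Xi y2 m2) (y21 : y2 0 = y1 b).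
Hypotheses (m1_neg : m1 [set p | p.1 < 0] = 0%E) (m1_0 : m1 (I0 0 `*` setT) = 0%E)
  (m1_off : m1 (off_Xi Xi y1) = 0%E)
  (m1_fin : forall t : R, 0 <= t -> (m1 (I0 t `*` setT) < +oo)%E)
  (m1_lip : forall s t : R, 0 <= s <= t -> (m1 (I0 t `*` setT) <=
     m1 (I0 s `*` setT) + (Num.min t b - Num.min s b)%:E)%E).

Let y := paste_path y1 b%:E y2.
Let m := paste_measure m1 b%:E m2.
Let cy2 : cadlag y2. Proof. by have [] := adm2. Qed.
Let m2_neg : m2 [set p | p.1 < 0] = 0%E. Proof. by have [] := adm2. Qed.

Lemma paste_path_lt t : t < b -> y t = y1 t.
Proof. by move=> tb; rewrite /y /paste_path lte_fin tb. Qed.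

Lemma paste_path_ge t : b <= t -> y t = y2 (t - b).
Proof. by move=> bt; rewrite /y /paste_path lte_fin ltNge bt. Qed.

Lemma paste_path_le t : t <= b -> y t = y1 t.
Proof.
rewrite le_eqVlt => /predU1P[->|]; last exact: paste_path_lt.
by rewrite paste_path_ge// subrr.
Qed.

Lemma cadlag_paste : cadlag y.
Proof.
apply: cadlagI => [t A t0|t t0].
  have [tb|bt] := ltP t b.
    rewrite paste_path_lt// => /(cadlag_right cy1 t0)[e e0 he].
    exists (Num.min e (b - t)); first by rewrite lt_min e0 subr_gt0.
    move=> s /andP[ts]; rewrite -ltrBlDl lt_min => /andP[s1 s2].
    by rewrite paste_path_lt; [apply: he; rewrite ts -ltrBlDl|move: s2; rewrite ltrD2r].
  rewrite paste_path_ge// => /(cadlag_right cy2)[|e e0 he]; first by rewrite subr_ge0.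
  exists e => // s /andP[ts se]; rewrite paste_path_ge ?(le_trans bt)//.
  by apply: he; rewrite lerD2r ts/=; lra.
have [tb|bt] := leP t b.
  exists (leftlim y1 t) => A /(cadlag_left cy1 t0)[e e0 he].
  exists e => // s /andP[es st]; rewrite paste_path_lt; last exact: lt_le_trans tb.
  by apply: he; rewrite es.
have tb0 : 0 < t - b by rewrite subr_gt0.
exists (leftlim y2 (t - b)) => A /(cadlag_left cy2 tb0)[e e0 he].
exists (Num.min e (t - b)); first by rewrite lt_min e0.
move=> s /andP[+ st]; rewrite ltrBlDr -ltrBlDl lt_min => /andP[s1 s2].
by rewrite paste_path_ge; [apply: he; apply/andP; split|]; lra.
Qed.

Lemma measurable_after : measurable ([set p | b < p.1] : set (R * Borel Uc)).
Proof.
rewrite (_ : mkset _ = ~` [set p : R * Borel Uc | p.1 <= b]).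
  exact: (measurableC (measurable_le_cst b (measurable_fst : measurable_fun setT (fst : R * Borel Uc -> R)))).
by apply/seteqP; split => p /=; [move=> h; apply/negP; rewrite -ltNge|move/negP; rewrite -ltNge].
Qed.

Lemma m1_after : m1 [set p | b < p.1] = 0%E.
Proof.
have mF (N : nat) : measurable ((I0 N%:R `*` setT) `\` (I0 b `*` setT) : set (R * Borel Uc)).
  by apply: measurableD; exact: measurable_I0T.
apply/negligibleP.
  exact: measurable_after.
apply: negligibleS (_ : negligible m1 (\bigcup_N ((I0 N%:R `*` setT) `\` (I0 b `*` setT)))).
  move=> [r u] /= br; exists (Num.truncn r).+1 => //.
  have rN : r <= (Num.truncn r).+1%:R by rewrite ltW// truncnS_gt.
  split; first by split => //; rewrite /I0 /= in_itv/= rN (le_trans b0 (ltW br)).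
  by move=> [/= + _]; rewrite /I0 /= in_itv/= => /andP[_]; rewrite leNgt br.
apply: negligible_bigcup => N; apply/negligibleP; first exact: mF.
have [Nb|bN] := leP N%:R b.
  rewrite (_ : _ `\` _ = set0) ?measure0//; rewrite -subset0 => -[r u] [[/= + _]] h.
  by rewrite /I0 /= in_itv/= => /andP[r0 rN]; apply: h; split => //; rewrite /I0 /= in_itv/= r0 (le_trans rN).
have sub : I0 b `*` setT `<=` (I0 N%:R `*` setT : set (R * Borel Uc)).
  by move=> [r u] [/= + _]; rewrite /I0 /= !in_itv/= => /andP[r0 rb]; split => //; rewrite r0 (le_trans rb (ltW bN)).
have e : m1 ((I0 b `*` setT) `|` ((I0 N%:R `*` setT) `\` (I0 b `*` setT))) =
    (m1 (I0 b `*` setT) + m1 ((I0 N%:R `*` setT) `\` (I0 b `*` setT)))%E.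
  by apply: measureU => //; [exact: measurable_I0T|rewrite setDIK].
rewrite setDUK// in e.
have bNl : 0 <= b <= N%:R by rewrite b0 ltW.
have := m1_lip bNl; rewrite (min_idPr (ltW bN)) minxx subrr adde0 e.
have key (x z : \bar R) : (0 <= x)%E -> (x < +oo)%E -> (0 <= z)%E -> (x + z <= x)%E -> z = 0%E.
  move: x z => [x| |] [z| |]//= _ _; rewrite -?EFinD ?lee_fin => z0 h.
  by congr EFin; lra.
by apply: key; [exact: measure_ge0|exact: m1_fin|exact: measure_ge0].
Qed.

Lemma measurable_shifted (D : set (R * Borel Uc)) : measurable D ->
  measurable ([set p | D (p.1 + b, p.2)] : set (R * Borel Uc)).
Proof. exact: (measurable_preimage (measurable_time_shift b)). Qed.

Lemma eq_m2 (D D' : set (R * Borel Uc)) : measurable D -> measurable D' ->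
  (forall p, 0 <= p.1 -> D p <-> D' p) -> m2 D = m2 D'.
Proof.
move=> mD mD' DD'; apply: (eq_measure_null (@measurable_lt0T R Uc) m2_neg) => // p np.
by apply: DD'; rewrite leNgt; apply/negP.
Qed.

Lemma eq_m1 (D D' : set (R * Borel Uc)) : measurable D -> measurable D' ->
  (forall p, p.1 <= b -> D p <-> D' p) -> m1 D = m1 D'.
Proof.
move=> mD mD' DD'; apply: (eq_measure_null measurable_after m1_after) => // p np.
by apply: DD'; rewrite leNgt; apply/negP.
Qed.

Lemma paste_I0 t C : measurable C ->
  m (I0 t `*` C) = (m1 (I0 t `*` C) + m2 (I0 (t - b) `*` C))%E.
Proof.
move=> mC; rewrite /m paste_measureE; congr (_ + _)%E.
have mI (s : R) : measurable (I0 s `*` C : set (R * Borel Uc)) by apply: measurableX => //; exact: measurable_I0.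
apply: eq_m2 => //; first exact: (measurable_shifted (mI t)).
move=> [r u] /= r0; rewrite /I0 /= !in_itv/= r0 addr_ge0//= lerBrDr; split => //.
Qed.

Lemma admissible_paste : admissible Xi y m.
Proof.
have cy := cadlag_paste; have [_ _ m2_0 m2_lip m2_off] := adm2.
have mI (s : R) : measurable (I0 s `*` setT : set (R * Borel Uc)) := measurable_I0T s.
split => //.
- rewrite /m paste_measureE m1_neg add0e; apply/eqP; rewrite -measure_le0 -m2_neg.
  apply: le_measure; rewrite ?inE; [exact: (measurable_shifted measurable_lt0T)|exact: measurable_lt0T|].
  by move=> [r u] /=; apply: le_lt_trans; rewrite lerDl.
- rewrite paste_I0// m1_0 add0e sub0r; apply/eqP; rewrite -measure_le0 -m2_0.
  apply: le_measure; rewrite ?inE//.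
  move=> [r u] [/= + _]; rewrite /I0 /= !in_itv/= => /andP[r0 rb]; split => //=.
  by rewrite r0 (le_trans rb)// oppr_le0.
- move=> s t /andP[s0 st]; have t0 := le_trans s0 st; rewrite !paste_I0//.
  have st' : 0 <= s <= t by rewrite s0.
  have h1 := m1_lip st'.
  (* Positive parts appear because [I0] of a negative number is empty. *)
  have h2 : (m2 (I0 (t - b) `*` setT) <= m2 (I0 (s - b) `*` setT) +
      (Num.max 0 (t - b) - Num.max 0 (s - b))%:E)%E.
    have [sb|bs] := leP 0 (s - b).
      have tb : 0 <= t - b by lra.
      by rewrite (max_idPr tb); apply: m2_lip; rewrite sb; lra.
    rewrite [I0 (s - b)]I0_lt0// set0X measure0 add0e subr0.
    have [tb|bt] := leP 0 (t - b); first by rewrite (admissible_le adm2).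
    by rewrite I0_lt0// set0X measure0.
  apply: (le_trans (leeD h1 h2)).
  (* This closes because min(t, b) + max(0, t - b) = t, and likewise for s. *)
  rewrite addeACA -EFinD; apply: leeD2l; rewrite lee_fin /Order.max /Order.min.
  by do 4 case: ltP => ?; lra.
have mX := measurable_off_Xi hE cE hU cU cXi.
rewrite /m paste_measureE.
have -> : m1 (off_Xi Xi y) = 0%E.
  rewrite -m1_off; apply: eq_m1; [exact: mX|exact: mX|].
  by move=> [r u] /= rb; rewrite /off_Xi /= paste_path_le.
rewrite add0e -m2_off; apply: eq_m2; [exact: (measurable_shifted (mX _ cy))|exact: mX|].
move=> [r u] /= r0; rewrite /off_Xi /= paste_path_ge ?lerDr// addrK.
by split => -[_ ?]; split => //; rewrite addr_ge0.
Qed.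

Lemma paste_time_integral (t K : R) (g : R -> R) : 0 <= t -> measurable_fun setT g ->
  (forall s, `|g s| <= K) ->
  fine (\int[lebesgue_measure]_(s in I0 t) (g s)%:E) =
  fine (\int[lebesgue_measure]_(s in I0 t `&` [set s | (s%:E <= b%:E)%E]) (g s)%:E) +
  fine (\int[lebesgue_measure]_(s in I0 (t - b)) (g (s + b))%:E).
Proof.
move=> t0 mg gK; pose leb : {measure set (measurableTypeR R) -> \bar R} := lebesgue_measure.
have mI (s : R) : measurable (I0 s : set (measurableTypeR R)) := measurable_I0 s.
have msh : measurable_fun setT (fun s : measurableTypeR R => s + b : measurableTypeR R).
  exact: measurable_funD.
have lebI (s : R) : (leb (I0 s) < +oo)%E.
  by have -> : leb (I0 s) = (Num.max 0 s)%:E by [exact: lebesgue_I0_max]; exact: ltry.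
pose l1 := mrestr leb (mI b).
pose l2 := image_measure (mrestr leb (mI (t - b))) msh.
pose nu : {measure set (measurableTypeR R) -> \bar R} := measure_add l1 l2.
have shI : (fun s : measurableTypeR R => s + b : measurableTypeR R) @^-1` I0 t `&` I0 (t - b) = I0 (t - b).
  apply/setIidr => s; rewrite /I0 /= !in_itv/= => /andP[s0 st].
  by rewrite addr_ge0//= -lerBrDr.
have -> : (\int[lebesgue_measure]_(s in I0 t) (g s)%:E = \int[nu]_(s in I0 t) (g s)%:E)%E.
  apply: (@eq_measure_integral _ (measurableTypeR R) _ (I0 t) nu leb) => D mD DI.
  transitivity (l1 D + l2 D)%E; last exact/esym/measure_addE.
  exact: (lebesgue_paste t0 b0 mD DI).
have i1 : l1.-integrable (I0 t) (EFin \o g).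
  apply: (bounded_integrable_on (K := K)) => //; last exact: measurable_funTS.
  by apply: le_lt_trans (lebI t); apply: le_measure; rewrite ?inE//; exact: measurableI.
have i2 : l2.-integrable (I0 t) (EFin \o g).
  apply: (bounded_integrable_on (K := K)) => //; last exact: measurable_funTS.
  by have -> : l2 (I0 t) = leb (I0 (t - b)) by [congr (lebesgue_measure _); exact: shI]; exact: lebI.
rewrite /nu (integral_measure_add (mI t) i1 i2) fineD; last 2 first.
- exact: integrable_fin_num i1.
- exact: integrable_fin_num i2.
congr (fine _ + fine _).
  rewrite (integral_mrestrI leb (mI b) (mI t)); last exact/measurable_EFinP/measurable_funTS.
  apply: eq_integral_set => s; rewrite /I0 /= !in_itv/=.
  by split => [[st /andP[_ sb]]|[/andP[s0 st] sb]]; rewrite ?lee_fin ?s0 ?st//.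
have mg' : measurable_fun setT (fun s : measurableTypeR R => g (s + b)) by exact: (measurableT_comp mg msh).
rewrite /l2 (integral_pushforward msh) => //; last 2 first.
- exact/measurable_EFinP.
- apply: (@bounded_integrable_on R _ (measurableTypeR R) (mrestr leb (mI (t - b))) _ (fun s : measurableTypeR R => g (s + b)) K) => //.
  + exact: (measurable_preimage msh).
  + by rewrite /= /mrestr shI; exact: lebI.
  + exact: measurable_funTS.
rewrite (integral_mrestrI leb (mI (t - b))); last 2 first.
- exact: (measurable_preimage msh).
- exact/measurable_EFinP/measurable_funTS.
by rewrite shI.
Qed.

Lemma paste_control_integral (t K : R) (G : R * Borel Uc -> R) : 0 <= t ->
  measurable_fun setT G -> (forall p, `|G p| <= K) ->
  fine (\int[m]_(p in I0 t `*` setT) (G p)%:E) =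
  fine (\int[m1]_(p in I0 t `*` setT) (G p)%:E) +
  fine (\int[m2]_(p in I0 (t - b) `*` setT) (G ((p.1 + b)%R, p.2))%:E).
Proof.
move=> t0 mG GK; have mI (s : R) := measurable_I0T s (Uc := Uc).
have msh := measurable_time_shift b.
pose l2 := image_measure m2 msh.
have m2I : (m2 (I0 (t - b) `*` setT) < +oo)%E.
  have [tb|tb] := leP 0 (t - b); first exact: (admissible_lt adm2).
  by rewrite I0_lt0// set0X measure0.
have l2I : l2 (I0 t `*` setT) = m2 (I0 (t - b) `*` setT).
  rewrite /l2 image_measureE; apply: eq_m2 => //; first exact: (measurable_shifted (mI t)).
  by move=> [r u] /= r0; rewrite /I0 /= !in_itv/= r0 addr_ge0//= lerBrDr.
have i1 : m1.-integrable (I0 t `*` setT) (EFin \o G).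
  by apply: (bounded_integrable_on (K := K)) => //; [exact: m1_fin|exact: measurable_funTS].
have i2 : l2.-integrable (I0 t `*` setT) (EFin \o G).
  by apply: (bounded_integrable_on (K := K)) => //; [rewrite l2I|exact: measurable_funTS].
have -> : (\int[m]_(p in I0 t `*` setT) (G p)%:E =
    \int[m1]_(p in I0 t `*` setT) (G p)%:E + \int[l2]_(p in I0 t `*` setT) (G p)%:E)%E.
  pose nu : LM := measure_add m1 l2.
  have h : (\int[m]_(p in I0 t `*` setT) (G p)%:E = \int[nu]_(p in I0 t `*` setT) (G p)%:E)%E.
    apply: (@eq_measure_integral _ _ _ _ nu m) => D _ _.
    by rewrite /m paste_measureE; apply/esym; exact: measure_addE.
  exact: (etrans h (integral_measure_add (mI t) i1 i2)).
rewrite fineD; last 2 first.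
- exact: integrable_fin_num i1.
- exact: integrable_fin_num i2.
congr (_ + fine _).
rewrite (integral_pushforward msh) => //; last 2 first.
- exact/measurable_EFinP.
- apply: (@bounded_integrable_on R _ _ m2 _ (fun p : R * Borel Uc => G ((p.1 + b)%R, p.2)) K) => //.
  + exact: (measurable_shifted (mI t)).
  + by move: l2I; rewrite /l2 image_measureE => ->.
  + by apply: measurable_funTS; exact: (measurableT_comp mG msh).
rewrite integral_mkcond [RHS]integral_mkcond.
apply: (eq_integral_null (measurable_lt0T (Uc := Uc)) m2_neg).
move=> [r u] _ /= /negP; rewrite -leNgt => r0; rewrite !patchE.
rewrite (_ : (_ \in _) = ((r, u) \in I0 (t - b) `*` setT))//.
apply/idP/idP; rewrite !inE /I0 /= !in_itv/= => -[/andP[h1 h2] _]; split => //.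
  by rewrite r0 lerBrDr.
by rewrite addr_ge0//= -lerBrDr.
Qed.

Hypothesis y1_frozen : forall t, b <= t -> y1 t = y1 b.
Variables (f a : E -> R) (c : E * Uc -> R).
Hypotheses (cf : continuous f) (ca : continuous a) (cc : continuous c).

(** The functional is additive under pasting: the integrals split at b, and the f-terms telescope
    because y2 starts where y1 is frozen. *)
Lemma compensated_paste_finite t : 0 <= t ->
  compensated_full y m f a c t = compensated f a c y1 m1 b%:E t +
    (if b <= t then compensated_full y2 m2 f a c (t - b) else 0).
Proof.
move=> t0; have cy := cadlag_paste.
have [Ka Ka0 aK] : exists2 K : R, 0 < K & forall x, setT x -> `|a x| <= K.
  by apply: continuous_compact_bounded => //; exact: continuous_subspaceT.
have [Kc Kc0 cK] : exists2 K : R, 0 < K & forall x, setT x -> `|c x| <= K.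
  apply: continuous_compact_bounded; first exact: compact_prodT.
  exact: continuous_subspaceT.
have mg : measurable_fun setT (fun s : R => a (y (clamp t s))).
  by have /rv_continuousP /(_ _ ca) := rv_path cy t0.
have mG : measurable_fun setT (fun p : R * Borel Uc => c (y (clamp t p.1), p.2)).
  by have /rv_continuousP /(_ _ cc) := rv_joint_path hE cE hU cU cy t0.
have := paste_time_integral t0 mg (K := Ka) (fun s => aK _ I).
have := paste_control_integral t0 mG (K := Kc) (fun s => cK _ I).
have -> : (\int[m]_(p in I0 t `*` setT) (c (y (clamp t p.1), p.2))%:E =
    \int[m]_(p in I0 t `*` setT) (c (y p.1, p.2))%:E)%E.
  by apply: eq_integral => -[s u]; rewrite inE /I0/= in_itv/= => -[st _]; rewrite clamp_id.
have -> : (\int[lebesgue_measure]_(s in I0 t) (a (y (clamp t s)))%:E =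
    \int[lebesgue_measure]_(s in I0 t) (a (y s))%:E)%E.
  by apply: eq_integral => s; rewrite inE /I0/= in_itv/= => st; rewrite clamp_id.
have -> : (\int[lebesgue_measure]_(s in I0 t `&` [set s | (s%:E <= b%:E)%E]) (a (y (clamp t s)))%:E =
    \int[lebesgue_measure]_(s in I0 t `&` [set s | (s%:E <= b%:E)%E]) (a (y1 s))%:E)%E.
  apply: eq_integral => s; rewrite inE /I0/= in_itv/= lee_fin => -[st sb].
  by rewrite clamp_id// paste_path_le.
have -> : (\int[m1]_(p in I0 t `*` setT) (c (y (clamp t p.1), p.2))%:E =
    \int[m1]_(p in I0 t `*` setT) (c (y1 p.1, p.2))%:E)%E.
  apply: (eq_integral_null (N := [set p | b < p.1])); [exact: measurable_after|exact: m1_after|].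
  move=> [s u] [/= + _] /negP; rewrite /I0/= in_itv/= -leNgt => st sb.
  by rewrite clamp_id// paste_path_le.
have shE s : 0 <= s <= t - b -> y (clamp t (s + b)) = y2 s.
  move=> /andP[s0 st]; rewrite clamp_id; last by rewrite addr_ge0//= -lerBrDr.
  by rewrite paste_path_ge ?lerDr// addrK.
have -> : (\int[lebesgue_measure]_(s in I0 (t - b)) (a (y (clamp t (s + b))))%:E =
    \int[lebesgue_measure]_(s in I0 (t - b)) (a (y2 s))%:E)%E.
  by apply: eq_integral => s; rewrite inE /I0/= in_itv/= => st; rewrite shE.
have -> : (\int[m2]_(p in I0 (t - b) `*` setT) (c (y (clamp t (p.1 + b)), p.2))%:E =
    \int[m2]_(p in I0 (t - b) `*` setT) (c (y2 p.1, p.2))%:E)%E.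
  by apply: eq_integral => -[s u]; rewrite inE /I0/= in_itv/= => -[st _]; rewrite shE.
move=> e2 e1; rewrite /compensated_full e1 e2 /compensated.
have -> : y 0 = y1 0 by rewrite paste_path_le.
have [bt|tb] := leP b t.
  rewrite (paste_path_ge bt) (y1_frozen bt) -y21.
  by move: (fine _) => u1; move: (fine _) => u2; move: (fine _) => u3; move: (fine _) => u4; lra.
rewrite paste_path_lt// [I0 (t - b)]I0_lt0 ?subr_lt0// set0X !integral_set0.
by rewrite /= !addr0.
Qed.

(** With Lebesgue measure in place of the Stieltjes measure, the condition splits at b into the
    conditions for the two pieces. *)
Lemma outside_paste_finite :
  (forall t, 0 <= t -> lebesgue_measure (I0 t `&` outside E0 y1 `&` [set s | (s%:E <= b%:E)%E]) =
     m1 ((I0 t `&` outside E0 y1) `*` setT)) ->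
  (forall t, 0 <= t -> lebesgue_measure (I0 t `&` outside E0 y2) =
     m2 ((I0 t `&` outside E0 y2) `*` setT)) ->
  forall t, 0 <= t -> lebesgue_measure (I0 t `&` outside E0 y) =
     m ((I0 t `&` outside E0 y) `*` setT).
Proof.
move=> h1 h2 t t0; have cy := cadlag_paste.
have mo (z : R -> E) (s : R) : cadlag z ->
    measurable ((I0 s `&` outside E0 z) : set (measurableTypeR R)).
  move=> cz; have [s0|s0] := leP 0 s; first exact: measurable_outside.
  by rewrite I0_lt0// set0I.
have moT (z : R -> E) (s : R) : cadlag z ->
    measurable ((I0 s `&` outside E0 z) `*` setT : set (R * Borel Uc)).
  by move=> cz; apply: measurableX => //; exact: mo.
have h2' : lebesgue_measure (I0 (t - b) `&` outside E0 y2) =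
     m2 ((I0 (t - b) `&` outside E0 y2) `*` setT).
  have [s0|s0] := leP 0 (t - b); first exact: h2.
  by rewrite I0_lt0// set0I set0X !measure0.
rewrite (lebesgue_paste t0 b0 (mo _ _ cy)); last by move=> s [].
rewrite /m paste_measureE; congr (_ + _)%E.
  transitivity (m1 ((I0 t `&` outside E0 y1) `*` setT)).
    rewrite -h1//; congr lebesgue_measure; apply/seteqP; split => s.
      move=> [[It o] /=]; rewrite /I0 /= in_itv/= => /andP[s0 sb]; split; [split => //|by rewrite lee_fin].
      by move: o; rewrite /outside /= paste_path_le.
    move=> [[It o] /=]; rewrite lee_fin => sb; split; [split => //|].
      by move: o; rewrite /outside /= paste_path_le.
    by move: It; rewrite /I0 /= !in_itv/= => /andP[-> _].
  apply: eq_m1; [exact: moT|exact: moT|move=> [s u] /= sb].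
  by split => -[[It o] _]; split => //; split => //; move: o; rewrite /outside /= paste_path_le.
transitivity (m2 ((I0 (t - b) `&` outside E0 y2) `*` setT)).
  rewrite -h2'; congr lebesgue_measure; apply/seteqP; split => s.
    move=> [[It o] /= Is]; split => //; move: (Is) o; rewrite /I0 /= in_itv/= => /andP[s0 _].
    by rewrite /outside /= paste_path_ge ?lerDr// addrK.
  move=> [Is o]; split => //; move: (Is) o; rewrite /I0 /= in_itv/= => /andP[s0 st].
  rewrite /outside /= => o; rewrite in_itv/= addr_ge0//= -lerBrDr; split => //.
  by rewrite paste_path_ge ?lerDr// addrK.
apply: eq_m2; [exact: moT|exact: (measurable_shifted (moT _ _ cy))|move=> [s u] /= s0].
rewrite /I0 /outside /= !in_itv/= s0 addr_ge0//= lerBrDr paste_path_ge ?lerDr// addrK.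
by split.
Qed.

End finite_time.
End pasting.

Section stopped_paste.
Context {R : realType} {E Uc : pseudoPMetricType R}.
Hypotheses (hE : hausdorff_space E) (cE : compact [set: E]).
Hypotheses (hU : hausdorff_space Uc) (cU : compact [set: Uc]).
Variables (E0 : set E) (Xi : set (E * Uc)) (cXi : closed Xi).
Local Notation LM := (@LMeas R Uc).
Variables (y1 y2 : R -> E) (F : R -> R) (m1 m2 : LM) (th : \bar R).
Hypotheses (cy1 : cadlag y1) (th0 : (0 <= th)%E) (m1LU : in_LU m1).
Hypotheses (F0 : forall t, 0 <= t -> 0 <= F t)
  (Fmono : forall s t : R, 0 <= s <= t -> F s <= F t)
  (Fm : forall t : R, 0 <= t -> ((F t)%:E + m1 (I0 t `*` setT) = mine t%:E th)%E)
  (m1_off : m1 (off_Xi Xi y1) = 0%E)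
  (y1_frozen : forall t, 0 <= t -> y1 t = y1 (tmin t th)).
Hypotheses (adm2 : admissible Xi y2 m2) (y21 : y2 0 = y1 (fine th)).

Let adm1 : admissible Xi y1 m1.
Proof. exact: (admissible_of_clock cy1 th0 m1LU F0 Fmono Fm m1_off). Qed.

Let lip b : th = b%:E -> forall s t : R, 0 <= s <= t -> (m1 (I0 t `*` setT) <=
     m1 (I0 s `*` setT) + (Num.min t b - Num.min s b)%:E)%E.
Proof.
move=> thb s t st; have /andP[s0 le_st] := st; have t0 := le_trans s0 le_st.
have mb (u : R) : mine u%:E b%:E = (Num.min u b)%:E.
  by rewrite /mine /Num.min /Order.min lte_fin; case: ifP.
have := Fm t0; have := Fm s0; have := Fmono st; rewrite thb !mb.
have := admissible_fin adm1 s0; have := admissible_fin adm1 t0.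
case: (m1 (I0 s `*` setT)) => // x; case: (m1 (I0 t `*` setT)) => // z _ _ Fst [e1] [e2].
by rewrite -EFinD lee_fin -e1 -e2; lra.
Qed.

Let frozen b : th = b%:E -> forall t, b <= t -> y1 t = y1 b.
Proof.
move=> thb t bt; have b0 : 0 <= b by rewrite -lee_fin -thb.
rewrite (y1_frozen (le_trans b0 bt)) /tmin thb lee_fin /=.
by case: ifP => // tb; congr y1; apply/eqP; rewrite eq_le tb.
Qed.

Lemma admissible_paste_stopped :
  admissible Xi (paste_path y1 th y2) (paste_measure m1 th m2).
Proof.
case thb : th => [b| |].
- have b0 : 0 <= b by rewrite -lee_fin -thb.
  have [_ n1 z1 _ _] := adm1.
  apply: (admissible_paste hE cE hU cU cXi b0 cy1 adm2 _ n1 z1 m1_off _ (lip thb)).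
    by rewrite y21 thb.
  by case: m1LU.
- rewrite (_ : paste_path _ _ _ = y1)//.
  by apply/funext => t; rewrite /paste_path ltry.
- by move: th0; rewrite thb.
Qed.

Lemma compensated_paste f a c t : continuous f -> continuous a -> continuous c -> 0 <= t ->
  compensated_full (paste_path y1 th y2) (paste_measure m1 th m2) f a c t =
  compensated f a c y1 m1 th t +
  (if (th <= t%:E)%E then compensated_full y2 m2 f a c (t - fine th) else 0).
Proof.
move=> cf ca cc t0; case thb : th => [b| |].
- have b0 : 0 <= b by rewrite -lee_fin -thb.
  have [_ n1 z1 _ _] := adm1.
  have y21b : y2 0 = y1 b by rewrite y21 thb.
  rewrite lee_fin.
  by apply: (compensated_paste_finite hE cE hU cU b0 cy1 adm2 y21b _ (lip thb)) => //;
    [case: m1LU|exact: frozen].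
- rewrite leye_eq /= addr0 (_ : paste_path _ _ _ = y1) ?compensated_fullE//.
  by apply/funext => s; rewrite /paste_path ltry.
- by move: th0; rewrite thb.
Qed.

Lemma outside_paste :
  (forall t, 0 <= t -> LS F (I0 t `&` outside E0 y1) = 0%E) ->
  (forall t, 0 <= t -> LS (idle_time m2) (I0 t `&` outside E0 y2) = 0%E) ->
  forall t, 0 <= t -> LS (idle_time (paste_measure m1 th m2))
     (I0 t `&` outside E0 (paste_path y1 th y2)) = 0%E.
Proof.
move=> h1 h2 t t0; have admP := admissible_paste_stopped.
have Ioo (D : set R) : D `&` [set s | (s%:E <= +oo)%E] = D.
  by apply/seteqP; split => [s []|s Ds]//; split => //=; exact: leey.
have oo0 : (0 <= +oo :> \bar R)%E by exact: leey.
have [cyP _ _ _ _] := admP; have [cy2 _ _ _ _] := adm2.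
apply/(clock_outsideP E0 cyP oo0 (admissible_in_LU admP) (idle_time_ge0 admP)
  (idle_time_mono admP) (idle_timeE admP) t0); rewrite Ioo.
have h1' s : 0 <= s -> lebesgue_measure (I0 s `&` outside E0 y1 `&` [set s | (s%:E <= th)%E]) =
     m1 ((I0 s `&` outside E0 y1) `*` setT).
  by move=> s0; apply/(clock_outsideP E0 cy1 th0 m1LU F0 Fmono Fm s0); exact: h1.
have h2' s : 0 <= s -> lebesgue_measure (I0 s `&` outside E0 y2) =
     m2 ((I0 s `&` outside E0 y2) `*` setT).
  move=> s0; rewrite -[LHS](congr1 lebesgue_measure (Ioo _)).
  apply/(clock_outsideP E0 cy2 oo0 (admissible_in_LU adm2) (idle_time_ge0 adm2)
    (idle_time_mono adm2) (idle_timeE adm2) s0); exact: h2.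
case thb : th => [b| |].
- have b0 : 0 <= b by rewrite -lee_fin -thb.
  have y21b : y2 0 = y1 b by rewrite y21 thb.
  apply: (outside_paste_finite b0 cy1 adm2 y21b _ (lip thb)) => //; first by case: m1LU.
  by move=> s s0; rewrite -thb; exact: h1'.
- rewrite (_ : paste_path _ _ _ = y1); last by apply/funext => s; rewrite /paste_path ltry.
  by rewrite /= -h1'// thb Ioo.
- by move: th0; rewrite thb.
Qed.

End stopped_paste.

Section evaluation_paths.
Context {R : realType} {E Uc : pseudoPMetricType R}.
Variables (Xi : set (E * Uc)) (y : R -> E) (m : @LMeas R Uc).
Hypothesis ym : admissible Xi y m.

Lemma evaluation_fin t (C : set (Borel Uc)) : measurable C -> m (I0 t `*` C) \is a fin_num.
Proof.
move=> mC; have [t0|t0] := leP 0 t; last by rewrite I0_lt0// set0X measure0.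
rewrite ge0_fin_numE ?measure_ge0//; apply: le_lt_trans (admissible_lt ym t0).
apply: le_measure; rewrite ?inE; [|exact: measurable_I0T|by move=> p []].
by apply: measurableX => //; exact: measurable_I0.
Qed.

Lemma evaluation_lip s t (C : set (Borel Uc)) : measurable C -> s <= t ->
  fine (m (I0 s `*` C)) <= fine (m (I0 t `*` C)) <= fine (m (I0 s `*` C)) + (t - s).
Proof.
move=> mC st; have mI (u : R) : measurable (I0 u `*` C : set (R * Borel Uc)).
  by apply: measurableX => //; exact: measurable_I0.
have mIT (u : R) := measurable_I0T u (Uc := Uc).
rewrite -!lee_fin EFinD !fineK ?evaluation_fin//; apply/andP; split.
  apply: le_measure; rewrite ?inE//.
  by move=> [r u] []; rewrite /I0 /= !in_itv/= => /andP[-> rs] Cu; rewrite (le_trans rs).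
apply: (@le_trans _ _ (m (I0 s `*` C) + m ((I0 t `*` setT) `\` (I0 s `*` setT)))%E).
  apply: le_trans (measureU2 m (mI s) (measurableD (mIT t) (mIT s))).
  apply: le_measure; rewrite ?inE//; first by apply: measurableU => //; exact: measurableD.
  move=> [r u] [It Cu]; have [Is|nIs] := pselect (I0 s r); [by left|right].
  by split => // -[].
apply: leeD2l; have [s0|s0] := leP 0 s; first by apply: (admissible_increment ym); rewrite s0.
have [t0|t0] := leP 0 t; last first.
  by rewrite (I0_lt0 t0) set0X set0D measure0 lee_fin subr_ge0.
rewrite (I0_lt0 s0) set0X setD0; apply: le_trans (admissible_le ym t0) _.
by rewrite lee_fin lerDl oppr_ge0 ltW.
Qed.

(** The evaluations are Lipschitz in time, so [rv_progressive] applies to them and controls can be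
    evaluated at the random elapsed time. *)
Lemma cadlag_evaluation (C : set (Borel Uc)) : measurable C ->
  cadlag (fun s => fine (m (I0 s `*` C)) : R^o).
Proof.
move=> mC; pose g (s : R) := fine (m (I0 s `*` C)).
have cg : continuous g.
  move=> t; apply/cvgrPdist_le => e e0; near=> s.
  have ts : `|t - s| <= e by near: s; exact: cvgr_dist_le.
  apply: le_trans ts; have [st|ts] := leP s t.
    have /andP[h1 h2] := evaluation_lip mC st.
    by rewrite !ger0_norm ?subr_ge0// /g; lra.
  have /andP[h1 h2] := evaluation_lip mC (ltW ts).
  have -> : `|t - s| = s - t by rewrite distrC gtr0_norm ?subr_gt0.
  by rewrite ler_norml /g; apply/andP; split; lra.
split => t _; first exact: cvg_within_filter (cg t).
by apply/cvg_ex; exists (g t); exact: cvg_within_filter (cg t).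
Unshelve. all: end_near. Qed.

End evaluation_paths.

Section pasted_process.
Context {R : realType} {E Uc : pseudoPMetricType R}.
Hypotheses (hE : hausdorff_space E) (cE : compact [set: E]).
Hypotheses (hU : hausdorff_space Uc) (cU : compact [set: Uc]).
Variables (E0 : set E) (Xi : set (E * Uc)) (cXi : closed Xi).
Variables (DA DB : set (E -> R)) (A : (E -> R) -> (E -> R)) (B : (E -> R) -> (E * Uc -> R)).
Hypotheses (DA_cont : forall f, DA f -> continuous f)
  (A_cont : forall f, DA f -> continuous (A f)).
Variables (U : set E) (oU : open U).
Local Notation LM := (@LMeas R Uc).
Context {d : measure_display} {Om : measurableType d} (P : probability Om R).
Variables (YU : Om -> R -> E) (l0U : Om -> R -> R) (LU : Om -> LM).
Hypothesis sol : stopped_cmp_solution E0 Xi DA A DB B U P YU l0U LU.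
Local Notation RR := (measurableTypeR R).
Variables (yd : RR -> R -> E) (Ld : RR -> LM).
Hypotheses (adm : forall r, admissible Xi (yd r) (Ld r))
  (ryd : forall t, 0 <= t -> rv (yd ^~ t))
  (mLd : forall D, measurable D -> measurable_fun setT (Ld ^~ D)).
Let th w := exit_time U (YU w).

Let cYU w : cadlag (YU w). Proof. by case: sol. Qed.
Let rYU t : 0 <= t -> rv (YU ^~ t). Proof. by move: t; case: sol => _ []. Qed.
Let mLU s C : 0 <= s -> measurable C -> measurable_fun setT (fun w => LU w (I0 s `*` C)).
Proof. exact: (solution_measurable_evaluation cU sol). Qed.
Let mth : measurable_fun setT th.
Proof. exact: measurable_exit_time. Qed.

Section sub_sigma_algebra.
Context {d2 : measure_display} {T2 : measurableType d2}.
Variables (y2 : T2 -> R -> E) (L2 : T2 -> LM) (v : R).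
Hypotheses (v0 : 0 <= v) (adm2 : forall r, admissible Xi (y2 r) (L2 r))
  (ry2 : forall s, 0 <= s <= v -> rv (y2 ^~ s))
  (mL2 : forall s C, 0 <= s <= v -> measurable C ->
    measurable_fun setT (fun r => L2 r (I0 s `*` C))).

Let measurable_lapse u : measurable_fun setT
  (fun p : Om * T2 => (p.2, u - fine (th p.1) : RR) : T2 * RR).
Proof.
apply/measurable_fun_pairP; split; first exact: measurable_snd.
apply: measurable_funB => //.
rewrite (_ : (fun p => _) = fine \o (th \o fst))//.
by apply: measurableT_comp => //; exact: measurableT_comp mth measurable_fst.
Qed.

Let measurable_before_exit u : measurable [set p : Om * T2 | (u%:E < th p.1)%E].
Proof.
rewrite -[X in measurable X]setTI; apply: emeasurable_fun_o_infty => //.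
exact: measurableT_comp mth measurable_fst.
Qed.

(** The second factor is an arbitrary measurable space, used twice: as the Borel line, and as the
    line with the past of the continuation up to v. Clamping the elapsed time at v ensures that only
    that past is consulted. *)
Lemma rv_paste_path u : 0 <= u ->
  rv (fun p : Om * T2 => if (u%:E < th p.1)%E then YU p.1 u
                         else y2 p.2 (clamp v (u - fine (th p.1)))).
Proof.
move=> u0; have cy2 r : cadlag (y2 r) by have [] := adm2 r.
rewrite (_ : (fun p : Om * T2 => _) = (fun p : Om * T2 =>
  if p \in [set p : Om * T2 | (u%:E < th p.1)%E] then YU p.1 u
                         else y2 p.2 (clamp v (u - fine (th p.1))))); last first.
  apply/funext => p; suff -> : (p \in [set p : Om * T2 | (u%:E < th p.1)%E]) = (u%:E < th p.1)%E by [].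
  by apply/idP/idP; rewrite inE.
apply: rv_if; first exact: measurable_before_exit.
  by apply: (rv_measurable_comp _ (rYU u0)); exact: measurable_fst.
have h := rv_progressive cy2 v0 ry2.
exact: (rv_measurable_comp (measurable_lapse u) h).
Qed.

Lemma measurable_paste_evaluation u C : 0 <= u -> measurable C ->
  measurable_fun setT (fun p : Om * T2 => (LU p.1 (I0 u `*` C) +
    (if u%:E < th p.1 then 0 else L2 p.2 (I0 (clamp v (u - fine (th p.1))) `*` C)))%E).
Proof.
move=> u0 mC; apply: emeasurable_funD.
  by apply: (measurableT_comp (mLU u0 mC)); exact: measurable_fst.
apply: measurable_fun_if => //.
- apply: (measurable_fun_bool true); rewrite setTI; exact: measurable_before_exit.
- apply: measurable_funTS.
  rewrite (_ : (fun p => _) = (fun q : T2 * RR => (fine (L2 q.1 (I0 (clamp v q.2) `*` C)))%:E) \o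
     (fun p : Om * T2 => (p.2, u - fine (th p.1) : RR))); last first.
    by apply/funext => p /=; rewrite fineK// (evaluation_fin (adm2 _)).
  apply: measurableT_comp; last exact: measurable_lapse.
  apply/measurable_EFinP/rv_realP.
  apply: (@rv_progressive R _ T2 R (fun r s => fine (L2 r (I0 s `*` C))) v _ v0).
    by move=> r; exact: (cadlag_evaluation (adm2 r)).
  move=> s sv; apply/rv_realP; apply: measurableT_comp => //; exact: mL2.
Qed.

End sub_sigma_algebra.
Variable G : set (Om * RR).
Hypothesis mG : measurable G.
Hypothesis Ggood : forall p, G p -> [/\ regular_at E0 Xi U YU l0U LU p.1,
  yd p.2 0 = YU p.1 (fine (th p.1)) &
  forall t, 0 <= t -> LS (idle_time (Ld p.2)) (I0 t `&` outside E0 (yd p.2)) = 0%E].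

(* Off the full-measure set [G] path and control are constants, so that the admissibility of
   the pasted pair and the clock identity hold for every [p], not just almost surely. *)
Definition pasted_path (p : Om * RR) (t : R) : E :=
  if p \in G then paste_path (YU p.1) (th p.1) (yd p.2) t else point.

Definition pasted_control (p : Om * RR) : LM :=
  if p \in G then paste_measure (LU p.1) (th p.1) (Ld p.2) else mzero.

Lemma pasted_pathE p : G p -> pasted_path p = paste_path (YU p.1) (th p.1) (yd p.2).
Proof. by move=> Gp; apply/funext => t; rewrite /pasted_path mem_set. Qed.

Lemma pasted_controlE p : G p -> pasted_control p = paste_measure (LU p.1) (th p.1) (Ld p.2).
Proof. by move=> Gp; rewrite /pasted_control mem_set. Qed.

Let LUi w : in_LU (LU w). Proof. by case: sol => _ [_ [_ [_ []]]]. Qed.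
Let l00 w t : 0 <= t -> 0 <= l0U w t.
Proof. by move: t; case: sol => _ [_ [/(_ w)[]]]. Qed.
Let l0mono w s t : 0 <= s <= t -> l0U w s <= l0U w t.
Proof. by move: s t; case: sol => _ [_ [/(_ w)[]]]. Qed.

Lemma admissible_pasted p : admissible Xi (pasted_path p) (pasted_control p).
Proof.
have [Gp|Gp] := pselect (G p).
  have [[ck xi fr _] yy _] := Ggood Gp; rewrite pasted_pathE// pasted_controlE//.
  apply: (admissible_paste_stopped hE cE hU cU cXi (cYU p.1) (exit_time_ge0 U (YU p.1)) (LUi p.1)
    (l00 p.1) (l0mono p.1) ck xi (adm p.2) yy).
rewrite (_ : pasted_path p = fun=> point); last first.
  by apply/funext => t; rewrite /pasted_path memNset.
rewrite /pasted_control memNset//; split => //.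
- by split => t _; [exact: cvg_cst|apply/cvg_ex; exists point; exact: cvg_cst].
- by move=> s t /andP[s0 st]; rewrite /= /mzero add0e lee_fin subr_ge0.
Qed.

Lemma compensated_pasted p f a c t : G p -> continuous f -> continuous a -> continuous c -> 0 <= t ->
  compensated_full (pasted_path p) (pasted_control p) f a c t =
  compensated f a c (YU p.1) (LU p.1) (th p.1) t +
  (if (th p.1 <= t%:E)%E then compensated_full (yd p.2) (Ld p.2) f a c (t - fine (th p.1)) else 0).
Proof.
move=> Gp cf ca cc t0; have [[ck xi fr _] yy _] := Ggood Gp; rewrite pasted_pathE// pasted_controlE//.
have fr' s : 0 <= s -> YU p.1 s = YU p.1 (tmin s (exit_time U (YU p.1))).
  by move=> s0; have [] := fr s s0.
exact: (compensated_paste hE cE hU cU (cYU p.1) (exit_time_ge0 U (YU p.1)) (LUi p.1)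
    (l00 p.1) (l0mono p.1) ck xi fr' (adm p.2) yy cf ca cc t0).
Qed.

Lemma outside_pasted p t : G p -> 0 <= t ->
  LS (idle_time (pasted_control p)) (I0 t `&` outside E0 (pasted_path p)) = 0%E.
Proof.
move=> Gp t0; have [[ck xi fr cl] yy cl2] := Ggood Gp; rewrite pasted_pathE// pasted_controlE//.
by apply: (outside_paste hE cE hU cU cXi (cYU p.1) (exit_time_ge0 U (YU p.1)) (LUi p.1)
    (l00 p.1) (l0mono p.1) ck xi (adm p.2) yy cl cl2 t0).
Qed.

Lemma exit_time_pasted p : G p -> exit_time U (pasted_path p) = th p.1.
Proof.
move=> Gp; have [_ yy _] := Ggood Gp; rewrite pasted_pathE//.
apply: (exit_time_eq oU (cYU p.1)) => t t0; rewrite -/(th p.1) le_eqVlt /paste_path => /orP[/eqP e|->//].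
by rewrite -e ltxx /= subrr yy -e.
Qed.

Lemma pasted_control_I0 p u C : G p -> measurable C ->
  pasted_control p (I0 u `*` C) = (LU p.1 (I0 u `*` C) +
    (if u%:E < th p.1 then 0 else Ld p.2 (I0 (u - fine (th p.1)) `*` C)))%E.
Proof.
move=> Gp mC; rewrite pasted_controlE//; have := exit_time_ge0 U (YU p.1); rewrite -/(th p.1).
case thb : (th p.1) => [b| |] // b0.
- rewrite lee_fin in b0; rewrite (paste_I0 (LU p.1) b0 (adm p.2))//; congr (_ + _)%E.
  rewrite lte_fin; case: ltP => // ub.
  by rewrite I0_lt0 ?subr_lt0// set0X measure0.
- by rewrite ltry adde0.
Qed.

Lemma rv_pasted_path t : 0 <= t -> rv (pasted_path ^~ t).
Proof.
move=> t0; have h := rv_paste_path t0 adm (fun s s0 => ryd (proj1 (andP s0))) t0.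
have -> : pasted_path ^~ t = fun p => if p \in G then
    (if (t%:E < th p.1)%E then YU p.1 t else yd p.2 (clamp t (t - fine (th p.1)))) else point.
  apply/funext => p; rewrite /pasted_path /paste_path; case: ifP => // _; case: ifPn => //.
  rewrite -leNgt => tht; rewrite clamp_id// gerBl fine_ge0 ?exit_time_ge0// andbT subr_ge0.
  by case: (th p.1) tht (exit_time_ge0 U (YU p.1 : R -> E)) => [b| |]//=.
by apply: rv_if => //; exact: rv_const.
Qed.

Lemma measurable_pasted_control u C : 0 <= u -> measurable C ->
  measurable_fun setT (fun p => pasted_control p (I0 u `*` C)).
Proof.
move=> u0 mC.
have mLd' (s : R) D : 0 <= s <= u -> measurable D -> measurable_fun setT (fun r => Ld r (I0 s `*` D)).
  by move=> _ mD; apply: mLd; apply: measurableX => //; exact: measurable_I0.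
have h := measurable_paste_evaluation u0 adm mLd' u0 mC.
have -> : (fun p => pasted_control p (I0 u `*` C)) = fun p => if p \in G then
    (LU p.1 (I0 u `*` C) +
    (if u%:E < th p.1 then 0 else Ld p.2 (I0 (clamp u (u - fine (th p.1))) `*` C)))%E else 0%E.
  apply/funext => p; case: ifPn => [/set_mem Gp|Gp]; last first.
    by rewrite /pasted_control (negbTE Gp).
  rewrite pasted_control_I0//; congr (_ + _)%E; case: ifPn => //.
  rewrite -leNgt => tht; rewrite clamp_id// gerBl fine_ge0 ?exit_time_ge0// andbT subr_ge0.
  by case: (th p.1) tht (exit_time_ge0 U (YU p.1 : R -> E)) => [b| |]//=.
apply: measurable_fun_if => //; last exact: measurable_funTS.
apply: (measurable_fun_bool true); rewrite setTI (_ : _ @^-1` _ = G)//.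
by apply/seteqP; split => r; rewrite /preimage/=; [move/set_mem|move/mem_set].
Qed.

End pasted_process.

(** * The martingale property after pasting *)

Lemma integral_cvg_eq0 {R : realType} d (T : measurableType d) (P : probability T R) (D : set T)
    (h_ : nat -> T -> R) (h : T -> R) (K : R) : measurable D ->
  (forall n, measurable_fun setT (h_ n)) -> (forall n x, `|h_ n x| <= K) ->
  (forall x, h_ n x @[n --> \oo] --> h x) ->
  (forall n, \int[P]_(x in D) (h_ n x)%:E = 0)%E ->
  measurable_fun setT h /\ (\int[P]_(x in D) (h x)%:E = 0)%E.
Proof.
move=> mD mh hK hh h0.
have mlim : measurable_fun setT h by apply: (measurable_fun_cvg (h := h_)) => // x _; exact: hh.
split => //.
have m1 n : measurable_fun D (fun x => (h_ n x)%:E).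
  by apply/measurable_EFinP; exact: measurable_funTS.
have m2 : measurable_fun D (fun x => (h x)%:E).
  by apply/measurable_EFinP; exact: measurable_funTS.
have c1 : {ae P, forall x, D x -> (h_ n x)%:E @[n --> \oo] --> (h x)%:E}.
  by apply: aeW => x _; apply: cvg_EFin; [exact: nearW|exact: hh].
have i1 : P.-integrable D (EFin \o (fun=> K)).
  apply: (bounded_integrable_on (K := `|K|)) => //.
  by apply: le_lt_trans (probability_le1 P mD) _; exact: ltry.
have b1 : {ae P, forall x, forall n, D x -> (`|(h_ n x)%:E| <= (EFin \o (fun=> K)) x)%E}.
  by apply: aeW => x n _; rewrite abse_EFin lee_fin.
have [_ _ hc] := dominated_convergence mD m1 m2 c1 i1 b1.
apply/esym/(cvg_unique _ _ hc) => //.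
by apply: cvg_near_cst; apply: nearW => n; exact: h0.
Qed.

Lemma dist_max0 {R : realType} (x y : R) : `|Num.max 0 x - Num.max 0 y| <= `|x - y|.
Proof.
have := ler_norm (x - y); have := ler_norm (y - x); rewrite (distrC y) ler_norml.
by move: `|_| => r; case: (leP 0 x); case: (leP 0 y); lra.
Qed.

Lemma measurable_fun_pieces {R : realType} d (T : measurableType d) (k : T -> nat)
    (h : T -> R) (g : nat -> T -> R) : (forall j, measurable [set x | k x = j]) ->
  (forall j, measurable_fun setT (g j)) -> (forall x, h x = g (k x) x) ->
  measurable_fun setT h.
Proof.
move=> mk mg hg; rewrite (_ : setT = \bigcup_j [set x | k x = j]); last first.
  by apply/seteqP; split => x _ //; exists (k x).
apply/measurable_fun_bigcup => // j; apply: (eq_measurable_fun (g j)); last exact: measurable_funTS.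
by move=> x /set_mem /= <-; rewrite hg.
Qed.

Lemma compensated_at0 {R : realType} {E Uc : pseudoPMetricType R} (Xi : set (E * Uc)) (y : R -> E)
    (m : @LMeas R Uc) (f a : E -> R) (c : E * Uc -> R) : admissible Xi y m ->
  compensated_full y m f a c 0 = 0.
Proof.
move=> [_ _ m0 _ _]; rewrite /compensated_full subrr.
have -> : (\int[m]_(p in I0 0 `*` setT) (c (y p.1, p.2))%:E = 0)%E.
  rewrite (eq_integral_null (N := I0 0 `*` setT) (g := cst 0%E)) ?integral0//.
  exact: measurable_I0T.
have -> : (\int[lebesgue_measure]_(s in I0 0%R) (a (y s))%:E = 0)%E.
  rewrite (_ : I0 0%R = [set 0%R]) ?integral_set1//.
  by apply/seteqP; split => s; rewrite /I0 /= in_itv/=; [rewrite -eq_le => /eqP|move=> ->; rewrite lexx].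
by rewrite !subr0.
Qed.

Section rectangles.
Context {R : realType} {d : measure_display} {Om : measurableType d}.
Local Notation RR := (measurableTypeR R).
Variables (P : probability (Om * RR)%type R) (gens : set (set RR)).
Hypothesis gens_measurable : gens `<=` measurable.
Variables (phi : Om * RR -> R) (K : R).
Hypotheses (mphi : measurable_fun setT phi) (phiK : forall p, `|phi p| <= K).
Hypothesis rect0 : forall (B : set Om) (D : set RR), measurable B -> <<s gens >> D ->
  (\int[P]_(p in B `*` D) (phi p)%:E = 0)%E.

(** Zero integral passes to complements and countable disjoint unions. Measurability in the full
    product is carried along in the same induction, so that these integrals can be split. *)
Lemma integral0_subproduct (X : set (Om * g_sigma_algebraType gens)) : measurable X ->
  measurable (X : set (Om * RR)) /\ (\int[P]_(p in (X : set (Om * RR))) (phi p)%:E = 0)%E.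
Proof.
have sub : <<s gens >> `<=` (measurable : set (set RR)).
  by apply: smallest_sub => //; exact: sigma_algebra_measurable.
have iphi (D : set (Om * RR)) : measurable D -> P.-integrable D (EFin \o phi).
  move=> mD; apply: (bounded_integrable_on (K := K)) => //.
    by apply: le_lt_trans (probability_le1 P mD) _; exact: ltry.
  exact: measurable_funTS.
have GE := measurable_prod_measurableType Om (g_sigma_algebraType gens).
move=> mX; have {}mX : <<s [set (D1 `*` D2 : set (Om * g_sigma_algebraType gens)) |
    D1 in d.-measurable & D2 in gens.-sigma.-measurable] >> X by rewrite -GE.
move: X mX; apply: (dynkin_induction GE).
- move=> _ _ [B1 mB1 [D1 mD1 <-]] [B2 mB2 [D2 mD2 <-]]; rewrite -setXI.
  exists (B1 `&` B2); first exact: measurableI.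
  by exists (D1 `&` D2) => //; exact: measurableI.
- split; first exact: measurableT.
  by rewrite -setXTT; apply: rect0 => //; exact: (@measurableT _ (g_sigma_algebraType gens)).
- move=> _ [B1 mB1 [D1 mD1 <-]]; split; last exact: rect0.
  by apply: measurableX => //; exact: sub.
- move=> S _ [mS S0]; split; first exact: measurableC.
  have mSC := measurableC mS.
  have e : (\int[P]_(p in setT) (phi p)%:E = \int[P]_(p in S) (phi p)%:E + \int[P]_(p in ~` S) (phi p)%:E)%E.
    rewrite -(setUv S) integral_setU_EFin//.
    - by rewrite setUv.
    - by apply/disj_setPS => x [].
  have T0 : (\int[P]_(p in setT) (phi p)%:E = 0)%E.
    by rewrite -setXTT; apply: rect0 => //; exact: (@measurableT _ (g_sigma_algebraType gens)).
  by move: e; rewrite S0 T0 add0e.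
- move=> F _ tF FF; pose F' : nat -> set (Om * RR) := F.
  have mF k : measurable (F' k) by have [] := FF k.
  have mUF : measurable (\bigcup_k F' k) by exact: bigcupT_measurable.
  split; first exact: mUF.
  apply: (etrans (@integral_bigcup _ (Om * RR)%type R P F' (EFin \o phi) tF mF (iphi _ mUF))).
  by apply: eseries0 => k _ _; have [_] := FF k.
Qed.

End rectangles.

Section frozen.
Context {R : realType} {E Uc : pseudoPMetricType R}.
Variables (y : R -> E) (m : @LMeas R Uc) (th : \bar R).
Hypothesis th0 : (0 <= th)%E.
Hypothesis m_frozen : forall t, 0 <= t -> m (I0 t `*` setT) = m (I0 (tmin t th) `*` setT).
Hypothesis mLU : in_LU m.

Let tmin_frozen u : (th <= u%:E)%E -> tmin u th = fine th.
Proof. by rewrite /tmin le_eqVlt => /predU1P[->|h]; [rewrite lexx|rewrite leNgt h]. Qed.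

Lemma frozen_null s t : (th <= s%:E)%E -> 0 <= s <= t ->
  m ((I0 t `*` setT) `\` (I0 s `*` setT)) = 0%E.
Proof.
move=> ths /andP[s0 st]; have t0 := le_trans s0 st.
have tst : (th <= t%:E)%E by rewrite (le_trans ths)// lee_fin.
have mI (u : R) := measurable_I0T u (Uc := Uc).
have sub : I0 s `*` setT `<=` (I0 t `*` setT : set (R * Borel Uc)).
  by move=> [r u] [/= + _]; rewrite /I0 /= !in_itv/= => /andP[r0 rs]; rewrite r0 (le_trans rs).
have e : m ((I0 s `*` setT) `|` ((I0 t `*` setT) `\` (I0 s `*` setT))) =
    (m (I0 s `*` setT) + m ((I0 t `*` setT) `\` (I0 s `*` setT)))%E.
  by apply: measureU => //; [exact: measurableD|rewrite setDIK].
move: e; rewrite setDUK// (m_frozen t0) (m_frozen s0) !tmin_frozen//.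
have : m (I0 (fine th) `*` setT) \is a fin_num.
  by rewrite ge0_fin_numE ?measure_ge0//; have [_] := mLU; apply; rewrite fine_ge0.
case: (m (I0 (fine th) `*` setT)) => // x _; case: (m _) => // z [e].
by congr EFin; lra.
Qed.

Hypothesis y_frozen : forall t, 0 <= t -> y t = y (tmin t th).

Lemma compensated_frozen f a c s t : (th <= s%:E)%E -> 0 <= s <= t ->
  compensated f a c y m th t = compensated f a c y m th s.
Proof.
move=> ths /andP[s0 st]; have t0 := le_trans s0 st.
have tst : (th <= t%:E)%E by rewrite (le_trans ths)// lee_fin.
rewrite /compensated (y_frozen t0) (y_frozen s0) !tmin_frozen//.
congr (_ - fine _ - fine _).
  apply: eq_integral_set => u; rewrite /I0 /= !in_itv/=; split => -[/andP[u0 us] uth]; split => //.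
    by rewrite u0 -lee_fin (le_trans uth).
  by rewrite u0 (le_trans us).
have mI (u : R) := measurable_I0T u (Uc := Uc).
have sub : I0 s `*` setT `<=` (I0 t `*` setT : set (R * Borel Uc)).
  by move=> [r u] [/= + _]; rewrite /I0 /= !in_itv/= => /andP[r0 rs]; rewrite r0 (le_trans rs).
have N0 := frozen_null ths (introT andP (conj s0 st)).
rewrite integral_mkcond [RHS]integral_mkcond.
apply: (eq_integral_null (measurableD (mI t) (mI s)) N0) => p _ np; rewrite !patchE.
suff -> : (p \in I0 t `*` setT) = (p \in I0 s `*` setT) by [].
apply/idP/idP; rewrite !inE => h; last exact: sub.
by apply: contrapT => nh; apply: np.
Qed.

End frozen.

Section pasted_martingale.
Context {R : realType} {E Uc : pseudoPMetricType R}.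
Hypotheses (hE : hausdorff_space E) (cE : compact [set: E]).
Hypotheses (hU : hausdorff_space Uc) (cU : compact [set: Uc]).
Variables (E0 : set E) (Xi : set (E * Uc)) (cXi : closed Xi).
Variables (DA DB : set (E -> R)) (A : (E -> R) -> (E -> R)) (B : (E -> R) -> (E * Uc -> R)).
Hypotheses (DA_cont : forall f, DA f -> continuous f)
  (A_cont : forall f, DA f -> continuous (A f)).
Variables (U : set E) (oU : open U).
Local Notation LM := (@LMeas R Uc).
Context {d : measure_display} {Om : measurableType d} (P : probability Om R).
Variables (YU : Om -> R -> E) (l0U : Om -> R -> R) (LU : Om -> LM).
Hypothesis sol : stopped_cmp_solution E0 Xi DA A DB B U P YU l0U LU.
Local Notation RR := (measurableTypeR R).
Variables (yd : RR -> R -> E) (Ld : RR -> LM).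
Hypotheses (adm : forall r, admissible Xi (yd r) (Ld r))
  (ryd : forall t, 0 <= t -> rv (yd ^~ t))
  (mLd : forall D, measurable D -> measurable_fun setT (Ld ^~ D)).
Let th w := exit_time U (YU w).
Variable G : set (Om * RR).
Hypothesis mG : measurable G.
Hypothesis Ggood : forall p, G p -> [/\ regular_at E0 Xi U YU l0U LU p.1,
  yd p.2 0 = YU p.1 (fine (th p.1)) &
  forall t, 0 <= t -> LS (idle_time (Ld p.2)) (I0 t `&` outside E0 (yd p.2)) = 0%E].
Variables (Q : probability RR R) (P' : probability (Om * RR)%type R).
Hypothesis G0 : P' (~` G) = 0%E.
Hypothesis marg : forall D, measurable D -> P' (D `*` setT) = P D.
Hypothesis indep : forall (h : R -> R) (K : R), measurable_fun setT h -> (forall r, `|h r| <= K) ->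
  (forall C : set (Borel E), measurable C -> (\int[Q]_(r in (yd ^~ 0%R) @^-1` C) (h r)%:E = 0)%E) ->
  forall D, measurable D -> (\int[P']_(p in D `*` setT) (h p.2)%:E = 0)%E.

Local Notation Y := (pasted_path U YU yd G).
Local Notation L := (pasted_control U YU LU Ld G).
Local Notation l0 := (fun p => idle_time (L p)).

Section test_function.
Variables (f a : E -> R) (k : E * Uc -> R).
Hypotheses (cf : continuous f) (ca : continuous a) (ck : continuous k).
Local Notation cd r := (compensated_full (yd r) (Ld r) f a k).
Hypothesis mart : forall s t D, 0 <= s <= t -> path_filtration yd Ld s D ->
  (\int[Q]_(r in D) (cd r t)%:E = \int[Q]_(r in D) (cd r s)%:E)%E.

Let measurable_cd t : 0 <= t -> measurable_fun setT (fun r => cd r t).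
Proof.
move=> t0; apply: (measurable_compensated hE cE hU cU adm t0 _ _ cf ca ck).
  by move=> s /andP[s0 _]; exact: ryd.
by move=> s C _ mC; apply: mLd; apply: measurableX => //; exact: measurable_I0.
Qed.

Let Q_int (D : set RR) t K : 0 <= t -> measurable D -> (forall r, `|cd r t| <= K) ->
  Q.-integrable D (EFin \o (fun r => cd r t)).
Proof.
move=> t0 mD cK; apply: (bounded_integrable_on (K := K)) => //.
  by apply: le_lt_trans (probability_le1 Q mD) _; exact: ltry.
by apply: measurable_funTS; exact: measurable_cd.
Qed.

(** Generators of the past of the continuation up to v. Named so that the line with this smaller
    sigma-algebra is itself a measurable type, on which ordinary measurability lemmas express
    adaptedness. *)
Definition pgens (v : R) : set (set RR) := [set D | exists s, 0 <= s <= v /\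
       ((exists V : set E, open V /\ D = (fun w => yd w s) @^-1` V) \/
        (exists (C : set (Borel Uc)) (V : set (\bar R)), measurable C /\ open V /\
            D = (fun w => Ld w (I0 s `*` C)) @^-1` V))].

Lemma pgens_measurable v : pgens v `<=` measurable.
Proof.
move=> _ [s [/andP[s0 _] [[V [oV ->]]|[C [V [mC [oV ->]]]]]]]; first exact: ryd.
have mLC : measurable_fun setT (fun r => Ld r (I0 s `*` C)).
  by apply: mLd; apply: measurableX => //; exact: measurable_I0.
by apply: (measurable_preimage mLC); exact: ereal_open_measurable.
Qed.

Lemma rv_yd_sub v s : 0 <= s <= v -> rv (fun r : g_sigma_algebraType (pgens v) => yd r s).
Proof. by move=> sv V oV; apply: sub_gen_smallest; exists s; split => //; left; exists V. Qed.

Lemma measurable_Ld_sub v s C : 0 <= s <= v -> measurable C ->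
  measurable_fun setT (fun r : g_sigma_algebraType (pgens v) => Ld r (I0 s `*` C)).
Proof.
move=> sv mC; apply/rv_erealP => V oV; apply: sub_gen_smallest; exists s; split => //.
by right; exists C, V.
Qed.

(** Future increments of the continuation have mean zero given the whole first factor together with
    the past up to v. On rectangles this is the martingale property under [Q] combined with the
    coupling. *)
Lemma increment_integral0 (D : set Om) v v' (X : set (Om * g_sigma_algebraType (pgens v))) :
  measurable D -> 0 <= v <= v' -> measurable X ->
  measurable (X : set (Om * RR)) /\
  (\int[P']_(p in (X : set (Om * RR))) (\1_D p.1 * (cd p.2 v' - cd p.2 v))%:E = 0)%E.
Proof.
move=> mD vv' mX; have /andP[v0 le_vv'] := vv'; have v'0 := le_trans v0 le_vv'.
have [K1 cK1] := compensated_uniform_bound hE cE hU cU cf ca ck v'0.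
have {}cK1 := cK1 v' (introT andP (conj v'0 (lexx v'))).
have [K2 cK2] := compensated_uniform_bound hE cE hU cU cf ca ck v0.
have {}cK2 := cK2 v (introT andP (conj v0 (lexx v))).
pose h r := cd r v' - cd r v.
have mh : measurable_fun setT (h : RR -> R) by apply: measurable_funB; exact: measurable_cd.
have hK r : `|h r| <= K1 + K2.
  by apply: (le_trans (ler_normB _ _)); apply: lerD; [exact: (cK1 _ _ _ (adm _))|exact: (cK2 _ _ _ (adm _))].
have K0 : 0 <= K1 + K2 by apply: le_trans (hK 0).
apply: (@integral0_subproduct _ _ _ P' (pgens v) (@pgens_measurable v) _ (K1 + K2)) => //.
- apply: measurable_funM; last exact: measurableT_comp mh measurable_snd.
  by apply: (measurableT_comp _ measurable_fst); exact: measurable_indic.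
- move=> p; rewrite normrM indicE; case: (_ \in _); first by rewrite normr1 mul1r; exact: hK.
  by rewrite normr0 mul0r.
move=> D1 D2 mD1 FD2.
have mD2 : measurable D2 by apply: smallest_sub FD2; [exact: sigma_algebra_measurable|exact: pgens_measurable].
(* The coupling accepts functions with zero mean on every event of the initial value, so the past
   event [D2] is absorbed into the function; the initial value belongs to that past. *)
pose h2 (r : RR) : R := h r * \1_D2 r.
have -> : (\int[P']_(p in D1 `*` D2) (\1_D p.1 * (cd p.2 v' - cd p.2 v))%:E =
    \int[P']_(p in (D1 `&` D) `*` setT) (h2 p.2)%:E)%E.
  rewrite integral_mkcond [RHS]integral_mkcond; apply: eq_integral => -[w r] _.
  rewrite !patchE /h2 !indicE /= -/(h r).
  have -> : ((w, r) \in D1 `*` D2) = (w \in D1) && (r \in D2).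
    by apply/idP/andP => [|[]]; rewrite !inE => //; case.
  have -> : ((w, r) \in (D1 `&` D) `*` setT) = (w \in D1) && (w \in D).
    by apply/idP/andP => [|[]]; rewrite !inE => //; case => -[].
  by case: (w \in D1); case: (r \in D2); case: (w \in D); rewrite /= ?mulr1 ?mul1r ?mulr0 ?mul0r.
apply: (indep (K := K1 + K2)) => //; last exact: measurableI.
- by apply: measurable_funM => //; exact: measurable_indic.
- move=> r; rewrite normrM indicE; case: (_ \in _); first by rewrite normr1 mulr1; exact: hK.
  by rewrite normr0 mulr0.
move=> C mC; have /rvP rv0 : rv (fun r : g_sigma_algebraType (pgens v) => yd r 0).
  by apply: rv_yd_sub; rewrite lexx v0.
have FD : <<s pgens v >> ((yd ^~ 0%R) @^-1` C `&` D2).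
  by apply: (@measurableI _ (g_sigma_algebraType (pgens v))) => //; exact: (measurable_preimage rv0 mC).
have mFD : measurable ((yd ^~ 0%R) @^-1` C `&` D2 : set RR).
  by apply: smallest_sub FD; [exact: sigma_algebra_measurable|exact: pgens_measurable].
have -> : (\int[Q]_(r in (yd ^~ 0%R) @^-1` C) (h2 r)%:E =
    \int[Q]_(r in (yd ^~ 0%R) @^-1` C `&` D2) (h r)%:E)%E.
  rewrite integral_mkcond [RHS]integral_mkcond; apply: eq_integral => r _.
  rewrite !patchE /h2 indicE.
  have -> : (r \in (yd ^~ 0%R) @^-1` C `&` D2) = (r \in (yd ^~ 0%R) @^-1` C) && (r \in D2).
    by apply/idP/andP => [|[]]; rewrite !inE => //; case.
  by case: (r \in _); case: (r \in D2); rewrite /= ?mulr1 ?mulr0.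
have i1 := Q_int v'0 mFD (fun r => cK1 _ _ _ (adm r)).
have i2 := Q_int v0 mFD (fun r => cK2 _ _ _ (adm r)).
have := integralB_EFin mFD i1 i2; rewrite /= => ->.
rewrite (mart vv' FD) subee//; exact: (integrable_fin_num mFD i2).
Qed.

Section trace.
Let rYU t : 0 <= t -> rv (YU ^~ t). Proof. by move: t; case: sol => _ []. Qed.

Let control_I0 p u C : G p -> measurable C -> L p (I0 u `*` C) = (LU p.1 (I0 u `*` C) +
    (if u%:E < th p.1 then 0 else Ld p.2 (I0 (u - fine (th p.1)) `*` C)))%E.
Proof. exact: (pasted_control_I0 U YU LU adm u). Qed.

Lemma pasted_lapse w u : 0 <= u -> (th w <= u%:E)%E -> 0 <= u - fine (th w).
Proof. by rewrite subr_ge0; have := exit_time_ge0 U (YU w : R -> E); rewrite -/(th w); case: (th w). Qed.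

Lemma pasted_idle p u : G p -> 0 <= u -> (u%:E < th p.1)%E -> l0 p u = l0U p.1 u.
Proof.
move=> Gp u0 ut; rewrite /idle_time control_I0// ut adde0.
have [[clk _ _ _] _ _] := Ggood Gp; have := clk u u0.
rewrite (min_idPl (ltW ut)); case: (LU _ _) => // r [e].
by rewrite -[in LHS]e /=; lra.
Qed.

(** After theta the glued process consults the continuation only up to the elapsed time, at most v
    on D; everything about the first factor is granted. *)
Lemma filtration_trace s v (D : set Om) : 0 <= s -> 0 <= v ->
  (forall w, D w -> s - fine (th w) <= v) -> forall C, nat_filtration Y l0 L s C ->
  exists2 X : set (Om * g_sigma_algebraType (pgens v)), measurable X &
    C `&` (G `&` D `*` setT) = (X : set (Om * RR)) `&` (G `&` D `*` setT).
Proof.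
move=> s0 v0 Dv C FC.
have mL2 (u : R) (C' : set (Borel Uc)) : 0 <= u <= v -> measurable C' ->
    measurable_fun setT (fun r : g_sigma_algebraType (pgens v) => Ld r (I0 u `*` C')).
  exact: measurable_Ld_sub.
have ev u p : 0 <= u <= s -> G p -> D p.1 -> (u%:E < th p.1)%E = false ->
    clamp v (u - fine (th p.1)) = u - fine (th p.1).
  move=> /andP[u0 us] Gp Dp /negbT; rewrite -leNgt => tu; rewrite clamp_id// pasted_lapse//=.
  by apply: le_trans (Dv _ Dp); rewrite lerB.
have Lt u C' p : 0 <= u <= s -> measurable C' -> G p -> D p.1 ->
    L p (I0 u `*` C') = (LU p.1 (I0 u `*` C') +
      (if u%:E < th p.1 then 0 else Ld p.2 (I0 (clamp v (u - fine (th p.1))) `*` C')))%E.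
  move=> us mC' Gp Dp; rewrite control_I0//; congr (_ + _)%E.
  by case: ifP => // h; rewrite ev.
pose Lv u C' := fun p : Om * g_sigma_algebraType (pgens v) => (LU p.1 (I0 u `*` C') +
  (if u%:E < th p.1 then 0 else Ld p.2 (I0 (clamp v (u - fine (th p.1))) `*` C')))%E.
have mLv u C' : 0 <= u -> measurable C' -> measurable_fun setT (Lv u C').
  by move=> u0 mC'; apply: (measurable_paste_evaluation (T2 := g_sigma_algebraType (pgens v)) cU oU sol v0 adm mL2 u0 mC').
apply: (sigma_trace (q := id : Om * RR -> Om * g_sigma_algebraType (pgens v)) (c := id)
  (S := (measurable : set (set (Om * g_sigma_algebraType (pgens v)))))) FC.
  exact: sigma_algebra_measurable.
move=> _ [u [us [[V [oV ->]]|[[V [oV ->]]|[C' [V [mC' [oV ->]]]]]]]]; have /andP[u0 le_us] := us.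
- exists ((fun p : Om * g_sigma_algebraType (pgens v) => if (u%:E < th p.1)%E then YU p.1 u
     else yd p.2 (clamp v (u - fine (th p.1)))) @^-1` V).
    apply: (rv_paste_path (T2 := g_sigma_algebraType (pgens v)) oU sol v0 adm (@rv_yd_sub v) u0) => //.
  apply/seteqP; split => p [/= h [Gp Dp]]; split => //; move: h.
    by rewrite pasted_pathE// /paste_path /=; case: ifP => // h; rewrite ev//; case: Dp.
  by rewrite pasted_pathE// /paste_path /=; case: ifP => // h; rewrite ev//; case: Dp.
- exists ((fun p => u - fine (Lv u setT p)) @^-1` V).
    have mh : measurable_fun setT (fun p => u - fine (Lv u setT p)).
      by apply: measurable_funB => //; apply: measurableT_comp => //; exact: mLv.
    by move/rv_realP : mh; apply.
  apply/seteqP; split => p [/= h [Gp Dp]]; split => //; move: h;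
    by rewrite /idle_time Lt//; case: Dp.
exists (Lv u C' @^-1` V).
  by move/rv_erealP : (mLv u C' u0 mC'); apply.
apply/seteqP; split => p [/= h [Gp Dp]]; split => //; move: h; by rewrite Lt//; case: Dp.
Qed.

(** For u <= s < theta the continuation does not enter path, control or idle time, so generators
    correspond one to one. *)
Lemma filtration_trace_before s C : 0 <= s -> nat_filtration Y l0 L s C ->
  exists2 B, nat_filtration YU l0U LU s B &
    C `&` (G `&` [set p | (s%:E < th p.1)%E]) = fst @^-1` B `&` (G `&` [set p | (s%:E < th p.1)%E]).
Proof.
move=> s0 FC; apply: (sigma_trace (c := id)) FC; first exact: smallest_sigma_algebra.
move=> _ [u [us [[V [oV ->]]|[[V [oV ->]]|[C' [V [mC' [oV ->]]]]]]]]; have /andP[u0 le_us] := us.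
- exists ((YU ^~ u) @^-1` V).
    by apply: sub_gen_smallest; exists u; split => //; left; exists V.
  apply/seteqP; split => p [/= h [Gp sp]]; split => //; move: h;
    by rewrite pasted_pathE// /paste_path (le_lt_trans _ sp)// lee_fin.
- exists ((l0U ^~ u) @^-1` V).
    by apply: sub_gen_smallest; exists u; split => //; right; left; exists V.
  apply/seteqP; split => p [/= h [Gp sp]]; split => //; move: h;
    by rewrite pasted_idle// (le_lt_trans _ sp)// lee_fin.
exists ((fun w => LU w (I0 u `*` C')) @^-1` V).
  by apply: sub_gen_smallest; exists u; split => //; right; right; exists C', V.
apply/seteqP; split => p [/= h [Gp sp]]; split => //; move: h;
  by rewrite control_I0// (le_lt_trans _ sp) ?adde0// lee_fin.
Qed.

End trace.

Let mth : measurable_fun setT th.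
Proof. exact: (measurable_exit_time oU (proj1 sol) (proj1 (proj2 sol))). Qed.

Section increments.
Variables (s t : R) (C : set (Om * RR)).
Hypotheses (st : 0 <= s <= t) (FC : nat_filtration Y l0 L s C) (mC : measurable C).
Let s0 : 0 <= s. Proof. by case/andP: st. Qed.
Let le_st : s <= t. Proof. by case/andP: st. Qed.
Let t0 : 0 <= t. Proof. exact: le_trans le_st. Qed.

Let cell n w := Num.truncn (fine (th w) * n.+1%:R).
(** Elapsed time at x when theta is replaced by the left end of its cell, hence never less than x -
    theta. The positive part covers s < theta, where the increment starts from time 0 of the
    continuation. *)
Let start n j (x : R) := Num.max 0 (x - j%:R / n.+1%:R).

Let measurable_cell n j : measurable [set w | cell n w = j].
Proof.
have m1 : measurable_fun setT (fun x : R => (Num.truncn x)%:R : R).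
  by apply: nondecreasing_measurable => // x y xy; rewrite ler_nat le_truncn.
have m2 : measurable_fun setT (fun w => (cell n w)%:R : R).
  apply: (measurableT_comp m1); apply: measurable_funM => //.
  exact: measurableT_comp mth.
have := measurable_preimage m2 (measurable_set1 (j%:R : R)).
rewrite (_ : _ @^-1` _ = [set w | cell n w = j])//.
apply/seteqP; split => w /=; last by move=> ->.
by move=> /eqP; rewrite eqr_nat => /eqP.
Qed.

Let cell_itv n w : (cell n w)%:R / n.+1%:R <= fine (th w) <= (cell n w)%:R / n.+1%:R + n.+1%:R^-1.
Proof.
have th0 : 0 <= fine (th w) by rewrite fine_ge0// exit_time_ge0.
have /andP[h1 h2] : (cell n w)%:R <= fine (th w) * n.+1%:R < (cell n w).+1%:R.
  by rewrite truncn_itv// mulr_ge0.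
rewrite ler_pdivrMr// h1/= -[X in _ + X]mul1r -mulrDl ler_pdivlMr// natr1.
exact: ltW.
Qed.

Let step n (p : Om * RR) : R :=
  if (th p.1 <= t%:E)%E then cd p.2 (start n (cell n p.1) t) - cd p.2 (start n (cell n p.1) s) else 0.
Local Notation late x p :=
  (if (th p.1 <= x%:E)%E then cd p.2 (x - fine (th p.1)) else 0).

Let start_ge0 n j x : 0 <= start n j x.
Proof. by rewrite /start le_max lexx. Qed.

Let measurable_D n j : measurable [set w | cell n w = j /\ (th w <= t%:E)%E].
Proof.
apply: measurableI; first exact: measurable_cell.
by rewrite -[X in measurable X]setTI; apply: emeasurable_fun_infty_c.
Qed.

Let stepE n p : step n p = \1_[set w | cell n w = cell n p.1 /\ (th w <= t%:E)%E] p.1 *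
  (cd p.2 (start n (cell n p.1) t) - cd p.2 (start n (cell n p.1) s)).
Proof.
rewrite /step indicE; case: ifPn => h.
  by rewrite mem_set ?mul1r//.
by rewrite memNset ?mul0r// => -[_]; exact/negP.
Qed.

Let measurable_step n : measurable_fun setT (step n).
Proof.
pose g j (p : Om * RR) := \1_[set w | cell n w = j /\ (th w <= t%:E)%E] p.1 *
  (cd p.2 (start n j t) - cd p.2 (start n j s)).
apply: (measurable_fun_pieces (k := fun p => cell n p.1) (g := g)) => [j|j|p].
- rewrite (_ : mkset _ = fst @^-1` [set w | cell n w = j])//.
  exact: (measurable_preimage measurable_fst (measurable_cell n j)).
- apply: measurable_funM.
    by apply: (measurableT_comp _ measurable_fst); exact: measurable_indic.
  by apply: measurable_funB; apply: (measurableT_comp (measurable_cd _) measurable_snd).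
- exact: stepE.
Qed.

Let step_bound : exists K, forall n p, `|step n p| <= K.
Proof.
have [K cK] := compensated_uniform_bound hE cE hU cU cf ca ck t0.
have K0 : 0 <= K.
  by apply: le_trans (cK t _ _ _ _ (adm 0)); rewrite ?normr_ge0// t0 lexx.
exists (K + K) => n p; rewrite /step; case: ifP => _; last by rewrite normr0 addr_ge0.
have h x : x <= t -> 0 <= start n (cell n p.1) x <= t.
  move=> xt; rewrite start_ge0 ge_max t0/= (le_trans _ xt)// gerBl.
  by rewrite mulr_ge0// invr_ge0.
by apply: le_trans (ler_normB _ _) _; apply: lerD; apply: (cK _ _ _ _ _ (adm p.2)); exact: h.
Qed.

(** On each cell the rounded elapsed times are constants, so [C] can be replaced by a set of the
    sub-product and [increment_integral0] applies; the cells are then summed. *)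
Let integral_step n : (\int[P']_(p in C) (step n p)%:E = 0)%E.
Proof.
have [K stepK] := step_bound.
pose F j := C `&` [set p : Om * RR | cell n p.1 = j].
have CF : C = \bigcup_j F j.
  by apply/seteqP; split => [p Cp|p [j _ []]//]; exists (cell n p.1).
have mF j : measurable (F j).
  apply: measurableI => //.
  exact: (measurable_preimage measurable_fst (measurable_cell n j)).
rewrite CF (@integral_bigcup _ (Om * RR)%type R P' F (fun p => (step n p)%:E))//; last 2 first.
- apply/trivIsetP => i j _ _ ij; rewrite -subset0 => p [[_ /= pi] [_ /= pj]].
  by move: ij; rewrite -pi pj eqxx.
- rewrite -CF; apply: (bounded_integrable_on (K := K)) => //.
    by apply: le_lt_trans (probability_le1 P' mC) _; exact: ltry.
  exact: measurable_funTS.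
apply: eseries0 => j _ _.
pose D := [set w | cell n w = j /\ (th w <= t%:E)%E].
have v0 : 0 <= start n j s by [].
have vv : 0 <= start n j s <= start n j t.
  by rewrite v0 /start ge_max le_max lexx/= le_max lerB ?orbT.
have Dv w : cell n w = j -> s - fine (th w) <= start n j s.
  move=> <-; have /andP[h _] := cell_itv n w.
  by rewrite /start le_max lerB ?orbT.
have [X mX /seteqP[sub1 sub2]] := filtration_trace s0 v0 Dv FC.
have [_ <-] := increment_integral0 (measurable_D n j) vv mX.
rewrite integral_mkcond [RHS]integral_mkcond.
apply: (eq_integral_null (N := ~` G)) => //; first exact: measurableC.
move=> p _ /contrapT Gp; rewrite !patchE.
have [pj|pj] := pselect (cell n p.1 = j).
  have -> : (p \in F j) = (p \in (X : set (Om * RR))).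
    apply/idP/idP => /set_mem => [[Cp _]|Xp]; apply/mem_set.
      by have [] := sub1 p (conj Cp (conj Gp (conj pj I))).
    by have [] := sub2 p (conj Xp (conj Gp (conj pj I))).
  by rewrite stepE pj.
rewrite memNset; last by move=> [].
by rewrite indicE (memNset (A := mkset _)) ?mul0r ?if_same// => -[].
Qed.

(** The rounded elapsed times converge from above, so right continuity suffices. When s < theta <= t
    the lower one tends to 0, where the functional vanishes. *)
Let step_cvg p : step n p @[n --> \oo] --> late t p - late s p.
Proof.
have cs x : x - (cell n p.1)%:R / n.+1%:R @[n --> \oo] --> x - fine (th p.1).
  apply: cvgB; first exact: cvg_cst.
  apply: (@squeeze_cvgr _ _ _ _ (fun n => fine (th p.1) - n.+1%:R^-1) (fun=> fine (th p.1))).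
  - by apply: nearW => n; have /andP[h1 h2] := cell_itv n p.1; rewrite h1 lerBlDr h2.
  - rewrite -[X in _ --> X]subr0; apply: cvgB; [exact: cvg_cst|exact: cvg_invS].
  - exact: cvg_cst.
have cms x : start n (cell n p.1) x @[n --> \oo] --> Num.max 0 (x - fine (th p.1)).
  apply/cvgrPdist_le => e e0; move/cvgrPdist_le/(_ _ e0) : (cs x); apply: filterS => n.
  exact/le_trans/dist_max0.
have lim x : cd p.2 (start n (cell n p.1) x) @[n --> \oo] --> cd p.2 (Num.max 0 (x - fine (th p.1))).
  apply: (compensated_right_cvg hE cE hU cU (adm p.2) cf ca ck) => //.
  - by rewrite le_max lexx.
  - move=> n; have /andP[h _] := cell_itv n p.1.
    by rewrite /start ge_max !le_max lexx/= lerB ?orbT.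
have cd0 : cd p.2 0 = 0 by exact: (compensated_at0 _ _ _ (adm p.2)).
have th0 := exit_time_ge0 U (YU p.1 : R -> E).
rewrite /step; have [tht|tht] := leP (th p.1) t%:E; last first.
  rewrite ifF ?subr0; first exact: cvg_cst.
  by apply/negbTE; rewrite -ltNge (le_lt_trans _ tht)// lee_fin.
have thf : th p.1 = (fine (th p.1))%:E.
  by rewrite fineK// ge0_fin_numE// (le_lt_trans tht)// ltry.
apply: cvgB.
  have := lim t; rewrite (_ : Num.max 0 _ = t - fine (th p.1))//.
  by apply/max_idPr; rewrite subr_ge0 -lee_fin -thf.
have := lim s; case: ifPn => ths.
  rewrite (_ : Num.max 0 _ = s - fine (th p.1))//.
  by apply/max_idPr; rewrite subr_ge0 -lee_fin -thf.
rewrite (_ : Num.max 0 _ = 0) ?cd0//.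
by apply/max_idPl; rewrite subr_le0 -lee_fin -thf ltW// ltNge.
Qed.

Lemma integral_late_increment : exists K,
  [/\ measurable_fun setT (fun p => late t p - late s p),
    forall p, `|late t p - late s p| <= K &
    (\int[P']_(p in C) (late t p - late s p)%:E = 0)%E].
Proof.
have [K stepK] := step_bound; exists K.
have [m0 i0] := integral_cvg_eq0 mC measurable_step stepK step_cvg integral_step.
split => // p; have /cvg_norm h := @step_cvg p.
by rewrite -(cvg_lim _ h)//; apply: limr_le; [apply/cvg_ex; eexists; exact: h|exact: nearW].
Qed.

End increments.

End test_function.

Let measurable_l0 u : 0 <= u -> measurable_fun setT (fun p => l0 p u).
Proof.
move=> u0; apply: measurable_funB => //; apply: measurableT_comp => //.
exact: (measurable_pasted_control cU oU sol adm mLd mG u0).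
Qed.

Lemma pasted_filtration_measurable s : nat_filtration Y l0 L s `<=` measurable.
Proof.
apply: nat_filtration_measurable => u => [/andP[u0 _]|/andP[u0 _]|C /andP[u0 _] mC].
- exact: (rv_pasted_path oU sol adm ryd mG u0).
- by apply/rv_realP; exact: measurable_l0.
- exact: (measurable_pasted_control cU oU sol adm mLd mG u0).
Qed.

Let P_pushforward (h : Om -> R) D : P.-integrable setT (EFin \o h) -> measurable D ->
  P'.-integrable setT (fun p => (h p.1)%:E) /\
  (\int[P']_(p in fst @^-1` D) (h p.1)%:E = \int[P]_(w in D) (h w)%:E)%E.
Proof.
move=> ih mD; have mh := measurable_int _ ih.
have mf : measurable_fun setT (fst : Om * RR -> Om) := measurable_fst.
have pE C : measurable C -> pushforward P' (fst : Om * RR -> Om) C = P C.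
  by move=> mC; rewrite -marg// /pushforward; congr (P' _); apply/seteqP; split => p // [].
have ih' : P'.-integrable setT (fun p => (h p.1)%:E).
  apply/integrableP; split; first exact: (measurableT_comp mh mf).
  have mah : measurable_fun setT (fun w => `|(h w)%:E|)%E by exact: measurableT_comp.
  have := ge0_integral_pushforward mf P' measurableT mah (fun w _ => abse_ge0 _).
  rewrite preimage_setT => <-; rewrite (eq_measure_integral P) => [|C mC _]; last exact: pE.
  by have /integrableP[] := ih.
split => //.
have mfD := measurable_preimage mf mD.
have := @integral_pushforward _ _ _ _ R _ mf P' D (EFin \o h) mh (integrableS measurableT mfD (@subsetT _ _) ih') mD.
by move=> <-; apply: eq_measure_integral => C mC _; exact: pE.
Qed.

Section domain_function.
Variables (f : E -> R) (b : E * Uc -> R).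
Hypotheses (fA : DA f) (fB : DB f) (cb : continuous b) (Bb : forall p, Xi p -> B f p = b p).
Local Notation k := (fun q : E * Uc => b q - A f q.1).
Local Notation MU := (fun t w => f (YU w t) - f (YU w 0)
          - fine (\int[LS (l0U w)]_(s in I0 t) (A f (YU w s))%:E)
          - fine (\int[LU w]_(p in I0 t `*` setT) (B f (YU w p.1, p.2))%:E)).

(** The event [D] taken from the stopped filtration matches [C] only where s < theta. Elsewhere the
    stopped functional no longer moves, so the mismatch contributes nothing and [D] can be used as
    it is. *)
Let integral_stopped_increment s t C : 0 <= s <= t -> nat_filtration Y l0 L s C ->
  P'.-integrable C (fun p => (MU t p.1 - MU s p.1)%:E) /\
  (\int[P']_(p in C) (MU t p.1 - MU s p.1)%:E = 0)%E.
Proof.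
move=> st FC; have /andP[s0 le_st] := st; have t0 := le_trans s0 le_st.
have mC := pasted_filtration_measurable FC.
have mart := solution_martingale sol fA fB.
have [_ [it ht]] := mart t t0; have [_ [is_ _]] := mart s s0.
have [D FD CD] := filtration_trace_before s0 FC.
have mD : measurable D by exact: (solution_filtration_measurable cU sol FD).
have i := integrableB measurableT it is_.
have {}i : P.-integrable setT (EFin \o (fun w => MU t w - MU s w)) by [].
have [i' e] := P_pushforward i mD.
split; first exact: integrableS i'.
have iD M : P.-integrable setT M -> P.-integrable D M by exact: integrableS.
transitivity (\int[P']_(p in fst @^-1` D) (MU t p.1 - MU s p.1)%:E)%E; last first.
  have := integralB_EFin mD (iD _ it) (iD _ is_); rewrite /= e => ->.
  have := ht s D st FD; rewrite /= => ->; rewrite subee//.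
  exact: (integrable_fin_num mD (iD _ is_)).
rewrite integral_mkcond [RHS]integral_mkcond.
apply: (eq_integral_null (N := ~` G)) => //; first exact: measurableC.
move=> p _ /contrapT Gp; rewrite !patchE.
have [ps|ps] := ltP s%:E (th p.1).
  move/seteqP: CD => [sub1 sub2].
  suff -> : (p \in C) = (p \in fst @^-1` D) by [].
  apply/idP/idP => /set_mem h; apply/mem_set.
    by have [] := sub1 p (conj h (conj Gp ps)).
  by have [] := sub2 p (conj h (conj Gp ps)).
suff -> : MU t p.1 - MU s p.1 = 0 by rewrite !if_same.
have [reg _ _] := Ggood Gp; have [_ _ fr _] := reg.
rewrite !(regular_compensated hE cE hU cU cXi sol f reg (A_cont fA) cb Bb)//.
have mLU : in_LU (LU p.1) by case: sol => _ [_ [_ [_ []]]].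
have fY u : 0 <= u -> YU p.1 u = YU p.1 (tmin u (th p.1)) by move=> u0; have [] := fr u u0.
have fL u : 0 <= u -> LU p.1 (I0 u `*` setT) = LU p.1 (I0 (tmin u (th p.1)) `*` setT).
  by move=> u0; have [_] := fr u u0; exact.
have fz := compensated_frozen (exit_time_ge0 U (YU p.1)) fL mLU fY f (A f) k ps st.
by rewrite fz subrr.
Qed.

Hypothesis mart : forall s t D, 0 <= s <= t -> path_filtration yd Ld s D ->
  (\int[Q]_(r in D) (compensated_full (yd r) (Ld r) f (A f) k t)%:E =
   \int[Q]_(r in D) (compensated_full (yd r) (Ld r) f (A f) k s)%:E)%E.

Lemma pasted_martingale s t C : 0 <= s <= t -> nat_filtration Y l0 L s C ->
  (\int[P']_(p in C) (compensated_full (Y p) (L p) f (A f) k t)%:E =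
   \int[P']_(p in C) (compensated_full (Y p) (L p) f (A f) k s)%:E)%E.
Proof.
move=> st FC; have /andP[s0 le_st] := st; have t0 := le_trans s0 le_st.
have mC := pasted_filtration_measurable FC.
have ca := A_cont fA; have cf := DA_cont fA.
have ck : continuous k.
  move=> q; apply: cvgB; first exact: cb.
  by apply: (@continuous_comp _ _ _ (fst : E * Uc -> E) (A f)); [exact: cvg_fst|exact: ca].
have admY p : admissible Xi (Y p) (L p) := admissible_pasted hE cE hU cU cXi sol adm Ggood p.
have PC : (P' C < +oo)%E by apply: le_lt_trans (probability_le1 P' mC) _; exact: ltry.
have iM u : 0 <= u -> P'.-integrable C (EFin \o (fun p => compensated_full (Y p) (L p) f (A f) k u)).
  move=> u0; have [K bK] := compensated_uniform_bound hE cE hU cU cf ca ck u0.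
  apply: (bounded_integrable_on (K := K)) => //.
    apply: measurable_funTS; apply: (measurable_compensated hE cE hU cU admY u0 _ _ cf ca ck).
      by move=> v /andP[v0 _]; exact: (rv_pasted_path oU sol adm ryd mG v0).
    move=> v C' /andP[v0 _] mC'; exact: (measurable_pasted_control cU oU sol adm mLd mG v0).
  by move=> p _; apply: (bK _ _ _ _ _ (admY p)); rewrite u0 lexx.
have [K [mlate lateK late0]] := integral_late_increment cf ca ck mart st FC mC.
have [iU U0] := integral_stopped_increment st FC.
have ilate := bounded_integrable_on mC PC (measurable_funTS mlate) (fun p _ => lateK p).
suff : (\int[P']_(p in C) ((compensated_full (Y p) (L p) f (A f) k t)%:E -
    (compensated_full (Y p) (L p) f (A f) k s)%:E) = 0)%E.
  rewrite (integralB_EFin mC (iM t t0) (iM s s0)).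
  have := integrable_fin_num mC (iM t t0); have := integrable_fin_num mC (iM s s0); rewrite /=.
  move: (integral _ _ _) => x; move: (integral _ _ _) => y.
  by case: x => // x; case: y => // y _ _ [e]; congr EFin; lra.
have := integralD mC iU ilate; rewrite /= U0 late0 adde0 => <-.
apply: (eq_integral_null (N := ~` G)) => //; first exact: measurableC.
move=> p _ /contrapT Gp; rewrite -EFinB -EFinD; congr EFin.
have [reg _ _] := Ggood Gp.
rewrite !(compensated_pasted hE cE hU cU sol adm Ggood Gp cf ca ck)//.
rewrite !(regular_compensated hE cE hU cU cXi sol f reg ca cb Bb)//.
by rewrite opprD addrACA.
Qed.

End domain_function.
End pasted_martingale.

(** * Existence of the continuation *)

Lemma eq_martingale {R : realType} d (Om : measurableType d) (P : probability Om R)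
    (F : R -> set (set Om)) (M N : R -> Om -> R) : (forall t, 0 <= t -> M t = N t) ->
  martingale P F N -> martingale P F M.
Proof.
move=> MN mN t t0; have [h1 [h2 h3]] := mN t t0; rewrite MN//; split => //; split => //.
by move=> s A st FA; rewrite (MN s); [exact: h3|case/andP: st].
Qed.

Section diagonal.
Context {R : realType} {E : pseudoPMetricType R}.
Hypotheses (hE : hausdorff_space E) (cE : compact [set: E]).

Lemma measurable_rv_eq {d} {Om : measurableType d} (X V : Om -> E) : rv X -> rv V ->
  measurable [set w | X w = V w].
Proof.
move=> rX rV; rewrite -[X in measurable X]setCK; apply: measurableC.
apply: (rv_pair hE cE hE cE rX rV (O := [set q | q.1 <> q.2])).
rewrite openE => -[x y] /= /eqP xy; have := hE; rewrite open_hausdorff => /(_ x y xy).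
move=> [[A B] /= [/set_mem Ax /set_mem By] [oA oB /eqP AB]].
exists (A, B); first by split; exact: open_nbhs_nbhs.
move=> [x' y'] /= [Ax' By'] e; have : (A `&` B) x' by split => //; rewrite e.
by rewrite AB.
Qed.

End diagonal.

Lemma integral_paste_stopped {R : realType} {E Uc : pseudoPMetricType R} (Xi : set (E * Uc))
    (y : R -> E) (m1 m2 : @LMeas R Uc) (th : \bar R) (f : R * Uc -> R) : (0 <= th)%E ->
  (forall t, 0 <= t -> m1 (I0 t `*` setT) = m1 (I0 (tmin t th) `*` setT)) ->
  in_LU m1 -> admissible Xi y m2 ->
  (\int[paste_measure m1 th m2]_(q in [set q : R * Borel Uc | (0 <= q.1)%R /\ (q.1%:E <= th)%E])
     (f q)%:E = int_LU m1 f)%E.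
Proof.
move=> th0 m1_frozen m1LU ym.
rewrite /int_LU; case thb : th => [b| |]; last by have := th0; rewrite thb.
  have b0 : 0 <= b by have := th0; rewrite thb lee_fin.
  have [_ n0 m0 _ _] := ym.
  rewrite (_ : mkset _ = I0 b `*` setT); last first.
    apply/seteqP; split => -[r u]; rewrite /I0 /= in_itv/= lee_fin; first by move=> [-> ->].
    by move=> [/andP[]].
  transitivity (\int[m1]_(q in I0 b `*` setT) (f q)%:E)%E.
    apply: eq_measure_integral => D mD sub; apply: (etrans (paste_measureE _ _ _ _)).
    rewrite (_ : m2 _ = 0%E) ?adde0//.
    have mneg : measurable [set q : R * Borel Uc | q.1 < 0].
      rewrite (_ : mkset _ = fst @^-1` `]-oo, 0[%classic); last first.
        by apply/seteqP; split => q /=; rewrite in_itv.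
      exact: (measurable_preimage measurable_fst (measurable_itv _)).
    have mNN := null_set_setU mneg (measurable_I0T 0) n0 m0.
    apply/eqP; rewrite -measure_le0 -mNN; apply: le_measure; rewrite ?inE.
    - by apply: measurable_preimage mD; exact: measurable_time_shift.
    - by apply: measurableU => //; exact: measurable_I0T.
    move=> [r u] /sub [/= + _]; rewrite /I0 /= in_itv/= => /andP[rb1 rb2].
    have [r0|r0] := ltP r 0; [by left|right; split => //=].
    by rewrite in_itv/= r0/= -(gerDr b).
  have N0 : m1 (\bigcup_k ((I0 (b + k%:R) `*` setT) `\` (I0 b `*` setT))) = 0%E.
    have mF k : measurable ((I0 (b + k%:R) `*` setT) `\` (I0 b `*` setT) : set (R * Borel Uc)).
      by apply: measurableD; exact: measurable_I0T.
    apply/negligibleP; first exact: bigcupT_measurable.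
    apply: negligible_bigcup => k; apply/negligibleP => //.
    have thle : (th <= b%:E)%E by rewrite thb.
    by apply: (frozen_null th0 m1_frozen m1LU thle); rewrite b0/= lerDl.
  rewrite integral_mkcond [RHS]integral_mkcond.
  apply: (eq_integral_null _ N0).
    by apply: bigcupT_measurable => k; apply: measurableD; exact: measurable_I0T.
  move=> [r u] _ nN; rewrite !patchE.
  suff -> : ((r, u) \in I0 b `*` setT) = ((r, u) \in [set q : R * Borel Uc | 0 <= q.1]) by [].
  apply/idP/idP => /set_mem h; apply/mem_set; move: h.
    by rewrite /I0 /= in_itv/= => -[/andP[]].
  move=> /= r0; apply: contrapT => nb; apply: nN; exists (Num.truncn r).+1 => //.
  split => //; split => //=; rewrite /I0 /= in_itv/= r0/=.
  by rewrite ler_wpDl// ltW// truncnS_gt.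
rewrite /paste_measure (_ : mkset _ = [set q : R * Borel Uc | 0 <= q.1])//.
by apply/seteqP; split => q /= => [[]//|q0]; split => //; exact: leey.
Qed.

Section pasted_solution.
Context {R : realType} {E Uc : pseudoPMetricType R}.
Hypotheses (hE : hausdorff_space E) (cE : compact [set: E]).
Hypotheses (hU : hausdorff_space Uc) (cU : compact [set: Uc]).
Variables (E0 : set E) (Xi : set (E * Uc)) (cXi : closed Xi).
Variables (DA DB : set (E -> R)) (A : (E -> R) -> (E -> R)) (B : (E -> R) -> (E * Uc -> R)).
Hypotheses (DA_cont : forall f, DA f -> continuous f)
  (A_cont : forall f, DA f -> continuous (A f))
  (B_cont : forall f, DB f -> {within Xi, continuous (B f)}).
Variables (U : set E) (oU : open U).
Local Notation LM := (@LMeas R Uc).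
Context {d : measure_display} {Om : measurableType d} (P : probability Om R).
Variables (YU : Om -> R -> E) (l0U : Om -> R -> R) (LU : Om -> LM).
Hypothesis sol : stopped_cmp_solution E0 Xi DA A DB B U P YU l0U LU.
Local Notation RR := (measurableTypeR R).
Variables (yd : RR -> R -> E) (Ld : RR -> LM).
Hypotheses (adm : forall r, admissible Xi (yd r) (Ld r))
  (ryd : forall t, 0 <= t -> rv (yd ^~ t))
  (mLd : forall D, measurable D -> measurable_fun setT (Ld ^~ D)).
Let th w := exit_time U (YU w).
Variable G : set (Om * RR).
Hypothesis mG : measurable G.
Hypothesis Ggood : forall p, G p -> [/\ regular_at E0 Xi U YU l0U LU p.1,
  yd p.2 0 = YU p.1 (fine (th p.1)) &
  forall t, 0 <= t -> LS (idle_time (Ld p.2)) (I0 t `&` outside E0 (yd p.2)) = 0%E].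
Variables (P' : probability (Om * RR)%type R).
Hypothesis G0 : P' (~` G) = 0%E.
Hypothesis marg : forall D, measurable D -> P' (D `*` setT) = P D.

Local Notation Y := (pasted_path U YU yd G).
Local Notation L := (pasted_control U YU LU Ld G).
Local Notation l0 := (fun p => idle_time (L p)).

Section solution.
Variable Q : probability RR R.
Let admY p : admissible Xi (Y p) (L p) := admissible_pasted hE cE hU cU cXi sol adm Ggood p.
Let rY t : 0 <= t -> rv (Y ^~ t) := @rv_pasted_path _ _ _ _ _ _ _ _ _ _ oU _ _ _ _ _ _ sol _ _ adm ryd _ mG t.
Let mL u C : 0 <= u -> measurable C -> measurable_fun setT (fun p => L p (I0 u `*` C)).
Proof. exact: (measurable_pasted_control cU oU sol adm mLd mG). Qed.
Let ml0 u : 0 <= u -> rv (fun p => l0 p u).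
Proof.
move=> u0; apply/rv_realP; apply: measurable_funB => //; apply: measurableT_comp => //.
exact: mL.
Qed.

Hypothesis indep : forall (h : R -> R) (K : R), measurable_fun setT h -> (forall r, `|h r| <= K) ->
  (forall C : set (Borel E), measurable C -> (\int[Q]_(r in (yd ^~ 0%R) @^-1` C) (h r)%:E = 0)%E) ->
  forall D, measurable D -> (\int[P']_(p in D `*` setT) (h p.2)%:E = 0)%E.
Hypothesis mart : forall f (b : E * Uc -> R), DA f -> DB f -> continuous b ->
  (forall p, Xi p -> B f p = b p) -> forall s t D, 0 <= s <= t -> path_filtration yd Ld s D ->
  (\int[Q]_(r in D) (compensated_full (yd r) (Ld r) f (A f) (fun q => b q - A f q.1) t)%:E =
   \int[Q]_(r in D) (compensated_full (yd r) (Ld r) f (A f) (fun q => b q - A f q.1) s)%:E)%E.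

Let compensated_martingale f (b : E * Uc -> R) : DA f -> DB f -> continuous b ->
  (forall p, Xi p -> B f p = b p) -> martingale P' (nat_filtration Y l0 L)
    (fun t p => compensated_full (Y p) (L p) f (A f) (fun q => b q - A f q.1) t).
Proof.
move=> fA fB cb Bb t t0; have ca := A_cont fA; have cf := DA_cont fA.
pose k (q : E * Uc) := b q - A f q.1.
have ck : continuous k.
  move=> q; apply: cvgB; first exact: cb.
  by apply: (@continuous_comp _ _ _ (fst : E * Uc -> E) (A f)); [exact: cvg_fst|exact: ca].
(* Adaptedness is measurability of the functional on the sample space equipped with only the
   sigma-algebra generated up to time t. *)
have F_compensated : forall V : set R, open V -> nat_filtration Y l0 L t
    ((fun p => compensated_full (Y p) (L p) f (A f) k t) @^-1` V).
  pose gen := [set D | exists s, 0 <= s <= t /\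
       ((exists V : set E, open V /\ D = (fun p => Y p s) @^-1` V) \/
        (exists V : set R, open V /\ D = (fun p => l0 p s) @^-1` V) \/
        (exists (C : set (Borel Uc)) (V : set (\bar R)), measurable C /\ open V /\
            D = (fun p => L p (I0 s `*` C)) @^-1` V))].
  have : measurable_fun setT ((fun p => compensated_full (Y p) (L p) f (A f) k t) :
      g_sigma_algebraType gen -> R).
    apply: (measurable_compensated (Om := g_sigma_algebraType gen) hE cE hU cU admY t0 _ _ cf ca ck).
      by move=> s st V oV; apply: sub_gen_smallest; exists s; split => //; left; exists V.
    move=> s C st mC; apply/rv_erealP => V oV; apply: sub_gen_smallest; exists s; split => //.
    by right; right; exists C, V.
  by move/rv_realP.
split; first exact: F_compensated.
split.
  have [K bK] := compensated_uniform_bound hE cE hU cU cf ca ck t0.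
  apply: (bounded_integrable_on (K := K)) => //.
  - by apply: le_lt_trans (probability_le1 P' measurableT) _; exact: ltry.
  - apply: (measurable_compensated hE cE hU cU admY t0 _ _ cf ca ck).
      by move=> v /andP[v0 _]; exact: rY.
    by move=> v C' /andP[v0 _] mC'; exact: mL.
  - by move=> p _; apply: (bK _ _ _ _ _ (admY p)); rewrite t0 lexx.
move=> s D st FD.
exact: (pasted_martingale hE cE hU cU cXi DA_cont A_cont oU sol adm ryd mLd mG Ggood G0 marg indep
  fA fB cb Bb (mart fA fB cb Bb) st FD).
Qed.

Lemma pasted_solution : cmp_solution E0 Xi DA A DB B P' Y l0 L.
Proof.
have cY p : cadlag (Y p) by have [] := admY p.
have LLU p : in_LU (L p) := admissible_in_LU (admY p).
have clkE p u : 0 <= u -> ((l0 p u)%:E + L p (I0 u `*` setT) = mine u%:E +oo)%E.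
  exact: (idle_timeE (admY p)).
have aeE (S : Om * RR -> Prop) : (forall p, S p) -> {ae P', forall p, S p} by move=> h; exact: aeW.
split; first exact: cY.
split; first exact: rY.
split; first by move=> p; split; [exact: idle_time_ge0 (admY p)|exact: idle_time_mono (admY p)].
split; first exact: ml0.
split; first exact: LLU.
split.
  have le p t : 0 <= t -> (L p (I0 t `*` setT) <= t%:E)%E by exact: (admissible_le (admY p)).
  by move=> f; exact: (rv_int_LU le mL).
split.
  apply: (full_set_ae mG G0) => p Gp t t0.
  have [_] := clock_closureP E0 (cY p) (leey 0 : (0 <= +oo :> \bar R)%E) (idle_time_ge0 (admY p))
    (idle_time_mono (admY p)) (clkE p) t0; apply.
  exact: (outside_pasted hE cE hU cU cXi sol adm Ggood Gp t0).
split.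
  apply: aeE => p t t0; have [_ _ _ _ xi] := admY p.
  rewrite -[LHS]mul1e -integral_cst; last exact: measurable_I0T.
  apply: (eq_integral_null (N := off_Xi Xi (Y p))) => //; first exact: measurable_off_Xi.
  move=> [r u] [/= + _] nX; rewrite /I0 /= in_itv/= => /andP[r0 _].
  rewrite indicE mem_set//; apply: contrapT => h; apply: nX; split => //.
split.
  by apply: aeE => p t t0; rewrite exit_timeT /tmin leey.
split.
  by apply: aeE => p t t0; rewrite exit_timeT; exact: clkE.
move=> f fA fB; have [b [cb Bb]] := closed_extension hE cE hU cU cXi (B_cont fB).
have M := compensated_martingale fA fB cb Bb.
apply: eq_martingale M => t t0; apply/funext => p; have [_ _ _ _ xi] := admY p.
rewrite compensated_fullE.
exact: (compensatedE hE cE hU cU cXi f (leey 0 : (0 <= +oo :> \bar R)%E) (idle_time_ge0 (admY p))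
    (idle_time_mono (admY p)) (clkE p) (cY p) xi (A_cont fA) cb Bb t0).
Qed.

End solution.

Let cYU w : cadlag (YU w). Proof. by case: sol. Qed.
Let rYU t : 0 <= t -> rv (YU ^~ t). Proof. by move: t; case: sol => _ []. Qed.
Let rlU t : 0 <= t -> rv (l0U ^~ t). Proof. by move: t; case: sol => _ [_ [_ []]]. Qed.
Let LUi w : in_LU (LU w). Proof. by case: sol => _ [_ [_ [_ []]]]. Qed.
Let rint f : Cc f -> rv (fun w => int_LU (LU w) f).
Proof. by move: f; case: sol => _ [_ [_ [_ [_ []]]]]. Qed.
Let th0 w : (0 <= th w)%E. Proof. exact: exit_time_ge0. Qed.

Local Notation X1 := (encode YU l0U LU th).
Local Notation X2 := (encode_stopped Y l0 L (fun p => exit_time U (Y p))).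

Let tmin_th w t : 0 <= t -> 0 <= tmin t (th w) /\ ((tmin t (th w))%:E = mine t%:E (th w))%E.
Proof.
move=> t0; rewrite /tmin; have := th0 w; have [h _|h b0] := leP t%:E (th w).
  by [].
by rewrite fine_ge0// fineK// ge0_fin_numE// (lt_trans h)// ltry.
Qed.

Let path_before p u : G p -> (u%:E <= th p.1)%E -> Y p u = YU p.1 u.
Proof.
move=> Gp; have [_ yy _] := Ggood Gp.
rewrite pasted_pathE// /paste_path -/(th p.1) le_eqVlt => /predU1P[e|->//].
by rewrite -e ltxx /= subrr yy -e.
Qed.

Let control_before p u C : G p -> measurable C -> 0 <= u -> (u%:E <= th p.1)%E ->
  L p (I0 u `*` C) = LU p.1 (I0 u `*` C).
Proof.
move=> Gp mC u0; rewrite (pasted_control_I0 U YU LU adm u Gp mC) -/(th p.1).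
rewrite le_eqVlt => /predU1P[e|->]; last by rewrite adde0.
rewrite -e ltxx /= subrr; have [_ _ m0 _ _] := adm p.2.
suff -> : Ld p.2 (I0 0 `*` C) = 0%E by rewrite adde0.
apply/eqP; rewrite -measure_le0 -m0; apply: le_measure; rewrite ?inE; last by move=> q [].
  by apply: measurableX => //; exact: measurable_I0.
exact: measurable_I0T.
Qed.

Let stopped_control p (f : R * Uc -> R) : G p ->
  (\int[L p]_(q in [set q : R * Borel Uc | (0 <= q.1)%R /\ (q.1%:E <= th p.1)%E]) (f q)%:E =
   int_LU (LU p.1) f)%E.
Proof.
move=> Gp; have [[_ _ fr _] _ _] := Ggood Gp; rewrite pasted_controlE//.
apply: (integral_paste_stopped f (th0 p.1) _ (LUi p.1) (adm p.2)) => u u0.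
by have [_] := fr u u0; exact.
Qed.

(** The two states need not be equal as functions, for at negative times they are unrelated;
    [state_gen] never looks there. So they are compared on generators, and the agreement passes to
    the sigma-algebra. *)
Let agree p H : G p -> <<s state_gen >> H -> H (X2 p) <-> H (X1 p.1).
Proof.
move=> Gp; have eth := exit_time_pasted oU sol Ggood Gp; have [reg _ _] := Ggood Gp.
have [clk _ fr _] := reg.
have tle t : 0 <= t -> ((tmin t (th p.1))%:E <= th p.1)%E.
  by move=> t0; have [_ ->] := tmin_th p.1 t0; rewrite ge_min lexx orbT.
move: H; apply: smallest_sub; first split.
- by [].
- by move=> H h; split => -[_ n]; split => // /h.
- by move=> F h; split => -[n _ /h ?]; exists n.
move=> _ [[t [V [t0 [oV ->]]]]|[[t [V [t0 [oV ->]]]]|[[f [V [cf [oV ->]]]]|[V [oV ->]]]]] /=;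
  rewrite eth -/(th p.1).
- have [-> _] := fr t t0; rewrite -/(th p.1) path_before//; exact: tle.
- have [tm0 tmE] := tmin_th p.1 t0.
  suff -> : idle_time (L p) (tmin t (th p.1)) = l0U p.1 t by [].
  rewrite /idle_time control_before//; last exact: tle.
  have := clk t t0; have [_ /(_ setT measurableT) ->] := fr t t0; rewrite -/(th p.1) -tmE.
  by case: (LU _ _) => // r [<-]; rewrite /= addrK.
- by rewrite stopped_control.
- by [].
Qed.

Lemma same_law_pasted : same_law P X1 P' X2.
Proof.
move=> H FH.
have mX1 : measurable (X1 @^-1` H).
  move: H FH; apply: smallest_sub; first split.
  - by rewrite preimage_set0.
  - by move=> D mD; rewrite setTD preimage_setC; exact: measurableC.
  - by move=> F mF; rewrite preimage_bigcup; exact: bigcupT_measurable.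
  move=> _ [[t [V [t0 [oV ->]]]]|[[t [V [t0 [oV ->]]]]|[[f [V [cf [oV ->]]]]|[V [oV ->]]]]].
  - exact: (rYU t0 oV).
  - exact: (rlU t0 oV).
  - exact: (rint cf oV).
  - by apply: (measurable_preimage (measurable_exit_time oU cYU rYU)); exact: ereal_open_measurable.
have mfst := measurable_preimage (measurable_fst (T1 := Om) (T2 := RR)) mX1.
have e1 : X2 @^-1` H `&` G = fst @^-1` (X1 @^-1` H) `&` G.
  by apply/seteqP; split => p [h Gp]; split => //; apply/(agree Gp FH).
(* Off [G] the pasted path and control do not depend on p, so [X2] is constant there; this gives
   measurability of its preimages on the complement. *)
have off p q : ~ G p -> ~ G q -> X2 p = X2 q.
  move=> Gp Gq; have eY : Y p = Y q by apply/funext => t; rewrite /pasted_path !memNset.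
  have eL : L p = L q by rewrite /pasted_control !memNset.
  by rewrite /encode_stopped eY eL.
have m2 : measurable (X2 @^-1` H `&` ~` G).
  have [[q [Hq Gq]]|h] := pselect (exists q, X2 q = X2 q /\ ~ G q /\ H (X2 q)).
    rewrite (_ : _ `&` _ = ~` G); first exact: measurableC.
    apply/seteqP; split => [p []//|p Gp]; split => //=; case: Gq => Gq.
    by rewrite (off p q).
  rewrite (_ : _ `&` _ = set0)// -subset0 => p [Hp Gp]; apply: h; by exists p.
have m1 : measurable (X2 @^-1` H `&` G) by rewrite e1; exact: measurableI.
have mX2 : measurable (X2 @^-1` H).
  by rewrite -[X2 @^-1` H]setIT -(setUv G) setIUr; exact: measurableU.
have full D : measurable D -> P' D = P' (D `&` G).
  move=> mD; have N0 : P' (D `&` ~` G) = 0%E.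
    apply/eqP; rewrite -measure_le0 -G0; apply: le_measure; rewrite ?inE; last by move=> p [].
      by apply: measurableI => //; exact: measurableC.
    exact: measurableC.
  have DG : D = (D `&` G) `|` (D `&` ~` G) by rewrite -setIUr setUv setIT.
  rewrite -[RHS]adde0 -N0 {1}DG; apply: measureU.
  - exact: measurableI.
  - by apply: measurableI => //; exact: measurableC.
  - by rewrite setIACA setICr setI0.
rewrite (full _ mX2) e1 -(full _ mfst) -(marg mX1); congr (P' _).
by apply/seteqP; split => p // [].
Qed.

End pasted_solution.

Section existence.
Context {R : realType} {E Uc : pseudoPMetricType R}.
Hypotheses (hE : hausdorff_space E) (cE : compact [set: E]).
Hypotheses (hU : hausdorff_space Uc) (cU : compact [set: Uc]).
Variables (E0 : set E) (Xi : set (E * Uc)) (cXi : closed Xi).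
Variables (DA DB : set (E -> R)) (A : (E -> R) -> (E -> R)) (B : (E -> R) -> (E * Uc -> R)).
Hypotheses (DA_cont : forall f, DA f -> continuous f)
  (A_cont : forall f, DA f -> continuous (A f))
  (B_cont : forall f, DB f -> {within Xi, continuous (B f)}).
Variables (U : set E) (oU : open U).
Local Notation LM := (@LMeas R Uc).
Local Notation RR := (measurableTypeR R).

(** The pair of [Z] and the second coordinate has the law of r -> (Y0 r, r), which is carried by the
    graph of [Y0]. Hence the continuation almost surely starts at the exit position. *)
Lemma coupling_diagonal d (Om : measurableType d) (Z : Om -> E) (Y0 : RR -> E)
    (Q : probability RR R) (P' : probability (Om * RR)%type R) : rv Z -> rv Y0 ->
  (forall C D, measurable (C : set (Borel E)) -> measurable D ->
     P' [set p | C (Z p.1) /\ D p.2] = Q (Y0 @^-1` C `&` D)) ->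
  P' [set p | Y0 p.2 <> Z p.1] = 0%E.
Proof.
move=> rZ rY h; have mZ : measurable_fun setT (Z : Om -> Borel E) by apply/rvP.
have mY : measurable_fun setT (Y0 : RR -> Borel E) by apply/rvP.
have m1 : measurable_fun setT (fun p : Om * RR => (Z p.1, p.2) : Borel E * RR).
  apply/measurable_fun_pairP; split; last exact: measurable_snd.
  exact: (measurableT_comp mZ measurable_fst).
have m2 : measurable_fun setT (fun r : RR => (Y0 r, r) : Borel E * RR).
  by apply/measurable_fun_pairP; split; [exact: mY|exact: measurable_id].
have mN : measurable [set q : Borel E * RR | Y0 q.2 <> q.1].
  apply: measurableC; apply: (measurable_rv_eq hE cE).
    exact: (rv_measurable_comp measurable_snd rY).
  by apply/rvP; exact: measurable_fst.
have e := @eq_measure_rect R _ _ (Borel E) RR (image_measure P' m1) (image_measure Q m2) _ _ _ mN.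
have {e} := e; rewrite !image_measureE preimage_setT => e.
transitivity (Q ((fun r : RR => (Y0 r, r) : Borel E * RR) @^-1` [set q | Y0 q.2 <> q.1])).
  apply: e => [|C D mC mD]; first by apply: le_lt_trans (probability_le1 P' measurableT) _; exact: ltry.
  by rewrite !image_measureE; exact: h.
by rewrite (_ : _ @^-1` _ = set0) ?measure0// -subset0 => r /=.
Qed.

Lemma continuation_exists (hex : forall nu : probability (Borel E) R,
     exists (d : measure_display) (Om : measurableType d) (P : probability Om R)
       (Y : Om -> R -> E) (l0 : Om -> R -> R) (L1 : Om -> LM),
       cmp_solution E0 Xi DA A DB B P Y l0 L1 /\ has_initial_law P Y nu)
    (d : measure_display) (Om : measurableType d) (P : probability Om R)
    (YU : Om -> R -> E) (l0U : Om -> R -> R) (LU : Om -> LM) :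
  stopped_cmp_solution E0 Xi DA A DB B U P YU l0U LU ->
  exists (P' : probability (Om * RR)%type R)
    (Y : Om * RR -> R -> E) (l0 : Om * RR -> R -> R) (L1 : Om * RR -> LM),
    cmp_solution E0 Xi DA A DB B P' Y l0 L1 /\
    same_law P (encode YU l0U LU (fun w => exit_time U (YU w)))
             P' (encode_stopped Y l0 L1 (fun w => exit_time U (Y w))).
Proof.
move=> sol.
have rZ := rv_exit_position oU (proj1 sol) (proj1 (proj2 sol)).
(* The initial law requested is that of the exit position, so that the two pieces can be made to
   meet at theta. *)
have [d2 [Om2 [P2 [Y2 [l2 [L2 [sol2 law2]]]]]]] := hex (image_prob P (proj1 (rvP _) rZ)).
have [Q [yd [Ld [adm [ryd mLd] [Q0 Q1 Qlaw] [Gd [mGd Gd0 Gdout]] mart]]]] :=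
  standard_solution hE cE hU cU cXi DA_cont A_cont sol2.
have [GU [mGU GU0 GUreg]] := regular_set hE cE hU cU cXi sol.
have lawZ (C : set (Borel E)) : measurable C ->
    P (exit_position U YU @^-1` C) = Q ((fun r => yd r 0) @^-1` C).
  by move=> mC; rewrite Qlaw// law2// image_probE.
have [P' [marg rect indep]] := coupling_exists (proj1 (rvP _) rZ)
  (proj1 (rvP _) (ryd 0 (lexx 0))) lawZ Q0 Q1.
pose G3 := [set p : Om * RR | yd p.2 0 = exit_position U YU p.1].
have mG3 : measurable G3.
  apply: (measurable_rv_eq hE cE); first exact: (rv_measurable_comp measurable_snd (ryd 0 (lexx 0))).
  exact: (rv_measurable_comp measurable_fst rZ).
have G30 : P' (~` G3) = 0%E by exact: (coupling_diagonal rZ (ryd 0 (lexx 0)) rect).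
pose G1 : set (Om * RR) := fst @^-1` GU.
pose G2 : set (Om * RR) := snd @^-1` Gd.
have mG1 : measurable G1 by exact: (measurable_preimage measurable_fst mGU).
have mG2 : measurable G2 by exact: (measurable_preimage measurable_snd mGd).
have G10 : P' (~` G1) = 0%E.
  rewrite -GU0 -marg; last exact: measurableC.
  by congr (P' _); apply/seteqP; split => p // [].
have G20 : P' (~` G2) = 0%E.
  have := rect setT (~` Gd) measurableT (measurableC mGd).
  rewrite preimage_setT setTI Gd0 => <-.
  by congr (P' _); apply/seteqP; split => p // [].
have mG23 := measurableI _ _ mG2 mG3.
have mG := measurableI _ _ mG1 mG23.
have G0 := full_setI mG1 mG23 G10 (full_setI mG2 mG3 G20 G30).
set G := G1 `&` (G2 `&` G3) in mG G0.
have Ggood p : G p -> [/\ regular_at E0 Xi U YU l0U LU p.1,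
    yd p.2 0 = YU p.1 (fine (exit_time U (YU p.1))) &
    forall t, 0 <= t -> LS (idle_time (Ld p.2)) (I0 t `&` outside E0 (yd p.2)) = 0%E].
  by move=> [/GUreg ? [/Gdout ? ?]].
exists P', (pasted_path U YU yd G), (fun p => idle_time (pasted_control U YU LU Ld G p)),
  (pasted_control U YU LU Ld G); split.
  exact: (pasted_solution hE cE hU cU cXi DA_cont A_cont B_cont oU sol adm ryd mLd mG Ggood G0 marg indep mart).
exact: (same_law_pasted oU sol adm mG Ggood G0 marg).
Qed.

End existence.

Theorem theorem2p3 (R : realType) (E Uc : pseudoPMetricType R)
  (* E and U (= Uc) are compact metric spaces *)
  (hE : hausdorff_space E) (cE : compact [set: E])
  (hU : hausdorff_space Uc) (cU : compact [set: Uc])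
  (E0 : set E) (oE0 : open E0)
  (Xi : set (E * Uc)) (cXi : closed Xi) (XiE : Xi `<=` (~` E0) `*` setT)
  (Xi_ex : forall x, ~ E0 x -> exists u, Xi (x, u))
  (* A : D(A) \subseteq C(E) -> C(E), linear, 1 \in D(A), A1 = 0 *)
  (DA : set (E -> R)) (A : (E -> R) -> (E -> R))
  (DA_cont : forall f, DA f -> continuous f)
  (A_cont : forall f, DA f -> continuous (A f))
  (DA_lin : forall (a : R) f g, DA f -> DA g -> DA (fun x => a * f x + g x))
  (A_lin : forall (a : R) f g, DA f -> DA g ->
     A (fun x => a * f x + g x) = (fun x => a * A f x + A g x))
  (DA1 : DA (fun _ => 1)) (A1 : A (fun _ => 1) = (fun _ => 0))
  (* B : D(B) \subseteq C(E) -> C(Xi), linear, 1 \in D(B), B1 = 0 *)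
  (DB : set (E -> R)) (B : (E -> R) -> (E * Uc -> R))
  (DB_cont : forall f, DB f -> continuous f)
  (B_cont : forall f, DB f -> {within Xi, continuous (B f)})
  (DB_lin : forall (a : R) f g, DB f -> DB g -> DB (fun x => a * f x + g x))
  (B_lin : forall (a : R) f g, DB f -> DB g -> forall p, Xi p ->
     B (fun x => a * f x + g x) p = a * B f p + B g p)
  (DB1 : DB (fun _ => 1)) (B1 : forall p, Xi p -> B (fun _ => 1) p = 0)
  (* D = D(A) \cap D(B) is dense in C(E) (sup norm) *)
  (Ddense : forall g : E -> R, continuous g -> forall e : R, 0 < e ->
     exists f, DA f /\ DB f /\ forall x, `|f x - g x| < e)
  (U : set E) (oU : open U)
  (* existence for every initial distribution *)
  (hex : forall nu : probability (Borel E) R,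
     exists (d : measure_display) (Om : measurableType d) (P : probability Om R)
       (Y : Om -> R -> E) (l0 : Om -> R -> R) (L1 : Om -> @LMeas R Uc),
       cmp_solution E0 Xi DA A DB B P Y l0 L1 /\ has_initial_law P Y nu) :
  forall (d : measure_display) (Om : measurableType d) (P : probability Om R)
    (YU : Om -> R -> E) (l0U : Om -> R -> R) (L1U : Om -> @LMeas R Uc),
  stopped_cmp_solution E0 Xi DA A DB B U P YU l0U L1U ->
  exists (d' : measure_display) (Om' : measurableType d') (P' : probability Om' R)
    (Y : Om' -> R -> E) (l0 : Om' -> R -> R) (L1 : Om' -> @LMeas R Uc),
    cmp_solution E0 Xi DA A DB B P' Y l0 L1 /\
    same_law P (encode YU l0U L1U (fun w => exit_time U (YU w)))
             P' (encode_stopped Y l0 L1 (fun w => exit_time U (Y w))).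
Proof.
move=> d Om P YU l0U L1U sol.
have [P' [Y [l0 [L1 h]]]] :=
  continuation_exists hE cE hU cU cXi DA_cont A_cont B_cont oU hex sol.
by exists _, (Om * measurableTypeR R)%type, P', Y, l0, L1.
Qed.
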